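(* Let $\tau\in\mathbb{H}$ and $n_k\in\mathbb{Z}_{\ge0}$ for $k=0,1,2,3$ with $\sum_k n_k\ge1$. If the curvature equation $$\Delta u+e^{u}=8\pi \sum_{k=0}^{3}n_{k}\delta_{\frac{\omega_{k}}{2}}\quad\text{on } E_{\tau}$$ has an even solution, then there exists $E\in \mathbb{C}$ such that the monodromy representation of the generalized Lam\'e equation $$y^{\prime \prime}(z)=\Big[\sum_{k=0}^{3}n_{k}(n_{k}+1)\wp\big(z+\tfrac{\omega_{k}}{2};\tau\big)+E\Big]y(z)$$ is unitary.
   Context: $\mathbb{H}=\{\tau\mid\operatorname{Im}\tau>0\}$; $\omega_0=0$, $\omega_1=1$, $\omega_2=\tau$, $\omega_3=1+\tau$; $\Lambda_\tau=\mathbb{Z}+\mathbb{Z}\tau$ and $E_\tau=\mathbb{C}/\Lambda_\tau$ is the flat torus; $\Delta=\partial_x^2+\partial_y^2$ with $z=x+iy$; $\delta_{\omega_k/2}$ is the Dirac measure at $\frac{\omega_k}{2}$; $\wp(z;\tau)$ is the Weierstrass elliptic function with periods $1,\tau$. A solution $u$ is real-valued, satisfies the equation in the sense of distributions, is smooth away from the points $\frac{\omega_k}{2}$, and satisfies $u(z)=4n_k\log|z-\frac{\omega_k}{2}|+O(1)$ near $\frac{\omega_k}{2}$; it is even if $u(z)=u(-z)$. Since $n_k\in\mathbb{Z}_{\ge0}$, the local monodromy of the generalized Lam\'e equation at every $\frac{\omega_k}{2}$ is the identity, so all solutions are meromorphic on $\mathbb{C}$ and the monodromy representation is a homomorphism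 $\pi_1(E_\tau)\to SL(2,\mathbb{C})$ given by the translations $z\mapsto z+1$, $z\mapsto z+\tau$ acting on a basis of solutions. It is unitary if its image is conjugate (by a common conjugation) to a subgroup of $SU(2)$. *)

(* Defs.v *)
From HB Require Import structures.
From mathcomp Require Import all_boot all_order all_algebra.
From mathcomp Require Import all_classical all_reals all_analysis.
From mathcomp Require Import complex.

Set Implicit Arguments.
Unset Strict Implicit.
Unset Printing Implicit Defensive.

Import Order.TTheory GRing.Theory Num.Theory.
Import numFieldNormedType.Exports.

Local Open Scope classical_set_scope.
Local Open Scope ring_scope.
Local Open Scope complex_scope.

(* The alias [R[i]^o] carries the topology and the normed-module structure of
   the complex numbers over themselves, so that [derivable f z 1] and [derive1 f]
   for [f : R[i]^o -> R[i]^o] are complex differentiability and the complex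
   derivative.  [normc] is the modulus with values in [R]. *)
Notation cplx R := (R[i]^o) (only parsing).
Notation normc := Normc.normc (only parsing).

Definition lattice (R : realType) (tau : cplx R) : set (cplx R) :=
  [set w | exists m n : int, w = m%:~R + n%:~R * tau].

Definition omega (R : realType) (tau : cplx R) (k : 'I_4) : cplx R :=
  match val k with
  | 0%N => 0
  | 1%N => 1
  | 2%N => tau
  | _ => 1 + tau
  end.

Definition doubly_periodic (R : realType) (V : Type) (tau : cplx R)
    (f : cplx R -> V) : Prop :=
  forall z, f (z + 1) = f z /\ f (z + tau) = f z.

(* The sum over the nonzero lattice points converges absolutely when z is not
   in the lattice, so summing along growing squares loses no generality. At
   lattice points the value is meaningless, since 0^-1 = 0. *)
Definition weierstrass_p (R : realType) (tau z : cplx R) : cplx R :=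
  (z ^+ 2)^-1 +
  lim ((fun N : nat =>
    \sum_(i < N.*2.+1) \sum_(j < N.*2.+1)
      let w : cplx R := (i%:Z - N%:Z)%:~R + (j%:Z - N%:Z)%:~R * tau in
      if w == 0 then 0 else ((z - w) ^+ 2)^-1 - (w ^+ 2)^-1 : cplx R)
    @ \oo).

Definition dx (R : realType) (f : cplx R -> R) (z : cplx R) : R :=
  derive1 (fun x : R => f (x +i* complex.Im z)) (complex.Re z).

Definition dy (R : realType) (f : cplx R -> R) (z : cplx R) : R :=
  derive1 (fun y : R => f (complex.Re z +i* y)) (complex.Im z).

Definition laplacian (R : realType) (f : cplx R -> R) (z : cplx R) : R :=
  dx (dx f) z + dy (dy f) z.

(* Class C^k on D; D is meant to be open. *)
Fixpoint Ck (R : realType) (k : nat) (D : set (cplx R)) (f : cplx R -> R) :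
    Prop :=
  (forall z, D z -> f x @[x --> z] --> f z) /\
  match k with
  | 0%N => True
  | k'.+1 =>
      (forall z, D z ->
         derivable (fun x : R => f (x +i* complex.Im z)) (complex.Re z) 1 /\
         derivable (fun y : R => f (complex.Re z +i* y)) (complex.Im z) 1) /\
      Ck k' D (dx f) /\ Ck k' D (dy f)
  end.

Definition smooth (R : realType) (D : set (cplx R)) (f : cplx R -> R) : Prop :=
  forall k, Ck k D f.

Definition half_periods (R : realType) (tau : cplx R) : set (cplx R) :=
  [set z | exists k : 'I_4, lattice tau (z - omega tau k / 2)].

Definition parallelogram (R : realType) (tau : cplx R) :
    set (measurableTypeR R * measurableTypeR R) :=
  [set p | exists s t : R,
     [/\ 0 <= s < 1, 0 <= t < 1 & p.1 +i* p.2 = s%:C + t%:C * tau]].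

(* Functions on the torus are doubly periodic functions on the plane. The values
   of u at the half periods are irrelevant. The distributional equation is
   tested against smooth functions on the torus; its integrand is integrable
   because the singularities of u are logarithmic. *)
Definition curvature_solution (R : realType) (tau : cplx R) (n : 'I_4 -> nat)
    (u : cplx R -> R) : Prop :=
  [/\ doubly_periodic tau u,
      smooth (~` half_periods tau) u,
      forall k : 'I_4, exists M : R,
        \forall z \near (omega tau k / 2 : cplx R)^',
          `|u z - 4 * (n k)%:R * ln (normc (z - omega tau k / 2))| <= M
    & forall phi : cplx R -> R, doubly_periodic tau phi -> smooth setT phi ->
        (\int[lebesgue_measure \x lebesgue_measure]_(p in parallelogram tau)
           (u (p.1 +i* p.2) * laplacian phi (p.1 +i* p.2)
            + expR (u (p.1 +i* p.2)) * phi (p.1 +i* p.2))%:E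
         = (8 * pi * \sum_(k < 4) (n k)%:R * phi (omega tau k / 2))%:E)%E].

Definition meromorphic (R : realType) (f : cplx R -> cplx R) : Prop :=
  forall p : cplx R, exists (N : nat) (g : cplx R -> cplx R),
    (\forall z \near p, derivable g z 1) /\
    (\forall z \near p^', f z = g z / (z - p) ^+ N).

Definition lame_potential (R : realType) (tau : cplx R) (n : 'I_4 -> nat)
    (E z : cplx R) : cplx R :=
  \sum_(k < 4) (n k * (n k).+1)%:R * weierstrass_p tau (z + omega tau k / 2)
  + E.

(* The singular points of the generalized Lamé equation; omega_k/2 and
   -omega_k/2 agree modulo the lattice. *)
Definition lame_singular (R : realType) (tau : cplx R) (n : 'I_4 -> nat) :
    set (cplx R) :=
  [set z | exists k : 'I_4, (0 < n k)%N /\ lattice tau (z - omega tau k / 2)].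

Definition lame_solution (R : realType) (tau : cplx R) (n : 'I_4 -> nat)
    (E : cplx R) (y : cplx R -> cplx R) : Prop :=
  meromorphic y /\
  forall z, ~ lame_singular tau n z ->
    [/\ derivable y z 1, derivable (derive1 y) z 1
      & derive1 (derive1 y) z = lame_potential tau n E z * y z].

(* Meromorphic functions are compared off the singular points only, where their
   values are meaningful. *)
Definition lame_basis (R : realType) (tau : cplx R) (n : 'I_4 -> nat)
    (E : cplx R) (y : 'I_2 -> cplx R -> cplx R) : Prop :=
  [/\ forall i, lame_solution tau n E (y i),
      forall c : 'I_2 -> cplx R,
        (forall z, ~ lame_singular tau n z -> \sum_(i < 2) c i * y i z = 0) ->
        forall i, c i = 0
    & forall f, lame_solution tau n E f ->
        exists c : 'I_2 -> cplx R, forall z, ~ lame_singular tau n z ->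
          f z = \sum_(i < 2) c i * y i z].

(* [rho m l] is the image of the class of the translation by m + l tau in the
   fundamental group Z + Z tau of the torus, acting on the column (y_0, y_1). *)
Definition monodromy_representation (R : realType) (tau : cplx R)
    (n : 'I_4 -> nat) (y : 'I_2 -> cplx R -> cplx R)
    (rho : int -> int -> 'M[R[i]]_2) : Prop :=
  [/\ forall m l : int, \det (rho m l) = 1,
      forall m l m' l' : int, rho (m + m') (l + l') = rho m l *m rho m' l'
    & forall (m l : int) z, ~ lame_singular tau n z -> forall i,
        y i (z + (m%:~R + l%:~R * tau)) = \sum_(j < 2) rho m l i j * y j z].

Definition conjugate_into_SU2 (R : realType)
    (rho : int -> int -> 'M[R[i]]_2) : Prop :=
  exists2 P : 'M[R[i]]_2, P \in unitmx &
    forall m l : int, let A := P *m rho m l *m invmx P in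
      A \is unitarymx /\ \det A = 1.

(* Independent of the chosen basis: changing it conjugates rho. *)
Definition unitary_monodromy (R : realType) (tau : cplx R) (n : 'I_4 -> nat)
    (E : cplx R) : Prop :=
  exists (y : 'I_2 -> cplx R -> cplx R) (rho : int -> int -> 'M[R[i]]_2),
    [/\ lame_basis tau n E y, monodromy_representation tau n y rho
      & conjugate_into_SU2 rho].

(* Main.v *)
From mathcomp Require Import all_boot all_order all_algebra.
From mathcomp Require Import all_classical all_reals all_analysis.
From mathcomp Require Import complex ring lra zify measurable_realfun.
Require Import Defs.

(* Off the half periods the equation reads [4 u_{z zbar} = - e^u], which makes
   [V = - (u_zz - u_z^2 / 2) / 2] holomorphic. In logarithmic polar coordinates at a half period
   [u - 4 n_k log |z - omega_k / 2|] is bounded, so the second derivative of its mean square along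
   circles, which dominates the angular energy up to a vanishing error, cannot stay bounded away
   from zero. On circles of small energy [V] is close to a double pole with coefficient
   [n_k (n_k + 1)], and evenness of [u] kills the residue. Hence
   [V - \sum_k n_k (n_k + 1) wp (z + omega_k / 2)] is an entire elliptic function, that is, a
   constant [E].

   Now [v = e^{- u / 2}] satisfies [v_zz = V v] and [v_{zbar zbar} = conj(V) v]. For solutions [f],
   [g] of the Lamé equation, [v f' g'* - v_z f g'* - v_zbar f' g* + v_{z zbar} f g*] therefore has
   vanishing differential. It is a positive definite Hermitian form on the space of solutions, and
   it is invariant under the lattice translations because [u] is. *)

Set Implicit Arguments.
Unset Strict Implicit.
Unset Printing Implicit Defensive.

Import Order.TTheory GRing.Theory Num.Theory.
Import numFieldNormedType.Exports.

Local Open Scope classical_set_scope.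
Local Open Scope ring_scope.
Local Open Scope complex_scope.

(** * Real differentiability and circle integrals *)

(** The bound on [u] near a half period says nothing about its derivatives, so no growth of [V] is
    known there a priori; the energy is small only on some sequence of shrinking circles. The local
    theory is arranged to need no more: Cauchy's formula on a punctured disc is proved assuming that
    the Cauchy integrals are small on some circles of arbitrarily small radius, and smallness is
    tested against smooth functions of the angle, because the expansion of [V] contains an angular
    derivative without pointwise control. The coefficient is that of the model [u = 4 n log |z|],
    for which [u_z = 2 n / z] and [V = n (n + 1) / z ^ 2].

    The plane without the singular points is not simply connected. Evenness of [V] about every half
    period removes all odd coefficients of [z ^ 2 V], so Frobenius' method meets no logarithm and
    each singular point has a single-valued local basis. Bases of Wronskian one are then glued by
    constant matrices over rectangles in lattice coordinates, whose overlaps stay connected when the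
    half periods are removed; no continuation along paths occurs. *)

Section Basics.
Context {R : realType}.
Local Notation C := (cplx R).

Lemma normcE' (z : C) : `|z| = (normc z)%:C.
Proof. by case: z => a b; rewrite normc_def. Qed.

Lemma normc_ge0 (z : C) : 0 <= normc z.
Proof. by rewrite -lecR -normcE'; exact: normr_ge0. Qed.

Lemma normc_real (x : R) : normc (x%:C : C) = `|x|.
Proof. by rewrite /= expr0n addr0 sqrtr_sqr. Qed.

Lemma normc_eq0 (z : C) : (normc z == 0) = (z == 0).
Proof.
apply/eqP/eqP => [|->]; first exact: Normc.eq0_normc.
by rewrite Normc.normc0.
Qed.

Lemma normc_gt0 (z : C) : (0 < normc z) = (z != 0).
Proof. by rewrite lt0r normc_eq0 normc_ge0 andbT. Qed.

Lemma normcD (x y : C) : normc (x + y) <= normc x + normc y.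
Proof. exact: le_normcD. Qed.

Lemma normcN (x : C) : normc (- x) = normc x.
Proof. exact: normcN. Qed.

Lemma normcB (x y : C) : normc (x - y) <= normc x + normc y.
Proof. by rewrite (le_trans (normcD _ _)) // normcN. Qed.

Lemma normcBC (x y : C) : normc (x - y) = normc (y - x).
Proof. by rewrite -normcN opprB. Qed.

Lemma normcM (x y : C) : normc (x * y) = normc x * normc y.
Proof. exact: Normc.normcM. Qed.

Lemma normcV (x : C) : normc (x^-1) = (normc x)^-1.
Proof. exact: Normc.normcV. Qed.

Lemma normcX (x : C) n : normc (x ^+ n) = normc x ^+ n.
Proof. by elim: n => [|n IH]; rewrite ?expr0 ?Normc.normc1 // !exprS normcM IH. Qed.

Lemma normc_subl (x y z : C) : normc (x - z) <= normc (x - y) + normc (y - z).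
Proof. by rewrite (_ : x - z = (x - y) + (y - z)) ?normcD //; ring. Qed.

Lemma normc_lb (x y : C) : normc x - normc y <= normc (x - y).
Proof. by rewrite lerBlDr; rewrite {1}(_ : x = (x - y) + y) ?normcD // subrK. Qed.

Lemma normcR (z : C) : normc z ^+ 2 = complex.Re z ^+ 2 + complex.Im z ^+ 2.
Proof. by case: z => a b /=; rewrite sqr_sqrtr // addr_ge0 // sqr_ge0. Qed.

Lemma normc_Re (z : C) : `|complex.Re z| <= normc z.
Proof.
rewrite -(@ler_pXn2r _ 2) ?nnegrE ?normc_ge0 // normcR real_normK ?num_real //.
by rewrite lerDl sqr_ge0.
Qed.

Lemma normc_Im (z : C) : `|complex.Im z| <= normc z.
Proof.
rewrite -(@ler_pXn2r _ 2) ?nnegrE ?normc_ge0 // normcR real_normK ?num_real //.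
by rewrite lerDr sqr_ge0.
Qed.

Lemma normc_le (z : C) : normc z <= `|complex.Re z| + `|complex.Im z|.
Proof.
case: z => a b; rewrite (_ : a +i* b = a%:C + 'i * b%:C); last first.
  by apply/eqP; rewrite eq_complex /=; apply/andP; split; apply/eqP; ring.
rewrite (le_trans (normcD _ _)) // normcM !normc_real /=.
by rewrite expr0n expr1n add0r sqrtr1 mul1r !(mul0r, mulr0, subr0, addr0, mul1r, add0r).
Qed.

Lemma normc_sum (I : Type) (s : seq I) (P : pred I) (F : I -> C) :
  normc (\sum_(i <- s | P i) F i) <= \sum_(i <- s | P i) normc (F i).
Proof.
elim/big_ind2 : _ => // [|x1 x2 y1 y2 h1 h2]; first by rewrite Normc.normc0.
by rewrite (le_trans (normcD _ _)) // lerD.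
Qed.

Lemma nbhsCP (z : C) (P : set C) :
  nbhs z P <-> exists2 d : R, 0 < d & forall w, normc (w - z) < d -> P w.
Proof.
split.
  move=> /nbhs_ballP[e /= e0 eP]; exists (complex.Re e).
    by move: e0; rewrite ltcE => /andP[].
  move=> w wz; apply: eP; rewrite -ball_normE /= normcE' normcBC.
  by move: e0; rewrite !ltcE /= => /andP[/eqP -> _]; rewrite eqxx.
move=> [d d0 dP]; apply/nbhs_ballP; exists d%:C; first by rewrite /= ltcR.
by move=> w; rewrite -ball_normE /= normcE' ltcR normcBC => /dP.
Qed.

Lemma cvgCP (T : Type) (F : set_system T) {FF : Filter F} (f : T -> C) (l : C) :
  f x @[x --> F] --> l <->
  (forall e : R, 0 < e -> \forall x \near F, normc (f x - l) < e).
Proof.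
split=> [fl e e0|fl].
  have e0' : 0 < e%:C :> R[i] by rewrite ltcR.
  near=> x; rewrite -ltcR -normcE' -normrN opprB.
  by near: x; exact: (cvgr_dist_lt _ _ fl).
apply/cvgrPdist_lt => e e0.
have e0' : 0 < complex.Re e by move: e0; rewrite ltcE => /andP[].
near=> x.
have h : normc (f x - l) < complex.Re e by near: x; exact: fl.
rewrite normcE' normcBC.
by move: e0; rewrite !ltcE /= => /andP[/eqP -> _]; rewrite eqxx.
Unshelve. all: by end_near. Qed.

Lemma contCP (f : C -> C) (z : C) :
  f x @[x --> z] --> f z <->
  (forall e : R, 0 < e -> exists2 d : R, 0 < d &
     forall w, normc (w - z) < d -> normc (f w - f z) < e).
Proof.
have E := @cvgCP _ (nbhs z) (nbhs_filter z) f (f z).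
split=> [/E h e e0|h]; first by apply/nbhsCP/h.
by apply/E => e e0; apply/nbhsCP; have := h e e0.
Qed.

Lemma contCRP (f : C -> R) (z : C) :
  f x @[x --> z] --> f z <->
  (forall e : R, 0 < e -> exists2 d : R, 0 < d &
     forall w, normc (w - z) < d -> `|f w - f z| < e).
Proof.
have E := @cvgrPdist_lt _ R^o _ (nbhs z) (nbhs_filter z) f (f z).
split=> [/E h e e0|h].
  move: (h e e0) => /nbhsCP[d d0 dh].
  by exists d => // w /dh; rewrite distrC.
apply/E => e e0; apply/nbhsCP; have [d d0 dh] := h e e0.
by exists d => // w /dh; rewrite distrC.
Qed.

(** The real differential of [f] at [z], with partial derivatives [a] in x and [b] in y. The
    non-strict bound spares a separate case [h = 0]. *)
Definition fdiff (f : C -> C) (z a b : C) : Prop :=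
  forall e : R, 0 < e -> exists2 d : R, 0 < d & forall h : C, normc h < d ->
    normc (f (z + h) - f z - (a * (complex.Re h)%:C + b * (complex.Im h)%:C))
      <= e * normc h.

Definition rder (g : R -> C) (t : R) (d : C) : Prop :=
  forall e : R, 0 < e -> exists2 r : R, 0 < r & forall h : R, `|h| < r ->
    normc (g (t + h) - g t - d * h%:C) <= e * `|h|.

Lemma complexRI (h : C) : h = (complex.Re h)%:C + 'i * (complex.Im h)%:C.
Proof. by rewrite {1}(complexE h). Qed.

Lemma mulRI (d h : C) :
  d * h = d * (complex.Re h)%:C + 'i * d * (complex.Im h)%:C.
Proof. by rewrite {1}(complexRI h); ring. Qed.

(** These are the Cauchy-Riemann equations: complex differentiability is a real differential whose
    partial derivatives satisfy [b = i a]. *)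
Lemma cderP (f : C -> C) (z d : C) :
  is_derive z (1 : C) f d <-> fdiff f z d ('i * d).
Proof.
have eqv : fdiff f z d ('i * d) <-> forall e : R, 0 < e -> exists2 r : R, 0 < r &
    forall h : C, normc h < r -> normc (f (z + h) - f z - d * h) <= e * normc h.
  rewrite /fdiff; split=> H e e0; have [r r0 rH] := H e e0; exists r => // h hr; have := rH h hr; rewrite (mulRI d h) //.
rewrite eqv {eqv}; split.
  move=> [df <- e e0].
  have df2 : ((fun h : C => h^-1 *: ((f \o shift z) (h *: (1:C)) - f z)) @ 0^')
    --> 'D_1 f z := df.
  move/cvgCP : df2 => /(_ e e0) /nbhsCP[r r0 rh]; exists r => // h hr.
  have [->|h0] := eqVneq h 0.
    by rewrite addr0 mulr0 !subrr Normc.normc0 mulr0.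
  have := rh h; rewrite subr0 => /(_ hr h0).
  rewrite /= [h *: 1]mulr1 [h + z]addrC.
  move=> /ltW; rewrite -(ler_pM2r (x := normc h)) ?normc_gt0 // -normcM.
  by rewrite mulrBl [h^-1 *: _]mulrC mulfVK.
move=> H.
have cv : ((fun h : C => h^-1 *: ((f \o shift z) (h *: (1:C)) - f z)) @ 0^') --> d.
  apply/cvgCP => e e0; have e20 : 0 < e / 2 by rewrite divr_gt0.
  have [r r0 rH] := H _ e20.
  apply/nbhsCP; exists r => // h; rewrite subr0 => hr h0.
  rewrite /= [h *: 1]mulr1 [h + z]addrC [h^-1 *: _]mulrC.
  rewrite -(ltr_pM2r (x := normc h)) ?normc_gt0 // -normcM mulrBl mulfVK //.
  rewrite (le_lt_trans (rH _ hr)) // ltr_pM2r ?normc_gt0 //.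
  by rewrite ltr_pdivrMr // ltr_pMr // ltr1n.
have D : 'D_1 f z = d by apply: cvg_lim cv; exact: norm_hausdorff.
exact (DeriveDef (cvgP d cv : derivable f z 1) D).
Qed.

Lemma is_deriveRP (f : R -> R) (t l : R) : is_derive t 1 f l <->
  (forall e : R, 0 < e -> exists2 r : R, 0 < r & forall h : R, `|h| < r ->
    `|f (t + h) - f t - l * h| <= e * `|h|).
Proof.
split.
  move=> [df <- e e0].
  have /cvgrPdist_le /(_ e e0) : h^-1 *: ((f \o shift t) (h *: 1) - f t) @[h --> 0^'] --> 'D_1 f t.
    exact: df.
  move=> /nbhs_ballP[r /= r0 rh]; exists r => // h hr.
  have [->|h0] := eqVneq h 0.
    by rewrite addr0 mulr0 !subrr normr0 mulr0.
  have := rh h; rewrite -ball_normE /= sub0r normrN => /(_ hr h0).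
  rewrite /= [h *: 1]mulr1 [h + t]addrC distrC.
  rewrite -(ler_pM2r (x := `|h|)) ?normr_gt0 // -normrM.
  by rewrite mulrBl [h^-1 *: _]mulrC mulfVK.
move=> H.
have cv : h^-1 *: ((f \o shift t) (h *: 1) - f t) @[h --> 0^'] --> l.
  apply/cvgrPdist_le => e e0; have [r r0 rH] := H _ e0.
  apply/nbhs_ballP; exists r => //= h; rewrite -ball_normE /= sub0r normrN => hr h0.
  rewrite /= [h *: 1]mulr1 [h + t]addrC [h^-1 *: _]mulrC distrC.
  by rewrite -(ler_pM2r (x := `|h|)) ?normr_gt0 // -normrM mulrBl mulfVK // rH.
have D : 'D_1 f t = l by apply: cvg_lim cv.
by split => //; apply/cvg_ex; exists l.
Qed.

Lemma rderP (g : R -> C) (t : R) (d : C) :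
  rder g t d <-> is_derive t 1 (fun x => complex.Re (g x)) (complex.Re d) /\
                 is_derive t 1 (fun x => complex.Im (g x)) (complex.Im d).
Proof.
have re h : complex.Re (g (t + h) - g t - d * h%:C) =
    complex.Re (g (t + h)) - complex.Re (g t) - complex.Re d * h.
  by case: (g _) => ? ?; case: (g _) => ? ?; case: (d) => ? ? /=; ring.
have im h : complex.Im (g (t + h) - g t - d * h%:C) =
    complex.Im (g (t + h)) - complex.Im (g t) - complex.Im d * h.
  by case: (g _) => ? ?; case: (g _) => ? ?; case: (d) => ? ? /=; ring.
rewrite !is_deriveRP; split.
  move=> H; split=> e /H[r r0 rH]; exists r => // h /rH.
    by rewrite -re; apply: le_trans; exact: normc_Re.
  by rewrite -im; apply: le_trans; exact: normc_Im.
move=> [H1 H2] e e0; have e20 : 0 < e / 2 by rewrite divr_gt0.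
have [r1 r10 h1] := H1 _ e20; have [r2 r20 h2] := H2 _ e20.
exists (Num.min r1 r2); first by rewrite lt_min r10.
move=> h; rewrite lt_min => /andP[/h1 {}h1 /h2 {}h2].
rewrite (le_trans (normc_le _)) // re im (le_trans (lerD h1 h2)) //.
by rewrite -mulrDl -splitr.
Qed.

Lemma fdiff_rder (f : C -> C) (g : R -> C) (t : R) (a b d : C) :
  fdiff f (g t) a b -> rder g t d ->
  rder (f \o g) t (a * (complex.Re d)%:C + b * (complex.Im d)%:C).
Proof.
move=> Hf Hg e e0.
(* [K] bounds the differential of [f] and [L] the difference quotients of [g] near [t]; each of the
   two remainders gets half of [e]. *)
pose K := normc a + normc b + 1.
have K0 : 0 < K by rewrite /K ltr_wpDl // addr_ge0 // normc_ge0.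
pose L := normc d + 1.
have L0 : 0 < L by rewrite /L ltr_wpDl // normc_ge0.
have e1 : 0 < e / 2 / L by rewrite !divr_gt0.
have [r1 r10 h1] := Hf _ e1.
have e2 : 0 < Num.min 1 (e / 2 / K) by rewrite lt_min ltr01 !divr_gt0.
have [r2 r20 h2] := Hg _ e2.
exists (Num.min r2 (r1 / L)); first by rewrite lt_min r20 divr_gt0.
move=> h; rewrite lt_min => /andP[/h2 {}h2 hr1].
set k := g (t + h) - g t.
have kE : g (t + h) = g t + k by rewrite /k; ring.
have kL : normc k <= L * `|h|.
  rewrite (_ : k = (k - d * h%:C) + d * h%:C); last by rewrite subrK.
  rewrite (le_trans (normcD _ _)) // normcM normc_real /L mulrDl mul1r [leRHS]addrC.
  rewrite lerD // (le_trans h2) // ler_piMl //.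
  by rewrite ge_min lexx.
have kr : normc k < r1.
  by rewrite (le_lt_trans kL) // mulrC -ltr_pdivlMr.
rewrite /= kE.
have -> : f (g t + k) - f (g t) -
   (a * (complex.Re d)%:C + b * (complex.Im d)%:C) * h%:C =
  (f (g t + k) - f (g t) - (a * (complex.Re k)%:C + b * (complex.Im k)%:C)) +
  (a * (complex.Re (k - d * h%:C))%:C + b * (complex.Im (k - d * h%:C))%:C).
  have -> : complex.Re (k - d * h%:C) = complex.Re k - complex.Re d * h.
    by case: (k) => ? ?; case: (d) => ? ? /=; ring.
  have -> : complex.Im (k - d * h%:C) = complex.Im k - complex.Im d * h.
    by case: (k) => ? ?; case: (d) => ? ? /=; ring.
  by rewrite !(rmorphB, rmorphM) /=; ring.
rewrite (le_trans (normcD _ _)) // (splitr e) mulrDl lerD //.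
  rewrite (le_trans (h1 _ kr)) //.
  by rewrite (le_trans (ler_wpM2l (ltW e1) kL)) // mulrA divfK ?gt_eqF.
rewrite (le_trans (normcD _ _)) // !normcM !normc_real.
have {}h2 : normc (k - d * h%:C) <= e / 2 / K * `|h|.
  by rewrite (le_trans h2) // ler_wpM2r // ge_min lexx orbT.
have q1 := le_trans (normc_Re _) h2.
have q2 := le_trans (normc_Im _) h2.
rewrite (le_trans (lerD (ler_wpM2l (normc_ge0 _) q1) (ler_wpM2l (normc_ge0 _) q2))) //.
rewrite -mulrDl (le_trans (_ : _ <= K * (e / 2 / K * `|h|))) //.
  apply: ler_wpM2r; last by rewrite /K lerDl.
  by rewrite mulr_ge0 // ltW // !divr_gt0.
by rewrite mulrA [K * _]mulrC divfK ?gt_eqF.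
Qed.

Lemma cder_rder (f : C -> C) (g : R -> C) (t : R) (c d : C) :
  is_derive (g t) (1 : C) f c -> rder g t d -> rder (f \o g) t (c * d).
Proof.
move=> /cderP /fdiff_rder H /H.
by rewrite -mulRI.
Qed.

Lemma fdiff_cont (f : C -> C) (z a b : C) :
  fdiff f z a b -> f x @[x --> z] --> f z.
Proof.
move=> H; apply/contCP => e e0.
have [d d0 dH] := H 1 ltr01.
pose K := normc a + normc b + 1 + 1.
have K0 : 0 < K by rewrite /K !ltr_wpDl // !addr_ge0 // normc_ge0.
exists (Num.min d (e / K)); first by rewrite lt_min d0 divr_gt0.
move=> w; rewrite lt_min => /andP[/dH {}dH wz].
move: dH; rewrite [z + _]addrC subrK mul1r => dH.
set h := w - z in dH wz.
have -> : f w - f z = (f w - f z - (a * (complex.Re h)%:C + b * (complex.Im h)%:C))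
   + (a * (complex.Re h)%:C + b * (complex.Im h)%:C) by rewrite subrK.
rewrite (le_lt_trans (normcD _ _)) //.
have : normc (a * (complex.Re h)%:C + b * (complex.Im h)%:C) <= (normc a + normc b) * normc h.
  rewrite (le_trans (normcD _ _)) // !normcM !normc_real mulrDl lerD // ler_wpM2l ?normc_ge0 //.
    exact: normc_Re.
  exact: normc_Im.
move=> /(lerD dH) /le_lt_trans; apply.
rewrite -{1}[normc h]mul1r -mulrDl (le_lt_trans (_ : _ <= K * normc h)) //.
  rewrite ler_wpM2r ?normc_ge0 // /K; lra.
by rewrite mulrC -ltr_pdivlMr.
Qed.

Lemma cder_cont (f : C -> C) (z d : C) :
  is_derive z (1 : C) f d -> f x @[x --> z] --> f z.
Proof. by move=> /cderP /fdiff_cont. Qed.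

End Basics.

(** * Integrals over segments and their dependence on a parameter *)

Section Integral.
Context {R : realType}.
Local Notation C := (cplx R).
Local Notation mu := (@lebesgue_measure R).

Definition rint (a b : R) (f : R -> R) : R := \int[mu]_(x in `[a, b]) f x.

Lemma cont_integrable (a b : R) (f : R -> R) :
  continuous f -> mu.-integrable `[a, b] (EFin \o f).
Proof.
move=> cf; apply: continuous_compact_integrable; first exact: segment_compact.
exact: continuous_subspaceT.
Qed.

Lemma eq_int (a b : R) (f g : R -> R) :
  (forall x, a <= x <= b -> f x = g x) -> rint a b f = rint a b g.
Proof.
by move=> h; apply: eq_Rintegral => x; rewrite inE /= in_itv /= => /h.
Qed.

Lemma intD (a b : R) (f g : R -> R) : continuous f -> continuous g ->
  rint a b (fun x => f x + g x) = rint a b f + rint a b g.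
Proof. by move=> cf cg; apply: RintegralD => //; exact: cont_integrable. Qed.

Lemma intB (a b : R) (f g : R -> R) : continuous f -> continuous g ->
  rint a b (fun x => f x - g x) = rint a b f - rint a b g.
Proof. by move=> cf cg; apply: RintegralB => //; exact: cont_integrable. Qed.

Lemma intZ (a b r : R) (f : R -> R) : continuous f ->
  rint a b (fun x => r * f x) = r * rint a b f.
Proof. by move=> cf; apply: RintegralZl => //; exact: cont_integrable. Qed.

Lemma int_le (a b : R) (f g : R -> R) : continuous f -> continuous g ->
  (forall x, a <= x <= b -> f x <= g x) -> rint a b f <= rint a b g.
Proof.
move=> cf cg h; apply: le_Rintegral => //; try exact: cont_integrable.
Qed.

Lemma int_cst (a b r : R) : a <= b -> rint a b (fun=> r) = r * (b - a).
Proof.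
move=> ab; transitivity (r * fine (mu `[a, b])); first exact: Rintegral_cst.
have -> : mu [set` `[a, b]] = (if a < b then (b - a)%:E else 0%E).
  by rewrite lebesgue_measure_itv /= lte_fin EFinN -EFinB; case: ifP.
case: ltP => // ba; have -> : b = a by apply/eqP; rewrite eq_le ab ba.
by rewrite subrr /= mulr0.
Qed.

Lemma int_norm (a b : R) (f : R -> R) : continuous f ->
  `|rint a b f| <= rint a b (fun x => `|f x|).
Proof. by move=> cf; apply: le_normr_Rintegral => //; exact: cont_integrable. Qed.

Lemma cont_norm (f : R -> R) : continuous f -> continuous (fun x => `|f x|).
Proof. by move=> cf x; apply: cvg_norm; exact: cf. Qed.

Lemma int_bound (a b r : R) (f : R -> R) : a <= b -> continuous f ->
  (forall x, a <= x <= b -> `|f x| <= r) -> `|rint a b f| <= r * (b - a).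
Proof.
move=> ab cf h; rewrite (le_trans (int_norm _ _ cf)) // -int_cst //.
apply: int_le => //; first exact: cont_norm.
by move=> x; exact: cvg_cst.
Qed.

Lemma is_derive_cont (f : R -> R) (x l : R) :
  is_derive x 1 f l -> {for x, continuous f}.
Proof. by move=> [d _]; apply: differentiable_continuous; exact/derivable1_diffP. Qed.

Lemma int_FTC (a b : R) (F f : R -> R) : a < b -> continuous f ->
  (forall x : R, is_derive x 1 F (f x)) -> rint a b f = F b - F a.
Proof.
move=> ab cf dF.
have cF : continuous F by move=> x; apply: is_derive_cont (dF x).
have : (\int[mu]_(x in `[a, b]) (f x)%:E = (F b)%:E - (F a)%:E)%E.
  apply: continuous_FTC2 => //; first exact: continuous_subspaceT.
  - split => [x _||]; first by case: (dF x).
    + by apply: cvg_at_right_filter; exact: cF.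
    + by apply: cvg_at_left_filter; exact: cF.
  - by move=> x _; rewrite derive1E; case: (dF x).
by rewrite /rint /Rintegral => ->.
Qed.

(** The tube lemma: joint continuity at the points of the compact slice over [t0] gives a
    neighbourhood of [t0] that serves all [th] at once. *)
Lemma unif_near (a b t0 : R) (g : R -> R -> R) :
  (forall th, a <= th <= b -> {for (t0, th), continuous (fun p : R * R => g p.1 p.2)}) ->
  forall e : R, 0 < e -> \forall t \near t0,
    forall th, a <= th <= b -> `|g t th - g t0 th| < e.
Proof.
move=> H e e0.
have /compact_near_coveringP K := @segment_compact R a b.
have P : \forall t \near t0, `[a, b] `<=` (fun th => `|g t th - g t0 th| < e).
  apply: (K _ (nbhs t0) (fun t th => `|g t th - g t0 th| < e)).
  move=> th /=; rewrite in_itv /= => /H cg.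
  have e2 : 0 < e / 2 by rewrite divr_gt0.
  move/cvgrPdist_lt : cg => /(_ _ e2) [[U V] /= [Ut Vt]] UV.
  exists (V, U) => //= -[th' t] [/= Vth Ut']; rewrite (splitr e).
  rewrite (_ : _ - _ = (g t0 th - g t0 th') - (g t0 th - g t th')); last by lra.
  rewrite (le_lt_trans (ler_normB _ _)) // ltrD //.
    by apply: (UV (t0, th')); split => //=; exact: nbhs_singleton.
  exact: (UV (t, th')).
by near=> t => th thab; apply: (near P t) => //; rewrite /= in_itv.
Unshelve. all: by end_near. Qed.

Lemma int_param_cont (a b t0 : R) (g : R -> R -> R) : a <= b ->
  (\forall t \near t0, continuous (g t)) ->
  (forall th, a <= th <= b -> {for (t0, th), continuous (fun p : R * R => g p.1 p.2)}) ->
  {for t0, continuous (fun t => rint a b (g t))}.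
Proof.
move=> ab cg H; apply/cvgrPdist_le => e e0.
(* The summand 1 keeps the quotient meaningful when [a = b]. *)
have e1 : 0 < e / (b - a + 1) by rewrite divr_gt0 // ltr_wpDl // subr_ge0.
have U := unif_near H e1.
have cg0 : continuous (g t0) by exact: nbhs_singleton cg.
near=> t.
have cgt : continuous (g t) by near: t.
have Ut : forall th, a <= th <= b -> `|g t th - g t0 th| < e / (b - a + 1) by near: t.
rewrite -intB //.
apply: (@le_trans _ _ (e / (b - a + 1) * (b - a))).
  apply: int_bound => // [x|x /Ut /ltW]; last by rewrite distrC.
  by apply: cvgB; [exact: cg0|exact: cgt].
rewrite -mulrA ler_piMr ?ltW // mulrC ltr_pdivrMr ?mul1r ?ltrDl //.
by rewrite ltr_wpDl // subr_ge0.
Unshelve. all: by end_near. Qed.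

(** Differentiation under the integral sign: for each fixed [th] the mean value theorem in [t] turns
    the uniform closeness of [g' t] to [g' t0] into a uniform first-order remainder of [g]. *)
Lemma int_param_derive (a b t0 : R) (g g' : R -> R -> R) : a <= b ->
  (\forall t \near t0, continuous (g t)) ->
  continuous (g' t0) ->
  (\forall t \near t0, forall th : R, is_derive (t : R) 1 (g ^~ th) (g' t th)) ->
  (forall th, a <= th <= b -> {for (t0, th), continuous (fun p : R * R => g' p.1 p.2)}) ->
  is_derive t0 1 (fun t => rint a b (g t)) (rint a b (g' t0)).
Proof.
move=> ab cg cg' dg H; apply/is_deriveRP => e e0.
have e1 : 0 < e / (b - a + 1) by rewrite divr_gt0 // ltr_wpDl // subr_ge0.
have U := unif_near H e1.
have [/= r r0 rP] : \forall t \near t0, [/\ continuous (g t),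
     forall th : R, is_derive (t : R) 1 (g ^~ th) (g' t th) &
     forall th, a <= th <= b -> `|g' t th - g' t0 th| < e / (b - a + 1)].
  by near=> t; split; near: t.
exists r => // h hr.
have cg0 : continuous (g t0) by exact: nbhs_singleton cg.
have near_r k : `|k| <= `|h| -> ball_ [eta Num.Def.normr] t0 r (t0 + k).
  by rewrite /ball_ /= opprD addNKr normrN => /le_lt_trans; apply.
have [cgt _ _] := rP _ (near_r h (lexx _)).
rewrite -intB // mulrC -intZ // -intB //; last 2 first.
- by move=> x; apply: cvgB; [exact: cgt|exact: cg0].
- by move=> x; apply: cvgM; [exact: cvg_cst|exact: cg'].
apply: (@le_trans _ _ (e / (b - a + 1) * `|h| * (b - a))); last first.
  rewrite mulrAC ler_wpM2r // -mulrA ler_piMr ?ltW // mulrC ltr_pdivrMr ?mul1r ?ltrDl //.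
  by rewrite ltr_wpDl // subr_ge0.
apply: int_bound => // [x|th thab].
  apply: cvgB; first by apply: cvgB; [exact: cgt|exact: cg0].
  by apply: cvgM; [exact: cvg_cst|exact: cg'].
have d k : `|k| <= `|h| -> is_derive (t0 + k) 1 (g ^~ th) (g' (t0 + k) th).
  by move=> /near_r /rP[].
have u k : `|k| <= `|h| -> `|g' (t0 + k) th - g' t0 th| <= e / (b - a + 1).
  by move=> /near_r /rP[_ _ /(_ th thab) /ltW].
have key k : `|k| <= `|h| -> g (t0 + h) th - g t0 th = g' (t0 + k) th * h ->
    `|g (t0 + h) th - g t0 th - h * g' t0 th| <= e / (b - a + 1) * `|h|.
  by move=> kh ->; rewrite [h * _]mulrC -mulrBl normrM ler_wpM2r // u.
have cont (x y : R) : (forall z, z \in `[x, y] -> `|z - t0| <= `|h|) ->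
    {within `[x, y], continuous (g ^~ th)}.
  move=> xy; apply: continuous_in_subspaceT => z /set_mem /xy zh.
  by have := is_derive_cont (d _ zh); rewrite addrC subrK.
have der (x y : R) : (forall z, z \in `[x, y] -> `|z - t0| <= `|h|) ->
    forall z, z \in `]x, y[ -> is_derive z 1 (g ^~ th) (g' z th).
  move=> xy z zxy; have /xy /d : z \in `[x, y] by exact: subset_itv_oo_cc.
  by rewrite addrC subrK.
have [h0|h0|->] := ltgtP h 0; last first.
- by rewrite addr0 mul0r !subrr normr0 mulr0.
- have s z : z \in `[t0, t0 + h] -> `|z - t0| <= `|h|.
    rewrite in_itv /= => /andP[z1 z2]; rewrite !ger0_norm ?(ltW h0) ?subr_ge0 //; lra.
  have := @MVT _ (g ^~ th) (g' ^~ th) t0 (t0 + h) _ (der _ _ s) (cont _ _ s).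
  rewrite ltrDl => /(_ h0)[c cc E].
  have cI : c \in `[t0, t0 + h] by exact: subset_itv_oo_cc.
  apply: (key (c - t0)); first exact: s.
  by rewrite E [t0 + (c - _)]addrC subrK; congr (_ * _); ring.
- have s z : z \in `[t0 + h, t0] -> `|z - t0| <= `|h|.
    rewrite in_itv /= => /andP[z1 z2]; rewrite !ler0_norm ?(ltW h0) ?subr_le0 //; lra.
  have := @MVT _ (g ^~ th) (g' ^~ th) (t0 + h) t0 _ (der _ _ s) (cont _ _ s).
  rewrite gtrDl => /(_ h0)[c cc E].
  have cI : c \in `[t0 + h, t0] by exact: subset_itv_oo_cc.
  apply: (key (c - t0)); first exact: s.
  rewrite [t0 + (c - _)]addrC subrK -opprB E -mulrN; congr (_ * _); ring.
Unshelve. all: by end_near. Qed.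

End Integral.

(** * Integrals over circles in logarithmic polar coordinates *)

Section Circle.
Context {R : realType}.
Local Notation C := (cplx R).

Lemma cReD (x y : C) : complex.Re (x + y) = complex.Re x + complex.Re y.
Proof. by case: x; case: y. Qed.
Lemma cImD (x y : C) : complex.Im (x + y) = complex.Im x + complex.Im y.
Proof. by case: x; case: y. Qed.
Lemma cReB (x y : C) : complex.Re (x - y) = complex.Re x - complex.Re y.
Proof. by case: x; case: y. Qed.
Lemma cImB (x y : C) : complex.Im (x - y) = complex.Im x - complex.Im y.
Proof. by case: x; case: y. Qed.
Lemma cReM (x y : C) : complex.Re (x * y) = complex.Re x * complex.Re y - complex.Im x * complex.Im y.
Proof. by case: x; case: y. Qed.
Lemma cImM (x y : C) : complex.Im (x * y) = complex.Re x * complex.Im y + complex.Im x * complex.Re y.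
Proof. by case: x => a b; case: y => c d /=; ring. Qed.

Lemma complex_ext (x y : C) : complex.Re x = complex.Re y -> complex.Im x = complex.Im y -> x = y.
Proof. by case: x => ? ?; case: y => ? ? /= -> ->. Qed.

Lemma cvg_Re (T : Type) (F : set_system T) {FF : Filter F} (f : T -> C) (l : C) :
  f x @[x --> F] --> l -> complex.Re (f x) @[x --> F] --> complex.Re l.
Proof.
move=> /cvgCP h; apply/cvgrPdist_lt => e e0; near=> x.
rewrite -cReB (le_lt_trans (normc_Re _)) // normcBC.
by near: x; exact: h.
Unshelve. all: by end_near. Qed.

Lemma cvg_Im (T : Type) (F : set_system T) {FF : Filter F} (f : T -> C) (l : C) :
  f x @[x --> F] --> l -> complex.Im (f x) @[x --> F] --> complex.Im l.
Proof.
move=> /cvgCP h; apply/cvgrPdist_lt => e e0; near=> x.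
rewrite -cImB (le_lt_trans (normc_Im _)) // normcBC.
by near: x; exact: h.
Unshelve. all: by end_near. Qed.

Lemma cvg_ReIm (T : Type) (F : set_system T) {FF : Filter F} (f : T -> C) (l : C) :
  complex.Re (f x) @[x --> F] --> complex.Re l ->
  complex.Im (f x) @[x --> F] --> complex.Im l -> f x @[x --> F] --> l.
Proof.
move=> /cvgrPdist_lt h1 /cvgrPdist_lt h2; apply/cvgCP => e e0.
have e2 : 0 < e / 2 by rewrite divr_gt0.
near=> x; rewrite (le_lt_trans (normc_le _)) // (splitr e) cReB cImB distrC.
rewrite [X in _ + X]distrC ltrD //; near: x; [exact: h1|exact: h2].
Unshelve. all: by end_near. Qed.

(** Integration in the angle, with neither [1 / (2 pi)] nor [dz]; as [dz = i (z - p) dth] on a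
    circle, a contour integral appears with an extra factor [z - p] in the integrand. *)
Definition ci (f : R -> C) : C :=
  rint 0 (2 * pi) (fun x => complex.Re (f x)) +i* rint 0 (2 * pi) (fun x => complex.Im (f x)).

Lemma twopi_gt0 : 0 < 2 * pi :> R.
Proof. by rewrite mulr_gt0 // pi_gt0. Qed.

Lemma contRe (f : R -> C) : continuous f -> continuous (fun x => complex.Re (f x)).
Proof. by move=> cf x; apply: cvg_Re; exact: cf. Qed.
Lemma contIm (f : R -> C) : continuous f -> continuous (fun x => complex.Im (f x)).
Proof. by move=> cf x; apply: cvg_Im; exact: cf. Qed.

Lemma eq_ci (f g : R -> C) : (forall x, 0 <= x <= 2 * pi -> f x = g x) -> ci f = ci g.
Proof. by move=> h; rewrite /ci; congr (_ +i* _); apply: eq_int => x /h ->. Qed.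

Lemma ciD (f g : R -> C) : continuous f -> continuous g ->
  ci (fun x => f x + g x) = ci f + ci g.
Proof.
move=> cf cg; apply: complex_ext; rewrite ?cReD ?cImD /=.
  rewrite -intD; [|exact: contRe|exact: contRe].
  by apply: eq_int => x _; rewrite cReD.
rewrite -intD; [|exact: contIm|exact: contIm].
by apply: eq_int => x _; rewrite cImD.
Qed.

Lemma ciZ (c : C) (f : R -> C) : continuous f -> ci (fun x => c * f x) = c * ci f.
Proof.
move=> cf; have cr := contRe cf; have cim := contIm cf.
have z (r : R) (g : R -> R) : continuous g -> continuous (fun x => r * g x).
  by move=> cg x; apply: cvgM; [exact: cvg_cst|exact: cg].
apply: complex_ext; rewrite ?cReM ?cImM /= -!intZ //.
  by rewrite -intB; [|exact: z|exact: z]; apply: eq_int => x _; rewrite cReM.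
by rewrite -intD; [|exact: z|exact: z]; apply: eq_int => x _; rewrite cImM.
Qed.

Lemma ciB (f g : R -> C) : continuous f -> continuous g ->
  ci (fun x => f x - g x) = ci f - ci g.
Proof.
move=> cf cg; apply: complex_ext; rewrite ?cReB ?cImB /=.
  rewrite -intB; [|exact: contRe|exact: contRe].
  by apply: eq_int => x _; rewrite cReB.
rewrite -intB; [|exact: contIm|exact: contIm].
by apply: eq_int => x _; rewrite cImB.
Qed.

Lemma ci_cst (c : C) : ci (fun=> c) = c * (2 * pi)%:C.
Proof.
by rewrite /ci !int_cst ?ltW ?twopi_gt0 // subr0; apply: complex_ext;
  rewrite ?cReM ?cImM /=; ring.
Qed.

(** The factor 2 comes from estimating real and imaginary parts separately; it is harmless, since
    the bound serves only to make integrals arbitrarily small or coefficients geometric. *)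
Lemma ci_bound (f : R -> C) (r : R) : continuous f ->
  (forall x, 0 <= x <= 2 * pi -> normc (f x) <= r) -> normc (ci f) <= 2 * (r * (2 * pi)).
Proof.
move=> cf h; rewrite (le_trans (normc_le _)) //= [leRHS](_ : _ = r * (2 * pi) + r * (2 * pi)) ?lerD //; last by ring.
  have := @int_bound _ 0 (2 * pi) r _ (ltW twopi_gt0) (contRe cf).
  by rewrite subr0; apply => x /h; apply: le_trans; exact: normc_Re.
have := @int_bound _ 0 (2 * pi) r _ (ltW twopi_gt0) (contIm cf).
by rewrite subr0; apply => x /h; apply: le_trans; exact: normc_Im.
Qed.

Lemma ci_FTC (F f : R -> C) : continuous f -> (forall x, rder F x (f x)) ->
  ci f = F (2 * pi) - F 0.
Proof.
move=> cf dF; apply: complex_ext; rewrite ?cReB ?cImB /=.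
  apply: (int_FTC (F := fun x => complex.Re (F x)) twopi_gt0 (contRe cf)).
  by move=> x; have /rderP[] := dF x.
apply: (int_FTC (F := fun x => complex.Im (F x)) twopi_gt0 (contIm cf)).
by move=> x; have /rderP[] := dF x.
Qed.

Lemma rder_cont (f : R -> C) t d : rder f t d -> {for t, continuous f}.
Proof.
by move=> /rderP[/is_derive_cont h1 /is_derive_cont h2]; apply: cvg_ReIm.
Qed.

(** The point [p + exp (t + i th)], on the circle of radius [exp t] about [p]; small circles are
    [t -> - oo]. *)
Definition pt (p : C) (t th : R) : C := p + (expR t)%:C * (cos th +i* sin th).

Lemma normc_cis (th : R) : normc (cos th +i* sin th : C) = 1.
Proof. by rewrite /= cos2Dsin2 sqrtr1. Qed.

Lemma normc_pt (p : C) (t th : R) : normc (pt p t th - p) = expR t.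
Proof.
rewrite /pt addrC addKr normcM normc_real normc_cis mulr1 ger0_norm //.
Qed.

Lemma pt_2pi (p : C) (t : R) : pt p t (2 * pi) = pt p t 0.
Proof. by rewrite /pt mulr2n mulrDl mul1r -{1 3}[pi]add0r !cosDpi !sinDpi !opprK. Qed.

Lemma pt_cont (p : C) : continuous (fun q : R * R => pt p q.1 q.2).
Proof.
move=> q.
have e : (expR q'.1)  @[q' --> q] --> expR q.1.
  by apply: continuous_comp; [exact: cvg_fst|exact: continuous_expR].
have c : (cos q'.2)  @[q' --> q] --> cos q.2.
  by apply: continuous_comp; [exact: cvg_snd|exact: continuous_cos].
have s : (sin q'.2)  @[q' --> q] --> sin q.2.
  by apply: continuous_comp; [exact: cvg_snd|exact: continuous_sin].
have E z t th : (pt z t th) = (complex.Re z + expR t * cos th) +i* (complex.Im z + expR t * sin th).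
  by apply: complex_ext; rewrite /pt ?cReD ?cImD ?cReM ?cImM /=; ring.
apply: cvg_ReIm; rewrite E /=.
  under eq_fun do rewrite E /=.
  by apply: cvgD; [exact: cvg_cst|apply: cvgM].
under eq_fun do rewrite E /=.
by apply: cvgD; [exact: cvg_cst|apply: cvgM].
Qed.

(** The exponential of [t + i th] is its own derivative, hence both partial derivatives of [pt] are
    multiples of [pt p t th - p]: by 1 in [t] and by [i] in [th]. *)
Lemma pt_rder_t (p : C) (t th : R) : rder (fun t => pt p t th) t (pt p t th - p).
Proof.
apply/rderP; rewrite /pt; split.
  rewrite (_ : (fun x => _) = (fun x => complex.Re p + expR x * cos th)); last first.
    by apply/funext => x; rewrite cReD cReM /=; ring.
  by apply: is_derive_eq; rewrite cReB cReD cReM /= /GRing.scale /=; ring.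
rewrite (_ : (fun x => _) = (fun x => complex.Im p + expR x * sin th)); last first.
  by apply/funext => x; rewrite cImD cImM /=; ring.
by apply: is_derive_eq; rewrite cImB cImD cImM /= /GRing.scale /=; ring.
Qed.

Lemma pt_rder_th (p : C) (t th : R) : rder (pt p t) th ('i * (pt p t th - p)).
Proof.
apply/rderP; rewrite /pt; split.
  rewrite (_ : (fun x => _) = (fun x => complex.Re p + expR t * cos x)); last first.
    by apply/funext => x; rewrite cReD cReM /=; ring.
  by apply: is_derive_eq; rewrite cReM cReB cImB cReD cImD cReM cImM /= /GRing.scale /=; ring.
rewrite (_ : (fun x => _) = (fun x => complex.Im p + expR t * sin x)); last first.
  by apply/funext => x; rewrite cImD cImM /=; ring.
by apply: is_derive_eq; rewrite cImM cReB cImB cReD cImD cReM cImM /= /GRing.scale /=; ring.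
Qed.

Lemma ci_param_cont (t0 : R) (g : R -> R -> C) :
  (\forall t \near t0, continuous (g t)) ->
  (forall th, {for (t0, th), continuous (fun p : R * R => g p.1 p.2)}) ->
  {for t0, continuous (fun t => ci (g t))}.
Proof.
move=> cg H; apply: cvg_ReIm => /=.
  apply: int_param_cont; first exact: ltW twopi_gt0.
    by near=> t; apply: contRe; near: t.
  by move=> th _; apply: cvg_Re; exact: H.
apply: int_param_cont; first exact: ltW twopi_gt0.
  by near=> t; apply: contIm; near: t.
by move=> th _; apply: cvg_Im; exact: H.
Unshelve. all: by end_near. Qed.

Lemma ci_param_derive (t0 : R) (g g' : R -> R -> C) :
  (\forall t \near t0, continuous (g t)) -> continuous (g' t0) ->
  (\forall t \near t0, forall th, rder (g ^~ th) t (g' t th)) ->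
  (forall th, {for (t0, th), continuous (fun p : R * R => g' p.1 p.2)}) ->
  rder (fun t => ci (g t)) t0 (ci (g' t0)).
Proof.
move=> cg cg' dg H; apply/rderP; split => /=.
  apply: (int_param_derive (g' := fun t th => complex.Re (g' t th))).
  - exact: ltW twopi_gt0.
  - by near=> t; apply: contRe; near: t.
  - exact: contRe.
  - near=> t => th; have : rder (g ^~ th) t (g' t th) by apply: (near dg t).
    by move=> /rderP[].
  - by move=> th _; apply: cvg_Re; exact: H.
apply: (int_param_derive (g' := fun t th => complex.Im (g' t th))).
- exact: ltW twopi_gt0.
- by near=> t; apply: contIm; near: t.
- exact: contIm.
- near=> t => th; have : rder (g ^~ th) t (g' t th) by apply: (near dg t).
  by move=> /rderP[].
- by move=> th _; apply: cvg_Im; exact: H.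
Unshelve. all: by end_near. Qed.

End Circle.

(** * Holomorphic functions *)

Section Hol.
Context {R : realType}.
Local Notation C := (cplx R).

Lemma ccD (T : topologicalType) (f g : T -> C) x : {for x, continuous f} ->
  {for x, continuous g} -> {for x, continuous (fun z => f z + g z)}.
Proof. by move=> cf cg; exact: (cvgD cf cg). Qed.

Lemma ccB (T : topologicalType) (f g : T -> C) x : {for x, continuous f} ->
  {for x, continuous g} -> {for x, continuous (fun z => f z - g z)}.
Proof. by move=> cf cg; exact: (cvgB cf cg). Qed.

Lemma ccM (T : topologicalType) (f g : T -> C) x : {for x, continuous f} ->
  {for x, continuous g} -> {for x, continuous (fun z => f z * g z)}.
Proof. by move=> cf cg; exact: (cvgM cf cg). Qed.

Lemma ccN (T : topologicalType) (f : T -> C) x : {for x, continuous f} ->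
  {for x, continuous (fun z => - f z)}.
Proof. by move=> cf; exact: (cvgN cf). Qed.

Lemma ccV (T : topologicalType) (f : T -> C) x : f x != 0 -> {for x, continuous f} ->
  {for x, continuous (fun z => (f z)^-1)}.
Proof. by move=> f0 cf; exact: (cvgV f0 cf). Qed.

Lemma cc_cst (T : topologicalType) (c : C) (x : T) : {for x, continuous (fun=> c)}.
Proof. exact: cvg_cst. Qed.

Lemma ccX (T : topologicalType) (f : T -> C) x n : {for x, continuous f} ->
  {for x, continuous (fun z => f z ^+ n)}.
Proof.
move=> cf; elim: n => [|n IH].
  rewrite (_ : (fun z => f z ^+ 0) = fun=> 1); first exact: cc_cst.
  by apply/funext => z; rewrite expr0.
rewrite (_ : (fun z => f z ^+ n.+1) = fun z => f z * f z ^+ n); first exact: ccM.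
by apply/funext => z; rewrite exprS.
Qed.

Lemma gcM (T : topologicalType) (f g : T -> C) : continuous f -> continuous g ->
  continuous (fun z => f z * g z).
Proof. by move=> cf cg z; exact: (ccM (cf z) (cg z)). Qed.

Lemma gcD (T : topologicalType) (f g : T -> C) : continuous f -> continuous g ->
  continuous (fun z => f z + g z).
Proof. by move=> cf cg z; exact: (ccD (cf z) (cg z)). Qed.

Lemma gc_cst (T : topologicalType) (c : C) : continuous (fun _ : T => c).
Proof. by move=> z; exact: cc_cst. Qed.

Lemma gcZ (T : topologicalType) (c : C) (f : T -> C) : continuous f ->
  continuous (fun z => c * f z).
Proof. by move=> cf z; exact (ccM (@cc_cst _ c z) (cf z)). Qed.

Definition copen (D : set C) : Prop :=
  forall z, D z -> exists2 d : R, 0 < d & forall w, normc (w - z) < d -> D w.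

Definition dC (f : C -> C) : C -> C := derive1 f.

(* A record, so that proof search does not unfold it. *)
Record hol (D : set C) (f : C -> C) : Prop := Hol { hol_at :>
  forall z, D z -> derivable f z 1 /\ {for z, continuous (dC f)} }.

Lemma cder_eq (f g : C -> C) (z l d : C) (r : R) : 0 < r ->
  (forall w, normc (w - z) < r -> f w = g w) ->
  is_derive z (1 : C) f l -> is_derive z (1 : C) g l.
Proof.
move=> r0 fg /cderP H; apply/cderP => e e0; have [d' d0 dH] := H e e0.
exists (Num.min d' r); first by rewrite lt_min d0.
move=> h; rewrite lt_min => /andP[/dH {}dH hr].
have E : g (z + h) = f (z + h) by rewrite fg // addrC addKr.
by rewrite E -(fg z) // subrr Normc.normc0.
Qed.

Lemma cont_eq (f g : C -> C) (z : C) (r : R) : 0 < r ->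
  (forall w, normc (w - z) < r -> f w = g w) ->
  {for z, continuous f} -> {for z, continuous g}.
Proof.
move=> r0 fg /contCP H; apply/contCP => e e0; have [d' d0 dH] := H e e0.
exists (Num.min d' r); first by rewrite lt_min d0.
move=> h; rewrite lt_min => /andP[/dH {}dH hr].
by rewrite -(fg h) // -(fg z) // subrr Normc.normc0.
Qed.

Lemma derive1_is (f : C -> C) (z l : C) : is_derive z (1 : C) f l -> dC f z = l.
Proof. by move=> [_ <-]; rewrite /dC derive1E. Qed.

Lemma is_derive1 (f : C -> C) (z : C) : derivable f z 1 ->
  is_derive z (1 : C) f (dC f z).
Proof. by move=> d; apply: DeriveDef; [exact: d|rewrite /dC derive1E]. Qed.

Lemma holI (D : set C) (f f' : C -> C) : copen D ->
  (forall z, D z -> is_derive z (1 : C) f (f' z)) ->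
  (forall z, D z -> {for z, continuous f'}) -> hol D f.
Proof.
move=> oD df cf; apply: Hol => z Dz; split; first by case: (df _ Dz).
have [d d0 dD] := oD _ Dz.
by apply: (cont_eq d0 _ (cf _ Dz)) => w /dD /df /derive1_is.
Qed.

Lemma hol_is (D : set C) (f : C -> C) z : hol D f -> D z ->
  is_derive z (1 : C) f (dC f z).
Proof. by move=> h Dz; have [/is_derive1] := h z Dz. Qed.

Lemma hol_cont (D : set C) (f : C -> C) z : hol D f -> D z -> {for z, continuous f}.
Proof. by move=> h /(hol_is h) /cder_cont. Qed.

Lemma hol_sub (D D' : set C) (f : C -> C) : D' `<=` D -> hol D f -> hol D' f.
Proof. by move=> s h; apply: Hol => z /s Dz; exact: h. Qed.

Lemma hol_eq (D : set C) (f g : C -> C) : copen D -> (forall z, D z -> f z = g z) ->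
  hol D f -> hol D g.
Proof.
move=> oD fg hf; apply: (holI (f' := dC f) oD) => z Dz; last by case: (hf z Dz).
have [d d0 dD] := oD _ Dz.
by apply: (cder_eq 0 d0 _ (hol_is hf Dz)) => w /dD /fg.
Qed.

Lemma holD (D : set C) (f g : C -> C) : copen D -> hol D f -> hol D g ->
  hol D (fun z => f z + g z).
Proof.
move=> oD hf hg; apply (@holI _ _ (fun z => dC f z + dC g z) oD).
  move=> z Dz.
  by apply: is_deriveD; [exact: (hol_is hf Dz)|exact: (hol_is hg Dz)].
by move=> z Dz; apply: ccD; [case: (hf z Dz)|case: (hg z Dz)].
Qed.

Lemma holM (D : set C) (f g : C -> C) : copen D -> hol D f -> hol D g ->
  hol D (fun z => f z * g z).
Proof.
move=> oD hf hg; apply (@holI _ _ (fun z => f z * dC g z + g z * dC f z) oD).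
  move=> z Dz.
  exact: (is_deriveM (hol_is hf Dz) (hol_is hg Dz)).
by move=> z Dz; apply: ccD; apply: ccM; [exact: (hol_cont hf Dz)|case: (hg z Dz)|exact: (hol_cont hg Dz)|case: (hf z Dz)].
Qed.

Lemma cderV (f : C -> C) (z d : C) : f z != 0 -> is_derive z (1 : C) f d ->
  is_derive z (1 : C) (fun z => (f z)^-1) (- (f z)^-2 * d).
Proof.
move=> fz [df <-]; split; first exact: derivableV.
by rewrite deriveV // /GRing.scale.
Qed.

Lemma holV (D : set C) (f : C -> C) : copen D -> hol D f ->
  (forall z, D z -> f z != 0) -> hol D (fun z => (f z)^-1).
Proof.
move=> oD hf f0; apply (@holI _ _ (fun z => - (f z)^-2 * dC f z) oD).
  move=> z Dz.
  by apply: cderV; [exact: f0|exact: (hol_is hf Dz)].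
move=> z Dz; apply: ccM; last by case: (hf z Dz).
apply: ccN; apply: ccV; first by rewrite expf_eq0 (negbTE (f0 z Dz)).
by apply: ccX; exact: (hol_cont hf Dz).
Qed.

Lemma hol_cst (D : set C) (c : C) : copen D -> hol D (fun=> c).
Proof.
move=> oD; apply (@holI _ _ (fun=> 0) oD).
  by move=> z Dz; exact (is_derive_cst (c : C) z 1).
by move=> z Dz; exact: cc_cst.
Qed.

Lemma hol_id (D : set C) : copen D -> hol D (fun z => z).
Proof.
move=> oD; apply (@holI _ _ (fun=> 1) oD).
  by move=> z Dz; exact (is_derive_id z (1 : C)).
by move=> z Dz; exact: cc_cst.
Qed.

Lemma holB (D : set C) (f g : C -> C) : copen D -> hol D f -> hol D g ->
  hol D (fun z => f z - g z).
Proof.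
move=> oD hf hg; apply (@holI _ _ (fun z => dC f z - dC g z) oD).
  move=> z Dz.
  by apply: is_deriveB; [exact: (hol_is hf Dz)|exact: (hol_is hg Dz)].
by move=> z Dz; apply: ccB; [case: (hf z Dz)|case: (hg z Dz)].
Qed.

Lemma holX (D : set C) (f : C -> C) n : copen D -> hol D f -> hol D (fun z => f z ^+ n).
Proof.
move=> oD hf; elim: n => [|n IH].
  by apply: (hol_eq oD _ (hol_cst 1 oD)) => z _; rewrite expr0.
by apply: (hol_eq oD _ (holM oD hf IH)) => z _; rewrite exprS.
Qed.

Definition ann (p : C) (r1 r2 : R) : set C := [set z | r1 < normc (z - p) < r2].

Lemma copen_ann p r1 r2 : copen (ann p r1 r2).
Proof.
move=> z /andP[z1 z2].
exists (Num.min (normc (z - p) - r1) (r2 - normc (z - p))).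
  by rewrite lt_min !subr_gt0 z1.
move=> w; rewrite lt_min => /andP[w1 w2].
have q1 := normc_subl w z p; have q2 := normc_subl z w p.
rewrite [normc (z - w)]normcBC in q2.
rewrite /ann /=.
by apply/andP; split; lra.
Qed.

Lemma ann_pt p r1 r2 t th : r1 < expR t < r2 -> ann p r1 r2 (pt p t th).
Proof. by rewrite /ann /= normc_pt. Qed.

Lemma near_ann (r1 r2 t : R) : r1 < expR t < r2 -> \forall t' \near t, r1 < expR t' < r2.
Proof.
move=> /andP[h1 h2].
have := @continuous_expR R t.
move=> c; near=> t'; apply/andP; split; near: t'.
  by apply: (cvgr_gt _ c).
by apply: (cvgr_lt _ c).
Unshelve. all: by end_near. Qed.

Lemma pt_cont_th (p : C) t : continuous (pt p t).
Proof. by move=> th; exact: rder_cont (pt_rder_th p t th). Qed.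

Lemma cont_circ (f : C -> C) p t : (forall z, normc (z - p) = expR t -> {for z, continuous f}) ->
  continuous (fun th => f (pt p t th)).
Proof.
move=> cf th; apply: (@continuous_comp _ _ _ (pt p t) f); first exact: pt_cont_th.
by apply: cf; exact: normc_pt.
Qed.

Lemma rder0_const (G : R -> C) (t1 t2 : R) : t1 <= t2 ->
  (forall t, t1 <= t <= t2 -> {for t, continuous G}) ->
  (forall t, t1 < t < t2 -> rder G t 0) -> G t1 = G t2.
Proof.
rewrite le_eqVlt => /predU1P[->//|t12] cG dG.
have real (g : R -> R) : (forall t, t1 <= t <= t2 -> {for t, continuous g}) ->
    (forall t : R, t1 < t < t2 -> is_derive t 1 g 0) -> g t1 = g t2.
  move=> cg dg.
  have d0 (x : R) : x \in `]t1, t2[ -> is_derive x 1 g 0.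
    by rewrite in_itv /=; exact: dg.
  have c0 : {within `[t1, t2], continuous g}.
    by apply: continuous_in_subspaceT => x; rewrite inE /= in_itv /=; exact: cg.
  have [c _] := @MVT _ g (fun=> 0) t1 t2 t12 d0 c0.
  by rewrite mul0r => /eqP; rewrite subr_eq0 => /eqP.
apply: complex_ext.
  apply: (real (fun t => complex.Re (G t))); first by move=> t /cG h; apply: cvg_Re.
  by move=> t /dG /rderP[].
apply: (real (fun t => complex.Im (G t))); first by move=> t /cG h; apply: cvg_Im.
by move=> t /dG /rderP[].
Qed.

(** Cauchy's theorem for annuli. The derivative of the circle integral in [t] is the integral of
    [f' (z) (z - p)], which up to the factor [i] is an angular derivative and integrates to 0;
    continuity of [f'], part of [hol], allows differentiation under the integral. On the one
    exceptional circle of radius [rs] only continuity of [f] is asked: the difference quotients of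
    Cauchy's formula are treated as merely continuous on the circle through their base point. *)
Lemma circ_const (p : C) (r1 r2 rs t1 t2 : R) (f : C -> C) :
  r1 < expR t1 -> t1 <= t2 -> expR t2 < r2 ->
  (forall z, ann p r1 r2 z -> {for z, continuous f}) ->
  hol [set z | ann p r1 r2 z /\ normc (z - p) != rs] f ->
  ci (fun th => f (pt p t1 th)) = ci (fun th => f (pt p t2 th)).
Proof.
move=> h1 t12 h2 cf hf.
pose G t := ci (fun th => f (pt p t th)).
have in_ann t : t1 <= t <= t2 -> r1 < expR t < r2.
  move=> /andP[a b]; rewrite (lt_le_trans h1) ?ler_expR //=.
  by rewrite (le_lt_trans _ h2) ?ler_expR.
have contG t : t1 <= t <= t2 -> {for t, continuous G}.
  move=> /in_ann ta; apply: ci_param_cont.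
    near=> t' => th; apply: cont_circ => z zt; apply: cf.
    by rewrite /ann /= zt; near: t'; exact: near_ann.
  move=> th; apply: (@continuous_comp _ _ _ (fun q : R * R => pt p q.1 q.2) f).
    exact: pt_cont.
  by apply: cf; exact: ann_pt.
have derG t : t1 <= t <= t2 -> expR t != rs -> rder G t 0.
  move=> /in_ann ta ts.
  pose g' (t th : R) : C := dC f (pt p t th) * (pt p t th - p).
  have inD t' th : r1 < expR t' < r2 -> expR t' != rs ->
      [set z | ann p r1 r2 z /\ normc (z - p) != rs] (pt p t' th).
    by move=> a b; split; [exact: ann_pt|rewrite normc_pt].
  have cg' th : {for (t, th), continuous (fun q : R * R => g' q.1 q.2)}.
    apply: ccM.
      apply: (@continuous_comp _ _ _ (fun q : R * R => pt p q.1 q.2) (dC f)).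
        exact: pt_cont.
      by have [_] := hf _ (inD _ th ta ts).
    by apply: ccB; [exact: pt_cont|exact: cc_cst].
  have cgt : continuous (g' t).
    move=> th; apply (@ccM _ (fun th => dC f (pt p t th)) (fun th => pt p t th - p) th); last first.
      by apply (@ccB _ (pt p t) (fun=> p) th); [exact: pt_cont_th|exact: cc_cst].
    apply: (@continuous_comp _ _ _ (pt p t) (dC f)); first exact: pt_cont_th.
    by have [_] := hf _ (inD _ th ta ts).
  (* [i g'] is the derivative of [f] along the circle, which closes up. *)
  have E : ci (g' t) = 0.
    have i0 : 'i%C != 0 :> C by rewrite eq_complex /= oner_eq0 andbF.
    apply: (mulfI i0); rewrite mulr0 -ciZ //.
    rewrite (ci_FTC (F := fun th => f (pt p t th))).
    - by rewrite pt_2pi subrr.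
    - by move=> th; apply (@ccM _ (fun=> 'i%C) (g' t) th); [exact: cc_cst|exact: cgt].
    - move=> th; have := cder_rder (hol_is hf (inD _ th ta ts)) (pt_rder_th p t th).
      by rewrite /g' mulrCA.
  rewrite -E; apply: ci_param_derive => //.
    near=> t' => th; apply: cont_circ => z zt; apply: cf.
    by rewrite /ann /= zt; near: t'; exact: near_ann.
  near=> t' => th.
  have ta' : r1 < expR t' < r2 by near: t'; exact: near_ann.
  have ts' : expR t' != rs.
    near: t'; move: ts; rewrite neq_lt => /orP[lt|lt].
      near=> t'; rewrite lt_eqF //; near: t'.
      by apply: (cvgr_lt _ (@continuous_expR R t)).
    near=> t'; rewrite gt_eqF //; near: t'.
    by apply: (cvgr_gt _ (@continuous_expR R t)).
  exact (@cder_rder _ f (fun t => pt p t th) t' _ _ (hol_is hf (inD _ th ta' ts')) (pt_rder_t p t' th)).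
change (G t1 = G t2).
have [rs0|rs0] := leP rs 0.
  apply (@rder0_const G) => //.
  move=> t /andP[/ltW a /ltW b]; apply: derG; first by rewrite a.
  by rewrite gt_eqF // (le_lt_trans rs0) // expR_gt0.
(* The integral is constant on either side of the exceptional radius and continuous across it. *)
pose ts := ln rs.
have tsE t : t != ts -> expR t != rs.
  by apply: contra => /eqP e; rewrite /ts -e expRK.
have step a b : t1 <= a -> a <= b -> b <= t2 -> (forall t, a < t < b -> t != ts) -> G a = G b.
  move=> ta ab bt nts; apply (@rder0_const G) => // t /andP[x y].
    by apply: contG; rewrite (le_trans ta x) (le_trans y bt).
  apply: derG; last by apply: tsE; apply: nts; rewrite x.
  by rewrite (le_trans ta (ltW x)) (le_trans (ltW y) bt).
have [s1|s1] := leP ts t1.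
  by apply: step => // t /andP[x _]; rewrite gt_eqF // (le_lt_trans s1).
have [s2|s2] := leP t2 ts.
  by apply: step => // t /andP[_ y]; rewrite lt_eqF // (lt_le_trans y).
transitivity (G ts).
  by apply: step; rewrite ?lexx ?(ltW s1) ?(ltW s2) // => t /andP[_ y]; rewrite lt_eqF.
by apply: step; rewrite ?lexx ?(ltW s1) ?(ltW s2) // => t /andP[x _]; rewrite gt_eqF.
Unshelve. all: by end_near. Qed.

End Hol.

(** * Cauchy's formula on a punctured disc *)

Section Cauchy.
Context {R : realType}.
Local Notation C := (cplx R).

Lemma copen_punct (p : C) : copen [set z | z != p].
Proof.
move=> z /= zp; exists (normc (z - p)); first by rewrite normc_gt0 subr_eq0.
move=> w; apply: contraTneq => ->; rewrite normcBC ltxx //.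
Qed.

Lemma normc_le0P (z : C) : (forall e : R, 0 < e -> normc z <= e) -> z = 0.
Proof.
move=> h; apply/eqP; rewrite -normc_eq0 eq_le normc_ge0 andbT.
by apply/ler_addgt0Pl => e e0; rewrite addr0 h.
Qed.

Lemma hol_sub_cst (D : set C) (c : C) : copen D -> hol D (fun z => z - c).
Proof. by move=> oD; apply holB => //; [exact: hol_id|exact: hol_cst]. Qed.

Lemma hol_invX (p : C) n (D : set C) : copen D -> (forall z, D z -> z != p) ->
  hol D (fun w => ((w - p) ^+ n)^-1).
Proof.
move=> oD Dp; apply holV => //; first by apply holX => //; exact: hol_sub_cst.
by move=> z /Dp zp; rewrite expf_neq0 // subr_eq0.
Qed.

Lemma ann_neq (p : C) r1 r2 z : 0 <= r1 -> ann p r1 r2 z -> z != p.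
Proof.
move=> r10 /andP[h _]; apply: contraTneq h => ->.
by rewrite subrr Normc.normc0 -leNgt.
Qed.

Lemma pt_neq (p : C) t th : pt p t th - p != 0.
Proof. by rewrite -normc_gt0 normc_pt expR_gt0. Qed.

Lemma cont_ptX (p : C) t n : continuous (fun th => ((pt p t th - p) ^+ n)^-1 : C).
Proof.
apply (@cont_circ _ (fun z => ((z - p) ^+ n)^-1) p t) => z zt.
apply: (@hol_cont _ [set z | z != p]); last first.
  by rewrite /= -subr_eq0 -normc_gt0 zt expR_gt0.
by apply hol_invX => //; exact: copen_punct.
Qed.

(** The integral does not depend on the radius, and on large circles it is at most a constant over
    the radius. *)
Lemma ci_inv_pow (p : C) t n : ci (fun th => ((pt p t th - p) ^+ n.+1)^-1) = 0.
Proof.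
apply: normc_le0P => e e0.
pose t2 := Num.max t (Num.max 0 (ln (2 * (2 * pi) / e))).
have tt2 : t <= t2 by rewrite le_max lexx.
rewrite (@circ_const _ p 0 (expR t2 + 1) 0 t t2 (fun w => ((w - p) ^+ n.+1)^-1)); last 5 first.
- exact: expR_gt0.
- exact: tt2.
- by rewrite ltrDl.
- move=> z az; apply: (@hol_cont _ (ann p 0 (expR t2 + 1))) => //.
  by apply hol_invX; [exact: copen_ann|move=> w; exact: ann_neq].
- apply: (@hol_sub _ [set z | z != p]); last by apply hol_invX; [exact: copen_punct|].
  by move=> z [az _]; exact: ann_neq az.
apply: (@le_trans _ _ (2 * ((expR t2)^-1 * (2 * pi)))).
  apply ci_bound; first exact: cont_ptX.
  move=> th _; rewrite normcV normcX normc_pt lef_pV2 ?posrE ?exprn_gt0 ?expR_gt0 //.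
  rewrite exprS ler_peMr ?expR_ge0 // exprn_ege1 // -expR0 ler_expR /t2.
  by rewrite !le_max lexx !orbT.
rewrite mulrCA mulrC ler_pdivrMr ?expR_gt0 // -ler_pdivrMl //.
have q : 0 < 2 * (2 * pi) / e by rewrite divr_gt0 // mulr_gt0 // twopi_gt0.
rewrite mulrC -[leLHS]lnK ?posrE // ler_expR /t2 !le_max lexx !orbT //.
Qed.

(** The finite geometric series in [w / x] with its exact remainder, so that it can be integrated
    term by term without a limit under the integral. *)
Lemma kernel_geom (x w : C) N : x != 0 -> x - w != 0 ->
  x / (x - w) = \sum_(j < N) w ^+ j * (x ^+ j)^-1 + w ^+ N * (x ^+ N)^-1 * (x / (x - w)).
Proof.
move=> x0 xw; elim: N => [|N IH]; first by rewrite big_ord0 !expr0 invr1 !mul1r add0r.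
rewrite big_ord_recr /= -addrA {1}IH; congr (_ + _).
rewrite !exprS; field.
by rewrite xw x0 expf_neq0.
Qed.

Lemma cont_bounded (f : R -> C) : continuous f ->
  exists2 M : R, 0 < M & forall x, 0 <= x <= 2 * pi -> normc (f x) <= M.
Proof.
move=> cf.
have cn : {within `[0, 2 * pi], continuous (fun x => normc (f x))}.
  apply: continuous_subspaceT => x; apply/cvgrPdist_lt => e e0.
  have /cvgCP H : f y @[y --> x] --> f x by exact: cf.
  near=> y; have h : normc (f y - f x) < e by near: y; exact: H.
  rewrite ltr_norml; have := normc_lb (f x) (f y); have := normc_lb (f y) (f x).
  rewrite [normc (f x - f y)]normcBC; move: h; lra.
have [c _ H] := EVT_max (ltW twopi_gt0) cn.
exists (normc (f c) + 1); first by rewrite ltr_wpDl // normc_ge0.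
by move=> x xI; rewrite (le_trans (H x _)) ?in_itv // lerDl.
Unshelve. all: by end_near. Qed.

Lemma cont_kernel (p w : C) t : normc w < expR t ->
  continuous (fun th => (pt p t th - p) / (pt p t th - p - w)).
Proof.
move=> wt; apply (@cont_circ _ (fun z => (z - p) / (z - p - w)) p t) => z zt.
have cz c : {for z, continuous (fun z : C => z - c)} by apply (@ccB _ _ (fun z => z) (fun=> c) z) => //; exact: cc_cst.
apply (@ccM _ _ (fun z => z - p) (fun z => (z - p - w)^-1)) => //.
apply (@ccV _ _ (fun z => z - p - w)).
  by rewrite subr_eq0; apply: contraTneq wt => <-; rewrite zt ltxx.
apply (@ccB _ _ (fun z => z - p) (fun=> w)) => //; exact: cc_cst.
Qed.

Lemma normc_kernel (x w : C) r : normc x = r -> normc w < r ->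
  normc (x / (x - w)) <= r / (r - normc w).
Proof.
move=> xr wr; rewrite normcM normcV xr; have x0 := normc_ge0 w.
rewrite ler_pM2l ?(le_lt_trans x0 wr) //.
have := normc_lb x w; rewrite xr => h.
by rewrite lef_pV2 ?posrE ?subr_gt0 // (lt_le_trans _ h) // subr_gt0.
Qed.

(** For any continuous [f] on the circle, the boundary values of a holomorphic function or not, the
    Cauchy integral is a power series in [w] with coefficients and truncation error of geometric
    size. The constant [M] is chosen before [w]. *)
Lemma cauchy_series (p : C) t (f : R -> C) : continuous f ->
  exists2 M : R, 0 < M & forall w : C, normc w < expR t ->
    let a j := ci (fun th => f th * ((pt p t th - p) ^+ j)^-1) in
    (forall j, normc (a j) <= M / expR t ^+ j) /\
    forall N, normc (ci (fun th => f th * ((pt p t th - p) / (pt p t th - p - w)))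
      - \sum_(j < N) a j * w ^+ j)
    <= M * (normc w / expR t) ^+ N * (expR t / (expR t - normc w)).
Proof.
move=> cf; have [M M0 fM] := cont_bounded cf.
exists (2 * (M * (2 * pi))); first by rewrite mulr_gt0 // mulr_gt0 // twopi_gt0.
move=> w wt a; have et := expR_gt0 t.
have ca j : continuous (fun th => f th * ((pt p t th - p) ^+ j)^-1).
  by move=> th; apply (@ccM _ _ f (fun th => ((pt p t th - p) ^+ j)^-1)); [exact: cf|exact: cont_ptX].
split.
  move=> j; rewrite (le_trans (ci_bound (ca j) (r := M / expR t ^+ j) _)) //; last first.
    by rewrite le_eqVlt; apply/orP; left; apply/eqP; ring.
  move=> th /fM h; rewrite normcM normcV normcX normc_pt.
  by rewrite ler_pM2r // invr_gt0 exprn_gt0.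
move=> N.
have ck := @cont_kernel p w t wt.
pose rem th : C := f th * (w ^+ N * ((pt p t th - p) ^+ N)^-1 * ((pt p t th - p) / (pt p t th - p - w))).
have crem : continuous rem.
  move=> th; apply (@ccM _ _ f (fun th => w ^+ N * ((pt p t th - p) ^+ N)^-1 * ((pt p t th - p) / (pt p t th - p - w)))).
    exact: cf.
  apply (@ccM _ _ (fun th => w ^+ N * ((pt p t th - p) ^+ N)^-1)); last exact: ck.
  by apply (@ccM _ _ (fun=> w ^+ N)); [exact: cc_cst|exact: cont_ptX].
have csum n : continuous (fun th => \sum_(j < n) f th * ((pt p t th - p) ^+ j)^-1 * w ^+ j) /\
   ci (fun th => \sum_(j < n) f th * ((pt p t th - p) ^+ j)^-1 * w ^+ j) = \sum_(j < n) a j * w ^+ j.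
  elim: n => [|n [IH1 IH2]].
    rewrite (_ : (fun th => _) = fun=> 0); last by apply/funext => th; rewrite big_ord0.
    by split; [move=> th; exact: cc_cst|rewrite ci_cst mul0r big_ord0].
  rewrite (_ : (fun th => _) = fun th => \sum_(j < n) f th * ((pt p t th - p) ^+ j)^-1 * w ^+ j
     + w ^+ n * (f th * ((pt p t th - p) ^+ n)^-1)); last first.
    by apply/funext => th; rewrite big_ord_recr /= [X in _ + X]mulrC.
  have cl : continuous (fun th => w ^+ n * (f th * ((pt p t th - p) ^+ n)^-1)).
    by apply gcZ; exact: ca.
  split; first by move=> th; apply ccD; [exact: IH1|exact: cl].
  by rewrite (ciD IH1 cl) IH2 (ciZ _ (ca n)) big_ord_recr /=; congr (_ + _); rewrite mulrC.
have [cs es] := csum N.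
have -> : ci (fun th => f th * ((pt p t th - p) / (pt p t th - p - w))) =
   \sum_(j < N) a j * w ^+ j + ci rem.
  rewrite -es -ciD //; apply: eq_ci => th _.
  rewrite {1}(@kernel_geom _ w N) ?pt_neq //; last first.
    by rewrite subr_eq0; apply: contraTneq wt => <-; rewrite normc_pt ltxx.
  by rewrite mulrDr /rem; congr (_ + _); rewrite mulr_sumr; apply: eq_bigr => j _; rewrite -!mulrA [w ^+ j * _]mulrC.
rewrite addrC addKr.
have B : 0 <= (normc w / expR t) ^+ N * (expR t / (expR t - normc w)).
  rewrite mulr_ge0 ?exprn_ge0 ?divr_ge0 ?normc_ge0 ?expR_ge0 ?subr_ge0 ?(ltW wt) //.
rewrite (le_trans (ci_bound crem (r := M * ((normc w / expR t) ^+ N * (expR t / (expR t - normc w)))) _)) //; last first.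
  by rewrite le_eqVlt; apply/orP; left; apply/eqP; ring.
move=> th /fM h; rewrite /rem normcM ler_pM ?normc_ge0 // normcM ler_pM ?normc_ge0 //.
  by rewrite normcM normcV !normcX normc_pt expr_div_n.
by apply normc_kernel; rewrite ?normc_pt.
Qed.

Lemma geom_small (M q K : R) : 0 <= q < 1 -> 0 <= M -> 0 <= K ->
  forall e, 0 < e -> exists N, M * q ^+ N * K <= e.
Proof.
move=> /andP[q0 q1] M0 K0 e e0.
have c : q ^+ n @[n --> \oo] --> 0 by apply: cvg_expr; rewrite ger0_norm.
have e1 : 0 < e / (M * K + 1) by rewrite divr_gt0 // ltr_wpDl // mulr_ge0.
move/cvgrPdist_lt : c => /(_ _ e1) [N _ /(_ N (leqnn _))] /=.
rewrite sub0r normrN ger0_norm ?exprn_ge0 // => h; exists N.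
rewrite mulrAC (le_trans (ler_wpM2l (mulr_ge0 M0 K0) (ltW h))) //.
have MK : 0 < M * K + 1 by rewrite ltr_wpDl // mulr_ge0.
by rewrite mulrCA ler_piMr ?(ltW e0) // ler_pdivrMr ?mul1r ?lerDl.
Qed.

(** The series of the constant function 1: all coefficients but the zeroth vanish by
    [ci_inv_pow]. *)
Lemma kernel_int (p w : C) t : normc w < expR t ->
  ci (fun th => (pt p t th - p) / (pt p t th - p - w)) = (2 * pi)%:C.
Proof.
move=> wt; have c1 : continuous (fun _ : R => 1 : C) by move=> T; exact: cc_cst.
have [M M0 /(_ w wt) [_ H]] := cauchy_series p t c1.
apply/eqP; rewrite -subr_eq0; apply/eqP; apply: normc_le0P => e e0.
have q01 : 0 <= normc w / expR t < 1.
  by rewrite divr_ge0 ?normc_ge0 ?expR_ge0 //= ltr_pdivrMr ?expR_gt0 // mul1r.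
have K0 : 0 <= expR t / (expR t - normc w) by rewrite divr_ge0 ?expR_ge0 // subr_ge0 ltW.
have [N HN] := geom_small q01 (ltW M0) K0 e0.
apply: le_trans HN.
(* Passing to [N.+1] terms makes sure that the zeroth one, the value [2 pi], is in the sum. *)
have HN1 : M * (normc w / expR t) ^+ N.+1 * (expR t / (expR t - normc w)) <=
   M * (normc w / expR t) ^+ N * (expR t / (expR t - normc w)).
  rewrite ler_wpM2r // ler_wpM2l ?(ltW M0) // exprS ler_piMl ?exprn_ge0 //.
  - by case/andP: q01.
  - by case/andP: q01 => _ /ltW.
apply: le_trans HN1; apply: le_trans (H N.+1).
rewrite big_ord_recl /= big1; last first.
  move=> i _; rewrite (_ : (fun th => _) = (fun th => ((pt p t th - p) ^+ i.+1)^-1)).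
    by rewrite ci_inv_pow mul0r.
  by apply/funext => th; rewrite mul1r.
rewrite addr0 expr0 mulr1.
have -> : ci (fun th => 1 / (pt p t th - p) ^+ 0) = (2 * pi)%:C.
  rewrite -[RHS]mul1r -ci_cst; apply: eq_ci => th _; by rewrite expr0 divr1.
have -> : ci (fun th => 1 * ((pt p t th - p) / (pt p t th - p - w))) =
  ci (fun th => (pt p t th - p) / (pt p t th - p - w)) by apply: eq_ci => th _; rewrite mul1r.
by [].
Qed.

Lemma copenI (D E : set C) : copen D -> copen E -> copen (fun z => D z /\ E z).
Proof.
move=> oD oE z [/oD[d d0 dD] /oE[e e0 eE]]; exists (Num.min d e); first by rewrite lt_min d0.
by move=> w; rewrite lt_min => /andP[/dD ? /eE ?].
Qed.

Lemma copen_circ (p : C) (r : R) : copen [set z | normc (z - p) != r].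
Proof.
move=> z /= zr; exists (`|normc (z - p) - r|); first by rewrite normr_gt0 subr_eq0.
move=> w wz; apply: contraTneq wz => <-; rewrite -leNgt.
have := normc_lb (z - p) (w - p); have := normc_lb (w - p) (z - p).
rewrite (_ : w - p - (z - p) = w - z); last by ring.
rewrite (_ : z - p - (w - p) = z - w); last by ring.
rewrite [normc (z - w)]normcBC ler_norml; lra.
Qed.

(** The difference quotient continued by the derivative at [z0], where it stays continuous. *)
Definition dquot (f : C -> C) (z0 z : C) : C :=
  if z == z0 then dC f z0 else (f z - f z0) / (z - z0).

Lemma dquot_cont (f : C -> C) (z0 : C) : derivable f z0 1 -> {for z0, continuous (dquot f z0)}.
Proof.
move=> /is_derive1 /cderP H; apply/contCP => e e0.
have e2 : 0 < e / 2 by rewrite divr_gt0.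
have [d d0 dH] := H _ e2; exists d => // w wz; rewrite /dquot eqxx.
case: eqVneq => [_|wz0]; first by rewrite subrr Normc.normc0.
have h0 : w - z0 != 0 by rewrite subr_eq0.
have := dH _ wz; rewrite [z0 + _]addrC subrK -mulRI.
rewrite (_ : f w - f z0 - dC f z0 * (w - z0) = ((f w - f z0) / (w - z0) - dC f z0) * (w - z0)); last by field.
rewrite normcM ler_pM2r ?normc_gt0 // => /le_lt_trans; apply.
by rewrite ltr_pdivrMr // ltr_pMr // ltr1n.
Qed.

Lemma dquot_hol (D : set C) (f : C -> C) (z0 : C) : copen D -> hol D f ->
  (forall z, D z -> z != z0) -> hol D (dquot f z0).
Proof.
move=> oD hf Dz; apply (@hol_eq _ D (fun z => (f z - f z0) * ((z - z0) ^+ 1)^-1) _ oD).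
  by move=> z /Dz /negbTE h; rewrite /dquot h expr1.
apply (holM oD); last exact: hol_invX.
by apply (holB oD) => //; exact: hol_cst.
Qed.

(** Cauchy's formula at [p + w] with no growth condition at the puncture [p]: the hypothesis asks
    for small Cauchy integrals on some arbitrarily small circles, a sequence of radii being enough.
    The function [g] below has constant circle integrals; their value is the difference of the two
    sides on the large circle, and tends to 0 along the small ones. *)
Lemma cauchy_punct (p w : C) (r T : R) (f : C -> C) :
  hol (ann p 0 r) f -> 0 < normc w -> normc w < expR T -> expR T < r ->
  (forall e : R, 0 < e -> exists2 t, expR t < e &
     normc (ci (fun th => f (pt p t th) * ((pt p t th - p) / (pt p t th - p - w)))) <= e) ->
  ci (fun th => f (pt p T th) * ((pt p T th - p) / (pt p T th - p - w))) =
  f (p + w) * (2 * pi)%:C.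
Proof.
move=> hf w0 wT Tr W.
have az0 : ann p 0 r (p + w) by rewrite /ann /= [p + w]addrC addrK w0 (lt_trans wT Tr).
pose g z := (z - p) * dquot f (p + w) z.
have hid c (D : set C) : copen D -> hol D (fun z => z - c) by exact: hol_sub_cst.
have oD : copen [set z | ann p 0 r z /\ normc (z - p) != normc w].
  by apply: copenI; [exact: copen_ann|exact: copen_circ].
have hg : hol [set z | ann p 0 r z /\ normc (z - p) != normc w] g.
  apply holM => //; first exact: hid.
  apply dquot_hol => //; first by apply: hol_sub hf => z [].
  by move=> z [_]; apply: contraNneq => ->; rewrite [p + w]addrC addrK.
have cg z : ann p 0 r z -> {for z, continuous g}.
  move=> az; apply (@ccM _ _ (fun z => z - p)).
    by apply: (hol_cont (hid p _ (@copen_ann _ p 0 r))).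
  have [->|zn] := eqVneq z (p + w); first by apply dquot_cont; case: (hf _ az0).
  apply: (@hol_cont _ (fun z => ann p 0 r z /\ z != p + w)); last by [].
  apply dquot_hol; last by move=> ? [].
    apply: copenI; [exact: copen_ann|exact: copen_punct].
  by apply: hol_sub hf => ? [].
have contf t : expR t < r -> continuous (fun th => f (pt p t th)).
  move=> tr; apply cont_circ => z zt; apply: (hol_cont hf).
  by rewrite /ann /= zt expR_gt0.
have ckk t : expR t != normc w -> continuous (fun th => (pt p t th - p) / (pt p t th - p - w)).
  move=> tw; apply (@cont_circ _ (fun z => (z - p) / (z - p - w)) p t) => z zt.
  apply: (@hol_cont _ [set z | normc (z - p) != normc w]); last by rewrite /= zt.
  apply holM; [exact: copen_circ|apply hid; exact: copen_circ|].
  apply holV; first exact: copen_circ.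
    by apply holB; [exact: copen_circ|apply hid; exact: copen_circ|apply hol_cst; exact: copen_circ].
  by move=> x /= ; apply: contraNneq => /eqP; rewrite subr_eq0 => /eqP ->.
have E t : expR t < r -> expR t != normc w -> ci (fun th => g (pt p t th)) =
    ci (fun th => f (pt p t th) * ((pt p t th - p) / (pt p t th - p - w)))
    - f (p + w) * ci (fun th => (pt p t th - p) / (pt p t th - p - w)).
  move=> tr tw; rewrite -ciZ; last exact: ckk.
  rewrite -ciB.
  - apply: eq_ci => th _; rewrite /g /dquot ifN; last first.
      by apply: contraNneq tw => e; rewrite -(normc_pt p t th) e [p + w]addrC addrK.
    by rewrite opprD addrA; ring.
  - move=> th; apply (@ccM _ _ (fun th => f (pt p t th)) (fun th => (pt p t th - p) / (pt p t th - p - w)) th); [exact: contf|exact: ckk].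
  - move=> th; apply (@ccM _ _ (fun=> f (p + w)) (fun th => (pt p t th - p) / (pt p t th - p - w)) th); [exact: cc_cst|exact: ckk].
suff : ci (fun th => g (pt p T th)) = 0.
  rewrite E //; last by rewrite gt_eqF.
  by rewrite kernel_int // => /eqP; rewrite subr_eq0 => /eqP.
apply: normc_le0P => e e0.
(* [K * expR t] dominates the contribution of [f (p + w)] on circles of radius below [normc w / 2],
   where the kernel is at most [2 expR t / normc w]. *)
pose K := 2 * (2 * (2 * pi)) * (normc (f (p + w)) + 1) / normc w.
have K0 : 0 < K.
  rewrite divr_gt0 // mulr_gt0 // ?ltr_wpDl ?normc_ge0 //.
  by rewrite !mulr_gt0 // pi_gt0.
have e1 : 0 < Num.min (e / 2) (Num.min (normc w / 2) (e / 2 / K)).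
  have e20 : 0 < e / 2 by rewrite divr_gt0.
  have w20 : 0 < normc w / 2 by rewrite divr_gt0.
  by rewrite !lt_min e20 w20 /=; exact: (divr_gt0 e20 K0).
have [t] := W _ e1; rewrite !lt_min => /and3P[t1 t2 t3] Ht.
have tw : expR t < normc w.
  by rewrite (lt_trans t2) // ltr_pdivrMr // ltr_pMr // ltr1n.
have tT : t <= T by rewrite -ler_expR ltW // (lt_trans tw).
have tr : expR t < r by rewrite (lt_trans tw) // (lt_trans wT).
rewrite -(@circ_const _ p 0 r (normc w) t T g) //; last by rewrite expR_gt0.
rewrite E //; last by rewrite lt_eqF.
rewrite (le_trans (normcB _ _)) // (splitr e) lerD //.
  by rewrite (le_trans Ht) // ge_min lexx.
have kb : normc (ci (fun th => (pt p t th - p) / (pt p t th - p - w))) <=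
    2 * (expR t / (normc w / 2) * (2 * pi)).
  apply ci_bound; first by apply: ckk; rewrite lt_eqF.
  move=> th _; rewrite normcM normcV normc_pt ler_pM2l ?expR_gt0 //.
  rewrite lef_pV2 ?posrE ?divr_gt0 //; last first.
    rewrite normc_gt0 subr_eq0; apply: contraTneq tw => <-; by rewrite normc_pt ltxx.
  have := normc_lb w (pt p t th - p); rewrite normc_pt normcBC; lra.
rewrite normcM (le_trans (ler_wpM2l (normc_ge0 _) kb)) //.
apply: (@le_trans _ _ (K * expR t)); last first.
  by rewrite mulrC -ler_pdivlMr // ltW.
have -> : normc (f (p + w)) * (2 * (expR t / (normc w / 2) * (2 * pi))) =
  2 * (2 * (2 * pi)) * normc (f (p + w)) / normc w * expR t by field; rewrite gt_eqF.
rewrite /K ler_wpM2r ?expR_ge0 // ler_wpM2r ?invr_ge0 ?normc_ge0 // ler_wpM2l ?lerDl //.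
by rewrite ltW // !mulr_gt0 // pi_gt0.
Qed.

End Cauchy.

(** * Power series *)

Section PowerSeries.
Context {R : realType}.
Local Notation C := (cplx R).

Lemma geom_sum_le (q : R) m n : 0 <= q < 1 -> \sum_(m <= j < n) q ^+ j <= q ^+ m / (1 - q).
Proof.
move=> /andP[q0 q1]; have q1' : 0 < 1 - q by rewrite subr_gt0.
have [mn|nm] := leqP m n; last first.
  by rewrite big_geq ?(ltnW nm) // divr_ge0 ?exprn_ge0 // ltW.
have -> : \sum_(m <= j < n) q ^+ j = (q ^+ m - q ^+ n) / (1 - q).
  elim: n mn => [|n IH] mn.
    by move: mn; rewrite leqn0 => /eqP ->; rewrite big_nil subrr mul0r.
  move: mn; rewrite leq_eqVlt => /predU1P[->|]; first by rewrite big_geq // subrr mul0r.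
  rewrite ltnS => mn; rewrite big_nat_recr //= IH // exprS; field.
  by rewrite gt_eqF.
by rewrite ler_pM2r ?invr_gt0 // gerBl exprn_ge0.
Qed.

Lemma real_series (x : nat -> R) (M q : R) : 0 <= q < 1 -> 0 <= M ->
  (forall j, `|x j| <= M * q ^+ j) ->
  exists l, forall N, `|l - \sum_(j < N) x j| <= M * q ^+ N / (1 - q).
Proof.
move=> q01 M0 xM; have /andP[q0 q1] := q01.
have cv : cvgn (series x).
  apply: normed_cvg; apply: (@series_le_cvg _ _ (fun j => M * q ^+ j)) => //=.
  - by move=> j; rewrite mulr_ge0 // exprn_ge0.
  - by apply: is_cvg_geometric_series; rewrite ger0_norm.
exists (limn (series x)) => N; apply/ler_addgt0Pl => e e0.
move/cvgrPdist_lt : (cv) => /(_ e e0) [n0 _ H].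
have := H (maxn n0 N); rewrite /= leq_maxl => /(_ isT) h.
set n := maxn n0 N in h.
have Nn : (N <= n)%N by rewrite leq_maxr.
have -> : limn (series x) - \sum_(j < N) x j =
  (limn (series x) - series x n) + \sum_(N <= j < n) x j.
  have -> : series x n = \sum_(j < N) x j + \sum_(N <= j < n) x j.
    by rewrite -(big_mkord xpredT) /series /=; exact: big_cat_nat.
  ring.
rewrite (le_trans (ler_normD _ _)) // lerD ?(ltW h) //.
rewrite (le_trans (ler_norm_sum _ _ _)) //.
rewrite (le_trans (ler_sum _ (fun j _ => xM j))) // -mulr_sumr -mulrA ler_wpM2l //.
exact: geom_sum_le.
Qed.

Definition psum (a : nat -> C) (N : nat) (z : C) : C := \sum_(j < N) a j * z ^+ j.

(** These estimates stand for a radius of convergence at least [rho]; convergence, differentiation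
    and products of series are derived from them. *)
Definition geo (a : nat -> C) (rho M : R) : Prop :=
  0 <= M /\ forall j, normc (a j) <= M / rho ^+ j.

Definition tends (u : nat -> C) (l : C) : Prop :=
  forall e : R, 0 < e -> exists N0, forall N, (N0 <= N)%N -> normc (u N - l) <= e.

Lemma tends_uniq u l l' : tends u l -> tends u l' -> l = l'.
Proof.
move=> h h'; apply/eqP; rewrite -subr_eq0; apply/eqP; apply: normc_le0P => e e0.
have e2 : 0 < e / 2 by rewrite divr_gt0.
have [N0 H] := h _ e2; have [N1 H'] := h' _ e2.
have := H _ (leq_maxl N0 N1); have := H' _ (leq_maxr N0 N1).
set n := maxn _ _ => h1 h2.
rewrite (le_trans (normc_subl _ (u n) _)) // (splitr e) lerD // normcBC.
exact: h2.
Qed.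

Lemma tendsD u v l m : tends u l -> tends v m -> tends (fun n => u n + v n) (l + m).
Proof.
move=> h h' e e0; have e2 : 0 < e / 2 by rewrite divr_gt0.
have [N0 H] := h _ e2; have [N1 H'] := h' _ e2; exists (maxn N0 N1) => N.
rewrite geq_max => /andP[/H a /H' b].
rewrite (_ : _ - _ = (u N - l) + (v N - m)); last by ring.
by rewrite (le_trans (normcD _ _)) // (splitr e) lerD.
Qed.

Lemma tendsM u v l m : tends u l -> tends v m -> tends (fun n => u n * v n) (l * m).
Proof.
move=> h h' e e0.
pose K := normc l + normc m + 2.
have K0 : 0 < K by rewrite /K; have := normc_ge0 l; have := normc_ge0 m; lra.
have e2 : 0 < Num.min 1 (e / 2 / K) by rewrite lt_min ltr01 /= !divr_gt0.
have [N0 H] := h _ e2; have [N1 H'] := h' _ e2; exists (maxn N0 N1) => N.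
rewrite geq_max => /andP[/H a /H' b].
rewrite (_ : _ - _ = (u N - l) * v N + l * (v N - m)); last by ring.
rewrite (le_trans (normcD _ _)) // !normcM.
have vK : normc (v N) <= normc m + 1.
  have := normc_lb (v N) m; move: b; rewrite le_min => /andP[b _]; lra.
move: a b; rewrite !le_min => /andP[_ a] /andP[_ b].
apply: (@le_trans _ _ (e / 2 / K * (normc m + 1) + normc l * (e / 2 / K))).
  by apply: lerD; [apply: ler_pM; rewrite ?normc_ge0|apply: ler_wpM2l; rewrite ?normc_ge0].
rewrite [normc l * _]mulrC -mulrDr.
apply: (@le_trans _ _ (e / 2 / K * (2 * K))); last first.
  by rewrite le_eqVlt; apply/orP; left; apply/eqP; field; rewrite gt_eqF.
apply: ler_wpM2l; first by rewrite ltW // !divr_gt0.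
by rewrite /K; have := normc_ge0 l; have := normc_ge0 m; lra.
Qed.

Lemma tends_cst c : tends (fun=> c) c.
Proof. by move=> e e0; exists 0%N => N _; rewrite subrr Normc.normc0 ltW. Qed.

Lemma tends_eq u v l : (forall n, u n = v n) -> tends u l -> tends v l.
Proof. by move=> uv h e /h[N0 H]; exists N0 => N /H; rewrite uv. Qed.

Lemma tends_S u l : tends u l <-> tends (fun n => u n.+1) l.
Proof.
split=> h e /h[N0 H]; first by exists N0 => N NN; apply: H; rewrite (leq_trans NN).
by exists N0.+1 => -[//|N] NN; exact: H.
Qed.

Lemma tends_geom u l (M q : R) : 0 <= q < 1 -> 0 <= M ->
  (forall n, normc (u n - l) <= M * q ^+ n) -> tends u l.
Proof.
move=> q01 M0 H e e0; have [N HN] := geom_small q01 M0 (ler01 : 0 <= 1 :> R) e0.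
exists N => n Nn; rewrite (le_trans (H n)) // (le_trans _ HN) // mulr1 ler_wpM2l //.
by case/andP: q01 => q0 q1; apply: ler_wiXn2l => //; exact: ltW.
Qed.

(** The sum of the series, chosen as a limit of its partial sums; 0 is the default where there is
    none. *)
Definition pser (a : nat -> C) (z : C) : C := xget 0 [set l | tends (fun N => psum a N z) l].

Lemma pser_eq a z l : tends (fun N => psum a N z) l -> pser a z = l.
Proof.
move=> h; apply: (tends_uniq _ h).
by rewrite /pser; case: xgetP => [x ->|/(_ l)].
Qed.

#[local] Opaque pser.

Lemma psum_tail (a : nat -> C) (rho M : R) z : 0 < rho -> geo a rho M -> normc z < rho ->
  forall N, normc (psum a N z - pser a z) <= 2 * M / (1 - normc z / rho) * (normc z / rho) ^+ N.
Proof.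
move=> r0 [M0 aM] zr.
pose q := normc z / rho.
have q01 : 0 <= q < 1.
  by rewrite /q divr_ge0 ?normc_ge0 ?ltW //= ltr_pdivrMr // mul1r.
have b j : normc (a j * z ^+ j) <= M * q ^+ j.
  rewrite normcM normcX (le_trans (ler_wpM2r _ (aM j))) ?exprn_ge0 ?normc_ge0 //.
  by rewrite /q expr_div_n mulrAC mulrA.
have [l1 H1] := real_series q01 M0 (fun j => le_trans (normc_Re _) (b j)).
have [l2 H2] := real_series q01 M0 (fun j => le_trans (normc_Im _) (b j)).
have reS N : complex.Re (psum a N z) = \sum_(j < N) complex.Re (a j * z ^+ j).
  by rewrite /psum; elim: N => [|N IH]; rewrite ?big_ord0 // !big_ord_recr /= cReD IH.
have imS N : complex.Im (psum a N z) = \sum_(j < N) complex.Im (a j * z ^+ j).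
  by rewrite /psum; elim: N => [|N IH]; rewrite ?big_ord0 // !big_ord_recr /= cImD IH.
have key N : normc (psum a N z - (l1 +i* l2)) <= 2 * M / (1 - q) * q ^+ N.
  rewrite (le_trans (normc_le _)) // cReB cImB reS imS /= distrC.
  rewrite [X in _ + X]distrC (le_trans (lerD (H1 N) (H2 N))) //.
  by rewrite le_eqVlt; apply/orP; left; apply/eqP; ring.
suff -> : pser a z = l1 +i* l2 by exact: key.
apply: pser_eq; apply: (tends_geom q01 _ key).
by rewrite divr_ge0 ?mulr_ge0 // subr_ge0 ltW; case/andP: q01.
Qed.

Lemma psum_tends (a : nat -> C) (rho M : R) z : 0 < rho -> geo a rho M -> normc z < rho ->
  tends (fun N => psum a N z) (pser a z).
Proof.
move=> r0 g zr.
have q01 : 0 <= normc z / rho < 1.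
  by rewrite divr_ge0 ?normc_ge0 ?ltW //= ltr_pdivrMr // mul1r.
apply: (tends_geom q01 _ (psum_tail r0 g zr)); case: g => M0 _.
by rewrite divr_ge0 ?mulr_ge0 // subr_ge0 ltW; case/andP: q01.
Qed.

(** The factor [j + 1] is absorbed by a slightly larger ratio: [(j + 1) (q / s) ^ j] is at most the
    geometric sum of ratio [q / s], each of whose first [j + 1] terms is at least [(q / s) ^ j]. *)
Lemma succ_geom (q s : R) : 0 <= q < s -> forall j, j.+1%:R * q ^+ j <= s / (s - q) * s ^+ j.
Proof.
move=> /andP[q0 qs] j; have s0 : 0 < s by apply: le_lt_trans qs.
have x01 : 0 <= q / s < 1 by rewrite divr_ge0 ?(ltW s0) //= ltr_pdivrMr // mul1r.
have h : j.+1%:R * (q / s) ^+ j <= s / (s - q).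
  have -> : s / (s - q) = (q / s) ^+ 0 / (1 - q / s).
    by rewrite expr0; field; rewrite !gt_eqF ?subr_gt0 //= mulrC divrr ?unitfE ?gt_eqF.
  rewrite (le_trans _ (geom_sum_le 0 j.+1 x01)) //.
  rewrite mulr_natl -[X in _ *+ X](card_ord j.+1) -sumr_const big_mkord ler_sum // => i _.
  case/andP: x01 => x0 x1; apply: ler_wiXn2l => //; first exact: ltW.
  by rewrite -ltnS.
move: h; rewrite expr_div_n mulrA ler_pdivrMr ?exprn_gt0 //.
Qed.

Definition pder (a : nat -> C) (j : nat) : C := j.+1%:R * a j.+1.

Lemma geo_pder a (rho rho' M : R) : 0 < rho' -> rho' < rho -> geo a rho M ->
  exists M', geo (pder a) rho' M'.
Proof.
move=> r0 rr [M0 aM]; have rho0 := lt_trans r0 rr.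
have qs : 0 <= rho^-1 < rho'^-1 by rewrite invr_ge0 ltW //= ltf_pV2 ?posrE.
exists (M / rho * (rho'^-1 / (rho'^-1 - rho^-1))); split.
  rewrite mulr_ge0 ?divr_ge0 ?(ltW rho0) ?invr_ge0 ?(ltW r0) // subr_ge0.
  by case/andP: qs => _ /ltW.
move=> j; rewrite /pder normcM.
have -> : normc (j.+1%:R : C) = j.+1%:R.
  by rewrite -[j.+1%:R]/((j.+1%:R : R[i])) -(rmorph_nat (real_complex R)) normc_real ger0_norm.
rewrite (le_trans (ler_wpM2l _ (aM j.+1))) // exprS.
have h := succ_geom qs j.
rewrite -[(_ : R) / rho' ^+ j]mulrA -exprVn mulrACA -mulrA.
have -> : j.+1%:R * (M / (rho * rho ^+ j)) = M / rho * (j.+1%:R * rho^-1 ^+ j).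
  by rewrite exprVn; field; rewrite expf_neq0 ?gt_eqF.
rewrite [leRHS](_ : _ = M / rho * (rho'^-1 / (rho'^-1 - rho^-1) * rho'^-1 ^+ j)); last by ring.
by rewrite ler_wpM2l // divr_ge0 // ltW.
Qed.

Lemma normc_natr n : normc (n%:R : C) = n%:R.
Proof.
by rewrite -[n%:R]/((n%:R : R[i])) -(rmorph_nat (real_complex R)) normc_real ger0_norm.
Qed.

(** Induction on the exponent: the remainder for the next power is [z] times the present one plus
    [h] times a first difference, and [(n + 2) (n + 1) + (n + 2) <= (n + 3) (n + 2)]. *)
Lemma pow_taylor (z h : C) (r : R) n : normc z <= r -> normc (z + h) <= r ->
  normc (((z + h) ^+ n.+2 - z ^+ n.+2) - h * (n.+2%:R * z ^+ n.+1)) <=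
    (n.+2 * n.+1)%:R * r ^+ n * normc h ^+ 2.
Proof.
move=> zr zhr; have r0 : 0 <= r := le_trans (normc_ge0 _) zr.
have first m : normc ((z + h) ^+ m.+1 - z ^+ m.+1) <= m.+1%:R * r ^+ m * normc h.
  rewrite subrXX (_ : z + h - z = h); last by ring.
  rewrite normcM mulrC ler_wpM2r ?normc_ge0 //.
  rewrite (le_trans (normc_sum _ _ _)) //.
  rewrite mulr_natl -[X in _ *+ X](card_ord m.+1) -sumr_const ler_sum // => i _.
  rewrite normcM !normcX; have im : (i <= m)%N by rewrite -ltnS.
  rewrite /= -[in leRHS](subnK im) exprD ler_pM ?exprn_ge0 ?normc_ge0 //;
    by apply: lerXn2r; rewrite ?nnegrE ?normc_ge0.
elim: n => [|n IH].
  rewrite expr0 (_ : _ - _ = h ^+ 2); last by ring.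
  by rewrite normcX mulr1 ler_peMl ?sqr_ge0 // ler1n.
rewrite (_ : _ - _ = z * (((z + h) ^+ n.+2 - z ^+ n.+2) - h * (n.+2%:R * z ^+ n.+1))
   + h * ((z + h) ^+ n.+2 - z ^+ n.+2)); last first.
  by rewrite (exprS (z + h) n.+2) (exprS z n.+2) (exprS z n.+1) -[n.+3%:R]natr1; ring.
rewrite (le_trans (normcD _ _)) // !normcM.
have B1 : normc z * normc ((z + h) ^+ n.+2 - z ^+ n.+2 - h * (n.+2%:R * z ^+ n.+1)) <=
   r * ((n.+2 * n.+1)%:R * r ^+ n * normc h ^+ 2) by rewrite ler_pM ?normc_ge0.
have B2 := ler_wpM2l (normc_ge0 h) (first n.+1).
rewrite (le_trans (lerD B1 B2)) //.
rewrite [leLHS](_ : _ = (n.+2 * n.+1 + n.+2)%:R * (r ^+ n.+1 * normc h ^+ 2)); last first.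
  by rewrite (exprS r) natrD; ring.
rewrite -[leRHS]mulrA ler_wpM2r ?mulr_ge0 ?exprn_ge0 ?normc_ge0 // ler_nat; nia.
Qed.

Lemma psumS a N z : psum a N.+1 z = psum a N z + a N * z ^+ N.
Proof. by rewrite /psum big_ord_recr. Qed.

Lemma psum_recl a N z : psum a N.+1 z = a 0%N + z * psum (fun j => a j.+1) N z.
Proof.
rewrite /psum big_ord_recl expr0 mulr1; congr (_ + _); rewrite mulr_sumr.
by apply: eq_bigr => i _; rewrite exprS; ring.
Qed.

(** A second-order remainder, uniform on a closed disc, gives differentiability of the sum without a
    theorem on uniform limits. It is proved for partial sums, with the majorant of the second
    derived series, and passes to the limit. *)
Lemma pser_taylor (a : nat -> C) (rho M r : R) : geo a rho M -> 0 < r -> r < rho ->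
  exists2 K : R, 0 <= K & forall z h : C, normc z <= r -> normc (z + h) <= r ->
   normc (pser a (z + h) - pser a z - pser (pder a) z * h) <= K * normc h ^+ 2.
Proof.
move=> ga r0 rr; have rho0 := lt_trans r0 rr.
(* Two intermediate radii [r < r2 < r1 < rho], since each differentiation of the series costs some
   radius. *)
pose r1 := (r + rho) / 2; have rr1 : r < r1 by rewrite /r1; lra.
have r1rho : r1 < rho by rewrite /r1; lra.
have r10 := lt_trans r0 rr1.
have [M1 ga1] := geo_pder r10 r1rho ga.
pose r2 := (r + r1) / 2; have rr2 : r < r2 by rewrite /r2; lra.
have r21 : r2 < r1 by rewrite /r2; lra.
have r20 := lt_trans r0 rr2.
have [M2 [M20 ga2]] := geo_pder r20 r21 ga1.
pose q := r / r2.
have q01 : 0 <= q < 1 by rewrite divr_ge0 ?(ltW r0) ?(ltW r20) //= ltr_pdivrMr // mul1r.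
exists (M2 / (1 - q)); first by rewrite divr_ge0 // subr_ge0; case/andP: q01 => _ /ltW.
move=> z h zr zhr.
have pd N : normc (psum a N.+2 (z + h) - psum a N.+2 z - psum (pder a) N.+1 z * h) <=
    M2 / (1 - q) * normc h ^+ 2.
  have -> : psum a N.+2 (z + h) - psum a N.+2 z - psum (pder a) N.+1 z * h =
    \sum_(j < N) a j.+2 * (((z + h) ^+ j.+2 - z ^+ j.+2) - h * (j.+2%:R * z ^+ j.+1)).
    elim: N => [|N IH].
      by rewrite /psum !big_ord_recr !big_ord0 /= /pder expr0 !expr1; ring.
    rewrite big_ord_recr /= -IH !(psumS a N.+2) (psumS (pder a) N.+1) (_ : pder a N.+1 = N.+2%:R * a N.+2) //.
    move: (psum a N.+2 _) (psum a N.+2 _) (psum (pder a) N.+1 z) (a N.+2) => u1 u2 u3 u4.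
    move: ((z + h) ^+ N.+2) (z ^+ N.+2) (z ^+ N.+1) (N.+2%:R : C) => v1 v2 v3 v4.
    ring.
  rewrite (le_trans (normc_sum _ _ _)) //.
  apply: (@le_trans _ _ (\sum_(j < N) M2 * q ^+ j * normc h ^+ 2)).
    apply: ler_sum => j _; rewrite normcM.
    rewrite (le_trans (ler_wpM2l (normc_ge0 _) (pow_taylor j zr zhr))) //.
    rewrite mulrA ler_wpM2r ?exprn_ge0 ?normc_ge0 //.
    have := ga2 j; rewrite /pder !normcM !normc_natr => H.
    rewrite /q expr_div_n mulrA mulrA [leRHS]mulrAC ler_wpM2r ?exprn_ge0 ?(ltW r0) //.
    by rewrite (le_trans _ H) // natrM le_eqVlt; apply/orP; left; apply/eqP; ring.
  rewrite -mulr_suml ler_wpM2r ?exprn_ge0 ?normc_ge0 // -mulr_sumr ler_wpM2l //.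
  by have := geom_sum_le 0 N q01; rewrite big_mkord expr0 mul1r.
have zrho := le_lt_trans zr rr.
have T1 := psum_tends rho0 ga (le_lt_trans zhr rr).
have T2 := psum_tends rho0 ga zrho.
have T3 := psum_tends r10 ga1 (le_lt_trans zr rr1).
have T : tends (fun N => psum a N.+2 (z + h) - psum a N.+2 z - psum (pder a) N.+1 z * h)
   (pser a (z + h) - pser a z - pser (pder a) z * h).
  move/tends_S/tends_S : T1 => T1; move/tends_S/tends_S : T2 => T2; move/tends_S : T3 => T3.
  have := tendsD (tendsD T1 (tendsM (tends_cst (-1)) T2)) (tendsM T3 (tends_cst (- h))).
  have E (x y t k : C) : x + -1 * y + t * - k = x - y - t * k by ring.
  by rewrite E; apply: tends_eq => n; rewrite E.
apply/ler_addgt0Pl => e e0; have [N0 H] := T e e0.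
have := H N0 (leqnn _); have := pd N0; rewrite normcBC.
set X := psum a _ _ - _ - _; set Y := pser a _ - _ - _ => h1 h2.
by have := normc_lb Y X; lra.
Qed.

Lemma pser_der (a : nat -> C) (rho M : R) (z : C) : geo a rho M -> 0 < rho -> normc z < rho ->
  is_derive z (1 : C) (pser a) (pser (pder a) z).
Proof.
move=> ga rho0 zr; apply/cderP => e e0.
pose r := (normc z + rho) / 2.
have zr' : normc z < r by rewrite /r; lra.
have rr : r < rho by rewrite /r; lra.
have r0 : 0 < r by rewrite (le_lt_trans _ zr') // normc_ge0.
have [K K0 HK] := pser_taylor ga r0 rr.
have K1 : 0 < K + 1 by rewrite ltr_wpDl.
exists (Num.min (r - normc z) (e / (K + 1))).
  by rewrite lt_min subr_gt0 zr' divr_gt0.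
move=> h; rewrite lt_min => /andP[h1 h2].
rewrite -mulRI (le_trans (HK z h (ltW zr') _)) //.
  by rewrite (le_trans (normcD _ _)) //; lra.
rewrite expr2 mulrA ler_wpM2r ?normc_ge0 //.
move: h2; rewrite ltr_pdivlMr // => h2; have := normc_ge0 h; nra.
Qed.

Lemma pser_hol (a : nat -> C) (rho M : R) : geo a rho M -> 0 < rho ->
  hol [set z | normc z < rho] (pser a).
Proof.
move=> ga rho0; apply: (holI (f' := pser (pder a))).
- move=> z zr; exists (rho - normc z); first by rewrite subr_gt0.
  by move=> w wz /=; have := normc_lb w z; lra.
- by move=> z zr; exact: pser_der ga rho0 zr.
move=> z zr.
pose r := (normc z + rho) / 2.
have zr' : normc z < r by rewrite /r; have : normc z < rho by []; lra.
have rr : r < rho by rewrite /r; have : normc z < rho by []; lra.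
have r0 : 0 < r by rewrite (le_lt_trans _ zr') // normc_ge0.
have [M' g'] := geo_pder r0 rr ga.
exact: cder_cont (pser_der g' r0 zr').
Qed.

End PowerSeries.

(** * Taylor expansion, removable singularities and Liouville's theorem *)

Section Analytic.
Context {R : realType}.
Local Notation C := (cplx R).
#[local] Opaque pser ci.

Definition conv (a b : nat -> C) (n : nat) : C := \sum_(i < n.+1) a i * b (n - i)%N.

(** The product of two truncations differs from the truncated Cauchy product by terms of degree at
    least [N] and below [2 N]; these are bounded by [(n + 1) M M' q ^ n], hence by a geometric
    tail. *)
Lemma pser_conv (a b : nat -> C) (rho M M' : R) (z : C) : 0 < rho -> geo a rho M ->
  geo b rho M' -> normc z < rho -> tends (fun N => psum (conv a b) N z) (pser a z * pser b z).
Proof.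
move=> rho0 ga gb zr.
pose q := normc z / rho.
have q01 : 0 <= q < 1 by rewrite divr_ge0 ?normc_ge0 ?(ltW rho0) //= ltr_pdivrMr // mul1r.
have /andP[q0 q1] := q01.
pose s := (q + 1) / 2.
have qs : 0 <= q < s by rewrite q0 /s /=; lra.
have s1 : 0 <= s < 1 by rewrite /s; apply/andP; split; lra.
have [M0 aM] := ga; have [M'0 bM] := gb.
(* Polynomials turn the product of the partial sums into one finite sum over degrees. *)
pose P N : {poly R[i]} := \poly_(i < N) a i.
pose Q N : {poly R[i]} := \poly_(i < N) b i.
have PE N : psum a N z = (P N).[z] by rewrite /P horner_poly.
have QE N : psum b N z = (Q N).[z] by rewrite /Q horner_poly.
have sz N : (size (P N * Q N)%R <= N.*2)%N.
  rewrite (leq_trans (size_polyMleq _ _)) //.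
  have h1 : (size (P N) <= N)%N := size_poly N a.
  have h2 : (size (Q N) <= N)%N := size_poly N b.
  by move: (size _) (size _) h1 h2 => x y; lia.
pose K := M * M' * (s / (s - q)).
have K0 : 0 <= K.
  apply: mulr_ge0; first exact: mulr_ge0.
  by apply: divr_ge0; [case/andP: s1|rewrite subr_ge0; case/andP: qs => _ /ltW].
have coefB N n : normc ((P N * Q N)`_n * z ^+ n) <= K * s ^+ n.
  rewrite normcM normcX.
  have h : normc (P N * Q N)`_n <= n.+1%:R * (M * M' / rho ^+ n).
    rewrite coefM (le_trans (normc_sum _ _ _)) //.
    rewrite mulr_natl -[X in _ *+ X](card_ord n.+1) -sumr_const ler_sum // => i _.
    rewrite normcM !coef_poly.
    have -> : M * M' / rho ^+ n = (M / rho ^+ i) * (M' / rho ^+ (n - i)).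
      have hi : (i <= n)%N by rewrite -ltnS.
      by rewrite -[in LHS](subnK hi) exprD; field; rewrite !expf_neq0 ?gt_eqF.
    apply: ler_pM; rewrite ?normc_ge0 //; case: ifP => _ //; rewrite Normc.normc0;
      by rewrite divr_ge0 // exprn_ge0 // ltW.
  rewrite (le_trans (ler_wpM2r _ h)) ?exprn_ge0 ?normc_ge0 //.
  have := succ_geom qs n => h2.
  rewrite [leLHS](_ : _ = M * M' * (n.+1%:R * q ^+ n)); last first.
    rewrite /q expr_div_n; move: (normc z ^+ n) => u; field.
    by rewrite expf_neq0 // gt_eqF.
  by rewrite /K -[leRHS]mulrA ler_wpM2l // mulr_ge0.
have diff N : psum a N z * psum b N z - psum (conv a b) N z =
    \sum_(N <= n < N.*2) (P N * Q N)`_n * z ^+ n.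
  rewrite PE QE -hornerM (horner_coef_wide _ (sz N)).
  rewrite -(big_mkord xpredT (fun i => (P N * Q N)`_i * z ^+ i)) /=.
  have NN : (N <= N.*2)%N by rewrite -addnn leq_addr.
  rewrite (big_cat_nat (leq0n N) NN) /= big_mkord.
  have -> : \sum_(i < N) (P N * Q N)`_i * z ^+ i = psum (conv a b) N z.
    apply: eq_bigr => i _; congr (_ * _); rewrite coefM /conv; apply: eq_bigr => j _.
    rewrite !coef_poly.
    have -> : (j < N)%N by exact: leq_trans (ltn_ord j) (ltn_ord i).
    by have -> : (i - j < N)%N by exact: leq_ltn_trans (leq_subr _ _) (ltn_ord i).
  have E (x y : R[i]) : x + y - x = y by ring.
  by rewrite E.
have small : tends (fun N => psum (conv a b) N z - psum a N z * psum b N z) 0.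
  apply: (tends_geom (M := K / (1 - s)) s1) => [|N].
    by rewrite divr_ge0 // subr_ge0; case/andP: s1 => _ /ltW.
  rewrite subr0 normcBC diff (le_trans (normc_sum _ _ _)) //.
  rewrite (le_trans (ler_sum _ (fun n _ => coefB N n))) // -mulr_sumr.
  rewrite [leRHS](_ : _ = K * (s ^+ N / (1 - s))); last by ring.
  by rewrite ler_wpM2l // geom_sum_le.
have := tendsD small (tendsM (psum_tends rho0 ga zr) (psum_tends rho0 gb zr)).
by rewrite add0r; apply: tends_eq => N; rewrite subrK.
Qed.

Lemma geo_le (a : nat -> C) (rho rho' M : R) : 0 < rho' -> rho' <= rho -> geo a rho M -> geo a rho' M.
Proof.
move=> r0 rr [M0 aM]; split=> // j; rewrite (le_trans (aM j)) //.
rewrite ler_wpM2l // lef_pV2 ?posrE ?exprn_gt0 ?(lt_le_trans r0) //.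
by apply: lerXn2r => //; rewrite nnegrE ltW // (lt_le_trans r0).
Qed.

Lemma pser_0 (a : nat -> C) : pser a 0 = a 0%N.
Proof.
apply: pser_eq => e e0; exists 1%N => -[//|N] _.
by rewrite psum_recl mul0r addr0 subrr Normc.normc0 ltW.
Qed.

(** Cauchy's integral for the [j]-th Taylor coefficient, written in the angle: [1 / (2 pi i)] times
    the contour integral of [f (z) / (z - p) ^ (j + 1)]. *)
Definition circ_coef (f : C -> C) (p : C) (T : R) (j : nat) : C :=
  ((2 * pi)%:C)^-1 * ci (fun th => f (pt p T th) * ((pt p T th - p) ^+ j)^-1).

Lemma twopiC_neq0 : (2 * pi)%:C != 0 :> C.
Proof. by rewrite -normc_gt0 normc_real normr_gt0 gt_eqF // twopi_gt0. Qed.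

(** A removable singularity theorem: under the small-circle hypothesis of [cauchy_punct] the
    expansion about the puncture has no negative powers. *)
Lemma cauchy_pser (p : C) (r T : R) (f : C -> C) :
  hol (ann p 0 r) f -> expR T < r ->
  (forall w, 0 < normc w < expR T -> forall e : R, 0 < e -> exists2 t, expR t < e &
     normc (ci (fun th => f (pt p t th) * ((pt p t th - p) / (pt p t th - p - w)))) <= e) ->
  (exists M, geo (circ_coef f p T) (expR T) M) /\
  forall w, 0 < normc w < expR T -> f (p + w) = pser (circ_coef f p T) w.
Proof.
move=> hf Tr W.
have cf : continuous (fun th => f (pt p T th)).
  apply cont_circ => z zt; apply: (hol_cont hf).
  by rewrite /ann /= zt expR_gt0.
have [M M0 H] := cauchy_series p T cf.
have n0 : 0 < normc ((2 * pi)%:C : C) by rewrite normc_gt0 twopiC_neq0.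
split.
  exists (M / normc ((2 * pi)%:C : C)); split; first by rewrite divr_ge0 ?ltW.
  move=> j; have [] := H 0; first by rewrite Normc.normc0 expR_gt0.
  move=> /(_ j) h _; rewrite /circ_coef normcM normcV mulrC mulrAC.
  by rewrite ler_wpM2r // invr_ge0 ltW.
move=> w /andP[w0 wT]; have [_ HN] := H w wT.
have q01 : 0 <= normc w / expR T < 1.
  by rewrite divr_ge0 ?normc_ge0 ?expR_ge0 //= ltr_pdivrMr ?expR_gt0 // mul1r.
have C1 := cauchy_punct hf w0 wT Tr (W w _).
apply/esym/pser_eq.
have tt : tends (fun N => \sum_(j < N) ci (fun th => f (pt p T th) * ((pt p T th - p) ^+ j)^-1) * w ^+ j)
   (f (p + w) * (2 * pi)%:C).
  apply: (tends_geom (M := M * (expR T / (expR T - normc w))) q01) => [|N].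
    by rewrite mulr_ge0 ?(ltW M0) // divr_ge0 ?expR_ge0 // subr_ge0 ltW.
  rewrite normcBC -C1; last by rewrite w0.
  by rewrite (le_trans (HN N)) // le_eqVlt; apply/orP; left; apply/eqP; ring.
have := tendsM (tends_cst ((2 * pi)%:C)^-1) tt.
rewrite mulrCA mulVf ?twopiC_neq0 // mulr1; apply: tends_eq => N.
by rewrite /psum mulr_sumr; apply: eq_bigr => j _; rewrite /circ_coef mulrA.
Qed.

Definition disc (p : C) (r : R) : set C := [set z | normc (z - p) < r].

Lemma copen_disc p r : copen (disc p r).
Proof.
move=> z zr; exists (r - normc (z - p)); first by rewrite subr_gt0.
move=> w wz; rewrite /disc /=; have := normc_subl w z p; lra.
Qed.

(** Boundedness near [p] implies the small-circle hypothesis, because the kernel is of the order of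
    the radius. *)
Lemma weak_bounded (p : C) (r d B : R) (f : C -> C) (w : C) :
  hol (ann p 0 r) f -> 0 < d -> 0 < r -> 0 < normc w ->
  (forall z, 0 < normc (z - p) < d -> normc (f z) <= B) ->
  forall e : R, 0 < e -> exists2 t, expR t < e &
     normc (ci (fun th => f (pt p t th) * ((pt p t th - p) / (pt p t th - p - w)))) <= e.
Proof.
move=> hf d0 r0 w0 fB e e0.
have B0 : 0 <= B.
  apply: le_trans (normc_ge0 (f (pt p (ln (d / 2)) 0))) (fB _ _).
  by rewrite normc_pt lnK ?posrE ?divr_gt0 //=; lra.
pose K := 2 * (2 * (2 * pi)) * (B + 1) / normc w.
have K0 : 0 < K.
  by rewrite divr_gt0 // mulr_gt0 ?ltr_wpDl // !mulr_gt0 // pi_gt0.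
pose x := Num.min (Num.min (e / 2) (e / K)) (Num.min (Num.min (d / 2) (r / 2)) (normc w / 2)).
have x0 : 0 < x by rewrite /x !lt_min (divr_gt0 e0 K0) !divr_gt0.
exists (ln x).
  rewrite lnK ?posrE // /x !gt_min; apply/orP; left; apply/orP; left.
  by rewrite ltr_pdivrMr // ltr_pMr // ltr1n.
have [xe [xK [xd [xr xw]]]] : x <= e / 2 /\ x <= e / K /\ x <= d / 2 /\ x <= r / 2 /\ x <= normc w / 2.
  by rewrite /x !ge_min !lexx !orbT.
have xw' : x < normc w by lra.
have ptx th : normc (pt p (ln x) th - p) = x by rewrite normc_pt lnK ?posrE.
apply: (@le_trans _ _ (2 * (B * (x / (normc w / 2)) * (2 * pi)))).
  apply ci_bound.
    apply gcM.
      apply cont_circ => z zt; apply: (hol_cont hf).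
      by rewrite /ann /= zt lnK ?posrE // x0 /=; lra.
    apply (@cont_circ _ (fun z => (z - p) / (z - p - w)) p (ln x)) => z zt.
    have cz c : {for z, continuous (fun z : C => z - c)}.
      by apply: (@hol_cont _ setT) => //; apply hol_sub_cst => ? _; exists 1.
    apply ccM => //; apply ccV.
      rewrite subr_eq0; apply: contraTneq xw' => <-; rewrite zt lnK ?posrE //.
      by rewrite ltxx.
    by apply (@ccB _ _ (fun z => z - p) (fun=> w)) => //; exact: cc_cst.
  move=> th _; rewrite normcM ler_pM ?normc_ge0 //.
    by apply: fB; rewrite ptx x0 /=; lra.
  rewrite normcM normcV ptx ler_pM2l // lef_pV2 ?posrE ?divr_gt0 //.
    by have := normc_lb w (pt p (ln x) th - p); rewrite ptx normcBC; lra.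
  by rewrite normc_gt0 subr_eq0; apply: contraTneq xw' => <-; rewrite ptx ltxx.
rewrite [leLHS](_ : _ = 2 * (2 * (2 * pi)) * B / normc w * x); last by field; rewrite gt_eqF.
apply: (@le_trans _ _ (K * x)); last by rewrite mulrC -ler_pdivlMr.
rewrite /K ler_wpM2r ?(ltW x0) // ler_wpM2r ?invr_ge0 ?normc_ge0 // ler_wpM2l ?lerDl //.
by rewrite ltW // !mulr_gt0 // pi_gt0.
Qed.

Lemma cont_locbd (f : C -> C) p : {for p, continuous f} ->
  exists d B : R, 0 < d /\ forall z, normc (z - p) < d -> normc (f z) <= B.
Proof.
move=> /contCP /(_ 1 ltr01)[d d0 H]; exists d, (normc (f p) + 1); split => // z /H.
by have := normc_lb (f z) (f p); lra.
Qed.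

Lemma disc_pser (p : C) (r T : R) (f : C -> C) :
  hol (disc p r) f -> expR T < r ->
  (exists M, geo (circ_coef f p T) (expR T) M) /\
  forall w, normc w < expR T -> f (p + w) = pser (circ_coef f p T) w.
Proof.
move=> hf Tr; have r0 : 0 < r := lt_trans (expR_gt0 T) Tr.
have hf' : hol (ann p 0 r) f by apply: hol_sub hf => z /andP[].
have pd : disc p r p by rewrite /disc /= subrr Normc.normc0.
have [d [B [d0 fB]]] := cont_locbd (hol_cont hf pd).
have [|[M gM] H] := cauchy_pser hf' Tr.
  move=> w /andP[w0 wT]; apply: (weak_bounded hf' d0 r0 w0 (B := B)).
  by move=> z /andP[_ zd]; exact: fB.
split; first by exists M.
(* At the centre both sides are continuous, and they agree off it; a real displacement [x] is enough
   to compare them. *)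
move=> w wT; have [->|w0] := eqVneq w 0; last by apply: H; rewrite normc_gt0 w0.
rewrite addr0; apply/eqP; rewrite -subr_eq0; apply/eqP; apply: normc_le0P => e e0.
have e20 : 0 < e / 2 by rewrite divr_gt0.
have c0 : {for (0 : C), continuous (pser (circ_coef f p T))}.
  apply: cder_cont; apply: (pser_der gM (expR_gt0 T)); by rewrite Normc.normc0 expR_gt0.
have /contCP /(_ _ e20)[d1 d10 h1] := c0.
have /contCP /(_ _ e20)[d2 d20 h2] := hol_cont hf pd.
pose x : R := Num.min (Num.min d1 d2) (expR T) / 2.
have x0 : 0 < x by rewrite divr_gt0 // !lt_min d10 d20 expR_gt0.
have x3 : x < Num.min (Num.min d1 d2) (expR T).
  by rewrite /x ltr_pdivrMr // ltr_pMr ?ltr1n // !lt_min d10 d20 expR_gt0.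
move: x3; rewrite !lt_min => /andP[/andP[x1 x2] x3].
have nx : normc (x%:C : C) = x by rewrite normc_real gtr0_norm.
have := h1 x%:C; rewrite subr0 nx => /(_ x1).
have := h2 (p + x%:C); rewrite addrAC subrr add0r nx => /(_ x2).
rewrite -(H x%:C) ?nx ?x0 //.
have := normc_subl (f p) (f (p + x%:C)) (pser (circ_coef f p T) 0).
rewrite [normc (f p - f (p + _))]normcBC; lra.
Qed.

Lemma seg_const (f : C -> C) (z : C) : (forall t : R, 0 <= t <= 1 -> is_derive (t%:C * z : C) (1 : C) f 0) ->
  f z = f 0.
Proof.
move=> H; have r t : rder (fun t : R => t%:C * z) t z.
  move=> e e0; exists 1 => // h _.
  have E (a b c : C) : (a + b) * c - a * c - c * b = 0 by ring.
  by rewrite rmorphD /= E Normc.normc0 mulr_ge0 // ltW.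
have G (t : R) : 0 <= t <= 1 -> rder (fun t : R => f (t%:C * z)) t 0.
  move=> t01; have := @cder_rder _ f (fun t : R => t%:C * z) t 0 z (H t t01) (r t).
  by rewrite mul0r.
have := @rder0_const _ (fun t : R => f (t%:C * z)) 0 1 ler01.
rewrite mul0r mul1r => -> //.
  by move=> t /G; exact: rder_cont.
by move=> t /andP[a b]; apply: G; rewrite !ltW.
Qed.

Lemma liouville (f : C -> C) (B : R) : hol setT f -> (forall z, normc (f z) <= B) ->
  forall z, f z = f 0.
Proof.
move=> hf fB z; apply: seg_const => t _.
set p := t%:C * z.
have B0 : 0 <= B := le_trans (normc_ge0 (f 0)) (fB 0).
suff E : dC f p = 0 by rewrite -E; apply: (hol_is hf).
apply: normc_le0P => e e0.
(* By Cauchy's estimate [f' (p)] is at most [2 B] over the radius, the factor 2 being that of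
   [ci_bound]; this radius makes it at most [e]. *)
pose T := ln (2 * B / e + 1).
have x0 : 0 < 2 * B / e + 1 by rewrite ltr_wpDl // divr_ge0 ?(ltW e0) // mulr_ge0.
have hd : hol (disc p (expR T + 1)) f by apply: hol_sub hf.
have [|[M gM] H] := disc_pser hd (T := T); first by rewrite ltrDl.
have -> : dC f p = circ_coef f p T 1.
  apply: derive1_is; apply/cderP.
  have : is_derive (0 : C) (1 : C) (pser (circ_coef f p T)) (circ_coef f p T 1%N).
    have -> : circ_coef f p T 1 = pser (pder (circ_coef f p T)) 0 by rewrite pser_0 /pder mul1r.
    by apply: (pser_der gM (expR_gt0 T)); rewrite Normc.normc0 expR_gt0.
  move=> /cderP D e' e'0; have [d d0 Hd] := D e' e'0.
  exists (Num.min d (expR T)); first by rewrite lt_min d0 expR_gt0.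
  move=> h; rewrite lt_min => /andP[hd' hT]; have := Hd h hd'.
  by rewrite add0r -(H h hT) -[p in _ - f p]addr0 -(H 0) ?addr0 // Normc.normc0 expR_gt0.
rewrite /circ_coef normcM normcV normc_real gtr0_norm ?twopi_gt0 //.
rewrite mulrC ler_pdivrMr ?twopi_gt0 //.
have cf : continuous (fun th => f (pt p T th) * ((pt p T th - p) ^+ 1)^-1).
  apply gcM; last exact: cont_ptX.
  by apply cont_circ => ? _; exact: (hol_cont hf).
rewrite (le_trans (ci_bound cf (r := B / expR T) _)) //.
  by move=> th _; rewrite normcM normcV normcX normc_pt expr1 ler_wpM2r // invr_ge0 expR_ge0.
rewrite mulrA ler_wpM2r ?(ltW twopi_gt0) // /T lnK ?posrE // mulrA ler_pdivrMr //.
rewrite mulrDr mulr1 mulrCA divff ?gt_eqF // mulr1 lerDl ltW //.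
Qed.

End Analytic.

(** * The Weierstrass function *)

Section SquareSums.
Context {R : realType}.
Local Notation C := (cplx R).

(** The sum over [- N <= k <= N], indexed exactly as the sums in [weierstrass_p]. *)
Definition tsum (N : nat) (F : int -> C) : C := \sum_(i < N.*2.+1) F (i%:Z - N%:Z).

Lemma tsum0 F : tsum 0 F = F 0.
Proof. by rewrite /tsum big_ord_recl big_ord0 addr0 subrr. Qed.

Lemma tsumS N F : tsum N.+1 F = F (- (N.+1)%:Z) + (tsum N F + F N.+1).
Proof.
rewrite /tsum doubleS big_ord_recl big_ord_recr /=; congr (F _ + (_ + F _)).
- by rewrite sub0r.
- by apply: eq_bigr => i _; congr F; rewrite /bump /=; lia.
- by rewrite /bump /=; lia.
Qed.

Lemma eq_tsum N F F' : (forall k : int, (`|k| <= N)%N -> F k = F' k) -> tsum N F = tsum N F'.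
Proof. by move=> h; apply: eq_bigr => i _; apply: h; have := ltn_ord i; lia. Qed.

Lemma tsumD N F F' : tsum N (fun k => F k + F' k) = tsum N F + tsum N F'.
Proof. exact: big_split. Qed.

Lemma tsumZ N c F : tsum N (fun k => c * F k) = c * tsum N F.
Proof. by rewrite /tsum mulr_sumr. Qed.

Lemma tsum_tel N F : tsum N (fun k => F (k - 1) - F k) = F (- N%:Z - 1) - F N.
Proof.
elim: N => [|N IH]; first by rewrite tsum0.
rewrite tsumS IH.
have -> : (N.+1%:Z - 1) = N%:Z by lia.
have -> : (- N%:Z - 1) = - (N.+1)%:Z by lia.
by have E (x y z t : C) : x - y + (y - z + (z - t)) = x - t by ring.
Qed.

Lemma tsum_bound N F (B : R) : (forall k : int, (`|k| <= N)%N -> normc (F k) <= B) ->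
  normc (tsum N F) <= (N.*2.+1)%:R * B.
Proof.
move=> h; rewrite (le_trans (normc_sum _ _ _)) //.
rewrite mulr_natl -[X in _ *+ X](card_ord N.*2.+1) -sumr_const ler_sum // => i _.
by apply: h; have := ltn_ord i; lia.
Qed.

Definition ssum (N : nat) (G : int -> int -> C) : C := tsum N (fun m => tsum N (G m)).

Lemma eq_ssum N G G' : (forall m n, G m n = G' m n) -> ssum N G = ssum N G'.
Proof. by move=> h; apply: eq_tsum => m _; apply: eq_tsum. Qed.

Lemma ssumD N G G' : ssum N (fun m n => G m n + G' m n) = ssum N G + ssum N G'.
Proof. by rewrite /ssum -tsumD; apply: eq_tsum => m _; rewrite tsumD. Qed.

Lemma ssumZ N c G : ssum N (fun m n => c * G m n) = c * ssum N G.
Proof. by rewrite /ssum -tsumZ; apply: eq_tsum => m _; rewrite tsumZ. Qed.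

Lemma ssumB N G G' : ssum N (fun m n => G m n - G' m n) = ssum N G - ssum N G'.
Proof.
rewrite -[- ssum _ _]mulN1r -ssumZ -ssumD; apply: eq_ssum => m n.
by rewrite mulN1r.
Qed.

Lemma ssumS_bound N G (B : R) :
  (forall m n : int, maxn `|m| `|n| = N.+1 -> normc (G m n) <= B) ->
  normc (ssum N.+1 G - ssum N G) <= 8 * N.+1%:R * B.
Proof.
move=> h; rewrite /ssum tsumS.
have -> : tsum N (fun m => tsum N.+1 (G m)) =
   tsum N (fun m => G m (- (N.+1)%:Z)) + tsum N (fun m => tsum N (G m)) + tsum N (fun m => G m N.+1).
  by rewrite -!tsumD; apply: eq_tsum => m _; rewrite tsumS addrA.
have E (x y z t u : C) : x + (y + z + t + u) - z = (x + u) + (y + t) by ring.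
rewrite E (le_trans (normcD _ _)) //.
(* Two full sides of [2 N + 3] points and two shortened sides of [2 N + 1] points. *)
have -> : 8 * N.+1%:R * B = (N.+1.*2.+1%:R * B + N.+1.*2.+1%:R * B) + (N.*2.+1%:R * B + N.*2.+1%:R * B).
  rewrite -!addnn -!natr1 !natrD -!natr1; ring.
by apply: lerD; rewrite (le_trans (normcD _ _)) // lerD //; apply: tsum_bound => k kN; apply: h; lia.
Qed.

Lemma inv2_tel (K x : R) : 0 < x ->
  2 * K / x - 2 * K / (x + 1) = K / x ^+ 2 * (2 * x / (x + 1)).
Proof. by move=> x0; field; apply/andP; split; apply/eqP => ?; lra. Qed.

(** Since [K / (N + 1) ^ 2 <= 2 K / (N + 1) - 2 K / (N + 2)], the sequence minus [2 K / (N + 1)]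
    increases, the sequence plus [2 K / (N + 1)] decreases, and the two squeeze a limit. *)
Lemma real_cauchy (x : nat -> R) (K : R) N0 : 0 <= K ->
  (forall N, (N0 <= N)%N -> `|x N.+1 - x N| <= K / N.+1%:R ^+ 2) ->
  exists l, forall e : R, 0 < e -> exists N1, forall N, (N1 <= N)%N -> `|x N - l| <= e.
Proof.
move=> K0 H.
have inv2 (N : nat) : K / N.+1%:R ^+ 2 <= 2 * K / N.+1%:R - 2 * K / N.+2%:R :> R.
  have n1 : 0 < N.+1%:R :> R by [].
  have n2 : 0 < N.+2%:R :> R by [].
  have -> : 2 * K / N.+1%:R - 2 * K / N.+2%:R = K / N.+1%:R ^+ 2 * (2 * N.+1%:R / N.+2%:R).
    by rewrite -[N.+2%:R]natr1 inv2_tel.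
  rewrite ler_peMr ?divr_ge0 ?exprn_ge0 // ler_pdivlMr // mul1r -natrM ler_nat; lia.
pose y k := x (N0 + k)%N - 2 * K / (N0 + k).+1%:R.
have ynd : nondecreasing_seq y.
  apply/nondecreasing_seqP => k; rewrite /y addnS.
  have := H (N0 + k)%N (leq_addr _ _); have := inv2 (N0 + k)%N; rewrite ler_norml.
  move: (K / _ ^+ 2) (2 * K / _) (2 * K / _) => a b c; lra.
have zni k : x (N0 + k)%N + 2 * K / (N0 + k).+1%:R <= x N0 + 2 * K / N0.+1%:R.
  elim: k => [|k IH]; first by rewrite addn0.
  apply: le_trans IH; rewrite addnS.
  have := H (N0 + k)%N (leq_addr _ _); have := inv2 (N0 + k)%N; rewrite ler_norml.
  move: (K / _ ^+ 2) (2 * K / _) (2 * K / _) => a b c; lra.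
have cy : cvgn y.
  apply: nondecreasing_is_cvgn => //; exists (x N0 + 2 * K / N0.+1%:R) => _ [k _ <-].
  apply: le_trans (zni k); rewrite /y.
  have : 0 <= 2 * K / (N0 + k).+1%:R by rewrite divr_ge0 // mulr_ge0.
  move: (2 * K / _) => a; lra.
exists (limn y) => e e0; have e2 : 0 < e / 2 by rewrite divr_gt0.
move/cvgrPdist_lt : cy => /(_ _ e2)[n1 _ Hn1].
have [n2 Hn2] : exists n2, 2 * K / (e / 2) <= n2%:R.
  exists (Num.bound (2 * K / (e / 2))); apply: ltW; apply: archi_boundP.
  by apply: divr_ge0; [exact: mulr_ge0|exact: ltW].
exists (N0 + maxn n1 n2)%N => N NN.
have kN : N = (N0 + (N - N0))%N by lia.
have k1 : (n1 <= N - N0)%N by lia.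
have := Hn1 _ k1; rewrite /= /y -kN => h.
have : 2 * K / N.+1%:R <= e / 2.
  rewrite ler_pdivrMr // -ler_pdivrMl // mulrC (le_trans Hn2) // ler_nat; lia.
have : 0 <= 2 * K / N.+1%:R by rewrite divr_ge0 // mulr_ge0.
move: h; move: (2 * K / _) => a; rewrite ltr_norml ler_norml; lra.
Qed.

Lemma complex_cauchy (u : nat -> C) (K : R) N0 : 0 <= K ->
  (forall N, (N0 <= N)%N -> normc (u N.+1 - u N) <= K / N.+1%:R ^+ 2) ->
  (exists l, tends u l) /\ forall N, (N0 <= N)%N -> normc (u N - u N0) <= 2 * K.
Proof.
move=> K0 H; split.
  have [|l1 H1] := @real_cauchy (fun N => complex.Re (u N)) K N0 K0.
    by move=> N /H; rewrite -cReB; apply: le_trans; exact: normc_Re.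
  have [|l2 H2] := @real_cauchy (fun N => complex.Im (u N)) K N0 K0.
    by move=> N /H; rewrite -cImB; apply: le_trans; exact: normc_Im.
  exists (l1 +i* l2) => e e0; have e2 : 0 < e / 2 by rewrite divr_gt0.
  have [N1 h1] := H1 _ e2; have [N2 h2] := H2 _ e2; exists (maxn N1 N2) => N.
  rewrite geq_max => /andP[/h1 {}h1 /h2 {}h2].
  by rewrite (le_trans (normc_le _)) // cReB cImB (splitr e) lerD.
have tele k : normc (u (N0 + k)%N - u N0) <= 2 * K / N0.+1%:R - 2 * K / (N0 + k).+1%:R.
  elim: k => [|k IH]; first by rewrite addn0 !subrr Normc.normc0.
  rewrite addnS (le_trans (normc_subl _ (u (N0 + k)%N) _)) //.
  have := H (N0 + k)%N (leq_addr _ _).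
  have n1 : 0 < (N0 + k).+1%:R :> R by [].
  have : K / (N0 + k).+1%:R ^+ 2 <= 2 * K / (N0 + k).+1%:R - 2 * K / (N0 + k).+2%:R :> R.
    have -> : 2 * K / (N0 + k).+1%:R - 2 * K / (N0 + k).+2%:R =
       K / (N0 + k).+1%:R ^+ 2 * (2 * (N0 + k).+1%:R / (N0 + k).+2%:R).
      by rewrite -[(N0 + k).+2%:R]natr1 inv2_tel.
    rewrite ler_peMr ?divr_ge0 ?exprn_ge0 // ler_pdivlMr // mul1r -natrM ler_nat; lia.
  move: IH; move: (K / _ ^+ 2) (2 * K / _) (2 * K / _) (2 * K / _) => a b c d; lra.
move=> N NN; have -> : N = (N0 + (N - N0))%N by lia.
rewrite (le_trans (tele _)) //.
have : 2 * K / N0.+1%:R <= 2 * K by rewrite ler_pdivrMr // ler_peMr ?mulr_ge0 // ler1n.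
have : 0 <= 2 * K / (N0 + (N - N0)).+1%:R by rewrite divr_ge0 // mulr_ge0.
move: (2 * K / _) (2 * K / _) => a b; lra.
Qed.

(* Passing from [N] to [N.+1] adds a shell of 8(N+1) terms. *)
Lemma ssum_cauchy (G : int -> int -> C) (B : R) N0 : 0 <= B ->
  (forall m n : int, (N0 < maxn `|m| `|n|)%N -> normc (G m n) <= B / (maxn `|m| `|n|)%:R ^+ 3) ->
  (exists l, tends (fun N => ssum N G) l) /\
  forall N, (N0 <= N)%N -> normc (ssum N G - ssum N0 G) <= 16 * B.
Proof.
move=> B0 H; have B8 : 0 <= 8 * B by rewrite mulr_ge0.
have [|h1 h2] := @complex_cauchy (fun N => ssum N G) (8 * B) N0 B8.
  move=> N NN; rewrite (le_trans (ssumS_bound (B := B / N.+1%:R ^+ 3) _)).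
  - by [].
  - by move=> m n mn; rewrite -mn; apply: H; rewrite mn.
  - have n0 : N.+1%:R != 0 :> R by [].
    by rewrite le_eqVlt; apply/orP; left; apply/eqP; move: (N.+1%:R) n0 => x x0; field.
split => // N NN; rewrite (le_trans (h2 N NN)) //; lra.
Qed.

End SquareSums.

(** * The lattice, convergence, periodicity and poles of the Weierstrass function *)

Section Weierstrass.
Context {R : realType}.
Local Notation C := (cplx R).
Variables (tau : C) (tau_upper : 0 < complex.Im tau).

Definition lat (m n : int) : C := m%:~R + n%:~R * tau.

Lemma intC (m : int) : (m%:~R : C) = (m%:~R : R)%:C.
Proof. by rewrite (rmorph_int (real_complex R)). Qed.

Lemma lat_Im m n : complex.Im (lat m n) = n%:~R * complex.Im tau.
Proof. by rewrite /lat !intC cImD cImM /=; ring. Qed.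

Lemma absz_intr (k : int) : `|k%:~R : R| = `|k|%N%:R.
Proof. by rewrite -intr_norm -abszE -pmulrn. Qed.

(** The imaginary part controls [n], since [Im tau > 0]; then [m] is controlled by
    [lat m n - n tau]. The convergence estimates below rest on this comparison with the maximum
    norm. *)
Lemma lat_lb : exists2 c : R, 0 < c & forall m n : int,
  c * (maxn `|m| `|n|)%:R <= normc (lat m n).
Proof.
pose b := 1 + normc tau / complex.Im tau.
have t0 : 0 <= normc tau / complex.Im tau by rewrite divr_ge0 ?normc_ge0 // ltW.
have b0 : 0 < b by rewrite /b; lra.
exists (Num.min (complex.Im tau) b^-1); first by rewrite lt_min tau_upper invr_gt0.
move=> m n.
have hn : complex.Im tau * `|n|%N%:R <= normc (lat m n).
  rewrite (le_trans _ (normc_Im _)) // lat_Im normrM (gtr0_norm tau_upper) absz_intr mulrC //.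
have hm : `|m|%N%:R <= b * normc (lat m n).
  have -> : `|m|%N%:R = normc (lat m n - n%:~R * tau).
    by rewrite /lat addrK intC normc_real absz_intr.
  rewrite (le_trans (normcB _ _)) // /b mulrDl mul1r lerD //.
  rewrite normcM intC normc_real absz_intr mulrAC -mulrA mulrC ler_wpM2l ?normc_ge0 //.
  by rewrite ler_pdivlMr // mulrC.
have [mn|nm] := leqP `|m| `|n|.
  by rewrite (le_trans _ hn) // ler_wpM2r // ge_min lexx.
apply: (@le_trans _ _ (b^-1 * `|m|%N%:R)); last by rewrite ler_pdivrMl.
by rewrite ler_wpM2r // ge_min lexx orbT.
Qed.

Lemma lat_eq0 m n : (lat m n == 0) = (m == 0) && (n == 0).
Proof.
apply/eqP/andP => [e|[/eqP -> /eqP ->]]; last by rewrite /lat !mulr0z mul0r addr0.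
have [c c0 /(_ m n)] := lat_lb; rewrite e Normc.normc0 => h.
have : (maxn `|m| `|n|)%:R <= 0 :> R by move: h; rewrite pmulr_rle0.
by rewrite lern0 => /eqP h2; split; apply/eqP; lia.
Qed.

Lemma latD m n m' n' : lat m n + lat m' n' = lat (m + m') (n + n').
Proof. by rewrite /lat !rmorphD /=; ring. Qed.

Lemma latN m n : - lat m n = lat (- m) (- n).
Proof. by rewrite /lat !rmorphN /=; ring. Qed.

Lemma latticeD z w : lattice tau z -> lattice tau w -> lattice tau (z + w).
Proof. by move=> [m [n ->]] [m' [n' ->]]; exists (m + m'), (n + n'); exact: latD. Qed.

Lemma latticeN z : lattice tau z -> lattice tau (- z).
Proof. by move=> [m [n ->]]; exists (- m), (- n); exact: latN. Qed.

Lemma lattice0 : lattice tau 0.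
Proof. by exists 0, 0; rewrite mul0r addr0. Qed.

Lemma lattice_sep : exists2 c : R, 0 < c & forall z w, lattice tau z -> lattice tau w ->
  normc (z - w) < c -> z = w.
Proof.
have [c c0 H] := lat_lb; exists c => // z w lz lw zw.
have [m [n E]] := latticeD lz (latticeN lw).
have {E}E : z - w = lat m n by [].
apply/eqP; rewrite -subr_eq0 E lat_eq0; apply/andP.
have := le_lt_trans (H m n) (eq_ind _ (fun x => normc x < c) zw _ E).
rewrite gtr_pMr // ltrn1 => /eqP h; split; apply/eqP; lia.
Qed.

Lemma copen_nlattice : copen [set z | ~ lattice tau z].
Proof.
have [c c0 H] := lattice_sep; move=> z nz.
have c2 : 0 < c / 2 by rewrite divr_gt0.
have [[w lw wz]|no] := pselect (exists2 w, lattice tau w & normc (w - z) < c / 2).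
  have wz0 : w - z != 0 by rewrite subr_eq0; apply: contra_not_neq nz => <-.
  exists (Num.min (c / 2) (normc (w - z))).
    by rewrite lt_min c2 normc_gt0.
  move=> x; rewrite lt_min => /andP[x1 x2] lx.
  have E : x = w.
    apply: H => //; rewrite (le_lt_trans (normc_subl _ z _)) // [normc (z - w)]normcBC; lra.
  by move: x2; rewrite E ltxx.
by exists (c / 2) => // x xz lx; apply: no; exists x.
Qed.

Definition isq (x : C) : C := (x ^+ 2)^-1.
Definition gterm (z : C) (m n : int) : C := isq (z - lat m n) - isq (lat m n).

Lemma isq0 : isq 0 = 0. Proof. by rewrite /isq expr0n /= invr0. Qed.

(** By the convention [isq 0 = 0] the term of [gterm] at the origin is [z ^ -2] itself, so the
    leading term and the sum without the origin become one sum over the full square. *)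
Lemma weierstrass_sum z N : isq z + (\sum_(i < N.*2.+1) \sum_(j < N.*2.+1)
      let w : C := (i%:Z - N%:Z)%:~R + (j%:Z - N%:Z)%:~R * tau in
      if w == 0 then 0 else ((z - w) ^+ 2)^-1 - (w ^+ 2)^-1 : C) = ssum N (gterm z).
Proof.
pose dl (m n : int) : C := if lat m n == 0 then isq z else 0.
have E : ssum N dl = isq z.
  elim: N => [|N IH].
    by rewrite /ssum !tsum0 /dl lat_eq0 eqxx.
  apply/eqP; rewrite -[isq z]IH -subr_eq0 -normc_eq0 eq_le normc_ge0 andbT.
  have -> : 0 = 8 * N.+1%:R * 0 :> R by rewrite mulr0.
  apply: ssumS_bound => m n mn; rewrite /dl lat_eq0; case: ifP.
    by move=> /andP[/eqP m0 /eqP n0]; move: mn; rewrite m0 n0.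
  by rewrite Normc.normc0.
rewrite -{1}E.
pose G (m n : int) : C := if lat m n == 0 then 0 else ((z - lat m n) ^+ 2)^-1 - (lat m n ^+ 2)^-1.
transitivity (ssum N dl + ssum N G); first by [].
rewrite -ssumD; apply: eq_ssum => m n; rewrite /dl /G /gterm /=.
case: eqP => [->|_]; first by rewrite subr0 isq0 subr0 addr0.
by rewrite add0r.
Qed.

(** The difference is [z (2 w - z) / (w ^ 2 (z - w) ^ 2)]: subtracting [w ^ -2] gains the one power
    of [w] that makes the double sum converge. *)
Lemma isq_bound (z w : C) (r : R) : normc z <= r -> 2 * r <= normc w -> 0 < r ->
  normc (isq (z - w) - isq w) <= 10 * r / normc w ^+ 3.
Proof.
move=> zr rw r0.
have w0 : 0 < normc w by lra.
have wz : normc w / 2 <= normc (z - w).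
  have := normc_lb w z; rewrite [normc (w - z)]normcBC; lra.
have zw0 : z - w != 0 by rewrite -normc_gt0; lra.
have wn0 : w != 0 by rewrite -normc_gt0.
have -> : isq (z - w) - isq w = z * (2 * w - z) / (w ^+ 2 * (z - w) ^+ 2).
  by rewrite /isq; field; rewrite wn0 zw0.
rewrite !(normcM, normcV, normcX) -[2 : C]/(2%:R : C).
have num : normc (2 * w - z) <= 5 / 2 * normc w.
  rewrite (le_trans (normcB _ _)) // normcM normc_natr; lra.
apply: (@le_trans _ _ (r * (5 / 2 * normc w) / (normc w ^+ 2 * (normc w / 2) ^+ 2))).
  have d1 : 0 < normc w ^+ 2 * (normc w / 2) ^+ 2 by rewrite mulr_gt0 // exprn_gt0 // divr_gt0.
  apply: ler_pM; rewrite ?mulr_ge0 ?invr_ge0 ?mulr_ge0 ?exprn_ge0 ?normc_ge0 //.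
    by apply: ler_pM; rewrite ?normc_ge0.
  rewrite lef_pV2 ?posrE // ?mulr_gt0 ?exprn_gt0 ?normc_gt0 //.
  by rewrite ler_wpM2l ?exprn_ge0 ?normc_ge0 // lerXn2r ?nnegrE ?normc_ge0 // divr_ge0 // normc_ge0.
by rewrite le_eqVlt; apply/orP; left; apply/eqP; field; rewrite gt_eqF.
Qed.

Lemma far_index (r : R) : 0 < r -> exists c N0, 0 < c /\ forall m n : int,
  (N0 < maxn `|m| `|n|)%N -> 2 * r <= normc (lat m n) /\ c * (maxn `|m| `|n|)%:R <= normc (lat m n).
Proof.
move=> r0; have [c c0 H] := lat_lb; exists c, (Num.bound (2 * r / c)); split => // m n mn.
split; last exact: H.
apply: le_trans (H m n); rewrite -ler_pdivrMl // mulrC; apply: ltW.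
apply: lt_trans (archi_boundP _) _; first by rewrite divr_ge0 ?ltW // mulr_gt0.
by rewrite ltr_nat.
Qed.

(** The limit in [weierstrass_p] is reached through this statement: the sum of [gterm] over squares
    converges, and removing [isq z] leaves the defining sequence. *)
Lemma gterm_tends z : tends (fun N => ssum N (gterm z)) (weierstrass_p tau z).
Proof.
pose r := normc z + 1; have r0 : 0 < r by rewrite /r; have := normc_ge0 z; lra.
have [c [N0 [c0 H]]] := far_index r0.
have B0 : 0 <= 10 * r / c ^+ 3 by rewrite divr_ge0 ?exprn_ge0 ?ltW // mulr_gt0.
have [|[l Hl] _] := @ssum_cauchy _ (gterm z) (10 * r / c ^+ 3) N0 B0.
  move=> m n mn; have [h1 h2] := H m n mn.
  have k0 : 0 < (maxn `|m| `|n|)%:R :> R by rewrite ltr0n (leq_ltn_trans _ mn).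
  rewrite (le_trans (isq_bound _ h1 r0)) //; first by rewrite /r lerDl.
  rewrite [leRHS](_ : _ = 10 * r * ((c * (maxn `|m| `|n|)%:R) ^+ 3)^-1); last first.
    by move: ((maxn _ _)%:R) k0 => x x0; field; rewrite !gt_eqF.
  rewrite ler_wpM2l ?mulr_ge0 ?(ltW r0) // lef_pV2 ?posrE ?exprn_gt0 ?mulr_gt0 //.
    by rewrite lerXn2r ?nnegrE ?normc_ge0 // ltW // mulr_gt0.
  by rewrite (lt_le_trans _ h2) // mulr_gt0.
suff -> : weierstrass_p tau z = l by [].
rewrite /weierstrass_p -/(isq z).
set F := (fun N : nat => _).
have : (F @ \oo) --> (l - isq z : C).
  apply/cvgCP => e e0; have e2 : 0 < e / 2 by rewrite divr_gt0.
  have [N1 HN] := Hl _ e2; exists N1 => // N /= NN.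
  have := HN N NN; rewrite -weierstrass_sum -/(F N).
  have E (x y t : C) : x + y - t = y - (t - x) by ring.
  by rewrite E; lra.
move=> /cvg_lim ->; last exact: norm_hausdorff.
by rewrite addrC subrK.
Qed.

(** A side of the square carries [2 N + 1] terms of order [N ^ -2]. This disposes of the boundary
    terms left over when the square is translated. *)
Lemma bdry_tends (g : nat -> int -> C) (z c : C) : 
  (forall N k, (`|k| <= N)%N -> exists m n : int, (N <= maxn `|m| `|n|)%N /\ g N k = isq (z - lat m n)) ->
  tends (fun N => tsum N (g N)) 0.
Proof.
move=> H e e0.
pose r := normc z + 1; have r0 : 0 < r by rewrite /r; have := normc_ge0 z; lra.
have [d [N0 [d0 F]]] := far_index r0.
pose X := 12 / d ^+ 2 / e.
have X0 : 0 <= X by rewrite divr_ge0 ?(ltW e0) // divr_ge0 // exprn_ge0 // ltW.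
exists (maxn N0.+1 (Num.bound X)) => N NN; rewrite subr0.
have N0N : (N0 < N)%N by lia.
have NX : X < N%:R.
  by apply: lt_le_trans (archi_boundP X0) _; rewrite ler_nat; lia.
have Np : 0 < N%:R :> R by rewrite ltr0n; lia.
apply: (@le_trans _ _ (N.*2.+1%:R * (4 / (d * N%:R) ^+ 2))).
  apply: tsum_bound => k /(H N k)[m [n [mn ->]]].
  have [h1 h2] := F m n (leq_trans N0N mn).
  have zw : d * N%:R / 2 <= normc (z - lat m n).
    have : d * N%:R <= normc (lat m n).
      by rewrite (le_trans _ h2) // ler_wpM2l ?(ltW d0) // ler_nat.
    have := normc_lb (lat m n) z; rewrite [normc (lat m n - z)]normcBC.
    by move: h1; rewrite /r; lra.
  rewrite /isq normcV normcX.
  have -> : 4 / (d * N%:R) ^+ 2 = ((d * N%:R / 2) ^+ 2)^-1.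
    by field; rewrite !gt_eqF.
  have p0 : 0 < d * N%:R / 2 by rewrite divr_gt0 // mulr_gt0.
  rewrite lef_pV2 ?posrE ?exprn_gt0 //; last exact: lt_le_trans zw.
  by rewrite lerXn2r ?nnegrE ?normc_ge0 // ltW.
have b : N.*2.+1%:R <= 3 * N%:R :> R by rewrite -natrM ler_nat; lia.
apply: (@le_trans _ _ (3 * N%:R * (4 / (d * N%:R) ^+ 2))).
  by rewrite ler_wpM2r // divr_ge0 // exprn_ge0 // mulr_ge0 // ltW.
rewrite [leLHS](_ : _ = 12 / d ^+ 2 / N%:R); last by field; rewrite !gt_eqF.
move: NX; rewrite /X ltr_pdivrMr // => NX; by rewrite ler_pdivrMr // [leRHS]mulrC ltW.
Qed.

(** Translation by a period moves the square by one column or row; the constants [w ^ -2] cancel,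
    and the difference of the two sums telescopes to two boundary sides, which tend to 0. *)
Lemma wp_periodic z : weierstrass_p tau (z + 1) = weierstrass_p tau z /\
  weierstrass_p tau (z + tau) = weierstrass_p tau z.
Proof.
have sub u v : tends (fun N => ssum N (gterm u) - ssum N (gterm v)) 0 ->
    weierstrass_p tau u = weierstrass_p tau v.
  move=> h; have := tendsD h (gterm_tends v); rewrite add0r => h2.
  apply: (tends_uniq (gterm_tends u)); apply: tends_eq h2 => N; by rewrite subrK.
split; apply: sub.
  have E N : ssum N (gterm (z + 1)) - ssum N (gterm z) =
     tsum N (fun n => isq (z - lat (- N%:Z - 1) n)) - tsum N (fun n => isq (z - lat N%:Z n)).
    rewrite -ssumB -[- tsum _ _]mulN1r -tsumZ -tsumD.
    pose K m := tsum N (fun n => isq (z - lat m n)).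
    transitivity (tsum N (fun m => K (m - 1) - K m)).
      apply: eq_tsum => m _; rewrite /K -[- tsum _ _]mulN1r -tsumZ -tsumD; apply: eq_tsum => n _.
      rewrite /gterm mulN1r.
      have -> : z + 1 - lat m n = z - lat (m - 1) n by rewrite /lat rmorphB /=; ring.
      by have A (x y t : C) : x - y - (t - y) = x - t by ring.
    rewrite tsum_tel /K -[- tsum _ _]mulN1r -tsumZ -tsumD; apply: eq_tsum => n _.
    by [].
  have t1 := @bdry_tends (fun N n => isq (z - lat (- N%:Z - 1) n)) z 0.
  have t2 := @bdry_tends (fun N n => isq (z - lat N%:Z n)) z 0.
  have := tendsD (t1 _) (tendsM (tends_cst (-1)) (t2 _)).
  rewrite mulr0 addr0 => h; apply: tends_eq (h _ _) => [N|N k kN|N k kN].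
  - by rewrite E mulN1r.
  - by exists (- N%:Z - 1), k; split => //; lia.
  - by exists N%:Z, k; split => //; lia.
have E N : ssum N (gterm (z + tau)) - ssum N (gterm z) =
   tsum N (fun m => isq (z - lat m (- N%:Z - 1))) - tsum N (fun m => isq (z - lat m N%:Z)).
  rewrite -ssumB -[- tsum _ _]mulN1r -tsumZ -tsumD.
  apply: eq_tsum => m _; rewrite mulN1r.
  rewrite -(tsum_tel N (fun n => isq (z - lat m n))); apply: eq_tsum => n _.
  rewrite /gterm.
  have -> : z + tau - lat m n = z - lat m (n - 1) by rewrite /lat rmorphB /=; ring.
  by have A (x y t : C) : x - y - (t - y) = x - t by ring.
have t1 := @bdry_tends (fun N m => isq (z - lat m (- N%:Z - 1))) z 0.
have t2 := @bdry_tends (fun N m => isq (z - lat m N%:Z)) z 0.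
have := tendsD (t1 _) (tendsM (tends_cst (-1)) (t2 _)).
rewrite mulr0 addr0 => h; apply: tends_eq (h _ _) => [N|N k kN|N k kN].
- by rewrite E mulN1r.
- by exists k, (- N%:Z - 1); split => //; lia.
- by exists k, N%:Z; split => //; lia.
Qed.

(** Exchanging [z] and [w] in the estimate and adding shows that [V] is locally Lipschitz. One
    quadratic estimate thus provides both the derivative and its continuity. *)
Lemma hol_quad (D : set C) (f V : C -> C) (K : R) : copen D -> 0 <= K ->
  (forall z w, D z -> D w -> normc (f w - f z - (w - z) * V z) <= K * normc (w - z) ^+ 2) ->
  hol D f.
Proof.
move=> oD K0 H; have K1 : 0 < 2 * K + 1 by rewrite ltr_wpDl // mulr_ge0.
apply (@holI _ _ _ V oD) => z Dz; have [d d0 dD] := oD z Dz.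
  apply/cderP => e e0; exists (Num.min d (e / (2 * K + 1))).
    by rewrite lt_min d0 divr_gt0.
  move=> h; rewrite lt_min => /andP[hd he].
  have E (a b : C) : a + b - a = b by ring.
  have := H z (z + h) Dz; rewrite E => /(_ (dD _ _)); rewrite E => /(_ hd).
  rewrite -mulRI [V z * h]mulrC => /le_trans; apply.
  rewrite expr2 mulrA ler_wpM2r ?normc_ge0 //.
  by move: he; rewrite ltr_pdivlMr // => he; have := normc_ge0 h; nra.
apply/contCP => e e0; exists (Num.min d (e / (2 * K + 1))).
  by rewrite lt_min d0 divr_gt0.
move=> w; rewrite lt_min => /andP[wd we]; have Dw := dD _ wd.
have [->|wz] := eqVneq w z; first by rewrite subrr Normc.normc0.
have wz0 : 0 < normc (w - z) by rewrite normc_gt0 subr_eq0.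
have h1 := H z w Dz Dw; have h2 := H w z Dw Dz.
have : normc (w - z) * normc (V w - V z) <= normc (w - z) * (2 * K * normc (w - z)).
  rewrite -normcM.
  have -> : (w - z) * (V w - V z) = (f w - f z - (w - z) * V z) + (f z - f w - (z - w) * V w) by ring.
  rewrite (le_trans (normcD _ _)) // (le_trans (lerD h1 h2)) // [normc (z - w)]normcBC.
  by rewrite le_eqVlt; apply/orP; left; apply/eqP; ring.
rewrite ler_pM2l // => /le_lt_trans; apply.
by move: we; rewrite ltr_pdivlMr // => we; nra.
Qed.

Lemma tends_le (u : nat -> C) l (B : R) N0 : tends u l ->
  (forall N, (N0 <= N)%N -> normc (u N) <= B) -> normc l <= B.
Proof.
move=> h H; apply/ler_addgt0Pl => e e0; have [N1 H1] := h e e0.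
have := H1 _ (leq_maxl N1 N0); have := H _ (leq_maxr N1 N0).
by rewrite normcBC; have := normc_lb l (u (maxn N1 N0)); lra.
Qed.

(** The derivative of [isq] off the origin. *)
Definition icube (x : C) : C := - 2 * (x ^+ 3)^-1.

Lemma far_norm (z w : C) (r : R) : normc z < r -> 2 * r <= normc w -> 0 < r ->
  normc w / 2 <= normc (z - w) /\ normc (z - w) <= 3 / 2 * normc w.
Proof.
move=> zr rw r0; split.
  have := normc_lb w z; rewrite [normc (w - z)]normcBC; lra.
by rewrite (le_trans (normcB _ _)) //; lra.
Qed.

(** The quadratic remainder of a far term decays like [|w| ^ -3], so the remainders can be summed
    over the lattice. *)
Lemma isq_quad (z z' w : C) (r : R) : normc z < r -> normc z' < r -> 2 * r <= normc w -> 0 < r ->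
  normc (isq (z' - w) - isq (z - w) - (z' - z) * icube (z - w)) <=
    72 / r / normc w ^+ 3 * normc (z' - z) ^+ 2.
Proof.
move=> zr zr' rw r0; have w0 : 0 < normc w by lra.
have [l1 u1] := far_norm zr rw r0; have [l2 u2] := far_norm zr' rw r0.
have a0 : z - w != 0 by rewrite -normc_gt0; lra.
have b0 : z' - w != 0 by rewrite -normc_gt0; lra.
have -> : isq (z' - w) - isq (z - w) - (z' - z) * icube (z - w) =
   (z' - z) ^+ 2 * (((z - w) + 2 * (z' - w)) / ((z - w) ^+ 3 * (z' - w) ^+ 2)).
  by rewrite /isq /icube; field; rewrite a0 b0.
rewrite normcM normcX mulrC ler_wpM2r ?exprn_ge0 ?normc_ge0 //.
rewrite normcM normcV normcM !normcX.
have n1 : normc (z - w + 2 * (z' - w)) <= 9 / 2 * normc w.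
  rewrite (le_trans (normcD _ _)) // normcM -[2 : C]/(2%:R : C) normc_natr; lra.
have d1 : (normc w / 2) ^+ 3 * (normc w / 2) ^+ 2 <= normc (z - w) ^+ 3 * normc (z' - w) ^+ 2.
  by apply: ler_pM; rewrite ?exprn_ge0 ?divr_ge0 ?normc_ge0 // lerXn2r // nnegrE ?divr_ge0 ?normc_ge0.
have d0 : 0 < (normc w / 2) ^+ 3 * (normc w / 2) ^+ 2 by rewrite mulr_gt0 // exprn_gt0 // divr_gt0.
apply: (@le_trans _ _ (9 / 2 * normc w / ((normc w / 2) ^+ 3 * (normc w / 2) ^+ 2))).
  apply: ler_pM; rewrite ?normc_ge0 ?invr_ge0 ?(le_trans (ltW d0) d1) //.
  by rewrite lef_pV2 ?posrE // (lt_le_trans d0).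
have -> : 9 / 2 * normc w / ((normc w / 2) ^+ 3 * (normc w / 2) ^+ 2) = 144 / normc w / normc w ^+ 3.
  by field; rewrite gt_eqF.
rewrite ler_wpM2r ?invr_ge0 ?exprn_ge0 ?normc_ge0 //.
rewrite ler_pdivrMr // mulrAC ler_pdivlMr //; lra.
Qed.

Lemma icube_bound (z w : C) (r : R) : normc z < r -> 2 * r <= normc w -> 0 < r ->
  normc (icube (z - w)) <= 16 / normc w ^+ 3.
Proof.
move=> zr rw r0; have w0 : 0 < normc w by lra.
have [l1 u1] := far_norm zr rw r0.
rewrite /icube normcM normcN -[2 : C]/(2%:R : C) normc_natr normcV normcX.
have -> : 16 / normc w ^+ 3 = 2 * ((normc w / 2) ^+ 3)^-1 by field; rewrite gt_eqF.
have h0 : 0 < normc w / 2 by rewrite divr_gt0.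
rewrite ler_wpM2l // lef_pV2 ?posrE ?exprn_gt0 //; last exact: lt_le_trans l1.
by rewrite lerXn2r // nnegrE ?normc_ge0 ?(ltW h0).
Qed.

(** Outside a large enough square every lattice point has modulus at least [2 r], and the quadratic
    remainders add up to the estimate that [hol_quad] expects, with [V] the sum of the
    derivatives. *)
Lemma wp_far (r : R) : 0 < r -> exists N0 : nat,
  hol (disc 0 r) (fun z => weierstrass_p tau z - ssum N0 (gterm z)).
Proof.
move=> r0; have [c [N0 [c0 H]]] := far_index r0; exists N0.
have cube (a : R) m n : 0 <= a -> (N0 < maxn `|m| `|n|)%N ->
    a / normc (lat m n) ^+ 3 <= a / c ^+ 3 / (maxn `|m| `|n|)%:R ^+ 3.
  move=> a0 mn; have [_ h2] := H m n mn.
  have k0 : 0 < (maxn `|m| `|n|)%:R :> R by rewrite ltr0n (leq_ltn_trans _ mn).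
  rewrite [leRHS](_ : _ = a * ((c * (maxn `|m| `|n|)%:R) ^+ 3)^-1); last first.
    by move: ((maxn _ _)%:R) k0 => x x0; field; rewrite !gt_eqF.
  rewrite ler_wpM2l // lef_pV2 ?posrE ?exprn_gt0 ?mulr_gt0 //.
    by rewrite lerXn2r ?nnegrE ?normc_ge0 // ltW // mulr_gt0.
  by rewrite (lt_le_trans _ h2) // mulr_gt0.
pose gder z m n := icube (z - lat m n).
have cv z : normc z < r -> exists l, tends (fun N => ssum N (gder z) - ssum N0 (gder z)) l.
  move=> zr.
  have B0 : 0 <= 16 / c ^+ 3 by rewrite divr_ge0 // exprn_ge0 // ltW.
  have [|[l Hl] _] := @ssum_cauchy _ (gder z) (16 / c ^+ 3) N0 B0.
    move=> m n mn; have [h1 _] := H m n mn.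
    by rewrite (le_trans (icube_bound zr h1 r0)) // cube.
  by exists (l - ssum N0 (gder z)); apply: (tendsD Hl); exact: tends_cst.
pose V z := xget 0 [set l | tends (fun N => ssum N (gder z) - ssum N0 (gder z)) l].
have VP z : normc z < r -> tends (fun N => ssum N (gder z) - ssum N0 (gder z)) (V z).
  by move=> /cv[l Hl]; rewrite /V; case: xgetP => [x _ //|/(_ l)].
pose B := 72 / r / c ^+ 3.
have B0 : 0 <= B by rewrite /B divr_ge0 ?exprn_ge0 ?(ltW c0) // divr_ge0 // ltW.
apply: (@hol_quad _ _ V (16 * B)); [exact: copen_disc|by rewrite mulr_ge0|].
move=> z z'; rewrite /disc /= !subr0 => zr zr'.
pose rm m n := gterm z' m n - gterm z m n - (z' - z) * gder z m n.
have rmB : forall m n : int, (N0 < maxn `|m| `|n|)%N ->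
    normc (rm m n) <= (B * normc (z' - z) ^+ 2) / (maxn `|m| `|n|)%:R ^+ 3.
  move=> m n mn; have [h1 _] := H m n mn.
  rewrite /rm /gterm.
  have E (a b e d : C) : a - b - (e - b) - d = a - e - d by ring.
  rewrite E (le_trans (isq_quad zr zr' h1 r0)) // [leRHS]mulrAC.
  by rewrite ler_wpM2r ?exprn_ge0 ?normc_ge0 // /B cube // divr_ge0 // ltW.
have Bz0 : 0 <= B * normc (z' - z) ^+ 2 by rewrite mulr_ge0 // exprn_ge0 // normc_ge0.
have [_ bd] := ssum_cauchy Bz0 rmB.
rewrite -mulrA; apply: (tends_le (N0 := N0) _ bd).
have t1 := tendsD (gterm_tends z') (tends_cst (- ssum N0 (gterm z'))).
have t2 := tendsD (gterm_tends z) (tends_cst (- ssum N0 (gterm z))).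
have t3 := tendsM (tends_cst (- (z' - z))) (VP z zr).
have t4 := tendsD (tendsD t1 (tendsM (tends_cst (-1)) t2)) t3.
have E (a b d : C) : a + (-1) * b + - (z' - z) * d = a - b - (z' - z) * d by ring.
rewrite E in t4; apply: tends_eq t4 => N; rewrite E /rm !ssumB !ssumZ; ring.
Qed.

Lemma hol_sum (D : set C) (I : Type) (s : seq I) (F : I -> C -> C) : copen D ->
  (forall i, hol D (F i)) -> hol D (fun z => \sum_(i <- s) F i z).
Proof.
move=> oD hF; elim: s => [|i s IH].
  by apply: (hol_eq oD _ (hol_cst 0 oD)) => z _; rewrite big_nil.
by apply: (hol_eq oD _ (holD oD (hF i) IH)) => z _; rewrite big_cons.
Qed.

Lemma hol_ssum (D : set C) N (F : int -> int -> C -> C) : copen D ->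
  (forall m n, hol D (F m n)) -> hol D (fun z => ssum N (fun m n => F m n z)).
Proof.
move=> oD hF; apply: hol_sum => // i; apply: hol_sum => // j; exact: hF.
Qed.

Lemma hol_isq (D : set C) (w : C) : copen D -> (forall z, D z -> z != w) ->
  hol D (fun z => isq (z - w)).
Proof. by move=> oD Dw; exact: (hol_invX 2). Qed.

Lemma wp_hol : hol [set z | ~ lattice tau z] (weierstrass_p tau).
Proof.
apply: Hol => z nz.
pose r := normc z + 1; have r0 : 0 < r by rewrite /r; have := normc_ge0 z; lra.
have [N0 hf] := wp_far r0.
pose D : set C := fun z => ~ lattice tau z /\ disc 0 r z.
have oD : copen D by apply: copenI; [exact: copen_nlattice|exact: copen_disc].
suff : hol D (weierstrass_p tau).
  by move=> h; apply: h; split => //; rewrite /disc /= subr0 /r ltrDl.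
apply: (@hol_eq _ _ (fun z => (weierstrass_p tau z - ssum N0 (gterm z)) + ssum N0 (gterm z)) _ oD).
  by move=> x _; rewrite subrK.
apply: (holD oD); first by apply: hol_sub hf => ? [].
apply: (hol_ssum _ (F := fun m n z => gterm z m n) oD) => m n.
apply: (holB oD); last exact: hol_cst.
apply: hol_isq => // x [nx _]; apply: contra_not_neq nx => ->; by exists m, n.
Qed.

Lemma wp_pole : exists2 r : R, 0 < r & exists2 g, hol (disc 0 r) g &
  forall z : C, 0 < normc z < r -> weierstrass_p tau z = isq z + g z.
Proof.
have [c c0 H] := lat_lb.
have [N0 hf] := wp_far c0.
have oD : copen (disc (0 : C) c) by exact: copen_disc.
(* Nonzero lattice points have modulus at least [c], so the disc of radius [c] contains the pole at
   the origin only. *)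
exists c => //.
exists (fun z => (weierstrass_p tau z - ssum N0 (gterm z)) +
   ssum N0 (fun m n => if lat m n == 0 then 0 else gterm z m n)).
  apply: (holD oD hf).
  apply: (hol_ssum _ (F := fun m n z => if lat m n == 0 then 0 else gterm z m n) oD) => m n.
  case: eqP => [_|/eqP mn]; first exact: hol_cst.
  apply: (holB oD); last exact: hol_cst.
  apply: hol_isq => // x; rewrite /disc /= subr0 => xc.
  apply: contraTneq xc => ->; rewrite -leNgt (le_trans _ (H m n)) // ler_peMr ?(ltW c0) //.
  by rewrite ler1n; move: mn; rewrite lat_eq0; lia.
move=> z _; have := weierstrass_sum z N0.
have -> : ssum N0 (fun m n => if lat m n == 0 then 0 else gterm z m n) =
  \sum_(i < N0.*2.+1) \sum_(j < N0.*2.+1)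
      let w : C := (i%:Z - N0%:Z)%:~R + (j%:Z - N0%:Z)%:~R * tau in
      if w == 0 then 0 else ((z - w) ^+ 2)^-1 - (w ^+ 2)^-1 : C by [].
set S := \sum_(i < _) _; move=> <-.
by have E (a b d : C) : a = b + (a - (b + d) + d) by ring.
Qed.

End Weierstrass.

(** * Wirtinger calculus and the potential of a solution *)

Section RealCalc.
Context {R : realType}.
Local Notation C := (cplx R).

Lemma mvt_bound (g g' : R -> R) (a h l e : R) :
  (forall k, `|k| <= `|h| -> is_derive (a + k) 1 g (g' (a + k)) /\ `|g' (a + k) - l| <= e) ->
  `|g (a + h) - g a - h * l| <= e * `|h|.
Proof.
move=> H.
have key k : `|k| <= `|h| -> g (a + h) - g a = g' (a + k) * h ->
    `|g (a + h) - g a - h * l| <= e * `|h|.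
  by move=> kh ->; rewrite [h * _]mulrC -mulrBl normrM ler_wpM2r //; case: (H k kh).
have hz z : `|z - a| <= `|h| -> is_derive z 1 g (g' z).
  by move=> /H[]; rewrite addrC subrK.
have [h0|h0|->] := ltgtP h 0; last first.
- by rewrite addr0 mul0r !subrr normr0 mulr0.
- have s z : z \in `[a, a + h] -> `|z - a| <= `|h|.
    rewrite in_itv /= => /andP[z1 z2]; rewrite !ger0_norm ?(ltW h0) ?subr_ge0 //; lra.
  have d z : z \in `]a, (a + h)[ -> is_derive z 1 g (g' z).
    by move=> /subset_itv_oo_cc/s/hz.
  have c : {within `[a, a + h], continuous g}.
    by apply: continuous_in_subspaceT => z /set_mem /s /hz /is_derive_cont.
  have := @MVT _ g g' a (a + h) _ d c; rewrite ltrDl => /(_ h0)[x xx E].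
  have /s xI : x \in `[a, a + h] by exact: subset_itv_oo_cc.
  by apply: (key _ xI); rewrite E [a + (x - a)]addrC subrK; congr (_ * _); ring.
- have s z : z \in `[a + h, a] -> `|z - a| <= `|h|.
    rewrite in_itv /= => /andP[z1 z2]; rewrite !ler0_norm ?(ltW h0) ?subr_le0 //; lra.
  have d z : z \in `](a + h), a[ -> is_derive z 1 g (g' z).
    by move=> /subset_itv_oo_cc/s/hz.
  have c : {within `[a + h, a], continuous g}.
    by apply: continuous_in_subspaceT => z /set_mem /s /hz /is_derive_cont.
  have := @MVT _ g g' (a + h) a _ d c; rewrite gtrDl => /(_ h0)[x xx E].
  have /s xI : x \in `[a + h, a] by exact: subset_itv_oo_cc.
  apply: (key _ xI); rewrite [a + (x - a)]addrC subrK -opprB E -mulrN; congr (_ * _); ring.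
Qed.

(* The differential of [f] at [z] is [p dz + q dzbar]. *)
Definition wd (f : C -> C) (z p q : C) : Prop := fdiff f z (p + q) ('i * (p - q)).

Lemma wd_cder (f : C -> C) (z p : C) : wd f z p 0 <-> is_derive z (1 : C) f p.
Proof. by rewrite cderP /wd addr0 subr0. Qed.

Lemma conjcE (h : C) : conjc h = (complex.Re h)%:C - 'i * (complex.Im h)%:C.
Proof. by case: h => a b; apply: complex_ext; rewrite /= ?cReB ?cImB ?cReM ?cImM /=; ring. Qed.

Lemma wdE (p q h : C) : (p + q) * (complex.Re h)%:C + 'i * (p - q) * (complex.Im h)%:C = p * h + q * conjc h.
Proof.
rewrite conjcE {3}(complexRI h).
by move: (complex.Re h)%:C (complex.Im h)%:C => a b; ring.
Qed.

Lemma wdP (f : C -> C) (z p q : C) : wd f z p q <->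
  forall e : R, 0 < e -> exists2 d : R, 0 < d & forall h : C, normc h < d ->
    normc (f (z + h) - f z - (p * h + q * conjc h)) <= e * normc h.
Proof.
split=> H e e0; have [d d0 dh] := H e e0; exists d => // h hd; have := dh h hd; by rewrite wdE.
Qed.

Lemma normc_conj (h : C) : normc (conjc h) = normc h.
Proof. by case: h => a b /=; rewrite sqrrN. Qed.

Lemma wd_rder (f : C -> C) (g : R -> C) (t : R) (p q d : C) :
  wd f (g t) p q -> rder g t d -> rder (f \o g) t (p * d + q * conjc d).
Proof. by move=> Hf Hg; have := fdiff_rder Hf Hg; rewrite wdE. Qed.

Lemma wd_cont (f : C -> C) (z p q : C) : wd f z p q -> {for z, continuous f}.
Proof. exact: fdiff_cont. Qed.

Lemma wd_eq (f g : C -> C) (z p q : C) (r : R) : 0 < r ->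
  (forall w, normc (w - z) < r -> f w = g w) -> wd f z p q -> wd g z p q.
Proof.
move=> r0 fg /wdP H; apply/wdP => e e0; have [d d0 dH] := H e e0.
exists (Num.min d r); first by rewrite lt_min d0.
move=> h; rewrite lt_min => /andP[/dH {}dH hr].
have <- : f (z + h) = g (z + h) by rewrite fg // addrC addKr.
by rewrite -(fg z) // subrr Normc.normc0.
Qed.

Lemma wdD (f g : C -> C) (z p q p' q' : C) : wd f z p q -> wd g z p' q' ->
  wd (fun z => f z + g z) z (p + p') (q + q').
Proof.
move=> /wdP Hf /wdP Hg; apply/wdP => e e0; have e2 : 0 < e / 2 by rewrite divr_gt0.
have [d d0 dh] := Hf _ e2; have [d' d'0 dh'] := Hg _ e2.
exists (Num.min d d'); first by rewrite lt_min d0.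
move=> h; rewrite lt_min => /andP[/dh {}dh /dh' {}dh'].
have -> : f (z + h) + g (z + h) - (f z + g z) - ((p + p') * h + (q + q') * conjc h) =
  (f (z + h) - f z - (p * h + q * conjc h)) + (g (z + h) - g z - (p' * h + q' * conjc h)) by ring.
by rewrite (le_trans (normcD _ _)) // (splitr e) mulrDl lerD.
Qed.

Lemma wd_cst (c z : C) : wd (fun=> c) z 0 0.
Proof.
apply/wdP => e e0; exists 1 => // h _.
by rewrite !mul0r addr0 !subrr Normc.normc0 mulr_ge0 ?normc_ge0 // ltW.
Qed.

Lemma wd_id (z : C) : wd (fun z => z) z 1 0.
Proof.
apply/wdP => e e0; exists 1 => // h _.
have -> : z + h - z - (1 * h + 0 * conjc h) = 0 by ring.
by rewrite Normc.normc0 mulr_ge0 ?normc_ge0 // ltW.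
Qed.

Lemma wdM (f g : C -> C) (z p q p' q' : C) : wd f z p q -> wd g z p' q' ->
  wd (fun z => f z * g z) z (f z * p' + g z * p) (f z * q' + g z * q).
Proof.
move=> Hf Hg; have cg := wd_cont Hg; move: Hf Hg => /wdP Hf /wdP Hg; apply/wdP => e e0.
pose K := normc (f z) + normc (g z) + 1 + (normc p + normc q).
have K0 : 0 < K.
  by rewrite /K; have := normc_ge0 (f z); have := normc_ge0 (g z);
    have := normc_ge0 p; have := normc_ge0 q; lra.
have e1 : 0 < Num.min 1 (e / K) by rewrite lt_min ltr01 divr_gt0.
have [d1 d10 h1] := Hf _ e1; have [d2 d20 h2] := Hg _ e1.
have /contCP /(_ _ e1)[d3 d30 h3] := cg.
exists (Num.min d1 (Num.min d2 d3)); first by rewrite !lt_min d10 d20.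
move=> h; rewrite !lt_min => /and3P[/h1 {}h1 /h2 {}h2 hd3].
have := h3 (z + h); rewrite addrAC subrr add0r => /(_ hd3) {}h3.
set L := p * h + q * conjc h in h1 *; set L' := p' * h + q' * conjc h in h2 *.
have -> : f (z + h) * g (z + h) - f z * g z -
   ((f z * p' + g z * p) * h + (f z * q' + g z * q) * conjc h) =
  (f (z + h) - f z - L) * g (z + h) + L * (g (z + h) - g z) + f z * (g (z + h) - g z - L').
  by rewrite /L /L'; ring.
have nL : normc L <= (normc p + normc q) * normc h.
  by rewrite /L (le_trans (normcD _ _)) // !normcM normc_conj mulrDl.
have x0 := normc_ge0 h.
move: h1 h2 h3; set E := Num.min 1 (e / K) => h1 h2 h3.
have E1 : E <= 1 by rewrite /E ge_min lexx.
have EK : E * K <= e by rewrite -ler_pdivlMr // /E ge_min lexx orbT.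
have E0 : 0 < E by [].
have gz : normc (g (z + h)) <= normc (g z) + 1.
  have := normc_lb (g (z + h)) (g z); lra.
apply: (@le_trans _ _ (E * normc h * (normc (g z) + 1) + (normc p + normc q) * normc h * E + normc (f z) * (E * normc h))).
  rewrite (le_trans (normcD _ _)) // lerD //; last by rewrite normcM ler_wpM2l ?normc_ge0.
  rewrite (le_trans (normcD _ _)) // !normcM lerD //.
    by apply: ler_pM; rewrite ?normc_ge0.
  by apply: ler_pM; rewrite ?normc_ge0 // ltW.
rewrite [leLHS](_ : _ = E * K * normc h); last by rewrite /K; ring.
by rewrite ler_wpM2r.
Qed.

Lemma wdZ (f : C -> C) (c z p q : C) : wd f z p q -> wd (fun z => c * f z) z (c * p) (c * q).
Proof. by move=> /(wdM (wd_cst c z)); rewrite !mulr0 !addr0. Qed.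

Lemma wdN (f : C -> C) (z p q : C) : wd f z p q -> wd (fun z => - f z) z (- p) (- q).
Proof.
move=> /(wdZ (-1)); rewrite !mulN1r; apply: (wd_eq (r := 1)) => // w _; by rewrite mulN1r.
Qed.

Lemma wdB (f g : C -> C) (z p q p' q' : C) : wd f z p q -> wd g z p' q' ->
  wd (fun z => f z - g z) z (p - p') (q - q').
Proof. by move=> Hf Hg; exact: (wdD Hf (wdN Hg)). Qed.

Lemma wd_conj (f : C -> C) (z p q : C) : wd f z p q -> wd (fun z => (conjc (f z))) z (conjc q) (conjc p).
Proof.
move=> /wdP H; apply/wdP => e /H[d d0 dh]; exists d => // h /dh.
rewrite -normc_conj; have -> : conjc (f (z + h) - f z - (p * h + q * conjc h)) =
   (conjc (f (z + h))) - (conjc (f z)) - (conjc q * h + conjc p * conjc h); last by [].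
by rewrite !(rmorphB, rmorphD, rmorphM) /= conjcK [_ + conjc q * h]addrC.
Qed.

Lemma wd_real (f : C -> R) (g : R -> R) (z p q : C) (l : R) : is_derive (f z) 1 g l ->
  wd (fun z => (f z)%:C) z p q -> wd (fun z => (g (f z))%:C) z (l%:C * p) (l%:C * q).
Proof.
move=> /is_deriveRP Hg Hf; have cf := wd_cont Hf; move/wdP : Hf => Hf; apply/wdP => e e0.
pose K := normc p + normc q + 1 + `|l|.
have K0 : 0 < K.
  by rewrite /K; have := normc_ge0 p; have := normc_ge0 q; have := normr_ge0 l; lra.
have e1 : 0 < Num.min 1 (e / K) by rewrite lt_min ltr01 divr_gt0.
have [d1 d10 h1] := Hf _ e1; have [d2 d20 h2] := Hg _ e1.
have /contCP /(_ _ d20)[d3 d30 h3] := cf.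
exists (Num.min d1 d3); first by rewrite !lt_min d10.
move=> h; rewrite !lt_min => /andP[/h1 {}h1 hd3].
have := h3 (z + h); rewrite addrAC subrr add0r => /(_ hd3) {}h3.
set k := f (z + h) - f z.
have kE : (k%:C : C) = (f (z + h))%:C - (f z)%:C by rewrite /k rmorphB.
rewrite -kE in h1; rewrite -rmorphB normc_real -/k in h3.
have {}h2 := h2 k h3.
have fk : f z + k = f (z + h) by rewrite /k addrC subrK.
rewrite fk in h2.
set L := p * h + q * conjc h in h1.
have -> : (g (f (z + h)))%:C - (g (f z))%:C - (l%:C * p * h + l%:C * q * conjc h) =
  (g (f (z + h)) - g (f z) - l * k)%:C + l%:C * (k%:C - L).
  by rewrite !(rmorphB, rmorphM) /= /L; ring.
rewrite (le_trans (normcD _ _)) // normcM !normc_real.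
move: h1 h2 h3; set E := Num.min 1 (e / K) => h1 h2 h3.
have E1 : E <= 1 by rewrite /E ge_min lexx.
have EK : E * K <= e by rewrite -ler_pdivlMr // /E ge_min lexx orbT.
have E0 : 0 < E by [].
have x0 := normc_ge0 h.
have nL : normc L <= (normc p + normc q) * normc h.
  by rewrite /L (le_trans (normcD _ _)) // !normcM normc_conj mulrDl.
have nk : `|k| <= (normc p + normc q + 1) * normc h.
  rewrite -normc_real (_ : k%:C = (k%:C - L) + L); last by rewrite subrK.
  rewrite (le_trans (normcD _ _)) // mulrDl mul1r addrC lerD // (le_trans h1) //.
  by rewrite ler_piMl.
apply: (@le_trans _ _ (E * ((normc p + normc q + 1) * normc h) + `|l| * (E * normc h))).
  by apply: lerD; [rewrite (le_trans h2) // ler_wpM2l // ltW|rewrite ler_wpM2l].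
rewrite [leLHS](_ : _ = E * K * normc h); last by rewrite /K; ring.
by rewrite ler_wpM2r.
Qed.

Lemma Ck_cont k (D : set C) (f : C -> R) z : Ck k D f -> D z -> {for z, continuous f}.
Proof. by case: k => [|k] [h _] Dz; exact: h. Qed.

Lemma Ck_dx k (D : set C) (f : C -> R) x y : Ck k.+1 D f -> D (x +i* y) ->
  is_derive x 1 (fun x => f (x +i* y)) (dx f (x +i* y)).
Proof.
by move=> [_ [h _]] /h[d _]; apply: DeriveDef => //; rewrite /dx derive1E.
Qed.

Lemma Ck_dy k (D : set C) (f : C -> R) x y : Ck k.+1 D f -> D (x +i* y) ->
  is_derive y 1 (fun y => f (x +i* y)) (dy f (x +i* y)).
Proof.
by move=> [_ [h _]] /h[_ d]; apply: DeriveDef => //; rewrite /dy derive1E.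
Qed.

Lemma Ck_dxC k (D : set C) (f : C -> R) : Ck k.+1 D f -> Ck k D (dx f).
Proof. by move=> [_ [_ []]]. Qed.

Lemma Ck_dyC k (D : set C) (f : C -> R) : Ck k.+1 D f -> Ck k D (dy f).
Proof. by move=> [_ [_ []]]. Qed.

Lemma smooth_dx (D : set C) (f : C -> R) : smooth D f -> smooth D (dx f).
Proof. by move=> h k; have [_ [_ []]] := h k.+1. Qed.

Lemma smooth_dy (D : set C) (f : C -> R) : smooth D f -> smooth D (dy f).
Proof. by move=> h k; have [_ [_ []]] := h k.+1. Qed.

Lemma normc_lt_sum (x y d : R) : `|x| < d / 2 -> `|y| < d / 2 -> normc (x +i* y : C) < d.
Proof. by move=> h1 h2; rewrite (le_lt_trans (normc_le _)) //= (splitr d) ltrD. Qed.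

(** Continuous partial derivatives give a differential: the increment splits into a horizontal and a
    vertical one, each handled by the mean value theorem. *)
Lemma Ck_wd (D : set C) (f : C -> R) z : copen D -> Ck 1 D f -> D z ->
  wd (fun z => (f z)%:C) z (((dx f z)%:C - 'i * (dy f z)%:C) / 2)
     (((dx f z)%:C + 'i * (dy f z)%:C) / 2).
Proof.
move=> oD cf Dz; have cx := Ck_dxC cf; have cy := Ck_dyC cf.
move=> e e0; have e2 : 0 < e / 2 by rewrite divr_gt0.
have [d0 d00 dD] := oD _ Dz.
have /contCRP /(_ _ e2)[d1 d10 h1] := Ck_cont cx Dz.
have /contCRP /(_ _ e2)[d2 d20 h2] := Ck_cont cy Dz.
pose d := Num.min d0 (Num.min d1 d2); have dd : 0 < d by rewrite !lt_min d00 d10.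
exists (d / 2); first by rewrite divr_gt0.
move=> h hd.
have E1 : ((dx f z)%:C - 'i * (dy f z)%:C) / 2 + ((dx f z)%:C + 'i * (dy f z)%:C) / 2 = (dx f z)%:C :> C.
  by field.
have E2 : 'i * (((dx f z)%:C - 'i * (dy f z)%:C) / 2 - ((dx f z)%:C + 'i * (dy f z)%:C) / 2) = (dy f z)%:C :> C.
  have -> : 'i * (((dx f z)%:C - 'i * (dy f z)%:C) / 2 - ((dx f z)%:C + 'i * (dy f z)%:C) / 2) = - ('i ^+ 2) * (dy f z)%:C :> C by field.
  by rewrite sqr_i opprK mul1r.
rewrite E1 E2 -!rmorphM -!rmorphD -!rmorphB normc_real.
case: z Dz cf cx cy dD h1 h2 E1 E2 => x y Dz cf cx cy dD h1 h2 _ _.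
case: h hd => a b hd.
have ra := le_lt_trans (normc_Re _) hd; have rb := le_lt_trans (normc_Im _) hd.
rewrite /= in ra rb *.
have near a' b' : `|a'| <= `|a| -> `|b'| <= `|b| ->
    normc ((x + a') +i* (y + b') - (x +i* y : C)) < d.
  move=> ha hb; rewrite (_ : _ - _ = a' +i* b'); last first.
    by apply: complex_ext; rewrite ?cReB ?cImB /=; ring.
  by apply: normc_lt_sum; [exact: le_lt_trans ha ra|exact: le_lt_trans hb rb].
have H1 := @mvt_bound (fun x => f (x +i* (y + b))) (fun x => dx f (x +i* (y + b))) x a
  (dx f (x +i* y)) (e / 2).
have H2 := @mvt_bound (fun y => f (x +i* y)) (fun y => dy f (x +i* y)) y b
  (dy f (x +i* y)) (e / 2).
have -> : f ((x + a) +i* (y + b)) - f (x +i* y) - (dx f (x +i* y) * a + dy f (x +i* y) * b) =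
  (f ((x + a) +i* (y + b)) - f (x +i* (y + b)) - a * dx f (x +i* y)) +
  (f (x +i* (y + b)) - f (x +i* y) - b * dy f (x +i* y)) by ring.
apply: le_trans (ler_normD _ _) _.
rewrite (splitr e) mulrDl; apply: lerD.
  apply: le_trans (H1 _) _ => [k ka|]; last by rewrite ler_wpM2l ?(ltW e2) //; exact: (normc_Re (a +i* b)).
  have := near k b ka (lexx _); rewrite !lt_min => /and3P[n0 n1 n2].
  split; last by rewrite ltW //; exact: h1.
  by apply: (Ck_dx cf); exact: dD.
apply: le_trans (H2 _) _ => [k kb|]; last by rewrite ler_wpM2l ?(ltW e2) //; exact: (normc_Im (a +i* b)).
have := near 0 k; rewrite normr0 normr_ge0 addr0 => /(_ isT kb).
rewrite !lt_min => /and3P[n0 n1 n2].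
split; last by rewrite ltW //; exact: h2.
by apply: (Ck_dy cf); exact: dD.
Qed.

(** The second difference [Dl] over a square of side [a] is close to [a ^ 2] times either mixed
    derivative, depending on the order in which the mean value theorem is applied. *)
Lemma schwarz (D : set C) (f : C -> R) z : copen D -> Ck 2 D f -> D z ->
  dx (dy f) z = dy (dx f) z.
Proof.
move=> oD cf Dz; have cx := Ck_dxC cf; have cy := Ck_dyC cf.
have cxy := Ck_dyC cx; have cyx := Ck_dxC cy.
apply/eqP; rewrite -subr_eq0 -normr_eq0 eq_le normr_ge0 andbT.
apply/ler_addgt0Pl => e e0; rewrite addr0.
have e2 : 0 < e / 2 by rewrite divr_gt0.
have [d0 d00 dD] := oD _ Dz.
have /contCRP /(_ _ e2)[d1 d10 h1] := Ck_cont cxy Dz.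
have /contCRP /(_ _ e2)[d2 d20 h2] := Ck_cont cyx Dz.
pose d := Num.min d0 (Num.min d1 d2); have dd : 0 < d by rewrite !lt_min d00 d10.
case: z Dz dD h1 h2 => x y Dz dD h1 h2.
pose a := d / 4; have a0 : 0 < a by rewrite divr_gt0.
have near a' b' : `|a'| <= `|a| -> `|b'| <= `|a| ->
    normc ((x + a') +i* (y + b') - (x +i* y : C)) < d.
  move=> ha hb; rewrite (_ : _ - _ = a' +i* b'); last first.
    by apply: complex_ext; rewrite ?cReB ?cImB /=; ring.
  rewrite (gtr0_norm a0) in ha hb.
  by apply: normc_lt_sum; [apply: le_lt_trans ha _|apply: le_lt_trans hb _]; rewrite /a; lra.
have inD a' b' : `|a'| <= `|a| -> `|b'| <= `|a| -> D ((x + a') +i* (y + b')).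
  by move=> ha hb; apply: dD; have := near _ _ ha hb; rewrite !lt_min => /and3P[].
have a00 : `|0 : R| <= `|a| by rewrite normr0.
pose Dl := f ((x + a) +i* (y + a)) - f ((x + a) +i* y) - f (x +i* (y + a)) + f (x +i* y).
have F1 : `|Dl - a * (a * dy (dx f) (x +i* y))| <= e / 2 * a * a.
  have := @mvt_bound (fun x => f (x +i* (y + a)) - f (x +i* y))
    (fun x => dx f (x +i* (y + a)) - dx f (x +i* y)) x a (a * dy (dx f) (x +i* y)) (e / 2 * a).
  rewrite (gtr0_norm a0) => H.
  rewrite (_ : Dl = f ((x + a) +i* (y + a)) - f ((x + a) +i* y) - (f (x +i* (y + a)) - f (x +i* y))); last by rewrite /Dl; ring.
  apply: H => k ka; rewrite -(gtr0_norm a0) in ka; split.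
    apply: is_deriveB; apply: (Ck_dx cf); first exact: inD.
    by have := inD k 0 ka a00; rewrite addr0.
  have := @mvt_bound (fun y => dx f ((x + k) +i* y)) (fun y => dy (dx f) ((x + k) +i* y)) y a
    (dy (dx f) (x +i* y)) (e / 2).
  rewrite (gtr0_norm a0); apply => k' ka'; rewrite -(gtr0_norm a0) in ka'; split.
    by apply: (Ck_dy cx); exact: inD.
  rewrite ltW //; apply: h1; have := near _ _ ka ka'; by rewrite !lt_min => /and3P[].
have F2 : `|Dl - a * (a * dx (dy f) (x +i* y))| <= e / 2 * a * a.
  have := @mvt_bound (fun y => f ((x + a) +i* y) - f (x +i* y))
    (fun y => dy f ((x + a) +i* y) - dy f (x +i* y)) y a (a * dx (dy f) (x +i* y)) (e / 2 * a).
  rewrite (gtr0_norm a0) => H.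
  rewrite (_ : Dl = f ((x + a) +i* (y + a)) - f (x +i* (y + a)) - (f ((x + a) +i* y) - f (x +i* y))); last by rewrite /Dl; ring.
  apply: H => k ka; rewrite -(gtr0_norm a0) in ka; split.
    apply: is_deriveB; apply: (Ck_dy cf); first exact: inD.
    by have := inD 0 k a00 ka; rewrite addr0.
  have := @mvt_bound (fun x => dy f (x +i* (y + k))) (fun x => dx (dy f) (x +i* (y + k))) x a
    (dx (dy f) (x +i* y)) (e / 2).
  rewrite (gtr0_norm a0); apply => k' ka'; rewrite -(gtr0_norm a0) in ka'; split.
    by apply: (Ck_dx cy); exact: inD.
  rewrite ltW //; apply: h2; have := near _ _ ka' ka; by rewrite !lt_min => /and3P[].
have : `|a * (a * dx (dy f) (x +i* y)) - a * (a * dy (dx f) (x +i* y))| <= e * a * a.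
  rewrite (_ : _ - _ = (Dl - a * (a * dy (dx f) (x +i* y))) - (Dl - a * (a * dx (dy f) (x +i* y)))); last by ring.
  rewrite (le_trans (ler_normB _ _)) // (le_trans (lerD F1 F2)) //.
  by rewrite le_eqVlt; apply/orP; left; apply/eqP; field.
rewrite -!mulrBr mulrA normrM (gtr0_norm (mulr_gt0 a0 a0)).
by rewrite -[e * a * a]mulrA [e * _]mulrC ler_pM2l // mulr_gt0.
Qed.

End RealCalc.

(** * Half periods, and holomorphy and symmetries of the potential *)

Section Structure.
Context {R : realType}.
Local Notation C := (cplx R).

Lemma rder_uniq (g : R -> C) t d d' : rder g t d -> rder g t d' -> d = d'.
Proof.
move=> /rderP[[_ a] [_ b]] /rderP[[_ a'] [_ b']].
by apply: complex_ext; [rewrite -a a'|rewrite -b b'].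
Qed.

Lemma rder_line (z v : C) : rder (fun t : R => z + t%:C * v) 0 v.
Proof.
move=> e e0; exists 1 => // h _.
have -> : z + (0 + h)%:C * v - (z + 0%:C * v) - v * h%:C = 0.
  by rewrite add0r mul0r; ring.
by rewrite Normc.normc0 mulr_ge0 // ltW.
Qed.

(** Derivatives in the real and the imaginary direction determine [p + q] and [p - q]. Uniqueness is
    what transports identities and symmetries of [u] to its derivatives. *)
Lemma wd_uniq (f : C -> C) z p q p' q' : wd f z p q -> wd f z p' q' -> p = p' /\ q = q'.
Proof.
have key v p0 q0 : wd f z p0 q0 -> rder (fun t : R => f (z + t%:C * v)) 0 (p0 * v + q0 * conjc v).
  move=> h; have := @wd_rder _ f (fun t : R => z + t%:C * v) 0 p0 q0 v.
  by rewrite mul0r addr0 => H; apply: H => //; exact: rder_line.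
move=> h h'.
have := rder_uniq (key 1 _ _ h) (key 1 _ _ h'); rewrite conjc1 !mulr1 => e1.
have := rder_uniq (key 'i%C _ _ h) (key 'i%C _ _ h').
have -> : conjc 'i%C = - 'i%C :> C by apply: complex_ext; rewrite /= ?oppr0.
have i0 : 'i%C != 0 :> C by rewrite eq_complex /= oner_eq0 andbF.
have E (a b : C) : a * 'i%C + b * (- 'i%C) = (a - b) * 'i%C by ring.
rewrite !E => /(mulIf i0) e2.
have two : 2 != 0 :> C by [].
split; apply: (mulIf two).
  have -> : p * 2 = (p + q) + (p - q) by ring.
  by rewrite e1 e2; ring.
have -> : q * 2 = (p + q) - (p - q) by ring.
by rewrite e1 e2; ring.
Qed.

Lemma wd_shift (f : C -> C) z w p q : wd f (z + w) p q -> wd (fun z => f (z + w)) z p q.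
Proof.
move=> /wdP H; apply/wdP => e /H[d d0 dh]; exists d => // h /dh.
by have -> : z + h + w = z + w + h by ring.
Qed.

Lemma wd_neg (f : C -> C) z p q : wd f (- z) p q -> wd (fun z => f (- z)) z (- p) (- q).
Proof.
move=> /wdP H; apply/wdP => e /H[d d0 dh]; exists d => // h hd.
have := dh (- h); rewrite normcN => /(_ hd).
have -> : conjc (- h) = - conjc h by rewrite rmorphN.
by rewrite !mulrN -opprD !mulNr -opprD.
Qed.

Variables (tau : C) (tau_upper : 0 < complex.Im tau).

(** The parities of the two coordinates of [2 z] select the index [k]. In this form invariance of
    the half periods under translation and negation is immediate. *)
Lemma half_periodsP z : half_periods tau z <-> lattice tau (2 * z).
Proof.
have two : 2 != 0 :> C by [].
split.
  move=> [k [m [n E]]].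
  have -> : 2 * z = omega tau k + 2 * lat tau m n.
    have -> : z = lat tau m n + omega tau k / 2 by rewrite -[lat _ _ _]E subrK.
    by field.
  apply: latticeD; last by exists (m * 2), (n * 2); rewrite /lat !rmorphM /=; ring.
  rewrite /omega; case: k {E} => -[|[|[|k]]] /= _.
  - exact: lattice0.
  - by exists 1, 0; rewrite mul0r addr0.
  - by exists 0, 1; rewrite mul1r add0r.
  - by exists 1, 1; rewrite mul1r.
move=> [m [n E]].
pose a := (m %/ 2)%Z; pose b := (n %/ 2)%Z.
have ma := divz_eq m 2; have nb := divz_eq n 2; rewrite -/a -/b in ma nb.
have par (x : int) : (x %% 2)%Z = 0 \/ (x %% 2)%Z = 1.
  have := modz_ge0 x (isT : 2 != 0 :> int); have := ltz_mod x (isT : 2 != 0 :> int); lia.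
have zE (k : 'I_4) : m%:~R + n%:~R * tau = 2 * lat tau a b + omega tau k ->
    half_periods tau z.
  move=> h; exists k, a, b; rewrite -[RHS]/(lat tau a b).
  apply: (mulfI two); rewrite mulrBr E h; by field.
have k4 (j : nat) : (j < 4)%N -> val (inord j : 'I_4) = j by move=> ?; exact: inordK.
case: (par m) => pm; case: (par n) => pn; rewrite pm in ma; rewrite pn in nb.
- by apply: (zE (inord 0)); rewrite /omega k4 // ma nb /lat !addr0 !rmorphM /=; ring.
- by apply: (zE (inord 2)); rewrite /omega k4 // ma nb /lat !addr0 !rmorphD !rmorphM /=; ring.
- by apply: (zE (inord 1)); rewrite /omega k4 // ma nb /lat !addr0 !rmorphD !rmorphM /=; ring.
- by apply: (zE (inord 3)); rewrite /omega k4 // ma nb /lat !rmorphD !rmorphM /=; ring.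
Qed.

Definition reg : set C := ~` half_periods tau.

Lemma regP z : reg z <-> ~ lattice tau (2 * z).
Proof. by rewrite /reg /= half_periodsP. Qed.

Lemma copen_reg : copen reg.
Proof.
move=> z /regP nz; have [d d0 dD] := copen_nlattice tau_upper nz.
exists (d / 2); first by rewrite divr_gt0.
move=> w wz; apply/regP; apply: dD.
rewrite -mulrBr normcM -[2 : C]/(2%:R : C) normc_natr; lra.
Qed.

Lemma reg_shift z w : lattice tau w -> reg (z + w) <-> reg z.
Proof.
move=> lw; rewrite !regP; split => h h2; apply: h.
  have -> : 2 * (z + w) = 2 * z + (w + w) by ring.
  exact: latticeD h2 (latticeD lw lw).
have -> : 2 * z = 2 * (z + w) + - (w + w) by ring.
by apply: latticeD => //; apply: latticeN; exact: latticeD.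
Qed.

Lemma regN z : reg (- z) <-> reg z.
Proof.
have E (x : C) : 2 * - x = - (2 * x) by ring.
rewrite !regP E; split => h h2; apply: h; first exact: latticeN.
by rewrite -[2 * z]opprK; exact: latticeN.
Qed.

Lemma lattice1 : lattice tau 1.
Proof. by exists 1, 0; rewrite mul0r addr0. Qed.

Lemma lattice_tau : lattice tau tau.
Proof. by exists 0, 1; rewrite mul1r add0r. Qed.

Variables (u : C -> R).
Hypothesis (u_smooth : smooth reg u).
Hypothesis (pde : forall z, reg z -> laplacian u z = - expR (u z)).

Local Notation ii := ('i%R : R[i]).

Lemma ii2 : ii * ii = -1.
Proof. by rewrite -expr2 sqrCi. Qed.

Lemma conj_ii : conjc ii = - ii.
Proof. by rewrite -complexiE; apply: complex_ext; rewrite /= ?oppr0. Qed.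

Lemma conj_half (a b : R) : conjc ((a%:C - ii * b%:C) / 2) = (a%:C + ii * b%:C) / 2 :> C.
Proof.
have -> : (2^-1 : R[i]) = (2^-1 : R)%:C by rewrite fmorphV rmorph_nat.
by rewrite -complexiE; apply: complex_ext => /=; ring.
Qed.

Lemma wd_ext (f : C -> C) z p q p' q' : wd f z p q -> p = p' -> q = q' -> wd f z p' q'.
Proof. by move=> h <- <-. Qed.

Lemma ii_neq0 : ii != 0.
Proof. by rewrite -complexiE eq_complex /= oner_eq0 andbF. Qed.

(* The Wirtinger derivatives [u_z] and [u_zz], the equation being used to eliminate [u_yy]. *)
Definition mu z : C := ((dx u z)%:C - ii * (dy u z)%:C) / 2.
Definition uzz z : C := (dx (dx u) z)%:C / 2 + (expR (u z))%:C / 4 - ii / 2 * (dy (dx u) z)%:C.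
Definition pot z : C := - (1 / 2) * (uzz z - 1 / 2 * (mu z) ^+ 2).

#[local] Opaque dx dy expR.

Lemma conj_mu z : conjc (mu z) = ((dx u z)%:C + ii * (dy u z)%:C) / 2.
Proof. exact: conj_half. Qed.

Lemma der_smooth f z : smooth reg f -> reg z ->
  wd (fun z => (f z)%:C) z (((dx f z)%:C - ii * (dy f z)%:C) / 2)
     (((dx f z)%:C + ii * (dy f z)%:C) / 2).
Proof. by move=> sf Dz; exact: (Ck_wd copen_reg (sf 1%N) Dz). Qed.

Lemma u_wd z : reg z -> wd (fun z => (u z)%:C) z (mu z) (conjc (mu z)).
Proof. by move=> Dz; rewrite conj_mu; exact: der_smooth. Qed.

Lemma uyy z : reg z -> dy (dy u) z = - expR (u z) - dx (dx u) z.
Proof. by move=> /pde; rewrite /laplacian => h; lra. Qed.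

Lemma uxy z : reg z -> dx (dy u) z = dy (dx u) z.
Proof. exact: (schwarz copen_reg (u_smooth 2)). Qed.

Lemma E_wd z : reg z -> wd (fun z => (expR (u z))%:C) z ((expR (u z))%:C * mu z) ((expR (u z))%:C * conjc (mu z)).
Proof. by move=> Dz; exact: (wd_real (is_derive_expR (u z)) (u_wd Dz)). Qed.

Lemma alg_mu (P S S' Y E : R[i]) : S' = S -> Y = - E - P ->
  2^-1 * ((P - ii * S) / 2 - ii * ((S' - ii * Y) / 2)) = P / 2 + E / 4 - ii / 2 * S /\
  2^-1 * ((P + ii * S) / 2 - ii * ((S' + ii * Y) / 2)) = - E / 4.
Proof.
move=> -> ->; split.
  have -> : 2^-1 * ((P - ii * S) / 2 - ii * ((S - ii * (- E - P)) / 2)) =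
    P / 4 - ii * S / 2 + (ii * ii) * (- E - P) / 4 by field.
  by rewrite ii2; field.
have -> : 2^-1 * ((P + ii * S) / 2 - ii * ((S + ii * (- E - P)) / 2)) =
    P / 4 - (ii * ii) * (- E - P) / 4 by field.
by rewrite ii2; field.
Qed.

(** The equation in the form [u_{z zbar} = - e^u / 4], together with the symmetry of the mixed
    derivatives. *)
Lemma mu_wd z : reg z -> wd mu z (uzz z) (- (expR (u z))%:C / 4).
Proof.
move=> Dz.
have h1 := der_smooth (smooth_dx u_smooth) Dz.
have h2 := der_smooth (smooth_dy u_smooth) Dz.
have e1 : ((dy (dy u) z)%:C : R[i]) = - (expR (u z))%:C - (dx (dx u) z)%:C.
  by rewrite uyy // rmorphB rmorphN.
have e2 : ((dx (dy u) z)%:C : R[i]) = (dy (dx u) z)%:C by rewrite uxy.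
have [a1 a2] := alg_mu e2 e1.
have h := wd_ext (wdZ (2^-1) (wdB h1 (wdZ ii h2))) a1 a2.
by refine (wd_eq (r := 1) ltr01 _ h) => w _; rewrite /mu mulrC.
Qed.

(** The derivative of a holomorphic function is its x-derivative; it is written using
    [d mu / dx = uzz - e^u / 4] and with no repeated derivative in [y]. *)
Definition pot' z : C :=
  - (1 / 2) * ((dx (dx (dx u)) z)%:C / 2 + (expR (u z))%:C * (dx u z)%:C / 4
      - ii / 2 * (dy (dx (dx u)) z)%:C - mu z * (uzz z - (expR (u z))%:C / 4)).

Lemma ext_dx f g z : smooth reg f -> smooth reg g -> (forall w, reg w -> f w = g w) -> reg z ->
  dx f z = dx g z /\ dy f z = dy g z.
Proof.
move=> sf sg fg Dz.
have h1 := der_smooth sf Dz; have h2 := der_smooth sg Dz.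
have [d d0 dD] := copen_reg Dz.
have h3 : wd (fun w => (g w)%:C) z (((dx f z)%:C - ii * (dy f z)%:C) / 2)
   (((dx f z)%:C + ii * (dy f z)%:C) / 2).
  by apply: (wd_eq d0 _ h1) => w /dD /fg ->.
have [e1 e2] := wd_uniq h3 h2.
have E (a b c e : R[i]) : (a - b) / 2 = (c - e) / 2 -> (a + b) / 2 = (c + e) / 2 -> a = c /\ b = e.
  move=> x y; split.
    have -> : a = (a - b) / 2 + (a + b) / 2 by field.
    by rewrite x y; field.
  have -> : b = (a + b) / 2 - (a - b) / 2 by field.
  by rewrite x y; field.
have [a b] := E _ _ _ _ e1 e2; split; first exact: complexI a.
by apply: complexI; exact: (mulfI ii_neq0 b).
Qed.

Lemma third1 z : reg z -> dx (dy (dx u)) z = dy (dx (dx u)) z.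
Proof. exact: (schwarz copen_reg (smooth_dx u_smooth 2)). Qed.

(** The x-derivative of the equation, with the order of differentiation exchanged. *)
Lemma third2 z : reg z -> dy (dy (dx u)) z = - expR (u z) * dx u z - dx (dx (dx u)) z.
Proof.
move=> Dz.
have [d d0 dD] := copen_reg Dz.
have sxy : smooth reg (dy (dx u)) by exact/smooth_dy/smooth_dx.
have syx : smooth reg (dx (dy u)) by exact/smooth_dx/smooth_dy.
have [_ <-] := ext_dx syx sxy (fun w Dw => uxy Dw) Dz.
have <- : dx (dy (dy u)) z = dy (dx (dy u)) z := schwarz copen_reg (smooth_dy u_smooth 2) Dz.
have h1 := der_smooth (smooth_dy (smooth_dy u_smooth)) Dz.
have h2 := wdB (wdN (E_wd Dz)) (der_smooth (smooth_dx (smooth_dx u_smooth)) Dz).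
have h3 : wd (fun w => (dy (dy u) w)%:C) z
   (- ((expR (u z))%:C * mu z) - ((dx (dx (dx u)) z)%:C - ii * (dy (dx (dx u)) z)%:C) / 2)
   (- ((expR (u z))%:C * conjc (mu z)) - ((dx (dx (dx u)) z)%:C + ii * (dy (dx (dx u)) z)%:C) / 2).
  by apply: (wd_eq d0 _ h2) => w /dD /uyy ->; rewrite rmorphB rmorphN.
have [e1 e2] := wd_uniq h1 h3.
apply: complexI; rewrite rmorphB rmorphM rmorphN /=.
have H (X Y E m m' A B : R[i]) : (X - Y) / 2 = - (E * m) - (A - B) / 2 ->
   (X + Y) / 2 = - (E * m') - (A + B) / 2 -> X = - E * (m + m') - A.
  move=> x y; have -> : X = (X - Y) / 2 + (X + Y) / 2 by field.
  by rewrite x y; field.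
have K (a b : R[i]) : (a - b) / 2 + (a + b) / 2 = a by field.
have M : mu z + conjc (mu z) = (dx u z)%:C by rewrite conj_mu; exact: K.
have := H _ _ _ _ _ _ _ e1 e2; by rewrite M.
Qed.

Lemma alg_pot (A B B' Z E X Y P S m m' : R[i]) :
  m = (X - ii * Y) / 2 -> m' = (X + ii * Y) / 2 -> B' = B -> Z = - E * X - A ->
  - (1 / 2) * (2^-1 * ((A - ii * B) / 2) + 4^-1 * (E * m) -
        ii / 2 * ((B' - ii * Z) / 2) -
        1 / 2 * (m * (P / 2 + E / 4 - ii / 2 * S) + m * (P / 2 + E / 4 - ii / 2 * S))) =
  - (1 / 2) * (A / 2 + E * X / 4 - ii / 2 * B - m * ((P / 2 + E / 4 - ii / 2 * S) - E / 4)) /\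
  - (1 / 2) * (2^-1 * ((A + ii * B) / 2) + 4^-1 * (E * m') -
        ii / 2 * ((B' + ii * Z) / 2) -
        1 / 2 * (m * (- E / 4) + m * (- E / 4))) = 0.
Proof.
move=> mE -> -> ->; split.
  set U := P / 2 + E / 4 - ii / 2 * S.
  have -> : - (1 / 2) * (2^-1 * ((A - ii * B) / 2) + 4^-1 * (E * m) -
        ii / 2 * ((B - ii * (- E * X - A)) / 2) - 1 / 2 * (m * U + m * U)) =
     - (1 / 2) * (A / 4 - ii * B / 2 + E * m / 4 + (ii * ii) * (- E * X - A) / 4 - m * U).
    by field.
  by rewrite ii2; field.
have -> : - (1 / 2) * (2^-1 * ((A + ii * B) / 2) + 4^-1 * (E * ((X + ii * Y) / 2)) -
        ii / 2 * ((B + ii * (- E * X - A)) / 2) - 1 / 2 * (m * (- E / 4) + m * (- E / 4))) =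
  - (1 / 2) * (A / 4 + E * (X + ii * Y) / 8 - (ii * ii) * (- E * X - A) / 4 + m * E / 4) by field.
by rewrite ii2 mE; field.
Qed.

(** The zbar-derivative is [- (1 / 2) (u_{zz zbar} - u_z u_{z zbar})]; with [u_{z zbar} = - e^u / 4]
    both terms are [- e^u u_z / 4] and cancel. *)
Lemma pot_der z : reg z -> is_derive z (1 : C) pot (pot' z).
Proof.
move=> Dz; apply/wd_cder.
have h1 := der_smooth (smooth_dx (smooth_dx u_smooth)) Dz.
have h2 := der_smooth (smooth_dy (smooth_dx u_smooth)) Dz.
have h3 := mu_wd Dz.
have e1 : ((dy (dy (dx u)) z)%:C : R[i]) = - (expR (u z))%:C * (dx u z)%:C - (dx (dx (dx u)) z)%:C.
  by rewrite third2 // rmorphB rmorphM rmorphN.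
have e2 : ((dx (dy (dx u)) z)%:C : R[i]) = (dy (dx (dx u)) z)%:C by rewrite third1.
have [a1 a2] := alg_pot (dx (dx u) z)%:C (dy (dx u) z)%:C (erefl (mu z)) (conj_mu z) e2 e1.
have h := wd_ext (wdZ (- (1 / 2)) (wdB (wdB (wdD (wdZ (2^-1) h1) (wdZ (4^-1) (E_wd Dz))) (wdZ (ii / 2) h2))
   (wdZ (1 / 2) (wdM h3 h3)))) a1 a2.
refine (wd_eq (r := 1) ltr01 _ h) => w _; rewrite /pot /uzz expr2.
have K (a b c d : R[i]) : - (1 / 2) * (2^-1 * a + 4^-1 * b - c - d) = - (1 / 2) * (a / 2 + b / 4 - c - d) by ring.
exact: K.
Qed.

Lemma smooth_cont f z : smooth reg f -> reg z -> {for z, continuous (fun z => (f z)%:C : C)}.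
Proof. by move=> sf Dz; exact: wd_cont (der_smooth sf Dz). Qed.

Lemma pot_hol : hol reg pot.
Proof.
apply (@holI _ _ _ pot' copen_reg) => z Dz; first exact: pot_der.
have cx := smooth_cont (smooth_dx (smooth_dx (smooth_dx u_smooth))) Dz.
have cy := smooth_cont (smooth_dy (smooth_dx (smooth_dx u_smooth))) Dz.
have cE := wd_cont (E_wd Dz).
have c1 := smooth_cont (smooth_dx u_smooth) Dz.
have cxx := smooth_cont (smooth_dx (smooth_dx u_smooth)) Dz.
have cxy := smooth_cont (smooth_dy (smooth_dx u_smooth)) Dz.
have cm := wd_cont (mu_wd Dz).
have cst (c : C) : {for z, continuous (fun _ : C => c)} by exact: cc_cst.
have cu : {for z, continuous uzz}.
  exact: (ccB (ccD (ccM cxx (cst _)) (ccM cE (cst _))) (ccM (cst _) cxy)).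
exact: (ccM (cst _) (ccB (ccB (ccD (ccM cx (cst _)) (ccM (ccM cE c1) (cst _))) (ccM (cst _) cy))
   (ccM cm (ccB cu (ccM cE (cst _)))))).
Qed.

Lemma mu_shift w z : lattice tau w -> (forall z, u (z + w) = u z) -> reg z ->
  mu (z + w) = mu z /\ uzz (z + w) = uzz z.
Proof.
move=> lw uw.
have mw x : reg x -> mu (x + w) = mu x.
  move=> Dx; have Dxw : reg (x + w) by apply/reg_shift.
  have h := wd_shift (u_wd Dxw).
  have h' : wd (fun z => (u z)%:C) x (mu (x + w)) (conjc (mu (x + w))).
    by apply: (wd_eq (r := 1) _ _ h) => // y _; rewrite uw.
  by have [] := wd_uniq h' (u_wd Dx).
move=> Dz; split; first exact: mw.
have [d d0 dD] := copen_reg Dz.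
have h := wd_shift (mu_wd ((reg_shift z lw).2 Dz)).
have h' : wd mu z (uzz (z + w)) (- (expR (u (z + w)))%:C / 4).
  by apply: (wd_eq d0 _ h) => y /dD /mw ->.
by have [] := wd_uniq h' (mu_wd Dz).
Qed.

Lemma pot_shift w z : lattice tau w -> (forall z, u (z + w) = u z) -> reg z ->
  pot (z + w) = pot z.
Proof. by move=> lw uw Dz; have [h1 h2] := mu_shift lw uw Dz; rewrite /pot h1 h2. Qed.

Lemma pot_even z : (forall z, u (- z) = u z) -> reg z -> pot (- z) = pot z.
Proof.
move=> ue.
have mw x : reg x -> mu (- x) = - mu x.
  move=> Dx; have Dxw : reg (- x) by apply/regN.
  have h := wd_neg (u_wd Dxw).
  have h' : wd (fun z => (u z)%:C) x (- mu (- x)) (- conjc (mu (- x))).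
    by apply: (wd_eq (r := 1) _ _ h) => // y _; rewrite ue.
  by have [<- _] := wd_uniq h' (u_wd Dx); rewrite opprK.
move=> Dz.
have [d d0 dD] := copen_reg Dz.
have h := wdN (wd_neg (mu_wd ((regN z).2 Dz))).
have h' : wd mu z (- - uzz (- z)) (- - (- (expR (u (- z)))%:C / 4)).
  by apply: (wd_eq d0 _ h) => y /dD /mw ->; rewrite opprK.
have [e _] := wd_uniq h' (mu_wd Dz).
by rewrite /pot mw // sqrrN -e opprK.
Qed.

End Structure.

(** * The double pole at a half period *)

Section Energy.
Context {R : realType}.
Local Notation C := (cplx R).
Local Notation ii := ('i%R : R[i]).

Lemma normc_ii : normc (ii : C) = 1.
Proof. by rewrite -complexiE /= expr0n expr1n add0r sqrtr1. Qed.

Lemma normc_inv2 : normc (2^-1 : C) = 2^-1.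
Proof.
have -> : (2^-1 : C) = (2^-1 : R)%:C by rewrite fmorphV rmorph_nat.
by rewrite normc_real ger0_norm.
Qed.

Lemma cont_normc (f : R -> C) : continuous f -> continuous (fun x => normc (f x)).
Proof.
move=> cf x; apply/cvgrPdist_lt => e e0.
have /cvgCP H : f y @[y --> x] --> f x by exact: cf.
near=> y; have h : normc (f y - f x) < e by near: y; exact: H.
rewrite ltr_norml; have := normc_lb (f x) (f y); have := normc_lb (f y) (f x).
rewrite [normc (f x - f y)]normcBC; move: h; lra.
Unshelve. all: by end_near. Qed.

Lemma ci_le_int (f : R -> C) : continuous f ->
  normc (ci f) <= 2 * rint 0 (2 * pi) (fun x => normc (f x)).
Proof.
move=> cf; have cn := cont_normc cf.
rewrite (le_trans (normc_le _)) // [leRHS](_ : _ = rint 0 (2 * pi) (fun x => normc (f x)) + rint 0 (2 * pi) (fun x => normc (f x))); last by ring.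
apply: lerD.
  rewrite (le_trans (int_norm _ _ (contRe cf))) //; apply: int_le => //; first exact/cont_norm/contRe.
  by move=> x _; exact: normc_Re.
rewrite (le_trans (int_norm _ _ (contIm cf))) //; apply: int_le => //; first exact/cont_norm/contIm.
by move=> x _; exact: normc_Im.
Qed.

(** If [m2 >= e] on a whole half-line towards [- oo], then [m1] tends to [- oo] there and [m] grows
    without bound. *)
Lemma bounded_convex (m m1 m2 : R -> R) (T B : R) :
  (forall t, t < T -> is_derive t 1 m (m1 t) /\ is_derive t 1 m1 (m2 t)) ->
  (forall t, t < T -> `|m t| <= B) ->
  forall e, 0 < e -> forall T1, exists t, [/\ t < T, t < T1 & m2 t < e].
Proof.
move=> dm mB e e0 T1.
apply: contrapT => no.
pose s := Num.min T T1 - 1.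
have sT : s < T by have : Num.min T T1 <= T by [rewrite ge_min lexx]; rewrite /s; lra.
have sT1 : s < T1 by have : Num.min T T1 <= T1 by [rewrite ge_min lexx orbT]; rewrite /s; lra.
have m2e t : t <= s -> e <= m2 t.
  move=> ts; rewrite leNgt; apply/negP => h; apply: no; exists t.
  by split => //; apply: le_lt_trans ts _.
have mvt (f f' : R -> R) a b : a < b -> b <= s -> (forall t, t < T -> is_derive t 1 f (f' t)) ->
    exists2 c, a < c < b & f b - f a = f' c * (b - a).
  move=> ab bs df.
  have d z : z \in `]a, b[ -> is_derive z 1 f (f' z).
    by rewrite in_itv /= => /andP[_ zb]; apply: df; lra.
  have c : {within `[a, b], continuous f}.
    apply: continuous_in_subspaceT => z; rewrite inE /= in_itv /= => /andP[_ zb].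
    by apply: (is_derive_cont (df z _)); lra.
  by have [c' cI E] := MVT ab d c; exists c' => //; move: cI; rewrite in_itv.
have dm1 t : t < T -> is_derive t 1 m (m1 t) by move=> /dm[].
have dm2 t : t < T -> is_derive t 1 m1 (m2 t) by move=> /dm[].
(* Below [s1] the slope is at most -1; a further length [2 B + 1] then changes [m] by more than
   [2 B]. *)
pose s1 := s - (`|m1 s| + 1) / e - 1.
have q0 : 0 <= (`|m1 s| + 1) / e by rewrite divr_ge0 ?addr_ge0 // ltW.
have s1s : s1 < s by rewrite /s1; lra.
have m1neg t : t <= s1 -> m1 t <= -1.
  move=> ts1; have ts : t < s by lra.
  have [c /andP[c1 c2] E] := mvt _ _ _ _ ts (lexx s) dm2.
  have e2 := m2e c (ltW c2).
  have : (`|m1 s| + 1) <= e * (s - t).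
    by rewrite -ler_pdivrMl // mulrC; rewrite /s1 in ts1; lra.
  have : e * (s - t) <= m2 c * (s - t) by rewrite ler_wpM2r //; lra.
  have := ler_norm (m1 s); lra.
pose t := s1 - (2 * B + 1) .
have B0 : 0 <= B by apply: le_trans (mB s sT).
have ts1 : t < s1 by rewrite /t; lra.
have [c /andP[c1 c2] E] := mvt _ _ _ _ ts1 (ltW s1s) dm1.
have h := m1neg c (ltW c2).
have : m s1 - m t <= - (s1 - t) by rewrite E; have : 0 < s1 - t by [lra]; nra.
have := mB s1 (lt_trans s1s sT); have := mB t (lt_trans ts1 (lt_trans s1s sT)).
rewrite !ler_norml /t; lra.
Qed.

Lemma rcM (T : topologicalType) (f g : T -> R) x : {for x, continuous f} ->
  {for x, continuous g} -> {for x, continuous (fun z => f z * g z)}.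
Proof. by move=> cf cg; exact: (cvgM cf cg). Qed.
Lemma rcD (T : topologicalType) (f g : T -> R) x : {for x, continuous f} ->
  {for x, continuous g} -> {for x, continuous (fun z => f z + g z)}.
Proof. by move=> cf cg; exact: (cvgD cf cg). Qed.
Lemma rcB (T : topologicalType) (f g : T -> R) x : {for x, continuous f} ->
  {for x, continuous g} -> {for x, continuous (fun z => f z - g z)}.
Proof. by move=> cf cg; exact: (cvgB cf cg). Qed.
Lemma rc_cst (T : topologicalType) (c : R) (x : T) : {for x, continuous (fun=> c)}.
Proof. exact: cvg_cst. Qed.

Lemma gM (f g : R -> R) : continuous f -> continuous g -> continuous (fun z => f z * g z).
Proof. by move=> cf cg x; apply: rcM; [exact: cf|exact: cg]. Qed.
Lemma gD (f g : R -> R) : continuous f -> continuous g -> continuous (fun z => f z + g z).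
Proof. by move=> cf cg x; apply: rcD; [exact: cf|exact: cg]. Qed.
Lemma g_cst (c : R) : continuous (fun _ : R => c).
Proof. by move=> x; exact: rc_cst. Qed.

Lemma rderM (f g : R -> C) (t : R) (d d' : C) : rder f t d -> rder g t d' ->
  rder (fun t => f t * g t) t (d * g t + f t * d').
Proof.
move=> /rderP[f1 f2] /rderP[g1 g2]; apply/rderP; split.
  have -> : (fun t => complex.Re (f t * g t)) = (fun t => complex.Re (f t) * complex.Re (g t) - complex.Im (f t) * complex.Im (g t)).
    by apply/funext => x; rewrite cReM.
  by apply: is_derive_eq; rewrite !cReD !cReM /GRing.scale /=; ring.
have -> : (fun t => complex.Im (f t * g t)) = (fun t => complex.Re (f t) * complex.Im (g t) + complex.Im (f t) * complex.Re (g t)).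
  by apply/funext => x; rewrite cImM.
by apply: is_derive_eq; rewrite !cImD !cImM /GRing.scale /=; ring.
Qed.

(** The term [b'] has no bound of its own and is integrated by parts against [chi]; the linear term
    is bounded by [|b| <= d + |b| ^ 2 / d], where [d] is free. What remains are multiples of [d], of
    [kap], and of the energy of [b] with a coefficient depending on [d]. *)
Lemma circle_est (n : nat) (f b b' chi chi' k : R -> C) (kap d : R) :
  (forall th, rder b th (b' th)) -> continuous b' ->
  (forall th, rder chi th (chi' th)) -> continuous chi' -> continuous k ->
  b (2 * pi) = b 0 -> chi (2 * pi) = chi 0 ->
  (forall th, f th = n%:R * (n%:R + 1) + ii / 2 * b' th + (n%:R + 1 / 2) * b th + 1 / 4 * (b th * b th) + k th) ->
  (forall th, normc (k th) <= kap) ->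
  (forall th, normc (chi th) <= 2) -> (forall th, normc (chi' th) <= 4) -> 0 < d ->
  normc (ci (fun th => f th * chi th) - n%:R * (n%:R + 1) * ci chi) <=
  2 * ((2 * n%:R + 3) * (d * (2 * pi) + rint 0 (2 * pi) (fun th => normc (b th) ^+ 2) / d)
     + rint 0 (2 * pi) (fun th => normc (b th) ^+ 2) + 2 * kap * (2 * pi)).
Proof.
move=> db cb' dchi cchi' ck bper cper fE Bk B1 B2 d0.
have cchi : continuous chi by move=> th; exact: (rder_cont (dchi th)).
have cb : continuous b by move=> th; exact: (rder_cont (db th)).
have z (c : C) (F : R -> C) : continuous F -> continuous (fun th => c * F th).
  by move=> cf; exact (@gcM _ _ (fun=> c) F (@gc_cst _ _ c) cf).
pose g th : C := (n%:R + 1 / 2) * b th + 1 / 4 * (b th * b th) + k th.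
have cbb : continuous (fun th => b th * b th) by exact: (gcM cb cb).
have cg : continuous g.
  by apply: (gcD (f := fun th => (n%:R + 1 / 2) * b th + 1 / 4 * (b th * b th))); [exact: (gcD (z _ _ cb) (z _ _ cbb))|exact: ck].
have c1 := @gcM _ _ _ _ cb' cchi; have c2 := @gcM _ _ _ _ cg cchi; have c3 := @gcM _ _ _ _ cb cchi'.
have ibp : ci (fun th => b' th * chi th) = - ci (fun th => b th * chi' th).
  apply/eqP; rewrite -addr_eq0 -(ciD c1 c3); apply/eqP.
  rewrite (@ci_FTC _ (fun th => b th * chi th) (fun x => b' x * chi x + b x * chi' x)).
  - by rewrite bper cper subrr.
  - exact: gcD c1 c3.
  - by move=> th; exact: rderM (db th) (dchi th).
have cG : continuous (fun th => - (ii / 2) * (b th * chi' th) + g th * chi th : C) by exact: (gcD (z _ _ c3) c2).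
have -> : ci (fun th => f th * chi th) - n%:R * (n%:R + 1) * ci chi =
   ci (fun th => - (ii / 2) * (b th * chi' th) + g th * chi th).
  rewrite (ciD (z _ _ c3) c2) (ciZ _ c3) mulNr -mulrN -ibp -(ciZ (ii / 2) c1) -(ciD (z _ _ c1) c2).
  apply/eqP; rewrite subr_eq; apply/eqP; rewrite -(ciZ _ cchi) -(ciD (gcD (z _ _ c1) c2) (z _ _ cchi)).
  by apply: eq_ci => th _; rewrite fE /g; ring.
rewrite (le_trans (ci_le_int cG)) // ler_pM2l //.
have cn : continuous (fun th => normc (b th) ^+ 2).
  have cn1 := cont_normc cb.
  rewrite (_ : (fun th => _) = (fun th => normc (b th) * normc (b th))); last by apply/funext => x; rewrite expr2.
  exact: (gM cn1 cn1).
pose h th : R := ((2 * n%:R + 3) / d + 1) * normc (b th) ^+ 2 + ((2 * n%:R + 3) * d + 2 * kap).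
have ch : continuous h.
  by move=> x; apply: cvgD; [apply: cvgM; [exact: cvg_cst|exact: cn]|exact: cvg_cst].
apply: (@le_trans _ _ (rint 0 (2 * pi) h)).
  apply: int_le => //; first by move=> x; exact: (cont_normc cG).
  move=> th _.
  have hb : normc (b th) <= d + normc (b th) ^+ 2 / d.
    have q : 0 <= (normc (b th) - d) ^+ 2 by exact: sqr_ge0.
    have b0 := normc_ge0 (b th).
    rewrite -(ler_pM2r d0) mulrDl divfK ?gt_eqF //; move: q b0; move: (normc (b th)) => x; nra.
  have n1 : normc (- (ii / 2) * (b th * chi' th) : C) <= 2 * normc (b th).
    rewrite !normcM normcN normcM normc_ii normc_inv2 mul1r.
    have := B2 th; have := normc_ge0 (b th); have := normc_ge0 (chi' th).
    by move: (normc (b th)) (normc (chi' th)) => x y; nra.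
  have n2 : normc (g th) <= (n%:R + 1 / 2) * normc (b th) + 1 / 4 * normc (b th) ^+ 2 + kap.
    rewrite (le_trans (normcD _ _)) // lerD // (le_trans (normcD _ _)) //.
    rewrite [normc (_ * b th)]normcM [normc (1 / 4 * _)]normcM normcM expr2.
    have -> : (n%:R + 1 / 2 : C) = (n%:R + 1 / 2 : R)%:C by rewrite rmorphD rmorphM fmorphV !rmorph_nat.
    have -> : (1 / 4 : C) = (1 / 4 : R)%:C by rewrite rmorphM fmorphV !rmorph_nat.
    by rewrite !normc_real !ger0_norm // addr_ge0.
  rewrite (le_trans (normcD _ _)) // (le_trans (lerD n1 (lexx _))) //.
  have n3 : normc (g th * chi th) <= 2 * normc (g th).
    by rewrite normcM mulrC ler_wpM2r ?normc_ge0.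
  have x0 : 0 <= normc (b th) ^+ 2 by exact: sqr_ge0.
  have x1 : (2 * n%:R + 3) * normc (b th) <= (2 * n%:R + 3) * (d + normc (b th) ^+ 2 / d).
    by rewrite ler_wpM2l // addr_ge0 // mulr_ge0.
  have -> : h th = (2 * n%:R + 3) * (d + normc (b th) ^+ 2 / d) + normc (b th) ^+ 2 + 2 * kap.
    by rewrite /h; move: (normc (b th)) => x; field; rewrite gt_eqF.
  by lra.
have -> : h = (fun th => ((2 * n%:R + 3) / d + 1) * normc (b th) ^+ 2 + ((2 * n%:R + 3) * d + 2 * kap)) by [].
rewrite intD; [|by move=> x; apply: cvgM; [exact: cvg_cst|exact: cn]|by move=> x; exact: cvg_cst].
rewrite intZ // int_cst ?(ltW twopi_gt0) // subr0.
by set J := rint _ _ _; rewrite le_eqVlt; apply/orP; left; apply/eqP; field; rewrite gt_eqF.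
Qed.

Variables (u : C -> R) (mu uzz : C -> C) (p : C) (r0 M : R) (n : nat).
Hypothesis r0_gt0 : 0 < r0.
Hypothesis r0_le1 : r0 <= 1.
Local Notation D := (ann p 0 r0).
Hypothesis Hu : forall z, D z -> wd (fun z => (u z)%:C) z (mu z) (conjc (mu z)).
Hypothesis Hm : forall z, D z -> wd mu z (uzz z) (- (expR (u z))%:C / 4).
Hypothesis cuzz : forall z, D z -> {for z, continuous uzz}.
Hypothesis Hb : forall z, D z -> `|u z - 4 * n%:R * ln (normc (z - p))| <= M.

Let E z : C := (expR (u z))%:C.
(* In the coordinate [t + i th = log (z - p)] the function [wt = u - 4 n t] is bounded, and [bz] is its
   Wirtinger derivative. *)
Let bz z : C := (z - p) * mu z - 2 * n%:R.
(** [P] and [Q] are the Wirtinger derivatives of [bz]; [dth] and [dt] are its derivatives along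
    circles and along rays. *)
Let P z : C := (z - p) * uzz z + mu z.
Let Q z : C := (z - p) * (- E z / 4).
Let dth z : C := P z * (ii * (z - p)) + Q z * conjc (ii * (z - p)).
Let dt z : C := P z * (z - p) + Q z * conjc (z - p).
Let wt t th : R := u (pt p t th) - 4 * n%:R * t.

Lemma D_pt t th : t < ln r0 -> D (pt p t th).
Proof. by move=> tr; apply: ann_pt; rewrite expR_gt0 /= -[X in _ < X]lnK ?posrE // ltr_expR. Qed.

Lemma wd_bz z : D z -> wd bz z (P z) (Q z).
Proof.
move=> Dz; have h1 := wdB (wd_id z) (wd_cst p z).
have h := wdB (wdM h1 (Hm Dz)) (wd_cst (2 * n%:R) z).
by apply: (wd_ext h); rewrite /P /Q /E; ring.
Qed.

Lemma wt_dt t th : t < ln r0 -> is_derive t 1 (fun t => wt t th) (2 * complex.Re (bz (pt p t th))).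
Proof.
move=> tr; have Dz := D_pt th tr.
have h := @wd_rder _ (fun z => (u z)%:C) (fun t => pt p t th) t _ _ _ (Hu Dz) (pt_rder_t p t th).
have /rderP[h1 _] := h.
have h1' : is_derive t 1 (fun t => u (pt p t th))
   (complex.Re (mu (pt p t th) * (pt p t th - p) + conjc (mu (pt p t th)) * conjc (pt p t th - p))) := h1.
apply: is_derive_eq.
rewrite /GRing.scale /= /bz.
move: (mu _) (pt p t th - p) => a z.
have -> : (2 * n%:R : C) = (2 * n%:R)%:C by rewrite rmorphM !rmorph_nat.
by case: a => a1 a2; case: z => z1 z2 /=; rewrite [X in _ - X]mulr1; ring.
Qed.

Lemma wt_dth t th : t < ln r0 -> is_derive (th : R) 1 (wt t) (- 2 * complex.Im (bz (pt p t th))).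
Proof.
move=> tr; have Dz := D_pt th tr.
have h := @wd_rder _ (fun z => (u z)%:C) (pt p t) th _ _ _ (Hu Dz) (pt_rder_th p t th).
have /rderP[h1 _] := h.
have h1' : is_derive (th : R) 1 (fun th => u (pt p t th))
   (complex.Re (mu (pt p t th) * ('i%C * (pt p t th - p)) + conjc (mu (pt p t th)) * conjc ('i%C * (pt p t th - p)))).
  by move: h1; rewrite complexiE.
apply: is_derive_eq.
rewrite /bz; move: (mu _) (pt p t th - p) => a z.
have -> : (2 * n%:R : C) = (2 * n%:R)%:C by rewrite rmorphM !rmorph_nat.
by case: a => a1 a2; case: z => z1 z2 /=; ring.
Qed.

Lemma bz_dth t th : t < ln r0 -> rder (fun th => bz (pt p t th)) th (dth (pt p t th)).
Proof. by move=> tr; exact: (wd_rder (wd_bz (D_pt th tr)) (pt_rder_th p t th)). Qed.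

Lemma bz_dt t th : t < ln r0 -> rder (fun t => bz (pt p t th)) t (dt (pt p t th)).
Proof.
by move=> tr; exact: (@wd_rder _ bz (fun t => pt p t th) t _ _ _ (wd_bz (D_pt th tr)) (pt_rder_t p t th)).
Qed.

Lemma conj_mul (z : C) : z * conjc z = (normc z ^+ 2)%:C.
Proof. by rewrite normcR; case: z => a b; apply: complex_ext => /=; ring. Qed.

Lemma conj_iim (z : C) : conjc (ii * z) = - ii * conjc z :> C.
Proof. by rewrite [conjc (ii * z)](rmorphM (conjc : R[i] -> R[i])) -[in RHS]conj_ii. Qed.

(** In the coordinate [zeta = log (z - p)] this is the equation once more:
    [d bz / d zetabar = - |z - p| ^ 2 e^u / 4]. It trades the radial derivative for the angular
    one. *)
Lemma dt_dth z : dt z = - ii * dth z - E z / 2 * (normc (z - p) ^+ 2)%:C.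
Proof.
rewrite -conj_mul /dt /dth /Q conj_iim.
set c := conjc _; set k := E z; set Pz := P z.
have -> : - ii * (Pz * (ii * (z - p)) + (z - p) * (- k / 4) * (- ii * c)) - k / 2 * ((z - p) * c) =
  - (ii * ii) * (Pz * (z - p)) + (ii * ii) * ((z - p) * (- k / 4)) * c - k / 2 * ((z - p) * c) by field.
by rewrite ii2; field.
Qed.

Definition fz z : C := (z - p) ^+ 2 * (- (1 / 2) * (uzz z - 1 / 2 * (mu z) ^+ 2)).

(** The expansion of [(z - p) ^ 2 V] around the model [u = 4 n log |z - p|], for which [bz = 0]: the
    constant is [n (n + 1)], and second derivatives of [u] enter only through the angular derivative
    of [bz]. *)
Lemma fz_eq z : fz z = n%:R * (n%:R + 1) + ii / 2 * dth z + (n%:R + 1 / 2) * bz z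
   + 1 / 4 * (bz z * bz z) + (normc (z - p) ^+ 2)%:C * E z / 8.
Proof.
rewrite -conj_mul /fz /dth /Q /P /bz conj_iim.
set c := conjc _; set k := E z; set x := z - p; set N := (n%:R : C).
have -> : N * (N + 1) + ii / 2 * ((x * uzz z + mu z) * (ii * x) + x * (- k / 4) * (- ii * c)) +
   (N + 1 / 2) * (x * mu z - 2 * N) + 1 / 4 * ((x * mu z - 2 * N) * (x * mu z - 2 * N)) + x * c * k / 8 =
  N * (N + 1) + (ii * ii) * ((x * uzz z + mu z) * x / 2 + x * k * c / 8) +
   (N + 1 / 2) * (x * mu z - 2 * N) + 1 / 4 * ((x * mu z - 2 * N) * (x * mu z - 2 * N)) + x * c * k / 8 by field.
by rewrite ii2; field.
Qed.

Lemma c_mu z : D z -> {for z, continuous mu}. Proof. by move=> /Hm /wd_cont. Qed.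
Lemma c_u z : D z -> {for z, continuous (fun z => (u z)%:C : C)}. Proof. by move=> /Hu /wd_cont. Qed.
Lemma c_E z : D z -> {for z, continuous E}.
Proof. by move=> Dz; exact: (wd_cont (wd_real (is_derive_expR (u z)) (Hu Dz))). Qed.
Lemma c_bz z : D z -> {for z, continuous bz}. Proof. by move=> /wd_bz /wd_cont. Qed.
Lemma c_sub z : {for z, continuous (fun z : C => z - p)}.
Proof. exact: (wd_cont (wdB (wd_id z) (wd_cst p z))). Qed.
Lemma c_conj (g : C -> C) z : {for z, continuous g} -> {for z, continuous (fun z => conjc (g z) : C)}.
Proof.
move=> /contCP cg; apply/contCP => e /cg[d d0 dh]; exists d => // w /dh.
by rewrite -rmorphB normc_conj.
Qed.
Lemma c_P z : D z -> {for z, continuous P}.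
Proof. by move=> Dz; exact (@ccD _ _ (fun z => (z - p) * uzz z) mu z (@ccM _ _ (fun z => z - p) uzz z (@c_sub z) (cuzz Dz)) (c_mu Dz)). Qed.
Lemma c_Q z : D z -> {for z, continuous Q}.
Proof.
move=> Dz; apply (@ccM _ _ (fun z => z - p) (fun z => - E z / 4) z (@c_sub z)).
exact (@ccM _ _ (fun z => - E z) (fun _ => 4^-1) z (ccN (c_E Dz)) (@cc_cst _ _ (4^-1 : C) z)).
Qed.
Lemma c_isub z : {for z, continuous (fun z : C => ii * (z - p) : C)}.
Proof. exact (@ccM _ _ (fun _ => ii) (fun z => z - p) z (@cc_cst _ _ (ii : C) z) (@c_sub z)). Qed.
Lemma c_dth z : D z -> {for z, continuous dth}.
Proof.
move=> Dz; apply (@ccD _ _ (fun z => P z * (ii * (z - p))) (fun z => Q z * conjc (ii * (z - p))) z).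
  exact (@ccM _ _ P (fun z => ii * (z - p)) z (c_P Dz) (@c_isub z)).
exact (@ccM _ _ Q (fun z => conjc (ii * (z - p))) z (c_Q Dz) (c_conj (@c_isub z))).
Qed.
Lemma c_dt z : D z -> {for z, continuous dt}.
Proof.
move=> Dz; apply (@ccD _ _ (fun z => P z * (z - p)) (fun z => Q z * conjc (z - p)) z).
  exact (@ccM _ _ P (fun z => z - p) z (c_P Dz) (@c_sub z)).
exact (@ccM _ _ Q (fun z => conjc (z - p)) z (c_Q Dz) (c_conj (@c_sub z))).
Qed.

Lemma joint (g : C -> C) t th : (forall z, D z -> {for z, continuous g}) -> t < ln r0 ->
  {for (t, th), continuous (fun q : R * R => g (pt p q.1 q.2))}.
Proof.
move=> cg tr; apply: (@continuous_comp _ _ _ (fun q : R * R => pt p q.1 q.2) g).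
  exact: pt_cont.
exact: cg (D_pt th tr).
Qed.

Lemma circ (g : C -> C) t : (forall z, D z -> {for z, continuous g}) -> t < ln r0 ->
  continuous (fun th => g (pt p t th)).
Proof.
move=> cg tr; apply cont_circ => z zt; apply: cg.
by rewrite /ann /= zt expR_gt0 -[X in _ < X]lnK ?posrE // ltr_expR.
Qed.

Let B z : R := complex.Re (bz z).
Let I z : R := complex.Im (bz z).

Lemma near_t t : t < ln r0 -> \forall t' \near t, t' < ln r0.
Proof. by move=> tr; exact: lt_nbhsl. Qed.

(** The mean square of [wt] on the circle, up to normalisation, with its first two derivatives in
    [t]. *)
Let m t := rint 0 (2 * pi) (fun th => wt t th * wt t th).
Let m1 t := rint 0 (2 * pi) (fun th => 4 * (wt t th * B (pt p t th))).
Let m2 t := rint 0 (2 * pi) (fun th => 8 * (B (pt p t th) * B (pt p t th)) +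
   4 * (wt t th * complex.Re (dt (pt p t th)))).

Lemma j_Re (g : C -> C) t th : (forall z, D z -> {for z, continuous g}) -> t < ln r0 ->
  {for (t, th), continuous (fun q : R * R => complex.Re (g (pt p q.1 q.2)))}.
Proof. by move=> cg tr; apply: cvg_Re; exact (@joint g t th cg tr). Qed.

Lemma j_wt t th : t < ln r0 -> {for (t, th), continuous (fun q : R * R => wt q.1 q.2)}.
Proof.
move=> tr; apply: rcB; first exact (@j_Re (fun z => (u z)%:C) t th c_u tr).
by apply: rcM; [exact: rc_cst|exact: cvg_fst].
Qed.

Lemma slice (g : R -> R -> R) t : (forall th, {for (t, th), continuous (fun q : R * R => g q.1 q.2)}) ->
  continuous (g t).
Proof.
move=> cg th; apply: (@continuous_comp _ _ _ (fun th : R => (t, th)) (fun q : R * R => g q.1 q.2)).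
  exact: (cvg_pair (cvg_cst t) cvg_id).
exact: cg.
Qed.

Lemma m_der t : t < ln r0 -> is_derive t 1 m (m1 t) /\ is_derive t 1 m1 (m2 t).
Proof.
move=> tr.
have j1 s th : s < ln r0 -> {for (s, th), continuous (fun q : R * R => wt q.1 q.2 * wt q.1 q.2)}.
  by move=> sr; apply: rcM; exact: j_wt.
have j2 s th : s < ln r0 -> {for (s, th), continuous (fun q : R * R => 4 * (wt q.1 q.2 * B (pt p q.1 q.2)))}.
  move=> sr; apply: rcM; first exact: rc_cst.
  by apply: rcM; [exact: j_wt|exact (@j_Re bz s th c_bz sr)].
have j3 s th : s < ln r0 -> {for (s, th), continuous (fun q : R * R =>
   8 * (B (pt p q.1 q.2) * B (pt p q.1 q.2)) + 4 * (wt q.1 q.2 * complex.Re (dt (pt p q.1 q.2))))}.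
  move=> sr; apply: rcD; (apply: rcM; first exact: rc_cst); apply: rcM.
  - exact (@j_Re bz s th c_bz sr).
  - exact (@j_Re bz s th c_bz sr).
  - exact: j_wt.
  - exact (@j_Re dt s th c_dt sr).
have nr := near_t tr.
split.
  refine (@int_param_derive R 0 (2 * pi) t (fun t th => wt t th * wt t th)
    (fun t th => 4 * (wt t th * B (pt p t th))) _ _ _ _ _).
  - exact: ltW twopi_gt0.
  - near=> s; apply: (slice (g := fun t th => wt t th * wt t th)) => th; apply: j1.
    by near: s.
  - by apply: (slice (g := fun t th => 4 * (wt t th * B (pt p t th)))) => th; exact: j2.
  - near=> s => th; have sr : s < ln r0 by near: s.
    have h := wt_dt th sr; apply: is_derive_eq.
    by rewrite /GRing.scale /= /B; ring.
  - by move=> th _; exact: j2.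
refine (@int_param_derive R 0 (2 * pi) t (fun t th => 4 * (wt t th * B (pt p t th)))
    (fun t th => 8 * (B (pt p t th) * B (pt p t th)) + 4 * (wt t th * complex.Re (dt (pt p t th)))) _ _ _ _ _).
- exact: ltW twopi_gt0.
- near=> s; apply: (slice (g := fun t th => 4 * (wt t th * B (pt p t th)))) => th; apply: j2.
  by near: s.
- by apply: (slice (g := fun t th => 8 * (B (pt p t th) * B (pt p t th)) + 4 * (wt t th * complex.Re (dt (pt p t th))))) => th; exact: j3.
- near=> s => th; have sr : s < ln r0 by near: s.
  have h := wt_dt th sr; have /rderP[h2 _] := bz_dt th sr.
  have h2' : is_derive s 1 (fun t => B (pt p t th)) (complex.Re (dt (pt p s th))) := h2.
  apply: is_derive_eq.
  by rewrite /GRing.scale /= /B; ring.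
- by move=> th _; exact: j3.
Unshelve. all: by end_near. Qed.

Let W t := rint 0 (2 * pi) (fun th => normc (bz (pt p t th)) ^+ 2).

Lemma normc_sqr (z : C) : normc z ^+ 2 = complex.Re z * complex.Re z + complex.Im z * complex.Im z.
Proof. by have := conj_mul z; case: z => a b /(congr1 (@complex.Re R)) /= <-; ring. Qed.

Lemma c_Im (g : C -> C) t : (forall z, D z -> {for z, continuous g}) -> t < ln r0 ->
  continuous (fun th => complex.Im (g (pt p t th))).
Proof. by move=> cg tr; apply: contIm; exact: circ. Qed.
Lemma c_Re (g : C -> C) t : (forall z, D z -> {for z, continuous g}) -> t < ln r0 ->
  continuous (fun th => complex.Re (g (pt p t th))).
Proof. by move=> cg tr; apply: contRe; exact: circ. Qed.

Lemma c_wt t : t < ln r0 -> continuous (wt t).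
Proof. by move=> tr; apply: slice => th; exact: j_wt. Qed.

(** The angular derivative of [wt] is [- 2 I], and the boundary terms cancel over a full turn. *)
Lemma by_parts t : t < ln r0 ->
  rint 0 (2 * pi) (fun th => wt t th * complex.Im (dth (pt p t th))) =
  2 * rint 0 (2 * pi) (fun th => I (pt p t th) * I (pt p t th)).
Proof.
move=> tr; have cI := c_Im c_bz tr; have cd := c_Im c_dth tr; have cw := c_wt tr.
have c1 := gM cw cd; have c2 := gM cI cI.
rewrite -intZ //; apply/eqP; rewrite -subr_eq0; apply/eqP.
rewrite -intB //; last by exact (@gM (fun=> 2) _ (@g_cst 2) c2).
transitivity (wt t (2 * pi) * I (pt p t (2 * pi)) - wt t 0 * I (pt p t 0)).
  apply: (@int_FTC _ 0 (2 * pi) (fun th => wt t th * I (pt p t th))); first exact: twopi_gt0.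
- by have c3 := @gM (fun=> 2) _ (@g_cst 2) c2; move=> x; exact (@rcB _ _ _ x (c1 x) (c3 x)).
- move=> th; have h1 := wt_dth th tr; have /rderP[_ h2] := bz_dth th tr.
  have h2' : is_derive (th : R) 1 (fun t' => I (pt p t t')) (complex.Im (dth (pt p t th))) := h2.
  apply: is_derive_eq.
  by rewrite /GRing.scale /= /I; ring.
by rewrite /wt pt_2pi subrr.
Qed.

Lemma Re_dt z : complex.Re (dt z) = complex.Im (dth z) - expR (u z) / 2 * normc (z - p) ^+ 2.
Proof.
rewrite dt_dth; case: (dth z) => a b.
have -> : E z / 2 * (normc (z - p) ^+ 2)%:C = (expR (u z) / 2 * normc (z - p) ^+ 2)%:C.
  by rewrite /E !rmorphM fmorphV rmorph_nat.
have -> : - ii * (a +i* b) = b +i* (- a).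
  by rewrite -complexiE; apply: complex_ext => /=; ring.
by rewrite cReB.
Qed.

(** The radial part of the energy comes from differentiating the square twice, the angular part from
    [dt_dth] and [by_parts]; the nonlinearity carries the factor [expR t ^ 2] and disappears as
    [t -> - oo]. *)
Lemma energy t : t < ln r0 ->
  8 * W t = m2 t + 2 * (expR t ^+ 2 * rint 0 (2 * pi) (fun th => wt t th * expR (u (pt p t th)))).
Proof.
move=> tr; have cB := c_Re c_bz tr; have cI := c_Im c_bz tr; have cd := c_Im c_dth tr.
have cw := c_wt tr; have cE : continuous (fun th => expR (u (pt p t th))) := c_Re c_E tr.
have k (c : R) (f : R -> R) : continuous f -> continuous (fun th : R => c * f th) by move=> cf; exact (@gM (fun=> c) f (@g_cst c) cf).
have cBB := gM cB cB; have cII := gM cI cI; have cwE := gM cw cE; have cwd := gM cw cd.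
have -> : m2 t = 8 * rint 0 (2 * pi) (fun th => B (pt p t th) * B (pt p t th))
   + (4 * rint 0 (2 * pi) (fun th => wt t th * complex.Im (dth (pt p t th)))
   + (- 2 * expR t ^+ 2) * rint 0 (2 * pi) (fun th => wt t th * expR (u (pt p t th)))).
  rewrite -!intZ // -intD; [|exact: k|exact: k].
  rewrite -intD; [|exact: k|by apply: gD; exact: k].
  by apply: eq_int => th _; rewrite Re_dt normc_pt; field.
rewrite by_parts //.
have -> : W t = rint 0 (2 * pi) (fun th => B (pt p t th) * B (pt p t th)) +
    rint 0 (2 * pi) (fun th => I (pt p t th) * I (pt p t th)).
  by rewrite -intD //; apply: eq_int => th _; rewrite normc_sqr.
by ring.
Qed.

Lemma wt_le t th : t < ln r0 -> `|wt t th| <= M.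
Proof.
by move=> tr; have := Hb (D_pt th tr); rewrite normc_pt expRK.
Qed.

Lemma t_le0 t : t < ln r0 -> t <= 0.
Proof. by move=> tr; rewrite ltW // (lt_le_trans tr) // ln_le0. Qed.

(** For [t <= 0] the model term [4 n t] is nonpositive; this is the purpose of [r0 <= 1]. *)
Lemma E_le t th : t < ln r0 -> expR (u (pt p t th)) <= expR M.
Proof.
move=> tr; rewrite ler_expR; have := wt_le th tr; have := t_le0 tr.
rewrite ler_norml /wt => t0 /andP[_ h].
have : n%:R * t <= 0 by rewrite mulr_ge0_le0.
by move: h; lra.
Qed.

Lemma M_ge0 : 0 <= M.
Proof.
by apply: le_trans (@wt_le (ln r0 - 1) 0 _); [exact: normr_ge0|lra].
Qed.

Lemma exp_small (e K : R) : 0 < e -> 0 <= K -> exists T, forall t, t < T -> t <= 0 ->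
  expR t < e /\ K * expR t ^+ 2 <= e.
Proof.
move=> e0 K0; have k1 : 0 < e / (K + 1) by rewrite divr_gt0 // ltr_wpDl.
exists (Num.min (ln e) (ln (e / (K + 1)))) => t; rewrite lt_min => /andP[t1 t2] t0.
rewrite -ltr_expR lnK ?posrE // in t1; rewrite -ltr_expR lnK ?posrE // in t2.
split => //; have x0 := expR_gt0 t; have x1 : expR t <= 1 by rewrite -expR0 ler_expR.
move: t2; rewrite ltr_pdivlMr; last by rewrite ltr_wpDl.
by move: x0 x1; move: (expR t) => x; nra.
Qed.

Lemma energy_small (e T1 : R) : 0 < e -> exists t, [/\ t < ln r0, t < T1 & W t <= e].
Proof.
move=> e0.
have K0 : 0 <= 2 * (M * expR M * (2 * pi)).
  by rewrite !mulr_ge0 ?expR_ge0 ?M_ge0 ?pi_ge0.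
have [T2 T2P] := exp_small e0 K0.
have mB t : t < ln r0 -> `|m t| <= M ^+ 2 * (2 * pi - 0).
  move=> tr; apply: int_bound; [exact: ltW twopi_gt0|exact: gM (c_wt tr) (c_wt tr)|].
  by move=> th _; rewrite normrM expr2 ler_pM // wt_le.
have [t [tr tT tm]] := bounded_convex m_der mB e0 (Num.min T1 T2).
move: tT; rewrite lt_min => /andP[t1 t2]; exists t; split => //.
have [_ h] := T2P t t2 (t_le0 tr).
have := energy tr.
set J := rint _ _ _ => EE.
have hJ : `|J| <= M * expR M * (2 * pi - 0).
  apply: int_bound; [exact: ltW twopi_gt0|exact: gM (c_wt tr) (c_Re c_E tr)|].
  by move=> th _; rewrite normrM ler_pM // ?wt_le // ger0_norm ?expR_ge0 // E_le.
move: hJ; rewrite ler_norml subr0 => /andP[_ hJ].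
have x0 : 0 <= expR t ^+ 2 by rewrite exprn_ge0 // expR_ge0.
have : expR t ^+ 2 * J <= expR t ^+ 2 * (M * expR M * (2 * pi)) by rewrite ler_wpM2l.
by move: h EE tm e0; move: (expR t ^+ 2) => x; lra.
Qed.

(* Against test functions on the circle, integrating the angular derivative by parts, everything in
   the expansion of [fz] except its constant term is controlled by the energy. *)
Lemma weak_gen (e T1 : R) : 0 < e -> exists t, [/\ t < ln r0, t < T1 &
  forall chi chi' : R -> C, (forall th, rder chi th (chi' th)) -> continuous chi' ->
    chi (2 * pi) = chi 0 -> (forall th, normc (chi th) <= 2) -> (forall th, normc (chi' th) <= 4) ->
    normc (ci (fun th => fz (pt p t th) * chi th) - n%:R * (n%:R + 1) * ci chi) <= e].
Proof.
move=> e0.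
pose N : R := 2 * n%:R + 3; have N0 : 0 < N by rewrite ltr_wpDl // mulr_ge0.
have p0 : 0 < 2 * pi :> R := twopi_gt0.
(* Order of choice: [d] makes the term free of the energy small, then [w] bounds the energy, whose
   coefficient contains [N / d]. *)
pose d := e / 8 / (N * (2 * pi)); have d0 : 0 < d by rewrite !divr_gt0 // mulr_gt0.
pose w := e / 8 / (N / d + 1).
have q0 : 0 < N / d + 1 by rewrite ltr_wpDl // ltW // divr_gt0.
have w0 : 0 < w by rewrite !divr_gt0.
have K0 : 0 <= expR M * (2 * pi) by rewrite mulr_ge0 ?expR_ge0 // ltW.
have e8 : 0 < e / 8 by rewrite divr_gt0.
have [T2 T2P] := @exp_small (e / 8) (expR M * (2 * pi)) e8 K0.
have [t [tr tT tW]] := energy_small (Num.min T1 T2) w0.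
move: tT; rewrite lt_min => /andP[t1 t2]; exists t; split => // chi chi' dchi cchi' per B1 B2.
have [_ h2] := T2P t t2 (t_le0 tr).
have ck : continuous (fun th => (expR t ^+ 2)%:C * E (pt p t th) / 8 : C).
  have cE : continuous (fun th => E (pt p t th)) by exact: circ c_E tr.
  by move=> th; exact (@ccM _ _ (fun th => (expR t ^+ 2)%:C * E (pt p t th)) (fun=> 8^-1) th
    (@ccM _ _ (fun=> (expR t ^+ 2)%:C) (fun th => E (pt p t th)) th (@cc_cst _ _ _ th) (cE th)) (@cc_cst _ _ _ th)).
have Bk th : normc ((expR t ^+ 2)%:C * E (pt p t th) / 8 : C) <= expR t ^+ 2 * expR M / 8.
  rewrite (_ : _ / 8 = (expR t ^+ 2 * expR (u (pt p t th)) / 8)%:C); last first.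
    by rewrite /E !rmorphM fmorphV rmorph_nat.
  rewrite normc_real ger0_norm ?ler_wpM2r ?invr_ge0 // ?ler_wpM2l ?E_le ?exprn_ge0 ?expR_ge0 //.
have fE th : fz (pt p t th) = n%:R * (n%:R + 1) + ii / 2 * dth (pt p t th) + (n%:R + 1 / 2) * bz (pt p t th)
   + 1 / 4 * (bz (pt p t th) * bz (pt p t th)) + (expR t ^+ 2)%:C * E (pt p t th) / 8.
  by rewrite fz_eq normc_pt.
have := @circle_est n _ _ _ _ _ _ _ _ (fun th => bz_dth th tr) (circ c_dth tr) dchi cchi' ck _ per fE Bk B1 B2 d0.
rewrite pt_2pi => /(_ erefl) h; apply: le_trans h _.
rewrite -/N -/(W t).
have E1 : N * (d * (2 * pi)) = e / 8.
  have -> : N * (d * (2 * pi)) = d * (N * (2 * pi)) by ring.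
  by rewrite /d divfK // gt_eqF // mulr_gt0.
have E2 : (N / d + 1) * W t <= e / 8 by rewrite mulrC -ler_pdivlMr.
rewrite [N * (_ + _)]mulrDr E1; move: E2 h2; rewrite mulrDl mul1r.
have -> : N * (W t / d) = N / d * W t by field; rewrite gt_eqF.
by lra.
Qed.

Lemma weak_one (e T1 : R) : 0 < e -> exists t, [/\ t < ln r0, t < T1 &
  normc (ci (fun th => fz (pt p t th)) - n%:R * (n%:R + 1) * (2 * pi)%:C) <= e].
Proof.
move=> e0; have [t [tr tT H]] := weak_gen T1 e0; exists t; split => //.
have h1 : normc (1 : C) <= 2 by rewrite (normc_real 1) normr1 ler1n.
have := H (fun=> 1) (fun=> 0).
rewrite ci_cst mul1r (_ : (fun th => fz (pt p t th) * 1) = (fun th => fz (pt p t th))); last by apply/funext => th; rewrite mulr1.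
apply => //.
- by move=> th; apply/rderP; split => /=; exact: is_derive_cst.
- exact: gc_cst.
- by move=> th; rewrite Normc.normc0.
Qed.

(** The test function is the Cauchy kernel, itself of the order of the radius, so the constant
    [n (n + 1)] contributes nothing in the limit. This is the small-circle hypothesis of
    [cauchy_pser]. *)
Lemma weak_pole (w : C) (e : R) : 0 < normc w -> 0 < e -> exists2 t, expR t < e &
  normc (ci (fun th => fz (pt p t th) * ((pt p t th - p) / (pt p t th - p - w)))) <= e.
Proof.
move=> w0 e0.
pose K : R := 2 * (2 * (2 * pi)) * (normc (n%:R * (n%:R + 1) : C) / normc w).
have K0 : 0 <= K by rewrite !mulr_ge0 ?pi_ge0 ?invr_ge0 ?normc_ge0.
(* On circles of radius below [normc w / 2] the kernel is at most 1 and its angular derivative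
   [- i w z / (z - w) ^ 2] at most 2 in modulus, within the bounds of [weak_gen]. *)
pose e1 := Num.min e (Num.min (normc w / 2) (e / 2 / (K + 1))).
have K1 : 0 < K + 1 by rewrite ltr_wpDl.
have e10 : 0 < e1 by rewrite !lt_min e0 !divr_gt0.
have e2 : 0 < e / 2 by rewrite divr_gt0.
have [t [tr tT H]] := weak_gen (ln e1) e2.
move: tT; rewrite -ltr_expR lnK ?posrE // !lt_min => /and3P[t1 t2 t3]; exists t => //.
pose z th := pt p t th - p.
have nz th : normc (z th) = expR t by exact: normc_pt.
have nzw th : normc w / 2 <= normc (z th - w).
  by have := normc_lb w (z th); rewrite nz normcBC; lra.
have zw th : z th - w != 0.
  by rewrite -normc_gt0; apply: lt_le_trans (nzw th); rewrite divr_gt0.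
have dz th : rder z th (ii * z th).
  have h := pt_rder_th p t th; have h2 := @wd_rder _ (fun z => z - p) (pt p t) th _ _ _ (wdB (wd_id _) (wd_cst p _)) h.
  by move: h2; rewrite subr0 mul1r subr0 mul0r addr0.
have dq th : rder (fun th => z th / (z th - w)) th (- (ii * (w * z th)) / (z th - w) ^+ 2).
  have h1 : is_derive (pt p t th) (1 : C) (fun x => x - (p + w)) 1.
    have := wdB (wd_id (pt p t th)) (wd_cst (p + w) (pt p t th)).
    by rewrite !subr0 => /wd_cder.
  have n0 : pt p t th - (p + w) != 0 by rewrite opprD addrA; exact: zw.
  have h2 := cder_rder (@cderV _ (fun x => x - (p + w)) _ _ n0 h1) (pt_rder_th p t th).
  have h3 := rderM (dz th) h2.
  have <- : (fun th => z th * ((fun x => (x - (p + w))^-1) \o pt p t) th) = (fun th => z th / (z th - w)).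
    by apply/funext => x; rewrite /= /z opprD addrA.
  have E1 (a b d v : C) : b != 0 -> v = a - b -> (d * a) / b + a * (- b ^- 2 * 1 * (d * a)) = - (d * (v * a)) / b ^+ 2.
    by move=> b0 ->; field.
  rewrite -(E1 (z th) (z th - w) ii w (zw th)); last by ring.
  have <- : pt p t th - (p + w) = z th - w by rewrite /z opprD addrA.
  by move: h3; rewrite /= -complexiE.
have cz : continuous z by move=> th; exact: (rder_cont (dz th)).
have ciz : continuous (fun th => (z th - w)^-1).
  by move=> th; exact (@ccV _ _ (fun th => z th - w) th (zw th) (@ccB _ _ z (fun=> w) th (cz th) (@cc_cst _ _ w th))).
have chi_le th : normc (z th / (z th - w)) <= 2 * expR t / normc w.
  rewrite normcM normcV nz -mulrA mulrCA ler_wpM2l ?expR_ge0 //.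
  have := nzw th; have x0 : 0 < normc (z th - w) by rewrite normc_gt0.
  by move=> h; rewrite -[X in X^-1 <= _]invrK; rewrite invrK -[leRHS]invf_div lef_pV2 ?posrE // divr_gt0.
have E0 := expR_gt0 t.
have q : expR t / normc w <= 1 / 2.
  by rewrite ler_pdivrMr // mulrC; lra.
have zper : z (2 * pi) = z 0 by rewrite /z pt_2pi.
have cc : continuous (fun th : R => (- (ii * (w * z th)) / (z th - w) ^+ 2 : C)).
  rewrite (_ : (fun th => _) = (fun th => (- (ii * w)) * z th * ((z th - w)^-1 * (z th - w)^-1))).
    exact (@gcM _ _ _ _ (@gcM _ _ _ _ (@gc_cst _ _ (- (ii * w))) cz) (@gcM _ _ _ _ ciz ciz)).
  by apply/funext => th; rewrite expr2 invfM; move: (z th - w)^-1 (z th) => a b; ring.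
have h4 th : normc (- (ii * (w * z th)) / (z th - w) ^+ 2) <= 4.
  rewrite normcM normcN normcM normc_ii mul1r normcM nz normcV normcX.
  have x0 : 0 < normc (z th - w) by rewrite normc_gt0.
  rewrite ler_pdivrMr ?exprn_gt0 //; have := nzw th; rewrite expr2.
  by move: (normc (z th - w)) (normc w) x0 w0 t2 E0 => x y; nra.
have h2 th : normc (z th / (z th - w)) <= 2.
  by apply: le_trans (chi_le th) _; move: q; rewrite -mulrA; lra.
have := H (fun th => z th / (z th - w)) (fun th => - (ii * (w * z th)) / (z th - w) ^+ 2) dq cc (congr1 (fun x => x / (x - w)) zper) h2 h4.
move=> h.
have cchi : continuous (fun th => z th / (z th - w)) by exact: (gcM cz ciz).
have b1 := ci_bound cchi (fun th _ => chi_le th).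
set X := ci _ in h; set N0 : C := n%:R * (n%:R + 1) in h; set Y := ci _ in h b1.
rewrite -[X in normc X <= _]/X (_ : X = (X - N0 * Y) + N0 * Y); last by ring.
rewrite (le_trans (normcD _ _)) // [leRHS]splitr lerD // normcM.
have n0 := normc_ge0 N0.
apply: le_trans (ler_wpM2l n0 b1) _.
have -> : normc N0 * (2 * (2 * expR t / normc w * (2 * pi))) = K * expR t by rewrite /K -/N0; field; rewrite gt_eqF.
rewrite ltr_pdivlMr // in t3.
by move: t3; lra.
Qed.

Hypothesis hfz : hol D fz.

(** The zeroth coefficient is a circle mean, independent of the radius, and is read off on the
    circles of small energy. *)
Lemma fz_pser : exists (a : nat -> C) (rho K : R), [/\ 0 < rho, geo a rho K, a 0%N = n%:R * (n%:R + 1) &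
  forall w, 0 < normc w < rho -> fz (p + w) = pser a w].
Proof.
pose T := ln (r0 / 2); have r2 : 0 < r0 / 2 by rewrite divr_gt0.
have eT : expR T = r0 / 2 by rewrite lnK.
have Tr : expR T < r0 by rewrite eT; lra.
have [[K gK] ps] := cauchy_pser hfz Tr (fun w wT e e0 => @weak_pole w e (proj1 (andP wT)) e0).
exists (circ_coef fz p T), (expR T), K; split => //; first exact: expR_gt0.
rewrite /circ_coef.
have -> : (fun th => fz (pt p T th) * ((pt p T th - p) ^+ 0)^-1) = (fun th => fz (pt p T th)).
  by apply/funext => th; rewrite expr0 invr1 mulr1.
suff -> : ci (fun th => fz (pt p T th)) = n%:R * (n%:R + 1) * (2 * pi)%:C.
  by rewrite mulrC mulfK // twopiC_neq0.
apply/eqP; rewrite -subr_eq0; apply/eqP; apply: normc_le0P => e e0.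
have [t [tr tT H]] := weak_one T e0.
(* The radius -1 designates no circle: [fz] is holomorphic on the whole annulus. *)
have c := @circ_const R p 0 r0 (-1) t T fz (expR_gt0 t) (ltW tT) Tr (fun z Dz => hol_cont hfz Dz).
have s : hol [set z | D z /\ normc (z - p) != -1] fz.
  by refine (hol_sub _ hfz) => z [].
by rewrite -(c s).
Qed.

End Energy.

(** * The potential is a Lamé potential *)

Section Periods.
Context {R : realType}.
Local Notation C := (cplx R).

Lemma int_per (V : Type) (f : C -> V) (a : C) : (forall z, f (z + a) = f z) ->
  forall (m : int) z, f (z + m%:~R * a) = f z.
Proof.
move=> fa.
have nat_per (k : nat) z : f (z + k%:R * a) = f z.
  elim: k z => [|k IH] z; first by rewrite mul0r addr0.
  by rewrite -natr1 mulrDl mul1r addrA fa IH.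
case=> k z; first exact: nat_per.
rewrite NegzE mulrNz mulNr -(nat_per k.+1 (z - _)).
by rewrite -[X in _ = f X](subrK (k.+1%:R * a) z).
Qed.

Lemma lattice_per (tau : C) (V : Type) (f : C -> V) : doubly_periodic tau f ->
  forall w z, lattice tau w -> f (z + w) = f z.
Proof.
move=> per w z [m [n ->]].
rewrite addrA int_per; last by move=> x; have [] := per x.
by rewrite -[m%:~R]mulr1 int_per // => x; have [] := per x.
Qed.

Variables (tau : C) (tau_upper : 0 < complex.Im tau).

Lemma lattice_omega k : lattice tau (omega tau k).
Proof.
case: k => -[|[|[|[|//]]]] kl; rewrite /omega /=.
- exact: lattice0.
- exact: lattice1.
- exact: lattice_tau.
- by apply: latticeD; [exact: lattice1|exact: lattice_tau].
Qed.

Lemma wp_shift w z : lattice tau w -> weierstrass_p tau (z + w) = weierstrass_p tau z.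
Proof. by apply: lattice_per => x; exact: wp_periodic. Qed.

Lemma half_period_sep : exists2 c : R, 0 < c & forall z w, half_periods tau z -> half_periods tau w ->
  normc (z - w) < c -> z = w.
Proof.
have [c c0 H] := lattice_sep tau_upper; exists (c / 2); first by rewrite divr_gt0.
move=> z w /(half_periodsP tau_upper) lz /(half_periodsP tau_upper) lw zw.
have n2 : normc (2 : C) = 2 by exact: (normc_natr 2).
have n20 : (2 : C) != 0 by rewrite -normc_gt0 n2.
apply: (mulfI n20); apply: H => //; rewrite -mulrBr normcM n2; move: zw; rewrite ltr_pdivlMr //; lra.
Qed.

Lemma half_omega k : half_periods tau (omega tau k / 2).
Proof. by exists k; rewrite subrr; exact: lattice0. Qed.

Lemma lattice_repr (z : C) : exists w (s t : R), [/\ lattice tau w, 0 <= s <= 1, 0 <= t <= 1 &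
  z = s%:C + t%:C * tau + w].
Proof.
pose t := complex.Im z / complex.Im tau; pose s := complex.Re z - t * complex.Re tau.
exists (lat tau (Num.floor s) (Num.floor t)), (s - (Num.floor s)%:~R), (t - (Num.floor t)%:~R).
have [h1 h2] := andP (floor_itv s); have [h3 h4] := andP (floor_itv t).
rewrite intrD1 in h2; rewrite intrD1 in h4.
split; [by exists (Num.floor s), (Num.floor t)|lra|lra|].
rewrite /lat !intC; have t0 : complex.Im tau != 0 by rewrite gt_eqF.
apply: complex_ext; rewrite !(cReD, cImD, cReM, cImM) /=.
  by rewrite /s; ring.
by rewrite /t /=; field.
Qed.

Lemma par_bounded (f : C -> C) : continuous f -> exists B : R, forall s t : R,
  0 <= s <= 1 -> 0 <= t <= 1 -> normc (f (s%:C + t%:C * tau)) <= B.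
Proof.
move=> cf.
pose g (q : R * R) : R := normc (f (q.1%:C + q.2%:C * tau)).
have cg : continuous g.
  move=> q; apply/cvgrPdist_lt => e e0.
  have cl : (q'.1%:C + q'.2%:C * tau : C) @[q' --> q] --> (q.1%:C + q.2%:C * tau : C).
    have r1 : {for q, continuous (fun q' : R * R => q'.1%:C : C)}.
      by apply: cvg_ReIm => /=; [exact: cvg_fst|exact: cvg_cst].
    have r2 : {for q, continuous (fun q' : R * R => q'.2%:C : C)}.
      by apply: cvg_ReIm => /=; [exact: cvg_snd|exact: cvg_cst].
    exact: (ccD r1 (@ccM _ _ _ (fun=> tau) q r2 (@cc_cst _ _ tau q))).
  have cfl : f (q'.1%:C + q'.2%:C * tau : C) @[q' --> q] --> f (q.1%:C + q.2%:C * tau : C).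
    exact: (continuous_comp (f := fun q' : R * R => q'.1%:C + q'.2%:C * tau : C) (g := f) cl (cf _)).
  have /cvgCP H := cfl.
  near=> q'; have h : normc (f (q'.1%:C + q'.2%:C * tau) - f (q.1%:C + q.2%:C * tau)) < e by near: q'; exact: H.
  rewrite /g; move: h; set a := f _; set b := f _ => h.
  rewrite ltr_norml; have := normc_lb a b; have := normc_lb b a.
  rewrite [normc (b - a)]normcBC; move: h; lra.
have K : compact (`[0, 1]%classic `*` `[0, 1]%classic : set (R * R)).
  by apply: compact_setX; exact: segment_compact.
have cK : {within (`[0, 1]%classic `*` `[0, 1]%classic : set (R * R)), continuous g}.
  exact: continuous_subspaceT.
have [B [_ HB]] := compact_bounded (continuous_compact cK K).
exists (B + 1) => s t s01 t01.
have h := HB (B + 1) _ (g (s, t)).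
apply: le_trans (ler_norm _) _; apply: h; first by rewrite ltrDl.
by exists (s, t) => //; split; rewrite /= in_itv.
Unshelve. all: by end_near. Qed.

(** Only the value at [p] of each local continuation is kept, selected by choice; on the punctured
    discs the function is [F] already. *)
Lemma hol_patch (S : set C) (F : C -> C) : copen (~` S) -> hol (~` S) F ->
  (forall p, S p -> exists2 r : R, 0 < r & exists2 g, hol (disc p r) g &
     forall z, 0 < normc (z - p) < r -> ~ S z /\ F z = g z) ->
  exists2 G, hol setT G & forall z, ~ S z -> G z = F z.
Proof.
move=> oS hF HS.
have /choice[v vP] : forall p, exists c : C, S p -> exists2 r : R, 0 < r & exists2 g, hol (disc p r) g &
     g p = c /\ forall z, 0 < normc (z - p) < r -> ~ S z /\ F z = g z.
  move=> p; have [Sp|nS] := pselect (S p); last by exists 0.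
  by have [r r0 [g hg H]] := HS p Sp; exists (g p) => _; exists r => //; exists g.
pose G z := if `[< S z >] then v z else F z.
have GF z : ~ S z -> G z = F z by rewrite /G; case: asboolP.
exists G => //; apply: Hol => z _.
have [Sz|nS] := pselect (S z); last first.
  have hG : hol (~` S) G by refine (hol_eq oS _ hF) => w nw; rewrite GF.
  exact: (hG z nS).
have [r r0 [g hg [gz H]]] := vP z Sz.
have hG : hol (disc z r) G.
  refine (hol_eq (@copen_disc _ z r) _ hg) => w wr.
  have [->|wz] := eqVneq w z; first by rewrite gz /G; case: asboolP.
  have [] := H w; first by rewrite normc_gt0 subr_eq0 wz.
  by move=> nSw <-; rewrite GF.
by apply (hG z); rewrite /disc /= subrr Normc.normc0.
Qed.

Lemma reg_near z (e : R) : 0 < e -> exists2 w, reg tau w & normc (w - z) < e.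
Proof.
move=> e0; have [Rz|nR] := pselect (reg tau z); first by exists z => //; rewrite subrr Normc.normc0.
have Hz : half_periods tau z by apply: contrapT.
have [c c0 H] := half_period_sep.
pose d := Num.min e c / 2.
have m0 : 0 < Num.min e c by rewrite lt_min e0.
have d0 : 0 < d by rewrite divr_gt0.
have nd : normc (z + d%:C - z) = d by rewrite addrC addKr normc_real gtr0_norm.
exists (z + d%:C); last by rewrite nd; have : Num.min e c <= e by [rewrite ge_min lexx]; rewrite /d; lra.
move=> hw; have dc : d < c by have : Num.min e c <= c by [rewrite ge_min lexx orbT]; rewrite /d; lra.
have E : z + d%:C = z by apply: H => //; rewrite nd.
by move: nd; rewrite E subrr Normc.normc0 => h; move: d0; rewrite -h ltxx.
Qed.

(** The continuation is bounded on the closed parallelogram, by periodicity on all regular points,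
    and by their density everywhere; Liouville's theorem applies. Periodicity is used at regular
    points only. *)
Lemma torus_const (F : C -> C) : hol (reg tau) F ->
  (forall w z, lattice tau w -> reg tau z -> F (z + w) = F z) ->
  (forall p, half_periods tau p -> exists2 r : R, 0 < r & exists2 g, hol (disc p r) g &
     forall z, 0 < normc (z - p) < r -> reg tau z /\ F z = g z) ->
  exists E, forall z, reg tau z -> F z = E.
Proof.
move=> hF per HS.
have [G hG GF] := hol_patch (copen_reg tau_upper) hF HS.
have cG : continuous G by move=> z; exact: (hol_cont hG).
have [B HB] := par_bounded cG.
have bR z : reg tau z -> normc (G z) <= B + 1.
  move=> Rz; have [w [s [t [lw s01 t01 E]]]] := lattice_repr z.
  have Rz' : reg tau (s%:C + t%:C * tau) by apply/(reg_shift tau_upper _ lw); rewrite -E.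
  rewrite (GF _ Rz) E (per _ _ lw Rz') -(GF _ Rz').
  by apply: le_trans (HB _ _ s01 t01) _; rewrite lerDl.
have bG z : normc (G z) <= B + 2.
  have /contCP/(_ 1 ltr01)[d d0 dH] := cG z.
  have [w Rw wz] := reg_near z d0.
  have := dH w wz; have := bR w Rw; have := normc_lb (G z) (G w).
  by rewrite normcBC; lra.
by exists (G 0) => z Rz; rewrite -(GF _ Rz); exact: (liouville hG bG).
Qed.

End Periods.

Section Translate.
Context {R : realType}.
Local Notation C := (cplx R).

Lemma cder_add (f : C -> C) (z w d : C) : is_derive (z + w) (1 : C) f d ->
  is_derive z (1 : C) (fun z => f (z + w)) d.
Proof.
move=> /cderP H; apply/cderP => e e0; have [r r0 rH] := H e e0; exists r => // h hr.
have -> : z + h + w = z + w + h by ring.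
exact (rH h hr).
Qed.

Lemma hol_comp_add (D D' : set C) (f : C -> C) (w : C) : copen D -> hol D' f ->
  (forall z, D z -> D' (z + w)) -> hol D (fun z => f (z + w)).
Proof.
move=> oD hf DD'; apply (@holI _ _ _ (fun z => dC f (z + w)) oD) => z Dz.
  exact: (cder_add (hol_is hf (DD' z Dz))).
have /contCP c := (hf (z + w) (DD' z Dz)).2.
apply/contCP => e /c[d d0 dh]; exists d => // x xz; apply: dh.
by rewrite opprD addrACA subrr addr0.
Qed.

End Translate.

(** * Expansion of the potential at the half periods and the constant [E] *)

Section Potential.
Context {R : realType}.
Local Notation C := (cplx R).
Variables (tau : C) (tau_upper : 0 < complex.Im tau) (u : C -> R) (n : 'I_4 -> nat).
Hypothesis u_smooth : smooth (reg tau) u.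
Hypothesis pde : forall z, reg tau z -> laplacian u z = - expR (u z).
Hypothesis u_per : doubly_periodic tau u.
Hypothesis u_even : forall z, u (- z) = u z.
Hypothesis u_log : forall k : 'I_4, exists M : R,
  \forall z \near (omega tau k / 2 : C)^',
    `|u z - 4 * (n k)%:R * ln (normc (z - omega tau k / 2))| <= M.

Let pot_per w z : lattice tau w -> reg tau z -> pot u (z + w) = pot u z.
Proof. by move=> lw; apply: (pot_shift tau_upper u_smooth pde lw) => x; exact: lattice_per. Qed.

Lemma geo_even (a : nat -> C) (rho K : R) : geo a rho K ->
  geo (fun j => if odd j then 0 else a j) rho K.
Proof.
move=> [K0 H]; split => // j; case: odd; last exact: H.
by rewrite Normc.normc0; apply: le_trans (normc_ge0 _) (H j).
Qed.

(** The partial sums at [w] and [- w] are averaged, which removes the odd terms; this avoids an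
    identity theorem for coefficients. *)
Lemma pser_even (a : nat -> C) (rho K : R) (w : C) : 0 < rho -> geo a rho K -> normc w < rho ->
  pser a w = pser a (- w) -> pser (fun j => if odd j then 0 else a j) w = pser a w.
Proof.
move=> r0 ga wr E; apply: pser_eq.
have h1 := psum_tends r0 ga wr.
have wr' : normc (- w) < rho by rewrite normcN.
have h2 := psum_tends r0 ga wr'; rewrite -E in h2.
have -> : pser a w = 2^-1 * (pser a w + pser a w) by field.
apply: tends_eq (tendsM (tends_cst 2^-1) (tendsD h1 h2)) => N.
rewrite /psum -big_split /= mulr_sumr; apply: eq_bigr => j _.
by rewrite exprNn -signr_odd; case: odd => /=; rewrite ?expr1 ?expr0; field.
Qed.

(** The leading coefficient comes from the energy estimate, the parity from evenness of [u] combined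
    with its periodicity. *)
Lemma pot_local k : exists (a : nat -> C) (rho K : R), [/\ 0 < rho, geo a rho K,
  a 0%N = (n k)%:R * ((n k)%:R + 1), forall j, odd j -> a j = 0 &
  forall w, 0 < normc w < rho -> reg tau (omega tau k / 2 + w) /\
    w ^+ 2 * pot u (omega tau k / 2 + w) = pser a w].
Proof.
set p := omega tau k / 2.
have [c c0 sep] := half_period_sep tau_upper.
have [M] := u_log k; rewrite -/p => /nbhsCP[r r0 rM].
(* Within [r1] there is no other half period, the logarithmic bound holds, and the radius is at most
   1 as the energy estimate requires. *)
pose r1 := Num.min 1 (Num.min c r).
have r10 : 0 < r1 by rewrite !lt_min ltr01 c0.
have Rp z : ann p 0 r1 z -> reg tau z.
  move=> /andP[z0 z1] hz; move: z1; rewrite !lt_min => /and3P[_ z1 _].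
  have E : z = p by apply: sep => //; exact: half_omega.
  by move: z0; rewrite E subrr Normc.normc0 ltxx.
have Hb z : ann p 0 r1 z -> `|u z - 4 * (n k)%:R * ln (normc (z - p))| <= M.
  move=> /andP[z0 z1]; move: z1; rewrite !lt_min => /and3P[_ _ z1].
  by apply: rM => //; rewrite -subr_eq0 -normc_gt0.
have hpot := pot_hol tau_upper u_smooth pde.
have cu z : ann p 0 r1 z -> {for z, continuous (uzz u)}.
  move=> Dz; have Rz := Rp z Dz.
  have cp := hol_cont hpot Rz; have cm := wd_cont (mu_wd tau_upper u_smooth pde Rz).
  have E : (fun z => - 2 * pot u z + 1 / 2 * (mu u z * mu u z)) = uzz u.
    by apply/funext => x; rewrite /pot; field.
  rewrite -E.
  exact (@ccD _ _ (fun z => - 2 * pot u z) (fun z => 1 / 2 * (mu u z * mu u z)) z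
    (@ccM _ _ (fun=> -2) (pot u) z (@cc_cst _ _ (-2) z) cp)
    (@ccM _ _ (fun=> 1 / 2) (fun z => mu u z * mu u z) z (@cc_cst _ _ (1 / 2) z) (@ccM _ _ (mu u) (mu u) z cm cm))).
have hf : hol (ann p 0 r1) (fz (mu u) (uzz u) p).
  have oA := @copen_ann _ p 0 r1.
  refine (holM oA (holX 2 oA (hol_sub_cst p oA)) _).
  by refine (hol_sub _ hpot) => z /Rp.
have rle : r1 <= 1 by rewrite ge_min lexx.
have [a [rho [K [rho0 ga a0 ps]]]] := fz_pser r10 rle (fun z Dz => u_wd tau_upper u_smooth (Rp z Dz))
  (fun z Dz => mu_wd tau_upper u_smooth pde (Rp z Dz)) cu Hb hf.
pose rho' := Num.min rho r1.
have rho'0 : 0 < rho' by rewrite lt_min rho0.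
have pw w : p + w - p = w by rewrite addrC addKr.
have fzE w : fz (mu u) (uzz u) p (p + w) = w ^+ 2 * pot u (p + w) by rewrite /fz pw.
have Rw w : 0 < normc w < rho' -> reg tau (p + w).
  by move=> /andP[w0]; rewrite lt_min => /andP[_ w1]; apply: Rp; rewrite /ann /= pw w0.
exists (fun j => if odd j then 0 else a j), rho', K; split => //.
- by apply: geo_le (geo_even ga) => //; rewrite ge_min lexx.
- by move=> j ->.
move=> w wr; split; first exact: Rw.
have /andP[w0 w1] := wr.
have w2 : normc w < rho by apply: lt_le_trans w1 _; rewrite ge_min lexx.
rewrite (pser_even rho0 ga w2); first by rewrite -fzE ps // w0.
have nr : 0 < normc (- w) < rho by rewrite normcN w0.
have e1 : fz (mu u) (uzz u) p (p + w) = pser a w by apply: ps; rewrite w0 w2.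
rewrite -e1 -(ps _ nr) !fzE sqrrN; congr (_ * _).
have wr' : 0 < normc (- w) < rho' by rewrite normcN.
(* The reflection in the half period, [z -> omega_k - z], is negation followed by a lattice
   translation. *)
have -> : p + w = - (p - w) + omega tau k by rewrite /p; field.
rewrite pot_per; [|exact: lattice_omega|by apply (proj2 (regN tau_upper (p - w))); exact: Rw].
by apply: (pot_even tau_upper u_smooth pde) => //; exact: Rw.
Qed.

Lemma pser_shift2 (a : nat -> C) (rho K : R) w : 0 < rho -> geo a rho K -> a 1%N = 0 -> normc w < rho ->
  pser a w = a 0%N + w ^+ 2 * pser (fun j => a j.+2) w.
Proof.
move=> r0 ga a1 wr; apply: pser_eq; apply/tends_S/tends_S.
have g2 : geo (fun j => a j.+2) rho (K / rho ^+ 2).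
  case: ga => K0 H; split; first by rewrite divr_ge0 ?exprn_ge0 // ltW.
  by move=> j; rewrite -mulrA -invfM -exprD.
apply: tends_eq (tendsD (tends_cst (a 0%N)) (tendsM (tends_cst (w ^+ 2)) (psum_tends r0 g2 wr))) => N.
by rewrite !psum_recl a1 add0r mulrA expr2.
Qed.

Lemma wp_term_hol (k : 'I_4) (D : set C) : copen D -> (forall z, D z -> ~ lattice tau (z + omega tau k / 2)) ->
  hol D (fun z => weierstrass_p tau (z + omega tau k / 2)).
Proof.
move=> oD HD; exact (@hol_comp_add _ _ _ _ _ oD (wp_hol tau_upper) HD).
Qed.

Lemma omega_lat (k : 'I_4) : omega tau k = lat tau (odd k)%:Z (1 < k)%N%:Z.
Proof. by case: k => -[|[|[|[|//]]]] kl; rewrite /omega /lat /= ?mulr0z ?mulr1z ?mul0r ?mul1r ?add0r ?addr0. Qed.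

Lemma omega_half_inj (j k : 'I_4) : lattice tau (omega tau j / 2 - omega tau k / 2) -> j = k.
Proof.
case=> a [b E].
have : lat tau (2 * a) (2 * b) == omega tau j - omega tau k.
  have -> : omega tau j - omega tau k = 2 * (omega tau j / 2 - omega tau k / 2) by field.
  by rewrite E /lat !intrM; apply/eqP; ring.
rewrite -subr_eq0 !omega_lat opprB !latN !latD (lat_eq0 tau_upper) => /andP[/eqP E1 /eqP E2].
move: j k E1 E2 {E} => [[|[|[|[|//]]]] jl] [[|[|[|[|//]]]] kl] /= E1 E2; try (by apply: val_inj); exfalso; lia.
Qed.

Lemma reg_nlat z k : reg tau z -> ~ lattice tau (z + omega tau k / 2).
Proof.
move=> Rz h; apply: Rz; exists k.
have -> : z - omega tau k / 2 = z + omega tau k / 2 + - omega tau k by field.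
by apply: latticeD => //; apply/latticeN/lattice_omega.
Qed.

Lemma half_lat z k : lattice tau (z + omega tau k / 2) -> half_periods tau z.
Proof. by move=> h; apply: contrapT => Rz; exact: (reg_nlat Rz h). Qed.

Lemma pot_lame : exists E, forall z, reg tau z -> pot u z = lame_potential tau n E z.
Proof.
pose N k : C := (n k * (n k).+1)%:R.
pose S z : C := \sum_(k < 4) N k * weierstrass_p tau (z + omega tau k / 2).
have hpot := pot_hol tau_upper u_smooth pde.
have oR := copen_reg tau_upper.
have [E EP] : exists E, forall z, reg tau z -> pot u z - S z = E; last first.
  by exists E => z Rz; rewrite -(EP z Rz) /lame_potential addrC subrK.
apply (torus_const tau_upper).
- refine (holB oR hpot (hol_sum _ oR _)) => k.
  refine (holM oR (hol_cst _ oR) (wp_term_hol oR _)) => z Rz; exact: reg_nlat.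
- move=> w z lw Rz; rewrite pot_per //; congr (_ - _); apply: eq_bigr => k _.
  by rewrite addrAC wp_shift.
move=> p [k lk].
have [a [rho [K [rho0 ga a0 aodd ps]]]] := pot_local k.
have [r r0 [g hg wpg]] := wp_pole tau_upper.
have [c c0 sep] := half_period_sep tau_upper.
pose d := Num.min rho (Num.min r c).
have d0 : 0 < d by rewrite !lt_min rho0 r0.
have oD := @copen_disc R p d.
have dd (z : C) : disc p d z -> [/\ normc (z - p) < rho, normc (z - p) < r & normc (z - p) < c].
  by rewrite /disc /= !lt_min => /and3P[].
exists d => //.
(* Near a point congruent to [omega_k / 2] only the [k]-th summand can be singular, as [omega_k / 2]
   and [- omega_k / 2] are congruent; its principal part [n_k (n_k + 1) / (z - p) ^ 2] cancels that
   of [pot], whose expansion has no term in [1 / (z - p)]. *)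
exists (fun z => pser (fun j => a j.+2) (z - p) - N k * g (z - p)
  - \sum_(j < 4) (if j == k then 0 else N j * weierstrass_p tau (z + omega tau j / 2))).
  have g2 : geo (fun j => a j.+2) rho (K / rho ^+ 2).
    case: ga => K0 H; split; first by rewrite divr_ge0 ?exprn_ge0 // ltW.
    by move=> j; rewrite -mulrA -invfM -exprD.
  refine (holB oD (holB oD _ _) (hol_sum _ oD _)).
  + by refine (@hol_comp_add _ _ _ _ (- p) oD (pser_hol g2 rho0) _) => z /dd[].
  + refine (holM oD (hol_cst _ oD) _).
    by refine (@hol_comp_add _ _ _ _ (- p) oD hg _) => z /dd[_ h _]; rewrite /disc /= subr0.
  + move=> j; have [jk|jk] := eqVneq j k; first exact: hol_cst.
    refine (holM oD (hol_cst _ oD) (wp_term_hol oD _)) => z /dd[_ _ h] lz.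
    have zp : z = p by apply: sep => //; [exact: half_lat lz|exists k].
    move/eqP: jk; apply; apply: omega_half_inj.
    have -> : omega tau j / 2 - omega tau k / 2 = (z + omega tau j / 2) - (p - omega tau k / 2) - omega tau k.
      by rewrite zp; field.
    by apply: latticeD; [apply: latticeD => //; exact: latticeN|apply: latticeN; exact: lattice_omega].
move=> z /andP[z0 zd]; have [z1 z2 z3] := dd z zd.
have [Rz E] := ps (z - p) (introT andP (conj z0 z1)).
have ez : z = omega tau k / 2 + (z - p) + (p - omega tau k / 2) by ring.
have Rz' : reg tau z by rewrite ez; apply (proj2 (reg_shift tau_upper _ lk)).
split => //.
have w0 : z - p != 0 by rewrite -normc_gt0.
have -> : pot u z = pot u (omega tau k / 2 + (z - p)) by rewrite {1}ez pot_per.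
have -> : pot u (omega tau k / 2 + (z - p)) = N k * isq (z - p) + pser (fun j => a j.+2) (z - p).
  apply: (mulfI (expf_neq0 2 w0)); rewrite E (pser_shift2 rho0 ga) //; last by rewrite aodd.
  rewrite a0 /N natrM -natr1 /isq; field; exact: w0.
have -> : S z = N k * (isq (z - p) + g (z - p)) +
    \sum_(j < 4) (if j == k then 0 else N j * weierstrass_p tau (z + omega tau j / 2)).
  rewrite /S (bigD1 k) //= [in RHS](bigD1 k) //= eqxx add0r; congr (_ + _); last first.
    by apply: eq_bigr => j /negbTE ->.
  rewrite -wpg ?z0 //; congr (_ * _).
  have -> : z + omega tau k / 2 = z - p + ((p - omega tau k / 2) + omega tau k) by field.
  by rewrite wp_shift //; apply: latticeD => //; exact: lattice_omega.
by ring.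
Qed.

End Potential.

(** * From the distributional to the pointwise equation *)

Section BoxIntegral.
Context {R : realType}.
Local Notation mu := (@lebesgue_measure R).
Local Notation MR := (measurableTypeR R).

Lemma box_near (q r e N X y : R) : N < e / 2 -> e <= r -> q - N < X -> X < q + N ->
  X - N < y -> y < X + N -> `|q - y| < r.
Proof. by move=> h1 h2 h3 h4 h5 h6; rewrite ltr_norml; lra. Qed.

Lemma box_in (q N X : R) : q - N < X -> X < q + N -> X - N < q < X + N.
Proof. by move=> h1 h2; lra. Qed.

(** The product sigma-algebra is generated by rectangles: the open preimages are countable unions of
    boxes with rational centres and half-sides [1 / (n + 1)]. *)
Lemma cont2_measurable (H : MR * MR -> R) : continuous (H : R * R -> R) -> measurable_fun setT H.
Proof.
move=> cH; apply: (measurability _ (RGenOInfty.measurableE R)).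
move=> _ [_ [a ->] <-]; rewrite setTI.
pose box (i : rat * rat * nat) : set (MR * MR) :=
  `]ratr i.1.1 - i.2.+1%:R^-1, ratr i.1.1 + i.2.+1%:R^-1[ `*`
  `]ratr i.1.2 - i.2.+1%:R^-1, ratr i.1.2 + i.2.+1%:R^-1[.
have -> : H @^-1` `]a, +oo[%classic =
    \bigcup_i (if `[< box i `<=` H @^-1` `]a, +oo[ >] then box i else set0).
  apply/seteqP; split => [q /= Hq|q [i _]]; last by case: asboolP => // h /h.
  rewrite in_itv /= andbT in Hq.
  have /cvgrPdist_lt/(_ (H q - a))[|[A B] /= [[r1 r10 A1] [r2 r20 B2]] AB] := cH q; first by rewrite subr_gt0.
  pose e := Num.min r1 r2; have e0 : 0 < e by rewrite lt_min r10 r20.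
  have [n n2] : exists n : nat, n.+1%:R^-1 < e / 2.
    by have [n _ nP] := @near_infty_natSinv_lt R (PosNum (divr_gt0 e0 (ltr0n R 2))); exists n; apply: nP => /=.
  have n0 : 0 < n.+1%:R^-1 :> R by rewrite invr_gt0 ltr0n.
  have l1 (x : R) : x - n.+1%:R^-1 < x + n.+1%:R^-1 by rewrite ltrD2l gtrN.
  have [x1] := rat_in_itvoo (l1 q.1).
  have [x2] := rat_in_itvoo (l1 q.2).
  rewrite !in_itv /= => /andP[h3 h4] /andP[h1 h2].
  exists ((x1, x2), n) => //; case: asboolP => [_|]; last first.
    case=> -[y1 y2] [] /=; rewrite !in_itv /= => /andP[g1 g2] /andP[g3 g4].
    have /AB : (A `*` B) (y1, y2).
      split; [apply: A1|apply: B2]; rewrite /ball /=.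
        by apply: (box_near n2 _ h1 h2 g1 g2); rewrite ge_min lexx.
      by apply: (box_near n2 _ h3 h4 g3 g4); rewrite ge_min lexx orbT.
    by rewrite /= andbT => /ltr_normlW; rewrite ltrD2l ltrNl opprK.
  by split; rewrite /= in_itv /=; exact: box_in.
apply: countable_bigcupT_measurable => // i; case: asboolP => // _.
by apply: measurableX; exact: measurable_itv.
Qed.

Lemma int_fine (a b : R) (f : R -> R) : continuous f ->
  (\int[mu]_(x in `[a, b]) (f x)%:E = (rint a b f)%:E)%E.
Proof.
move=> cf; rewrite /rint /Rintegral fineK //.
by apply: integrable_fin_num; [exact: measurable_itv|exact: cont_integrable].
Qed.

Lemma slice1 (H : R * R -> R) x : continuous H -> continuous (fun y => H (x, y)).
Proof.
move=> cH y; apply: (@continuous_comp _ _ _ (fun y : R => (x, y)) H); last exact: cH.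
exact: (cvg_pair (cvg_cst x) cvg_id).
Qed.

Lemma slice2 (H : R * R -> R) y : continuous H -> continuous (fun x => H (x, y)).
Proof.
move=> cH x; apply: (@continuous_comp _ _ _ (fun x : R => (x, y)) H); last exact: cH.
exact: (cvg_pair cvg_id (cvg_cst y)).
Qed.

Lemma cont_rint1 (H : R * R -> R) (c d : R) : c <= d -> continuous H ->
  continuous (fun x => rint c d (fun y => H (x, y))).
Proof.
move=> cd cH x; apply: (@int_param_cont _ c d x (fun x y => H (x, y))) => //.
  by near=> t; exact: slice1.
have E : (fun p : R * R => H (p.1, p.2)) = H by apply/funext => -[].
by move=> th _; rewrite E; exact: (cH (x, th)).
Unshelve. all: by end_near. Qed.

Lemma int_box (H : R * R -> R) (a b c d : R) : a <= b -> c <= d -> continuous H ->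
  (\int[mu \x mu]_(p in (`[a, b] `*` `[c, d] : set (MR * MR))) (H p)%:E =
    (rint a b (fun x => rint c d (fun y => H (x, y))))%:E)%E /\
  rint a b (fun x => rint c d (fun y => H (x, y))) = rint c d (fun y => rint a b (fun x => H (x, y))).
Proof.
move=> ab cd cH; set K := _ `*` _.
have mK : measurable K by apply: measurableX; exact: measurable_itv.
have kK : compact (K : set (R * R)) by apply: compact_setX; exact: segment_compact.
have bH : [bounded H x | x in (K : set (R * R))].
  have := compact_bounded (continuous_compact (continuous_subspaceT cH) kK).
  move=> [M [Mr HM]]; exists M; split => // x Mx y Ky.
  by apply: HM => //; exists y.
have Kfin : ((mu \x mu) K < +oo)%E.
  rewrite /K product_measure1E; [|exact: measurable_itv|exact: measurable_itv].
  have m_itv (x y : R) : (0 <= mu `[x, y] < +oo)%E.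
    rewrite measure_ge0 /= (_ : mu [set` `[x, y]] = if x < y then (y - x)%:E else 0%E).
      by case: ifP => _; rewrite ltry.
    by rewrite lebesgue_measure_itv /= lte_fin EFinN -EFinB; case: ifP.
  have /andP[h1 h2] := m_itv a b; have /andP[h3 h4] := m_itv c d.
  by apply: lte_mul_pinfty; rewrite ?ge0_fin_numE.
have iH : (mu \x mu)%E.-integrable K (EFin \o H).
  by apply: measurable_bounded_integrable => //; apply: measurable_funS (cont2_measurable cH).
have [|i_f _] := @integrable_mkcond _ _ _ (mu \x mu)%E K (EFin \o H).
  by apply: measurableX; exact: measurable_itv.
have {}i_f := i_f iH.
have cx := cont_rint1 cd cH.
have cy : continuous (fun y => rint a b (fun x => H (x, y))).
  pose H' (p : R * R) := H (p.2, p.1).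
  have cH' : continuous H'.
    move=> p; apply: (@continuous_comp _ _ _ (fun p : R * R => (p.2, p.1)) H); last exact: cH.
    exact: (cvg_pair cvg_snd cvg_fst).
  exact: (cont_rint1 ab cH').
have e1 : (\int[mu \x mu]_(p in K) (H p)%:E = (rint a b (fun x => rint c d (fun y => H (x, y))))%:E)%E.
  rewrite integral_mkcond -integral12_prod_meas1 // -int_fine // [RHS]integral_mkcond.
  apply: eq_integral => x _; rewrite /patch; case: ifPn => xab.
    rewrite -int_fine; last exact: slice1.
    rewrite [RHS]integral_mkcond; apply: eq_integral => y _; rewrite /patch.
    congr (if _ then _ else _); apply/idP/idP; rewrite !inE /K /=.
      by case.
    by move=> yc; split => //; rewrite inE in xab.
  apply: integral0_eq => y _; rewrite /patch ifN // notin_setE /K /= => -[h _].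
  by move: xab; rewrite notin_setE.
have e2 : (\int[mu \x mu]_(p in K) (H p)%:E = (rint c d (fun y => rint a b (fun x => H (x, y))))%:E)%E.
  rewrite integral_mkcond -integral21_prod_meas1 // -int_fine // [RHS]integral_mkcond.
  apply: eq_integral => y _; rewrite /patch; case: ifPn => yab.
    rewrite -int_fine; last exact: slice2.
    rewrite [RHS]integral_mkcond; apply: eq_integral => x _; rewrite /patch.
    congr (if _ then _ else _); apply/idP/idP; rewrite !inE /K /=.
      by case.
    by move=> yc; split => //; rewrite inE in yab.
  apply: integral0_eq => x _; rewrite /patch ifN // notin_setE /K /= => -[_ h].
  by move: yab; rewrite notin_setE.
by split; [exact: e1|apply: EFin_inj; rewrite -e1 -e2].
Qed.

End BoxIntegral.

(** * Smooth test functions *)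

Section SmoothFunctions.
Context {R : realType}.
Local Notation C := (cplx R).
Implicit Types f g p q : C -> R.

(** Both partial derivatives as given functions, so that [dx] and [dy] can be computed and [Ck]
    proved by induction. *)
Definition partials f p q := forall z : C,
  is_derive (complex.Re z) 1 (fun x => f (x +i* complex.Im z)) (p z) /\
  is_derive (complex.Im z) 1 (fun y => f (complex.Re z +i* y)) (q z).

Lemma partials_dx f p q : partials f p q -> dx f = p /\ dy f = q.
Proof.
move=> H; split; apply/funext => z; have [h1 h2] := H z; rewrite ?/dx ?/dy derive1E.
  by case: h1.
by case: h2.
Qed.

Lemma CkS k f p q : continuous f -> partials f p q -> Ck k setT p -> Ck k setT q -> Ck k.+1 setT f.
Proof.
move=> cf H cp cq; have [Ep Eq] := partials_dx H.
split; first by move=> z _; exact: cf.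
split; last by rewrite Ep Eq.
by move=> z _; case: (H z) => -[h1 _] [h2 _]; exact (conj h1 h2).
Qed.

Lemma Ck_partials k f : Ck k.+1 setT f -> partials f (dx f) (dy f).
Proof.
move=> [_ [h _]] z; have [h1 h2] := h z I; rewrite /dx /dy !derive1E.
exact (conj (DeriveDef h1 (erefl _)) (DeriveDef h2 (erefl _))).
Qed.

Lemma Ck_gcont k f : Ck k setT f -> continuous f.
Proof. by move=> h z; exact: (Ck_cont h I). Qed.

Lemma Ck_le k f : Ck k.+1 setT f -> Ck k setT f.
Proof.
elim: k f => [|k IH] f cf; first by split => // z _; exact: (Ck_gcont cf).
by apply: CkS (Ck_gcont cf) (Ck_partials cf) _ _; apply: IH; [exact: Ck_dxC cf|exact: Ck_dyC cf].
Qed.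

Lemma partialsD f g p q p' q' : partials f p q -> partials g p' q' ->
  partials (fun z => f z + g z) (fun z => p z + p' z) (fun z => q z + q' z).
Proof. by move=> H H' z; have [h1 h2] := H z; have [h3 h4] := H' z; split; exact: is_deriveD. Qed.

Lemma partialsM f g p q p' q' : partials f p q -> partials g p' q' ->
  partials (fun z => f z * g z) (fun z => p z * g z + f z * p' z) (fun z => q z * g z + f z * q' z).
Proof.
move=> H H' z; have [h1 h2] := H z; have [h3 h4] := H' z.
by split; apply: is_derive_eq; case: z {H H' h1 h2 h3 h4} => a b; rewrite /GRing.scale /=; ring.
Qed.

Lemma Ck_add k f g : Ck k setT f -> Ck k setT g -> Ck k setT (fun z => f z + g z).
Proof.
have c f' g' : continuous f' -> continuous g' -> continuous (fun z : C => f' z + g' z : R).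
  by move=> cf cg z; exact: (cvgD (cf z) (cg z)).
elim: k f g => [|k IH] f g cf cg.
  by split => // z _; exact: (c _ _ (Ck_gcont cf) (Ck_gcont cg)).
apply: (CkS (c _ _ (Ck_gcont cf) (Ck_gcont cg)) (partialsD (Ck_partials cf) (Ck_partials cg))).
  by apply: IH; [exact: Ck_dxC cf|exact: Ck_dxC cg].
by apply: IH; [exact: Ck_dyC cf|exact: Ck_dyC cg].
Qed.

Lemma Ck_mul k f g : Ck k setT f -> Ck k setT g -> Ck k setT (fun z => f z * g z).
Proof.
have c f' g' : continuous f' -> continuous g' -> continuous (fun z : C => f' z * g' z : R).
  by move=> cf cg z; exact: (cvgM (cf z) (cg z)).
elim: k f g => [|k IH] f g cf cg.
  by split => // z _; exact: (c _ _ (Ck_gcont cf) (Ck_gcont cg)).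
apply: (CkS (c _ _ (Ck_gcont cf) (Ck_gcont cg)) (partialsM (Ck_partials cf) (Ck_partials cg))).
  by apply: Ck_add; apply: IH; [exact: Ck_dxC cf|exact: Ck_le|exact: Ck_le|exact: Ck_dxC cg].
by apply: Ck_add; apply: IH; [exact: Ck_dyC cf|exact: Ck_le|exact: Ck_le|exact: Ck_dyC cg].
Qed.

Lemma Ck_cst k (c : R) : Ck k setT (fun=> c).
Proof.
elim: k c => [|k IH] c; first by split => // z _; exact (@rc_cst R C c z).
apply: (@CkS _ _ (fun=> 0) (fun=> 0)) => //; first by move=> z; exact (@rc_cst R C c z).
by move=> z; split; exact: is_derive_cst.
Qed.

#[local] Opaque dx dy.

Definition lin (a b c : R) (z : C) : R := a * complex.Re z + b * complex.Im z + c.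

Lemma Re_cont : continuous (fun z : C => complex.Re z).
Proof.
move=> z; apply/contCRP => e e0; exists e => // w; apply: le_lt_trans.
by rewrite -cReB normc_Re.
Qed.

Lemma Im_cont : continuous (fun z : C => complex.Im z).
Proof.
move=> z; apply/contCRP => e e0; exists e => // w; apply: le_lt_trans.
by rewrite -cImB normc_Im.
Qed.

Lemma lin_cont a b c : continuous (lin a b c).
Proof.
move=> z.
exact (@rcD R C (fun z => a * complex.Re z + b * complex.Im z) (fun=> c) z
  (@rcD R C (fun z => a * complex.Re z) (fun z => b * complex.Im z) z
    (@rcM R C (fun=> a) _ z (@rc_cst R C a z) (@Re_cont z)) (@rcM R C (fun=> b) _ z (@rc_cst R C b z) (@Im_cont z)))
  (@rc_cst R C c z)).
Qed.

Lemma lin_partials a b c : partials (lin a b c) (fun=> a) (fun=> b).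
Proof.
by move=> z; split; rewrite /lin /=; apply: is_derive_eq; rewrite /GRing.scale /=; ring.
Qed.

Lemma comp_partials (h h' : R -> R) f p q : (forall x : R, is_derive x 1 h (h' x)) -> partials f p q ->
  partials (fun z => h (f z)) (fun z => h' (f z) * p z) (fun z => h' (f z) * q z).
Proof.
move=> dh H z; have [h1 h2] := H z; split.
  have := @is_derive1_comp _ h (fun x => f (x +i* complex.Im z)) (complex.Re z) _ _ (dh _) h1.
  by case: z {H h1 h2}.
have := @is_derive1_comp _ h (fun y => f (complex.Re z +i* y)) (complex.Im z) _ _ (dh _) h2.
by case: z {H h1 h2}.
Qed.

Lemma Ck_trig k a b c : Ck k setT (fun z => cos (lin a b c z)) /\ Ck k setT (fun z => sin (lin a b c z)).
Proof.
have cc : continuous (fun z : C => cos (lin a b c z)).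
  by move=> z; apply: continuous_comp; [exact: lin_cont|exact: continuous_cos].
have cs : continuous (fun z : C => sin (lin a b c z)).
  by move=> z; apply: continuous_comp; [exact: lin_cont|exact: continuous_sin].
elim: k => [|k [IHc IHs]]; first by split; split => // z _; [exact: cc|exact: cs].
have Hc := comp_partials (@is_derive_cos R) (lin_partials a b c).
have Hs := comp_partials (@is_derive_sin R) (lin_partials a b c).
have n : Ck k setT (fun z => - sin (lin a b c z)).
  have -> : (fun z => - sin (lin a b c z)) = (fun z => -1 * sin (lin a b c z)) by apply/funext => z; rewrite mulN1r.
  by apply: Ck_mul => //; exact: Ck_cst.
split.
  by apply: (CkS cc Hc); apply: Ck_mul => //; exact: Ck_cst.
by apply: (CkS cs Hs); apply: Ck_mul => //; exact: Ck_cst.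
Qed.

(** The flat functions [p (1 / x) exp (- 1 / x)], with [p] arbitrary so that the family is closed
    under differentiation; [p = 1] is the usual one. *)
Definition flat (p : {poly R}) (x : R) : R := if 0 < x then p.[x^-1] * expR (- x^-1) else 0.

(** From [exp y >= y] at [y = 1 / (N x)], raised to the power [N]. *)
Lemma exp_flat N : exists2 K : R, 0 <= K & forall x : R, 0 < x -> expR (- x^-1) <= K * x ^+ N.
Proof.
exists (N%:R ^+ N); first by rewrite exprn_ge0.
move=> x x0; case: N => [|N].
  by rewrite !expr0 mulr1 -expR0 ler_expR oppr_le0 invr_ge0 ltW.
have N0 : 0 < N.+1%:R :> R by rewrite ltr0n.
have -> : - x^-1 = N.+1%:R * (- (x * N.+1%:R)^-1).
  by field; rewrite !gt_eqF.
rewrite expRM_natl -exprMn lerXn2r ?nnegrE ?expR_ge0 ?mulr_ge0 ?(ltW x0) //.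
have w0 : 0 < (x * N.+1%:R)^-1 by rewrite invr_gt0 mulr_gt0.
rewrite expRN -[leRHS]invrK lef_pV2 ?posrE ?expR_gt0 ?invr_gt0 ?mulr_gt0 //.
rewrite [N.+1%:R * x]mulrC; by apply: le_trans (expR_ge1Dx _); rewrite lerDr ler01.
Qed.

Lemma flat_small (p : {poly R}) N : exists2 K : R, 0 <= K & forall x : R, 0 < x -> `|flat p x| <= K * x ^+ N.
Proof.
elim/poly_ind: p N => [|p c IH] N.
  by exists 0 => // x x0; rewrite /flat x0 horner0 !mul0r normr0.
have [K K0 H] := IH N.+1; have [K' K'0 H'] := exp_flat N.
exists (K + `|c| * K'); first by rewrite addr_ge0 // mulr_ge0.
move=> x x0; have := H x x0; rewrite /flat x0 hornerD hornerM hornerX hornerC mulrDl => h.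
rewrite (le_trans (ler_normD _ _)) // mulrDl lerD //.
  have -> : p.[x^-1] * x^-1 * expR (- x^-1) = (p.[x^-1] * expR (- x^-1)) * x^-1 by ring.
  rewrite normrM (@ger0_norm _ x^-1) ?invr_ge0 ?(ltW x0) // ler_pdivrMr //.
  by apply: le_trans h _; rewrite exprS mulrCA mulrC.
by rewrite normrM -mulrA ler_wpM2l // ger0_norm ?expR_ge0 // H'.
Qed.

(** The derivative of [p (1 / x) exp (- 1 / x)] is [x ^ -2 (p - p') (1 / x) exp (- 1 / x)]. *)
Definition dflat (p : {poly R}) : {poly R} := 'X^2 * (p - p^`()).

Lemma horner_der (p : {poly R}) (x : R) : is_derive x 1 (fun x => p.[x]) p^`().[x].
Proof.
elim/poly_ind: p => [|p c IH].
  have -> : (fun x : R => (0 : {poly R}).[x]) = (fun=> 0) by apply/funext => y; rewrite horner0.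
  by rewrite linear0 horner0; exact: is_derive_cst.
have -> : (fun x : R => (p * 'X + c%:P).[x]) = (fun x => p.[x] * x + c).
  by apply/funext => y; rewrite hornerD hornerM hornerX hornerC.
by apply: is_derive_eq; rewrite derivD derivM derivX derivC mulr1 !hornerE /GRing.scale /=; ring.
Qed.

Lemma is_derive_near_eq (f g : R -> R) (x l r : R) : 0 < r -> (forall y, `|y - x| < r -> f y = g y) ->
  is_derive x 1 f l -> is_derive x 1 g l.
Proof.
move=> r0 fg /is_deriveRP H; apply/is_deriveRP => e e0; have [d d0 dH] := H e e0.
exists (Num.min d r); first by rewrite lt_min d0.
move=> h; rewrite lt_min => /andP[hd hr].
rewrite -(fg x) ?subrr ?normr0 // -(fg (x + h)); last by rewrite addrC addKr.
exact: dH.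
Qed.

Lemma flat_der (p : {poly R}) (x : R) : is_derive x 1 (flat p) (flat (dflat p) x).
Proof.
have [x0|x0|<-] := ltgtP 0 x.
- have xn : x != 0 by rewrite gt_eqF.
  have h1 : is_derive x 1 (fun x : R => x^-1) (- x ^- 2).
    by have := is_deriveV xn (is_derive_id x 1); rewrite /GRing.scale /= mulr1.
  have h2 := is_derive1_comp (horner_der p x^-1) h1.
  have h3 : is_derive x 1 (fun x : R => expR (- x^-1)) (expR (- x^-1) * x ^- 2).
    have h4 : is_derive x 1 (fun x : R => - x^-1) (x ^- 2) by have := is_deriveN h1; rewrite opprK.
    exact (@is_derive1_comp _ expR (fun x => - x^-1) x _ _ (is_derive_expR (- x^-1)) h4).
  have h5 : is_derive x 1 (fun x : R => p.[x^-1] * expR (- x^-1)) (flat (dflat p) x).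
    apply: is_derive_eq (is_deriveM h2 h3) _.
    rewrite /flat x0 /dflat hornerM hornerXn hornerD hornerN /GRing.scale /= -exprVn.
    by ring.
  apply: (is_derive_near_eq x0 _ h5) => y; rewrite ltr_norml => /andP[y0 _].
  by rewrite /flat (_ : 0 < y) //; lra.
- rewrite {2}/flat ltNge (ltW x0) /=.
  have nx : 0 < - x by rewrite oppr_gt0.
  apply: (is_derive_near_eq nx _ (is_derive_cst 0 x 1)) => y; rewrite ltr_norml => /andP[_ y0].
  by rewrite /flat ltNge (_ : y <= 0) //; lra.
(* At 0 a quadratic bound is enough for the derivative to vanish. *)
have [K K0 H] := flat_small p 2.
rewrite {2}/flat ltxx; apply/is_deriveRP => e e0; exists (e / (K + 1)).
  by rewrite divr_gt0 // ltr_wpDl.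
move=> h; rewrite ltr_pdivlMr ?ltr_wpDl // => he.
rewrite add0r mul0r subr0 {2}/flat ltxx subr0.
have [h0|h0] := ltP 0 h; last by rewrite /flat ltNge h0 normr0 mulr_ge0 // ltW.
apply: le_trans (H h h0) _.
by move: he; rewrite gtr0_norm // => he; nra.
Qed.

Lemma flat_ge0 x : 0 <= flat 1 x.
Proof. by rewrite /flat; case: ifP => // _; rewrite hornerC mul1r expR_ge0. Qed.

Lemma flat_gt0 x : 0 < x -> 0 < flat 1 x.
Proof. by rewrite /flat => ->; rewrite hornerC mul1r expR_gt0. Qed.

Lemma flat_eq0 (p : {poly R}) x : x <= 0 -> flat p x = 0.
Proof. by rewrite /flat ltNge => ->. Qed.

(** The induction runs over all [p] at once, because differentiation replaces [p] by [dflat p]. *)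
Lemma flat_smooth f (p : {poly R}) : smooth setT f -> smooth setT (fun z => flat p (f z)).
Proof.
move=> sf k; have cf := Ck_gcont (sf 0%N).
have c (p' : {poly R}) : continuous (fun z => flat p' (f z)).
  move=> z; apply: (@continuous_comp _ _ _ f (flat p')); first exact: cf.
  exact: (is_derive_cont (flat_der p' (f z))).
elim: k p => [|k IH] p; first by split => // z _; exact: c.
have Hp := comp_partials (flat_der p) (Ck_partials (sf 1%N)).
by apply: (CkS (c p) Hp); apply: Ck_mul => //; [exact: Ck_dxC (sf k.+1)|exact: Ck_dyC (sf k.+1)].
Qed.

Lemma flat_d0 f (p : {poly R}) z : smooth setT f -> f z <= 0 ->
  dx (fun z => flat p (f z)) z = 0 /\ dy (fun z => flat p (f z)) z = 0.
Proof.
move=> sf fz; have [ex ey] := partials_dx (comp_partials (flat_der p) (Ck_partials (sf 1%N))).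
have z2 := flat_eq0 (dflat p) fz.
have E (a : R) : 0 * a = 0 by rewrite mul0r.
by rewrite ex ey z2 !E.
Qed.

Lemma flat_lap0 f (p : {poly R}) z : smooth setT f -> f z <= 0 ->
  flat p (f z) = 0 /\ laplacian (fun z => flat p (f z)) z = 0.
Proof.
move=> sf fz; split; first exact: flat_eq0.
have Hf := Ck_partials (sf 1%N).
have [ex ey] := partials_dx (comp_partials (flat_der p) Hf).
have H2 := comp_partials (flat_der (dflat p)) Hf.
have Hx := Ck_partials (Ck_dxC (sf 2%N)); have Hy := Ck_partials (Ck_dyC (sf 2%N)).
have [exx _] := partials_dx (partialsM H2 Hx).
have [_ eyy] := partials_dx (partialsM H2 Hy).
have z1 := flat_eq0 (dflat (dflat p)) fz; have z2 := flat_eq0 (dflat p) fz.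
rewrite /laplacian ex ey exx eyy z1 z2.
have E (a b c d : R) : 0 * a * a + 0 * b + (0 * c * c + 0 * d) = 0 by ring.
exact: E.
Qed.

End SmoothFunctions.

(** * Auxiliary facts on integrals and the cosine *)

Section RealLemmas.
Context {R : realType}.
Local Notation C := (cplx R).
Local Notation mu := (@lebesgue_measure R).

(** The integrand is continuous everywhere but known to be the derivative of [F] only on the
    segment, as for the clamped functions below. *)
Lemma int_FTC_in (a b : R) (F f g : R -> R) : a < b -> continuous g ->
  (forall x : R, a <= x <= b -> is_derive x 1 F (f x)) -> (forall x, a <= x <= b -> g x = f x) ->
  rint a b g = F b - F a.
Proof.
move=> ab cg dF gf.
have cF x : a <= x <= b -> {for x, continuous F} by move=> /dF; exact: is_derive_cont.
have aa : a <= a <= b by rewrite lexx ltW.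
have bb : a <= b <= b by rewrite lexx ltW.
have : (\int[mu]_(x in `[a, b]) (g x)%:E = (F b)%:E - (F a)%:E)%E.
  apply: continuous_FTC2 => //; first exact: continuous_subspaceT.
  - split => [x||]; first by rewrite in_itv /= => /andP[x1 x2]; case: (dF x) => //; lra.
    + by apply: cvg_at_right_filter; exact: cF.
    + by apply: cvg_at_left_filter; exact: cF.
  - move=> x; rewrite in_itv /= => /andP[x1 x2]; rewrite derive1E gf; last by lra.
    by case: (dF x) => //; lra.
by rewrite /rint /Rintegral => ->.
Qed.

Lemma rint_eq0 (a b x : R) (g : R -> R) : continuous g -> (forall y, a <= y <= b -> 0 <= g y) ->
  rint a b g = 0 -> a < x < b -> g x = 0.
Proof.
move=> cg g0 ig /andP[ax xb]; apply/eqP; rewrite eq_le g0 ?ax ?(ltW ax) ?(ltW xb) // andbT leNgt.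
apply/negP => gx.
have g2 : 0 < g x / 2 by rewrite divr_gt0.
have /cvgrPdist_lt/(_ _ g2)[e /= e0 eP] := cg x.
pose a' := Num.max a (x - e / 2); pose b' := Num.min b (x + e / 2).
have a1 : a <= a' by rewrite le_max lexx.
have a2 : x - e / 2 <= a' by rewrite le_max lexx orbT.
have a3 : a' < x by rewrite gt_max ax /=; lra.
have b1 : b' <= b by rewrite ge_min lexx.
have b2 : b' <= x + e / 2 by rewrite ge_min lexx orbT.
have b3 : x < b' by rewrite lt_min xb /=; lra.
have h1 : rint a' b' (fun=> g x / 2) <= rint a' b' g.
  apply: int_le => //; first by move=> y; exact: cvg_cst.
  move=> y /andP[y1 y2]; have : `|x - y| < e by rewrite ltr_norml; lra.
  by move=> /eP; rewrite ltr_norml; lra.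
have h2 : rint a' b' g <= rint a b g.
  rewrite -lee_fin -!int_fine //; apply: ge0_subset_integral => //.
  - by have /measurable_int := cont_integrable a b cg.
  - by move=> y; rewrite /= !in_itv /= => /andP[y1 y2]; lra.
move: h1 h2; rewrite ig int_cst; last by lra.
have : 0 < g x / 2 * (b' - a') by rewrite mulr_gt0 //; lra.
by lra.
Qed.

(** Retraction onto the segment. Composition with it turns functions continuous on a box into
    globally continuous ones, as the integral lemmas require. *)
Definition clamp (a b x : R) : R := if x < a then a else if b < x then b else x.

Lemma clamp_in a b x : a <= b -> a <= clamp a b x <= b.
Proof. by move=> ab; rewrite /clamp; case: ltP => h1; [lra|case: ltP; lra]. Qed.

Lemma clamp_id a b x : a <= x <= b -> clamp a b x = x.
Proof. by rewrite /clamp => /andP[h1 h2]; rewrite ltNge h1 /= ltNge h2. Qed.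

Lemma clamp_cont a b : a <= b -> continuous (clamp a b).
Proof.
move=> ab x; apply/cvgrPdist_lt => e e0; exists e => //= y; apply: le_lt_trans.
rewrite /clamp; have := ler_norm (x - y); have := ler_norm (- (x - y)); rewrite normrN => n1 n2.
rewrite ler_norml.
by case: (ltP x a) => h1; case: (ltP y a) => h2; try case: (ltP b x) => h3; try case: (ltP b y) => h4; lra.
Qed.

Lemma clamp_ext (a b c d : R) (h : C -> R) : a <= b -> c <= d ->
  (forall x y, a <= x <= b -> c <= y <= d -> {for (x +i* y : C), continuous h}) ->
  continuous (fun p : R * R => h (clamp a b p.1 +i* clamp c d p.2)).
Proof.
move=> ab cd ch p.
apply: (@continuous_comp _ _ _ (fun p : R * R => clamp a b p.1 +i* clamp c d p.2 : C) h); last first.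
  by apply: ch; exact: clamp_in.
apply: cvg_ReIm => /=.
  by apply: (@continuous_comp _ _ _ (fun p : R * R => p.1) (clamp a b)); [exact: cvg_fst|exact: clamp_cont].
by apply: (@continuous_comp _ _ _ (fun p : R * R => p.2) (clamp c d)); [exact: cvg_snd|exact: clamp_cont].
Qed.

Lemma rr_add (a b c d : R) (A B : R * R -> R) : c <= d -> continuous A -> continuous B ->
  rint a b (fun x => rint c d (fun y => A (x, y) + B (x, y))) =
  rint a b (fun x => rint c d (fun y => A (x, y))) + rint a b (fun x => rint c d (fun y => B (x, y))).
Proof.
move=> cd cA cB; rewrite -intD; [|exact: cont_rint1|exact: cont_rint1].
by apply: eq_int => x _; rewrite intD //; exact: slice1.
Qed.

Lemma oo_cc (a b x : R) : a < x < b -> a <= x <= b.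
Proof. by move=> /andP[h1 h2]; rewrite !ltW. Qed.

Lemma rr_zero (a b c d x0 y0 g : R) (A : R * R -> R) : a < x0 < b -> c < y0 < d -> continuous A ->
  (forall x y, a <= x <= b -> c <= y <= d -> 0 <= g * A (x, y)) ->
  rint a b (fun x => rint c d (fun y => A (x, y))) = 0 -> g * A (x0, y0) = 0.
Proof.
move=> x0ab y0cd cA pos A0.
have cdl : c <= d by case/andP: y0cd => h1 h2; lra.
pose H := fun x => rint c d (fun y => g * A (x, y)).
have cgA : continuous (fun p => g * A p).
  by move=> p; exact (@rcM R (R * R)%type (fun=> g) A p (@rc_cst R (R * R)%type g p) (cA p)).
have cH : continuous H := @cont_rint1 R (fun p => g * A p) c d cdl cgA.
have cg x : continuous (fun y => g * A (x, y)) := @slice1 R (fun p => g * A p) x cgA.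
have Hx0 : H x0 = 0.
  refine (@rint_eq0 a b x0 H cH _ _ x0ab) => [x xb|].
    have -> : 0 = rint c d (fun=> 0) :> R by rewrite int_cst // mul0r.
    by apply: int_le => // [|y yb]; [move=> y; exact: cvg_cst|exact: pos].
  rewrite -[RHS](mulr0 g) -A0 -intZ; last exact: cont_rint1.
  by apply: eq_int => x _; rewrite /H intZ //; exact: slice1.
apply: (@rint_eq0 c d y0 (fun y => g * A (x0, y)) (cg x0)) => // y yb.
by apply: pos => //; exact: oo_cc.
Qed.

Lemma cos_2piD (x : R) : cos (x + 2 * pi) = cos x.
Proof. by have := @cosD2pi R x; rewrite mulr2n mulrDl mul1r. Qed.

Lemma oo_co (x : R) : 0 < x < 1 -> 0 <= x < 1.
Proof. by move=> /andP[h1 h2]; rewrite (ltW h1). Qed.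

(** On [[0, 1 / 2]] the function [cos (2 pi x)] decreases, and [x -> 1 - x] reduces the other half
    to it; the bound [1 - d] keeps away from the next period. *)
Lemma cos_close (x d : R) : 0 < d -> d <= 1 / 2 -> `|x| <= 1 - d -> cos (2 * pi * d) < cos (2 * pi * x) ->
  `|x| < d.
Proof.
move=> d0 d2.
wlog x0 : x / 0 <= x.
  move=> H; have [|/ltW x0] := leP 0 x; first exact: H.
  rewrite -(normrN x) -[cos (2 * pi * x)]cosN -mulrN; apply: H.
  by rewrite oppr_ge0.
rewrite ger0_norm // => x1.
have p0 := pi_gt0 R.
have key y : d <= y -> y <= 1 / 2 -> cos (2 * pi * y) <= cos (2 * pi * d).
  move=> y1 y2; rewrite leNgt; apply/negP; rewrite ltr_cos; first by rewrite ltr_pM2l ?mulr_gt0 //; lra.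
    by rewrite in_itv /=; nra.
  by rewrite in_itv /=; nra.
move=> h; rewrite ltNge; apply/negP => dx.
have [x2|x2] := leP x (1 / 2); first by have := key x dx x2; lra.
have := key (1 - x) _ _.
have -> : cos (2 * pi * (1 - x)) = cos (2 * pi * x).
  by rewrite -[RHS]cosN -(cos_2piD (- _)); congr cos; ring.
by lra.
Qed.

Lemma cos_bump (s d : R) : 0 < d -> d <= s -> d <= 1 - s -> 0 < 1 + 1 + (1 - cos (2 * pi * d) - 2).
Proof.
move=> d0 d1 d2; have p0 := pi_gt0 R.
have : cos (2 * pi * d) < cos 0.
  rewrite ltr_cos; first by rewrite !mulr_gt0.
    by rewrite in_itv /= lexx pi_ge0.
  by rewrite in_itv /=; nra.
by rewrite cos0; lra.
Qed.

End RealLemmas.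

#[local] Opaque dx dy.

(** * Periodic bumps and the pointwise equation *)

Section WeakStrong.
Context {R : realType}.
Local Notation C := (cplx R).
Local Notation mu := (@lebesgue_measure R).
Variables (tau : C) (tau_upper : 0 < complex.Im tau) (u : C -> R) (n : 'I_4 -> nat).
Hypothesis u_smooth : smooth (reg tau) u.
Hypothesis u_per : doubly_periodic tau u.
Hypothesis weak : forall phi : C -> R, doubly_periodic tau phi -> smooth setT phi ->
  (\int[lebesgue_measure \x lebesgue_measure]_(p in parallelogram tau)
     (u (p.1 +i* p.2) * laplacian phi (p.1 +i* p.2) + expR (u (p.1 +i* p.2)) * phi (p.1 +i* p.2))%:E
   = (8 * pi * \sum_(k < 4) (n k)%:R * phi (omega tau k / 2))%:E)%E.

(** [sc] and [tc] are the coordinates in the real basis [1], [tau] of the plane. *)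
Let tc (z : C) : R := complex.Im z / complex.Im tau.
Let sc (z : C) : R := complex.Re z - tc z * complex.Re tau.

Lemma tau0 : complex.Im tau != 0. Proof. by rewrite gt_eqF. Qed.

Lemma sc_tc (s t : R) : sc (s%:C + t%:C * tau) = s /\ tc (s%:C + t%:C * tau) = t.
Proof.
have ht : tc (s%:C + t%:C * tau) = t.
  by rewrite /tc cImD cImM /=; move: tau0; move: (complex.Im tau) => x x0; field.
by split => //; rewrite /sc ht cReD cReM /=; ring.
Qed.

Lemma coords z : z = (sc z)%:C + (tc z)%:C * tau.
Proof.
apply: complex_ext; rewrite ?cReD ?cImD ?cReM ?cImM /=; rewrite /sc.
  by ring.
by rewrite /tc; move: tau0; move: (complex.Im tau) => x x0; field.
Qed.

(** In lattice coordinates [s], [t] this is [cos (2 pi (s - s0)) + cos (2 pi (t - t0)) + e - 2],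
    positive only near the centre modulo the lattice when [e] is small. Composed with [flat 1] it is
    a bump that is periodic by construction, with no sum over the lattice. *)
Definition trig_bump (s0 t0 e : R) (z : C) : R :=
  cos (lin (2 * pi) (- (2 * pi * complex.Re tau / complex.Im tau)) (- (2 * pi * s0)) z) +
  cos (lin 0 (2 * pi / complex.Im tau) (- (2 * pi * t0)) z) + (e - 2).

Lemma bumpE s0 t0 e z : trig_bump s0 t0 e z = cos (2 * pi * (sc z - s0)) + cos (2 * pi * (tc z - t0)) + (e - 2).
Proof.
rewrite /trig_bump; congr (cos _ + cos _ + _); rewrite /lin /sc /tc;
  by move: tau0; move: (complex.Im tau) => x x0; field.
Qed.

Lemma bump_smooth s0 t0 e : smooth setT (trig_bump s0 t0 e).
Proof.
by move=> k; apply: Ck_add (Ck_cst _ _); apply: Ck_add; [exact: (Ck_trig k _ _ _).1|exact: (Ck_trig k _ _ _).1].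
Qed.

Lemma bump_per s0 t0 e : doubly_periodic tau (trig_bump s0 t0 e).
Proof.
move=> z; rewrite !bumpE; rewrite (coords z); set s := sc z; set t := tc z.
have e1 : s%:C + t%:C * tau + 1 = (s + 1)%:C + t%:C * tau.
  by rewrite [(s + 1)%:C](rmorphD (real_complex R)) rmorph1; ring.
have e2 : s%:C + t%:C * tau + tau = s%:C + (t + 1)%:C * tau.
  by rewrite [(t + 1)%:C](rmorphD (real_complex R)) rmorph1; ring.
have [h1 h2] := sc_tc s t; have [h3 h4] := sc_tc (s + 1) t; have [h5 h6] := sc_tc s (t + 1).
rewrite e1 e2 h1 h2 h3 h4 h5 h6; split.
  by congr (_ + _ + _); rewrite -[RHS]cos_2piD; congr cos; ring.
by congr (_ + _ + _); rewrite -[RHS]cos_2piD; congr cos; ring.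
Qed.

Lemma bump_support s0 t0 d z : 0 < d -> d <= s0 -> d <= 1 - s0 -> d <= t0 -> d <= 1 - t0 ->
  0 <= sc z < 1 -> 0 <= tc z < 1 -> 0 < trig_bump s0 t0 (1 - cos (2 * pi * d)) z ->
  `|sc z - s0| < d /\ `|tc z - t0| < d.
Proof.
move=> d0 h1 h2 h3 h4 /andP[s1 s2] /andP[t1 t2]; rewrite bumpE => h.
have d2 : d <= 1 / 2 by lra.
have c1 := @cos_le1 R (2 * pi * (sc z - s0)); have c2 := @cos_le1 R (2 * pi * (tc z - t0)).
split; apply: (cos_close d0 d2).
- by rewrite ler_norml; lra.
- by lra.
- by rewrite ler_norml; lra.
- by lra.
Qed.

Let G (z : C) : R := laplacian u z + expR (u z).

Lemma ucont (f : C -> R) z : smooth (reg tau) f -> reg tau z -> {for z, continuous f}.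
Proof. by move=> sf Rz; exact: (Ck_cont (sf 0%N) Rz). Qed.

Lemma lap_cont z : reg tau z -> {for z, continuous (laplacian u)}.
Proof.
move=> Rz; have h1 := ucont (smooth_dx (smooth_dx u_smooth)) Rz.
have h2 := ucont (smooth_dy (smooth_dy u_smooth)) Rz.
exact (@rcD R C (dx (dx u)) (dy (dy u)) z h1 h2).
Qed.

Lemma G_cont z : reg tau z -> {for z, continuous G}.
Proof.
move=> Rz; apply (@rcD R C (laplacian u) (fun z => expR (u z)) z (lap_cont Rz)).
by apply: (@continuous_comp _ _ _ u expR); [exact: ucont|exact: continuous_expR].
Qed.

(** If the defect [G] did not vanish at the point, it would keep its sign on a small box inside the
    open parallelogram. Against a bump that vanishes outside that box within the parallelogram, the
    weak equation becomes, by integration by parts, a vanishing integral of [phi G], whose integrand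
    has one sign and is not 0 at the centre. *)
Lemma box_point (s0 t0 : R) : 0 < s0 < 1 -> 0 < t0 < 1 -> reg tau (s0%:C + t0%:C * tau) ->
  G (s0%:C + t0%:C * tau) = 0.
Proof.
move=> /andP[s00 s01] /andP[t00 t01]; set z0 := _ + _ => Rz0.
apply/eqP; apply: contrapT => /negP G0.
have [sz tz] : sc z0 = s0 /\ tc z0 = t0 := sc_tc s0 t0.
have It := tau_upper.
have [r [r0 rP]] : exists r : R, 0 < r /\ forall z : C, `|complex.Re z - complex.Re z0| <= r ->
    `|complex.Im z - complex.Im z0| <= r -> [/\ reg tau z, 0 < sc z < 1, 0 < tc z < 1 & 0 <= G z0 * G z].
  have [d1 d10 H1] := copen_reg tau_upper Rz0.
  have g0 : 0 < `|G z0| by rewrite normr_gt0.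
  have /contCRP/(_ _ g0)[d2 d20 H2] := G_cont Rz0.
  pose m := Num.min (Num.min s0 (1 - s0)) (Num.min t0 (1 - t0)).
  have m0 : 0 < m by rewrite !lt_min s00 t00 /=; lra.
  have ms : m <= s0 by rewrite !ge_min lexx.
  have ms' : m <= 1 - s0 by rewrite !ge_min lexx !orbT.
  have mt : m <= t0 by rewrite !ge_min lexx !orbT.
  have mt' : m <= 1 - t0 by rewrite !ge_min lexx !orbT.
  (* [q] bounds the change of the lattice coordinates in terms of that of the real and imaginary
     parts. *)
  pose q := 1 + (`|complex.Re tau| + 1) / complex.Im tau.
  have q0 : 0 < q by rewrite /q ltr_pwDl // divr_ge0 ?addr_ge0 // ltW.
  exists (Num.min (Num.min d1 d2 / 3) (m / q / 2)); split.
    by rewrite lt_min !divr_gt0 // lt_min d10.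
  move=> z; rewrite !le_min => /andP[x1 x2] /andP[y1 y2].
  have zd : normc (z - z0) < Num.min d1 d2.
    have dm : 0 < Num.min d1 d2 by rewrite lt_min d10.
    apply: le_lt_trans (normc_le _) _; rewrite cReB cImB; lra.
  move: zd; rewrite lt_min => /andP[/H1 Rz /H2 Gz].
  have dt : tc z - t0 = (complex.Im z - complex.Im z0) / complex.Im tau by rewrite -tz /tc; ring.
  have ds : sc z - s0 = (complex.Re z - complex.Re z0) - (tc z - t0) * complex.Re tau.
    by rewrite -sz -tz /sc; ring.
  pose k := m / q / 2; rewrite -/k in x2 y2.
  have k0 : 0 < k by rewrite !divr_gt0.
  have mq : k * q < m by rewrite /k mulrAC divfK ?gt_eqF //; lra.
  have qk : k * q = k + k / complex.Im tau * `|complex.Re tau| + k / complex.Im tau.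
    by rewrite /q; move: tau0; move: (complex.Im tau) => x xn; field.
  have kI : 0 < k / complex.Im tau by rewrite divr_gt0.
  have tb : `|tc z - t0| <= k / complex.Im tau.
    by rewrite dt normrM normfV (gtr0_norm It) ler_wpM2r // invr_ge0 ltW.
  have a0 : 0 <= k / complex.Im tau * `|complex.Re tau| by rewrite mulr_ge0 // ltW.
  have tb' : `|tc z - t0| < m by lra.
  have sb : `|sc z - s0| < m.
    rewrite ds; apply: le_lt_trans (ler_normB _ _) _; rewrite normrM.
    have := ler_wpM2r (normr_ge0 (complex.Re tau)) tb; lra.
  move: sb tb'; rewrite !ltr_norml => /andP[b1 b2] /andP[b3 b4].
  split => //; [lra|lra|].
  move: Gz; have [g1|g1] := leP 0 (G z0).
    by rewrite (ger0_norm g1) ltr_norml => /andP[g2 _]; rewrite mulr_ge0 //; lra.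
  by rewrite (ltr0_norm g1) ltr_norml => /andP[_ g2]; rewrite mulr_le0 //; lra.
pose x0 := complex.Re z0; pose y0 := complex.Im z0.
pose a := x0 - r; pose b := x0 + r; pose c := y0 - r; pose d := y0 + r.
have ab : a < b by rewrite /a /b; lra.
have cd : c < d by rewrite /c /d; lra.
have inK x y : a <= x <= b -> c <= y <= d ->
    [/\ reg tau (x +i* y), 0 < sc (x +i* y) < 1, 0 < tc (x +i* y) < 1 & 0 <= G z0 * G (x +i* y)].
  by move=> xb yb; apply: rP; rewrite /= ler_norml; rewrite /a /b /c /d in xb yb; lra.
(* This [q] serves the opposite direction, from lattice coordinates to real and imaginary parts. *)
pose q := 1 + `|complex.Re tau| + complex.Im tau.
have q0 : 0 < q by rewrite /q addr_gt0 // ltr_pwDl.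
pose dl := Num.min (Num.min (Num.min s0 (1 - s0)) (Num.min t0 (1 - t0))) (r / q).
have dl0 : 0 < dl by rewrite !lt_min divr_gt0 // s00 t00 /=; lra.
have l1 : dl <= s0 by rewrite !ge_min lexx.
have l2 : dl <= 1 - s0 by rewrite !ge_min lexx !orbT.
have l3 : dl <= t0 by rewrite !ge_min lexx !orbT.
have l4 : dl <= 1 - t0 by rewrite !ge_min lexx !orbT.
have l5 : dl * q <= r by rewrite -ler_pdivlMr // !ge_min lexx !orbT.
pose th := trig_bump s0 t0 (1 - cos (2 * pi * dl)).
have supp z : 0 <= sc z < 1 -> 0 <= tc z < 1 -> 0 < th z -> a < complex.Re z < b /\ c < complex.Im z < d.
  move=> s1 t1 /(bump_support dl0 l1 l2 l3 l4 s1 t1)[b1 b2].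
  have rx : complex.Re z - x0 = (sc z - s0) + (tc z - t0) * complex.Re tau.
    by rewrite -sz -tz /sc /x0; ring.
  have ry : complex.Im z - y0 = (tc z - t0) * complex.Im tau.
    by rewrite -tz /tc /y0; move: tau0; move: (complex.Im tau) => x xn; field.
  have hx : `|complex.Re z - x0| < r.
    rewrite rx; apply: le_lt_trans (ler_normD _ _) _; rewrite normrM.
    apply: lt_le_trans l5; rewrite /q !mulrDr mulr1.
    have := ler_wpM2r (normr_ge0 (complex.Re tau)) (ltW b2).
    have := mulr_gt0 dl0 It; lra.
  have hy : `|complex.Im z - y0| < r.
    rewrite ry normrM (gtr0_norm It); apply: lt_le_trans l5; rewrite /q !mulrDr mulr1.
    have := ler_wpM2r (ltW It) (ltW b2).
    have : 0 <= dl * `|complex.Re tau| by rewrite mulr_ge0 // ltW.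
    by lra.
  by move: hx hy; rewrite !ltr_norml /a /b /c /d; lra.
pose phi z := flat 1 (th z).
have sth : smooth setT th by exact: bump_smooth.
have sphi : smooth setT phi by exact: flat_smooth.
have per : doubly_periodic tau phi.
  by move=> z; have [h1 h2] := bump_per s0 t0 (1 - cos (2 * pi * dl)) z; rewrite /phi /th h1 h2.
have out z : 0 <= sc z < 1 -> 0 <= tc z < 1 -> ~ (a < complex.Re z < b /\ c < complex.Im z < d) -> th z <= 0.
  by move=> s1 t1 no; rewrite leNgt; apply/negP => /(supp z s1 t1).
have W := weak per sphi.
(* The box contains regular points only, so the bump vanishes at every half period. *)
have rhs0 : \sum_(k < 4) (n k)%:R * phi (omega tau k / 2) = 0.
  rewrite big1 // => k _; rewrite /phi flat_eq0 ?mulr0 //.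
  have E : omega tau k / 2 = ((odd k)%:R / 2)%:C + ((1 < k)%N%:R / 2)%:C * tau.
    by rewrite omega_lat /lat !rmorphM !fmorphV !rmorph_nat !pmulrn; ring.
  have [e1 e2] := sc_tc ((odd k)%:R / 2) ((1 < k)%N%:R / 2).
  apply: out; rewrite ?E ?e1 ?e2; [case: odd => /=; lra|case: ltnP => /= _; lra|].
  rewrite -E => -[h1 h2].
  have [Rk _ _ _] := inK (complex.Re (omega tau k / 2)) (complex.Im (omega tau k / 2)) ltac:(lra) ltac:(lra).
  by apply: Rk; have := half_omega tau k; case: (omega tau k / 2).
rewrite rhs0 mulr0 in W.
set f := fun p : R * R => u (p.1 +i* p.2) * laplacian phi (p.1 +i* p.2) + expR (u (p.1 +i* p.2)) * phi (p.1 +i* p.2) in W.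
pose K : set (measurableTypeR R * measurableTypeR R) := `[a, b]%classic `*` `[c, d]%classic.
have inP x y : K (x, y) -> parallelogram tau (x, y).
  rewrite /K /= !in_itv /= => -[xb yb]; have [_ s1 t1 _] := inK x y xb yb.
  by exists (sc (x +i* y)), (tc (x +i* y)); split; [lra|lra|exact: coords].
have IK : (\int[lebesgue_measure \x lebesgue_measure]_(p in K) (f p)%:E = 0%:E)%E.
  rewrite -W [LHS]integral_mkcond [RHS]integral_mkcond; apply: eq_integral => -[x y] _; rewrite /patch.
  case: ifPn => hK; first by rewrite ifT // inE; apply: inP; rewrite inE in hK.
  case: ifPn => // hP; rewrite inE in hP; case: hP => s [t [s1 t1 E]].
  have [e1 e2] := sc_tc s t.
  have thz : th (x +i* y) <= 0.
    apply: out; [by rewrite [x +i* y]E e1|by rewrite [x +i* y]E e2|].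
    move=> /= [h1 h2]; move: hK; rewrite notin_setE; apply; rewrite /K /= !in_itv /=; lra.
  have [p0 l0] := flat_lap0 1 sth thz.
  by rewrite /f /= /phi l0 p0 !mulr0 addr0.
(* The integrand is [phi G] plus two exact derivatives: of [u phi_x - u_x phi] in [x], and of
   [u phi_y - u_y phi] in [y]. *)
pose h0 z := phi z * G z.
pose h1 z := u z * dx (dx phi) z - dx (dx u) z * phi z.
pose h2 z := u z * dy (dy phi) z - dy (dy u) z * phi z.
have cphi (g : C -> R) z : smooth setT g -> {for z, continuous g} by move=> sg; exact: (Ck_gcont (sg 0%N)).
have abl := ltW ab; have cdl := ltW cd.
pose ext (h : C -> R) (p : R * R) := h (clamp a b p.1 +i* clamp c d p.2).
have extE h x y : a <= x <= b -> c <= y <= d -> ext h (x, y) = h (x +i* y) by move=> xb yb; rewrite /ext !clamp_id.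
have c0 : continuous (ext h0).
  apply: clamp_ext => // x y xb yb; have [Rz _ _ _] := inK x y xb yb.
  exact (@rcM R C phi G _ (cphi _ _ sphi) (G_cont Rz)).
have c1 : continuous (ext h1).
  apply: clamp_ext => // x y xb yb; have [Rz _ _ _] := inK x y xb yb.
  apply (@rcB R C (fun z => u z * dx (dx phi) z) (fun z => dx (dx u) z * phi z)).
    exact (@rcM R C u (dx (dx phi)) _ (ucont u_smooth Rz) (cphi _ _ (smooth_dx (smooth_dx sphi)))).
  exact (@rcM R C (dx (dx u)) phi _ (ucont (smooth_dx (smooth_dx u_smooth)) Rz) (cphi _ _ sphi)).
have c2 : continuous (ext h2).
  apply: clamp_ext => // x y xb yb; have [Rz _ _ _] := inK x y xb yb.
  apply (@rcB R C (fun z => u z * dy (dy phi) z) (fun z => dy (dy u) z * phi z)).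
    exact (@rcM R C u (dy (dy phi)) _ (ucont u_smooth Rz) (cphi _ _ (smooth_dy (smooth_dy sphi)))).
  exact (@rcM R C (dy (dy u)) phi _ (ucont (smooth_dy (smooth_dy u_smooth)) Rz) (cphi _ _ sphi)).
have c12 : continuous (fun p => ext h1 p + ext h2 p).
  by move=> p; exact (@rcD R (R * R)%type (ext h1) (ext h2) p (c1 p) (c2 p)).
have c012 : continuous (fun p => ext h0 p + (ext h1 p + ext h2 p)).
  by move=> p; exact (@rcD R (R * R)%type (ext h0) (fun p => ext h1 p + ext h2 p) p (c0 p) (c12 p)).
have alg (U P Eu A B A' B' : R) : U * (A + B) + Eu * P = P * (A' + B' + Eu) + (U * A - A' * P + (U * B - B' * P)).
  by ring.
have fE z : u z * laplacian phi z + expR (u z) * phi z = h0 z + (h1 z + h2 z) by exact: alg.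
have fK (x y : R) : a <= x <= b -> c <= y <= d -> f (x, y) = ext h0 (x, y) + (ext h1 (x, y) + ext h2 (x, y)).
  move=> xb yb; have e0 := extE h0 x y xb yb; have e1 := extE h1 x y xb yb; have e2 := extE h2 x y xb yb.
  exact (etrans (fE (x +i* y)) (esym (f_equal2 +%R e0 (f_equal2 +%R e1 e2)))).
have [B1 _] := int_box abl cdl c012.
have sum0 : rint a b (fun x => rint c d (fun y => ext h0 (x, y) + (ext h1 (x, y) + ext h2 (x, y)))) = 0.
  apply: EFin_inj; rewrite -B1 -IK; apply: eq_integral => -[x y]; rewrite inE /K /= !in_itv /= => -[xb yb].
  exact (congr1 EFin (esym (fK x y xb yb))).
rewrite (@rr_add R a b c d (ext h0) (fun p => ext h1 p + ext h2 p) cdl c0 c12) in sum0.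
rewrite (@rr_add R a b c d (ext h1) (ext h2) cdl c1 c2) in sum0.
have der (g : C -> R) x y : smooth (reg tau) g -> a <= x <= b -> c <= y <= d ->
    is_derive (x : R) 1 (fun x => g (x +i* y)) (dx g (x +i* y)) /\
    is_derive (y : R) 1 (fun y => g (x +i* y)) (dy g (x +i* y)).
  move=> sg xb yb; have [Rz _ _ _] := inK x y xb yb.
  by split; [exact: (Ck_dx (sg 1%N) Rz)|exact: (Ck_dy (sg 1%N) Rz)].
have der' (g : C -> R) x y : smooth setT g ->
    is_derive (x : R) 1 (fun x => g (x +i* y)) (dx g (x +i* y)) /\
    is_derive (y : R) 1 (fun y => g (x +i* y)) (dy g (x +i* y)).
  by move=> sg; split; [exact: (Ck_dx (sg 1%N) I)|exact: (Ck_dy (sg 1%N) I)].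
have edge x y : a <= x <= b -> c <= y <= d -> ~ (a < x < b /\ c < y < d) ->
    [/\ phi (x +i* y) = 0, dx phi (x +i* y) = 0 & dy phi (x +i* y) = 0].
  move=> xb yb no; have [_ s1 t1 _] := inK x y xb yb.
  have thz : th (x +i* y) <= 0 by apply: out; [exact: oo_co|exact: oo_co|].
  by have [d1 d2] := flat_d0 1 sth thz; split => //; exact: flat_eq0.
have alg2 (U Ux P Px Uxx Pxx : R) : U *: Pxx + Px *: Ux - (Ux *: Px + P *: Uxx) = U * Pxx - Uxx * P.
  by rewrite /GRing.scale /=; ring.
have out_r (B : Prop) : ~ (a < b < b /\ B) by move=> [/andP[_]]; rewrite ltxx.
have out_l (B : Prop) : ~ (a < a < b /\ B) by move=> [/andP[]]; rewrite ltxx.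
have out_r' (B : Prop) : ~ (B /\ c < d < d) by move=> [_ /andP[_]]; rewrite ltxx.
have out_l' (B : Prop) : ~ (B /\ c < c < d) by move=> [_ /andP[]]; rewrite ltxx.
have z1 : rint a b (fun x => rint c d (fun y => ext h1 (x, y))) = 0.
  have [_ ->] := int_box abl cdl c1.
  rewrite (@eq_int _ c d _ (fun=> 0)); first by rewrite int_cst // mul0r.
  move=> y yb; pose F (x : R) : R := u (x +i* y) * dx phi (x +i* y) - dx u (x +i* y) * phi (x +i* y).
  have dF (x : R) : a <= x <= b -> is_derive x 1 F (h1 (x +i* y)).
    move=> xb; have [d1 _] := der u x y u_smooth xb yb; have [d2 _] := der _ x y (smooth_dx u_smooth) xb yb.
    have [d3 _] := der' phi x y sphi; have [d4 _] := der' _ x y (smooth_dx sphi).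
    have D := is_deriveB (is_deriveM d1 d4) (is_deriveM d2 d3).
    refine (is_derive_eq D _); exact: alg2.
  have gF (x : R) : a <= x <= b -> ext h1 (x, y) = h1 (x +i* y) by move=> xb; exact: extE.
  have [p1 p2 _] := edge b y (andb_true_intro (conj abl (lexx b))) yb (@out_r _).
  have [p3 p4 _] := edge a y (andb_true_intro (conj (lexx a) abl)) yb (@out_l _).
  rewrite (@int_FTC_in R a b F _ _ ab (@slice2 R (ext h1) y c1) dF gF) /F p1 p2 p3 p4.
  by rewrite !mulr0 !subr0.
have z2 : rint a b (fun x => rint c d (fun y => ext h2 (x, y))) = 0.
  rewrite (@eq_int _ a b _ (fun=> 0)); first by rewrite int_cst // mul0r.
  move=> x xb; pose F (y : R) : R := u (x +i* y) * dy phi (x +i* y) - dy u (x +i* y) * phi (x +i* y).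
  have dF (y : R) : c <= y <= d -> is_derive y 1 F (h2 (x +i* y)).
    move=> yb; have [_ d1] := der u x y u_smooth xb yb; have [_ d2] := der _ x y (smooth_dy u_smooth) xb yb.
    have [_ d3] := der' phi x y sphi; have [_ d4] := der' _ x y (smooth_dy sphi).
    have D := is_deriveB (is_deriveM d1 d4) (is_deriveM d2 d3).
    refine (is_derive_eq D _); exact: alg2.
  have gF (y : R) : c <= y <= d -> ext h2 (x, y) = h2 (x +i* y) by move=> yb; exact: extE.
  have [p1 _ p2] := edge x d xb (andb_true_intro (conj cdl (lexx d))) (@out_r' _).
  have [p3 _ p4] := edge x c xb (andb_true_intro (conj (lexx c) cdl)) (@out_l' _).
  rewrite (@int_FTC_in R c d F _ _ cd (@slice1 R (ext h2) x c2) dF gF) /F p1 p2 p3 p4.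
  by rewrite !mulr0 !subr0.
have alg3 (A B D : R) : A + (B + D) = 0 -> B = 0 -> D = 0 -> A = 0 by move=> h hB hD; move: h; rewrite hB hD !addr0.
have {}sum0 := alg3 _ _ _ sum0 z1 z2.
have pos x y : a <= x <= b -> c <= y <= d -> 0 <= G z0 * ext h0 (x, y).
  move=> xb yb; have [_ _ _ g0] := inK x y xb yb; have e0 := extE h0 x y xb yb.
  rewrite e0 /h0 mulrCA; apply: mulr_ge0 => //; exact: flat_ge0.
have xin : a < x0 < b by rewrite /a /b ltrBlDr ltrDl r0.
have yin : c < y0 < d by rewrite /c /d ltrBlDr ltrDl r0.
have E0 := rr_zero xin yin c0 pos sum0.
have e0 := extE h0 x0 y0 (oo_cc xin) (oo_cc yin); rewrite e0 in E0.
have phi0 : 0 < phi z0.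
  apply: flat_gt0; rewrite /th bumpE sz tz !subrr mulr0 cos0.
  exact: (cos_bump dl0 l1 l2).
move: E0; rewrite (_ : x0 +i* y0 = z0); last by rewrite /x0 /y0; case: (z0).
rewrite /h0 => /eqP; rewrite !mulf_eq0 (gt_eqF phi0) /= orbb => /eqP h.
by move: G0; rewrite h eqxx.
Qed.

Lemma dx_shift (f : C -> R) w z : dx f (z + w) = dx (fun z => f (z + w)) z /\
  dy f (z + w) = dy (fun z => f (z + w)) z.
Proof.
#[local] Transparent dx dy.
rewrite /dx /dy !derive1E /derive; split; congr (lim (_ @ 0^')); apply/funext => h /=.
  congr (_ *: (f _ - f _)); first by apply: complex_ext; rewrite /= ?cReD ?cImD /=; ring.
  by apply: complex_ext; rewrite /= ?cReD ?cImD.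
congr (_ *: (f _ - f _)); first by apply: complex_ext; rewrite /= ?cReD ?cImD /=; ring.
by apply: complex_ext; rewrite /= ?cReD ?cImD.
Qed.

Lemma G_shift w z : lattice tau w -> G (z + w) = G z.
Proof.
move=> lw; have us : (fun z => u (z + w)) = u by apply/funext => x; exact: lattice_per.
have [ex ey] : (fun z => dx u (z + w)) = dx u /\ (fun z => dy u (z + w)) = dy u.
  by split; apply/funext => x; have [h1 h2] := dx_shift u w x; rewrite ?h1 ?h2 us.
rewrite /G /laplacian; have [-> _] := dx_shift (dx u) w z; have [_ ->] := dx_shift (dy u) w z.
by rewrite ex ey (lattice_per u_per).
Qed.

(** A lattice translation brings the point to the closed parallelogram; by continuity of the defect
    it is enough to treat interior points near it. *)
Lemma strong z : reg tau z -> laplacian u z = - expR (u z).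
Proof.
move=> Rz; apply/eqP; rewrite -addr_eq0 -/(G z); apply: contrapT => /negP Gz.
have [w [s [t [lw /andP[s0 s1] /andP[t0 t1] E]]]] := lattice_repr tau_upper z.
set z1 := s%:C + t%:C * tau in E.
have Rz1 : reg tau z1 by apply/(reg_shift tau_upper _ lw); rewrite -E.
have Gz1 : G z1 != 0 by move: Gz; rewrite E G_shift.
have [d1 d10 H1] := copen_reg tau_upper Rz1.
have g0 : 0 < `|G z1| by rewrite normr_gt0.
have /contCRP/(_ _ g0)[d2 d20 H2] := G_cont Rz1.
pose K := 1 + normc tau; have K0 : 0 < K by rewrite ltr_pwDl // normc_ge0.
pose m := Num.min d1 d2; have m0 : 0 < m by rewrite lt_min d10.
pose e := Num.min (1 / 2) (m / K / 2).
have e0 : 0 < e by rewrite lt_min !divr_gt0.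
have e1 : e <= 1 / 2 by rewrite ge_min lexx.
have e2 : e <= m / K / 2 by rewrite ge_min lexx orbT.
(* Moving slightly towards the centre of the parallelogram enters its interior. *)
pose s' := s + e * (1 / 2 - s); pose t' := t + e * (1 / 2 - t).
have s'0 : 0 < s' < 1 by rewrite /s'; apply/andP; split; nra.
have t'0 : 0 < t' < 1 by rewrite /t'; apply/andP; split; nra.
pose z2 := s'%:C + t'%:C * tau.
have zd : normc (z2 - z1) < m.
  have -> : z2 - z1 = (s' - s)%:C + (t' - t)%:C * tau.
    by rewrite /z2 /z1 !rmorphB; ring.
  apply: le_lt_trans (normcD _ _) _; rewrite normcM !normc_real.
  have hs : `|s' - s| <= e by rewrite /s' addrC addKr normrM (gtr0_norm e0) ger_pMr // ler_norml; lra.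
  have ht : `|t' - t| <= e by rewrite /t' addrC addKr normrM (gtr0_norm e0) ger_pMr // ler_norml; lra.
  have h3 : `|t' - t| * normc tau <= e * normc tau by rewrite ler_wpM2r ?normc_ge0.
  have h4 : e * K <= m / 2 by rewrite -ler_pdivlMr // mulrAC.
  by rewrite /K in h4; lra.
move: zd; rewrite lt_min => /andP[/H1 Rz2 /H2].
by rewrite (box_point s'0 t'0 Rz2) sub0r normrN ltxx.
Qed.

End WeakStrong.

(** * Local solutions of the linear equation *)

Section PowerSeriesSolutions.
Context {R : realType}.
Local Notation C := (cplx R).

(** Course-of-values recursion stated as a fixed point: [F j] may look at the whole sequence but
    depends only on its entries below [j]. The sequence is built through the lists of its initial
    segments. *)
Lemma strong_rec (F : nat -> (nat -> C) -> C) :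
  (forall j c c', (forall i, (i < j)%N -> c i = c' i) -> F j c = F j c') ->
  exists c, forall j, c j = F j c.
Proof.
move=> HF.
pose s := fix s n : seq C := if n is n'.+1 then rcons (s n') (F n' (nth 0 (s n'))) else [::].
have sz n : size (s n) = n by elim: n => //= n IH; rewrite size_rcons IH.
have st n m i : (i < n)%N -> (n <= m)%N -> nth 0 (s m) i = nth 0 (s n) i.
  move=> ni; elim: m => [|m IH]; first by rewrite leqn0 => /eqP ->.
  rewrite leq_eqVlt => /orP[/eqP -> //|]; rewrite ltnS => nm.
  by rewrite /= nth_rcons sz (leq_trans ni nm) IH.
exists (fun j => nth 0 (s j.+1) j) => j.
change (nth 0 (rcons (s j) (F j (nth 0 (s j)))) j = F j (fun j => nth 0 (s j.+1) j)).
rewrite nth_rcons sz ltnn eqxx; apply: HF => i ij.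
exact: (st i.+1 j i).
Qed.

(** Radii for two successive differentiations of a series. *)
Lemma radii (r : R) : 0 < r -> [/\ 0 < r * 3 / 4, r * 3 / 4 < r, 0 < r / 2 & r / 2 < r * 3 / 4].
Proof. by move=> r0; split; lra. Qed.

Lemma natC_neq0 (j : nat) : (j.+1%:R : C) != 0.
Proof. by rewrite pnatr_eq0. Qed.

(** Comparing coefficients in [y'' = b y] gives [(j + 2) (j + 1) c_{j+2} = conv b c j], with the
    first two coefficients free; a geometric majorant is carried through the recursion. *)
Lemma regular_series (b : nat -> C) (rho K : R) (x0 x1 : C) : 0 < rho -> geo b rho K ->
  exists (c : nat -> C) (r M : R), [/\ 0 < r, r <= rho, geo c r M, c 0%N = x0 /\ c 1%N = x1 &
    forall w, normc w < r -> pser (pder (pder c)) w = pser b w * pser c w].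
Proof.
move=> r0 [K0 Hb].
pose F j c : C := if j is j'.+2 then conv b c j' / (j'.+2%:R * j'.+1%:R) else if j is 1 then x1 else x0.
have [c cP] : exists c, forall j, c j = F j c.
  apply: strong_rec => -[//|[//|j]] c c' H /=; congr (_ / _); apply: eq_bigr => i _.
  by rewrite H // ltnS (leq_trans (leq_subr _ _)).
(* The ratio [L / rho] is chosen so that [L >= 1] and [(L / rho) ^ 2 >= K]; these absorb one step of
   the recursion. *)
pose L := 1 + K * rho ^+ 2.
have L1 : 1 <= L by rewrite lerDl mulr_ge0 // exprn_ge0 // ltW.
have L0 : 0 < L by lra.
pose M := normc x0 + normc x1 * rho.
have M0 : 0 <= M by rewrite addr_ge0 ?mulr_ge0 ?normc_ge0 // ltW.
have bound j : normc (c j) <= M * (L / rho) ^+ j.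
  elim/ltn_ind: j => -[|[|j]] IH.
  - by rewrite cP expr0 mulr1 lerDl mulr_ge0 ?normc_ge0 // ltW.
  - rewrite cP expr1 mulrA ler_pdivlMr //=.
    apply: (@le_trans _ _ (M * 1)); last by rewrite ler_wpM2l.
    by rewrite mulr1 lerDr normc_ge0.
  rewrite cP /= normcM normcV normcM !normc_natr ler_pdivrMr ?mulr_gt0 ?ltr0n //.
  have t i : (i <= j)%N -> normc (b i * c (j - i)%N) <= K * M * (L / rho) ^+ j.
    move=> ij; rewrite normcM.
    apply: (@le_trans _ _ (K / rho ^+ i * (M * (L / rho) ^+ (j - i)))).
      by rewrite ler_pM ?normc_ge0 // IH // ltnS (leq_trans (leq_subr _ _)).
    rewrite -[in leRHS](subnKC ij) exprD.
    have e : rho ^- i <= (L / rho) ^+ i.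
      by rewrite expr_div_n ler_pdivlMr ?exprn_gt0 // mulVf ?gt_eqF ?exprn_gt0 // exprn_ege1.
    rewrite [leLHS](_ : _ = K * M * (L / rho) ^+ (j - i) * rho ^- i); last by ring.
    rewrite [leRHS](_ : _ = K * M * (L / rho) ^+ (j - i) * (L / rho) ^+ i); last by ring.
    by rewrite ler_wpM2l // !mulr_ge0 // exprn_ge0 // divr_ge0 // ltW.
  have h : normc (conv b c j) <= j.+1%:R * (K * M * (L / rho) ^+ j).
    apply: le_trans (normc_sum _ _ _) _.
    apply: (@le_trans _ _ (\sum_(i < j.+1) K * M * (L / rho) ^+ j)).
      by apply: ler_sum => i _; apply: t; rewrite -ltnS.
    by rewrite sumr_const card_ord mulr_natl.
  apply: le_trans h _.
  have q0 : 0 <= M * (L / rho) ^+ j by rewrite mulr_ge0 // exprn_ge0 // divr_ge0 // ltW.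
  have e2 : K <= (L / rho) ^+ 2.
    rewrite expr_div_n ler_pdivlMr ?exprn_gt0 //; apply: (@le_trans _ _ L); first by rewrite /L; lra.
    by rewrite expr2 ler_peMr // ltW.
  rewrite [leLHS](_ : _ = M * (L / rho) ^+ j * K * j.+1%:R); last by ring.
  rewrite -addn2 exprD [leRHS](_ : _ = M * (L / rho) ^+ j * (L / rho) ^+ 2 * j.+1%:R * (j + 2)%:R); last by ring.
  rewrite -[leLHS]mulr1; apply: ler_pM => //; last by rewrite ler1n addn2.
    by rewrite !mulr_ge0 // ?exprn_ge0 // ?divr_ge0 // ltW.
  by rewrite ler_wpM2r // ler_wpM2l.
pose r1 := rho / L.
have r10 : 0 < r1 by rewrite divr_gt0.
have r1r : r1 <= rho by rewrite ler_pdivrMr // ler_peMr // ltW.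
have gc : geo c r1 M.
  split => // j; apply: le_trans (bound j) _.
  by rewrite /r1 -exprVn invf_div.
have ga : geo b r1 K by apply: (geo_le r10 r1r); split.
exists c, (r1 / 2), M; split.
- by rewrite divr_gt0.
- by lra.
- by apply: geo_le gc; lra.
- by split; rewrite cP.
move=> w wr; have wr1 : normc w < r1 by lra.
apply: pser_eq; apply: tends_eq (pser_conv r10 ga gc wr1) => N.
apply: eq_bigr => j _; congr (_ * _); rewrite /pder [c j.+2]cP /=.
by move: (natC_neq0 j) (natC_neq0 j.+1); move: (j.+1%:R) (j.+2%:R) (conv b c j) => A B X A0 B0; field; rewrite A0 B0.
Qed.

Lemma psum_ext (a b : nat -> C) N w : (forall j, a j = b j) -> psum a N w = psum b N w.
Proof. by move=> ab; apply: eq_bigr => j _; rewrite ab. Qed.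

(** Multiplication by the index is the Euler operator [w d/dw]; the shift in the number of terms
    accounts for the constant that it kills. *)
Lemma psum_euler1 (c : nat -> C) N w : psum (fun j => j%:R * c j) N.+1 w = w * psum (pder c) N w.
Proof. by rewrite psum_recl mul0r add0r. Qed.

Lemma psum_euler2 (c : nat -> C) N w :
  psum (fun j => j%:R * (j%:R - 1) * c j) N.+2 w = w ^+ 2 * psum (pder (pder c)) N w.
Proof.
rewrite !psum_recl mul0r mul0r add0r subrr mulr0 mul0r add0r mulrA expr2; congr (_ * _).
by apply: psum_ext => j; rewrite /pder -[j.+2%:R]natr1; ring.
Qed.

(* The Frobenius method: [w ^ s * pser c w] solves [y'' = w ^ -2 * pser a w * y]. The odd coefficients
   vanish, which is what prevents a resonance between the two exponents. *)
Lemma frobenius_series (a : nat -> C) (rho K : R) (s : C) : 0 < rho -> geo a rho K ->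
  a 0%N = s * (s - 1) -> (forall j, odd j -> a j = 0) ->
  (forall j, (0 < j)%N -> ~~ odd j -> j%:R <= normc (j%:R * (j%:R - 1 + 2 * s) : C)) ->
  exists (c : nat -> C) (r M : R), [/\ 0 < r, r <= rho, geo c r M, c 0%N = 1 &
    forall w, normc w < r ->
     w ^+ 2 * pser (pder (pder c)) w + 2 * s * (w * pser (pder c) w) + s * (s - 1) * pser c w = pser a w * pser c w].
Proof.
move=> r0 ga a0 aodd Hden; have [K0 Ha] := ga.
(* [den j] is [(s + j) (s + j - 1) - s (s - 1)], the value of the indicial polynomial at [s + j]. *)
pose den j : C := j%:R * (j%:R - 1 + 2 * s).
pose F j (c : nat -> C) : C := if j == 0%N then 1 else if odd j then 0 else
  (\sum_(i < j) a i.+1 * c (j - i.+1)%N) / den j.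
have [c cP] : exists c, forall j, c j = F j c.
  apply: strong_rec => j c c' H; rewrite /F; case: ifP => // j0; case: ifP => // _.
  congr (_ / _); apply: eq_bigr => i _; rewrite H // ltn_subrL /= lt0n j0 //.
have codd j : odd j -> c j = 0 by rewrite cP /F; case: j => // j ->.
(* For odd [j] one of the two indices in every product is odd, so setting the odd coefficients to 0
   satisfies the recursion even where [den j] vanishes. *)
have sodd j : odd j -> \sum_(i < j) a i.+1 * c (j - i.+1)%N = 0.
  move=> oj; apply: big1 => i _; have [oi|ei] := boolP (odd i.+1); first by rewrite aodd // mul0r.
  by rewrite codd ?mulr0 // oddB ?oj ?(negbTE ei).
pose L := 1 + K.
have L1 : 1 <= L by rewrite lerDl.
have L0 : 0 < L by lra.
have q0 : 0 <= L / rho by rewrite divr_ge0 // ltW.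
have bound j : normc (c j) <= (L / rho) ^+ j.
  elim/ltn_ind: j => j IH; rewrite cP /F; case: ifPn => [/eqP ->|j0]; first by rewrite expr0 (normc_real 1) normr1.
  case: ifPn => [_|ej]; first by rewrite Normc.normc0 exprn_ge0.
  have jpos : (0 < j)%N by rewrite lt0n.
  have jR : 0 < j%:R :> R by rewrite ltr0n.
  have dj := Hden j jpos ej; rewrite -/(den j) in dj.
  have dj0 : 0 < normc (den j) by apply: lt_le_trans dj.
  rewrite normcM normcV ler_pdivrMr //; apply: (@le_trans _ _ ((L / rho) ^+ j * j%:R)); last first.
    by rewrite ler_wpM2l // exprn_ge0.
  apply: le_trans (normc_sum _ _ _) _.
  apply: (@le_trans _ _ (\sum_(i < j) (L / rho) ^+ j)); last by rewrite sumr_const card_ord mulr_natr.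
  apply: ler_sum => i _; rewrite normcM.
  have ij : (i < j)%N by [].
  apply: (@le_trans _ _ (K / rho ^+ i.+1 * (L / rho) ^+ (j - i.+1))).
    by rewrite ler_pM ?normc_ge0 // IH // ltn_subrL.
  rewrite -[in leRHS](subnKC ij) exprD ler_wpM2r ?exprn_ge0 // expr_div_n.
  rewrite ler_wpM2r ?invr_ge0 ?exprn_ge0 ?(ltW r0) //.
  apply: (@le_trans _ _ L); first by rewrite /L; lra.
  by rewrite exprS ler_peMr ?(ltW L0) // exprn_ege1.
pose r1 := rho / L.
have r10 : 0 < r1 by rewrite divr_gt0.
have r1r : r1 <= rho by rewrite ler_pdivrMr // ler_peMr // ltW.
have gc : geo c r1 1.
  by split => // j; apply: le_trans (bound j) _; rewrite mul1r /r1 -exprVn invf_div.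
have ga1 : geo a r1 K by exact: geo_le ga.
(* Comparison of coefficients: the first term of the convolution carries [a 0 = s (s - 1)], the
   others form the recursion for [c j]. *)
have co j : j%:R * (j%:R - 1) * c j + 2 * s * (j%:R * c j) + s * (s - 1) * c j = conv a c j.
  rewrite /conv big_ord_recl /= subn0 a0.
  have -> : \sum_(i < j) a (bump 0 i) * c (j - bump 0 i)%N = den j * c j.
    rewrite (eq_bigr (fun i : 'I_j => a i.+1 * c (j - i.+1)%N)); last by move=> i _; rewrite /bump /= add1n.
    have [oj|ej] := boolP (odd j); first by rewrite sodd // codd // mulr0.
    have [->|j0] := eqVneq j 0%N; first by rewrite big_ord0 /den !mul0r.
    rewrite [c j in RHS]cP /F (negbTE j0) (negbTE ej) mulrC divfK //.
    rewrite -normc_gt0; apply: lt_le_trans (Hden j _ ej); by rewrite ?ltr0n lt0n.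
  by rewrite /den; ring.
exists c, (r1 / 2), 1; split.
- by rewrite divr_gt0.
- by lra.
- by apply: geo_le gc; lra.
- by rewrite cP.
move=> w wr; have wr1 : normc w < r1 by lra.
have [h1 h2 h3 h4] := radii r10.
have [M1 g1] := geo_pder h1 h2 gc.
have [M2 g2] := geo_pder h3 h4 g1.
have t0 := psum_tends r10 gc wr1.
have t1 := psum_tends h1 g1 (lt_trans wr h4).
have t2 := psum_tends h3 g2 wr.
apply: (tends_uniq (u := fun N => psum (conv a c) N.+2 w)); last first.
  apply (proj1 (tends_S (fun N => psum (conv a c) N.+1 w) _)); apply (proj1 (tends_S (fun N => psum (conv a c) N w) _)).
  exact: (pser_conv r10 ga1 gc wr1).
have t0' : tends (fun N => psum c N.+2 w) (pser c w) by apply (proj1 (tends_S (fun N => psum c N.+1 w) _)); apply (proj1 (tends_S (fun N => psum c N w) _)).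
have t1' : tends (fun N => psum (pder c) N.+1 w) (pser (pder c) w) by apply (proj1 (tends_S (fun N => psum (pder c) N w) _)).
have := tendsD (tendsD (tendsM (tends_cst (w ^+ 2)) t2) (tendsM (tends_cst (2 * s)) (tendsM (tends_cst w) t1')))
  (tendsM (tends_cst (s * (s - 1))) t0').
apply: tends_eq => N; rewrite -psum_euler2 -psum_euler1 /psum !mulr_sumr -!big_split /=.
by apply: eq_bigr => j _; rewrite -co; ring.
Qed.

End PowerSeriesSolutions.

(** * Local bases of Wronskian one *)

Section LocalBases.
Context {R : realType}.
Local Notation C := (cplx R).
Variable Q : C -> C.

(** The equation [y'' = Q y] as a first-order system; the derivative is carried along as a function
    of its own, so that gluing and changes of basis act on pairs. *)
Definition sol (z : C) (y d : C -> C) : Prop :=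
  is_derive z (1 : C) y (d z) /\ is_derive z (1 : C) d (Q z * y z).

Definition wronskian (y d y' d' : C -> C) (z : C) : C := y z * d' z - d z * y' z.

Lemma cderM (f g : C -> C) (z a b : C) : is_derive z (1 : C) f a -> is_derive z (1 : C) g b ->
  is_derive z (1 : C) (fun z => f z * g z) (a * g z + f z * b).
Proof.
move=> hf hg; refine (is_derive_eq (is_deriveM hf hg) _).
by rewrite /GRing.scale /=; ring.
Qed.

Lemma cderB (f g : C -> C) (z a b : C) : is_derive z (1 : C) f a -> is_derive z (1 : C) g b ->
  is_derive z (1 : C) (fun z => f z - g z) (a - b).
Proof. move=> hf hg; exact (is_deriveB hf hg). Qed.

Lemma cderD (f g : C -> C) (z a b : C) : is_derive z (1 : C) f a -> is_derive z (1 : C) g b ->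
  is_derive z (1 : C) (fun z => f z + g z) (a + b).
Proof. move=> hf hg; exact (is_deriveD hf hg). Qed.

Lemma cder_cst (c z : C) : is_derive z (1 : C) (fun=> c) 0.
Proof. exact (is_derive_cst c z 1). Qed.

Lemma cder_ext (f : C -> C) (z a b : C) : is_derive z (1 : C) f a -> a = b -> is_derive z (1 : C) f b.
Proof. by move=> h <-. Qed.

Lemma cderZ (c : C) (f : C -> C) (z a : C) : is_derive z (1 : C) f a ->
  is_derive z (1 : C) (fun z => c * f z) (c * a).
Proof. by move=> h; refine (cder_ext (cderM (cder_cst c z) h) _); rewrite mul0r add0r. Qed.

Lemma wronskian_der z y d y' d' : sol z y d -> sol z y' d' ->
  is_derive z (1 : C) (wronskian y d y' d') 0.
Proof.
move=> [h1 h2] [h3 h4]; refine (cder_ext (cderB (cderM h1 h4) (cderM h2 h3)) _).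
by move: (Q z) => q; ring.
Qed.

Lemma sol_lin z y d y' d' (a b : C) : sol z y d -> sol z y' d' ->
  sol z (fun z => a * y z + b * y' z) (fun z => a * d z + b * d' z).
Proof.
move=> [h1 h2] [h3 h4]; split; first exact (cderD (cderZ a h1) (cderZ b h3)).
by refine (cder_ext (cderD (cderZ a h2) (cderZ b h4)) _); move: (Q z) => q; ring.
Qed.

Lemma disc_const (f : C -> C) (p : C) (r : R) : (forall z : C, normc (z - p) < r -> is_derive z (1 : C) f 0) ->
  forall z : C, normc (z - p) < r -> f z = f p.
Proof.
move=> H z zr; have := @seg_const _ (fun w => f (w + p)) (z - p) _.
rewrite subrK add0r; apply => t /andP[t0 t1]; refine (cder_add _); apply H.
rewrite addrK normcM normc_real ger0_norm //.
by apply: le_lt_trans zr; rewrite ler_piMl ?normc_ge0.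
Qed.

Lemma cont_zero (f : C -> C) (p : C) (r : R) : 0 < r -> {for p, continuous f} ->
  (forall z : C, 0 < normc (z - p) < r -> f z = 0) -> f p = 0.
Proof.
move=> r0 /contCP cf f0; apply/eqP; apply: contrapT => /negP fp.
have [d d0 dH] := cf (normc (f p)) ltac:(by rewrite normc_gt0).
pose e := Num.min d r / 2.
have m0 : 0 < Num.min d r by rewrite lt_min d0.
have e0 : 0 < e by rewrite divr_gt0.
have nd : normc (p + e%:C - p) = e by rewrite addrC addKr normc_real gtr0_norm.
have ed : e < d by have : Num.min d r <= d by [rewrite ge_min lexx]; rewrite /e; lra.
have er : e < r by have : Num.min d r <= r by [rewrite ge_min lexx orbT]; rewrite /e; lra.
have := dH (p + e%:C); rewrite nd => /(_ ed).
by rewrite f0 ?nd ?e0 // sub0r normcN ltxx.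
Qed.

Lemma pser_sol_der (c : nat -> C) (r M : R) (p z : C) : 0 < r -> geo c r M -> normc (z - p) < r ->
  is_derive z (1 : C) (fun z => pser c (z - p)) (pser (pder c) (z - p)).
Proof. by move=> r0 gc zr; refine (cder_add _); exact (pser_der gc r0 zr). Qed.

Lemma pser_hol_disc (c : nat -> C) (r r' M : R) (p : C) : 0 < r -> r' <= r -> geo c r M ->
  hol (disc p r') (fun z => pser c (z - p)).
Proof.
move=> r0 rr gc; refine (@hol_comp_add _ _ _ _ (- p) (@copen_disc _ p r') (pser_hol gc r0) _) => z zr.
exact: lt_le_trans rr.
Qed.

(** The initial data [(1, 0)] and [(0, 1)] make the Wronskian 1 at [p], and it is constant. *)
Lemma regular_basis p r : 0 < r -> hol (disc p r) Q ->
  exists r', [/\ 0 < r', r' <= r & exists y1 d1 y2 d2, 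
   [/\ forall z, disc p r' z -> [/\ sol z y1 d1, sol z y2 d2 & wronskian y1 d1 y2 d2 z = 1],
       hol (disc p r') y1 & hol (disc p r') y2]].
Proof.
move=> r0 hQ; pose T := ln (r / 2); have r2 : 0 < r / 2 by rewrite divr_gt0.
have eT : expR T = r / 2 by rewrite lnK.
have Tr : expR T < r by rewrite eT; lra.
have [[K gb] Qp] := disc_pser hQ Tr; set b := circ_coef Q p T in gb Qp.
rewrite eT in gb Qp.
have [c [rc [Mc [rc0 rcr gc [c0 c1] Hc]]]] := regular_series 1 0 r2 gb.
have [e [re [Me [re0 rer ge [e0 e1] He]]]] := regular_series 0 1 r2 gb.
pose m := Num.min rc re; have m0 : 0 < m by rewrite lt_min rc0.
have mc : m <= rc by rewrite ge_min lexx.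
have me : m <= re by rewrite ge_min lexx orbT.
have [h1 h2 h3 h4] := radii m0.
have [Mc' gc'] := geo_pder h1 h2 (geo_le m0 mc gc).
have [Me' ge'] := geo_pder h1 h2 (geo_le m0 me ge).
have hc : m / 2 <= rc := le_trans (ltW (lt_trans h4 h2)) mc.
have he : m / 2 <= re := le_trans (ltW (lt_trans h4 h2)) me.
have hr : m / 2 <= r.
  by apply: le_trans hc (le_trans rcr _); rewrite ler_pdivrMr // ler_peMr ?ler1n // ltW.
exists (m / 2); split=> //.
exists (fun z => pser c (z - p)), (fun z => pser (pder c) (z - p)),
  (fun z => pser e (z - p)), (fun z => pser (pder e) (z - p)).
have Sc z : disc p (m / 2) z -> sol z (fun z => pser c (z - p)) (fun z => pser (pder c) (z - p)).
  rewrite /disc /= => zm; split; first exact (pser_sol_der rc0 gc (lt_le_trans zm hc)).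
  refine (cder_ext (pser_sol_der h1 gc' (lt_trans zm h4)) _).
  rewrite (Hc _ (lt_le_trans zm hc)) -(Qp _ (lt_le_trans zm (le_trans hc rcr))).
  by rewrite [p + _]addrC subrK.
have Se z : disc p (m / 2) z -> sol z (fun z => pser e (z - p)) (fun z => pser (pder e) (z - p)).
  rewrite /disc /= => zm; split; first exact (pser_sol_der re0 ge (lt_le_trans zm he)).
  refine (cder_ext (pser_sol_der h1 ge' (lt_trans zm h4)) _).
  rewrite (He _ (lt_le_trans zm he)) -(Qp _ (lt_le_trans zm (le_trans he rer))).
  by rewrite [p + _]addrC subrK.
split.
- move=> z Dz; split; [exact (Sc z Dz)|exact (Se z Dz)|].
  rewrite (disc_const (f := wronskian _ _ _ _) _ Dz); last first.
    move=> x Dx; exact (wronskian_der (Sc x Dx) (Se x Dx)).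
  by rewrite /wronskian subrr !pser_0 /pder c0 e0 c1 e1; ring.
- exact (pser_hol_disc p rc0 hc gc).
- exact (pser_hol_disc p re0 he ge).
Qed.

(** The factor [ex] stands for the power [(x - p) ^ s] and is known only through its logarithmic
    derivative, so that one computation serves a negative and a positive exponent. *)
Lemma frobenius_sol (p z s : C) (ex g g' : C -> C) (g'' A : C) : z - p != 0 ->
  (forall x, x - p != 0 -> is_derive x (1 : C) ex (s * ex x / (x - p))) ->
  is_derive z (1 : C) g (g' z) -> is_derive z (1 : C) g' g'' ->
  (z - p) ^+ 2 * Q z = A ->
  (z - p) ^+ 2 * g'' + 2 * s * ((z - p) * g' z) + s * (s - 1) * g z = A * g z ->
  sol z (fun z => ex z * g z) (fun z => ex z * (s * g z / (z - p) + g' z)).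
Proof.
move=> zp dex dg dg' QA E; split.
  refine (cder_ext (cderM (dex z zp) dg) _).
  by move: (ex z) (g z) (g' z) (z - p) zp => a b c w w0; field.
have dw : is_derive z (1 : C) (fun z => z - p) 1.
  by have := wdB (wd_id z) (wd_cst p z); rewrite !subr0 => /wd_cder.
have dv := @cderV _ (fun z => z - p) z 1 zp dw.
refine (cder_ext (cderM (dex z zp) (cderD (cderM (cderZ s dg) dv) dg')) _).
have -> : Q z = A / (z - p) ^+ 2 by rewrite -QA mulrAC divff ?mul1r // expf_neq0.
have -> : g'' = (A * g z - s * (s - 1) * g z - 2 * s * ((z - p) * g' z)) / (z - p) ^+ 2.
  rewrite -E; move: (z - p) zp => w w0; field; exact: w0.
by move: (ex z) (g z) (g' z) (z - p) zp => a b c w w0; field.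
Qed.

Lemma pow_der (p z : C) (N : nat) : z - p != 0 ->
  is_derive z (1 : C) (fun z => (z - p) ^+ N) (N%:R * (z - p) ^+ N / (z - p)).
Proof.
move=> zp; elim: N => [|N IH].
  refine (cder_ext (cder_cst 1 z) _); first by rewrite mul0r mul0r.
have dw : is_derive z (1 : C) (fun z => z - p) 1.
  by have := wdB (wd_id z) (wd_cst p z); rewrite !subr0 => /wd_cder.
have -> : (fun z => (z - p) ^+ N.+1) = (fun z => (z - p) * (z - p) ^+ N) by apply/funext => x; rewrite exprS.
refine (cder_ext (cderM dw IH) _).
by rewrite -natr1 exprS; move: ((z - p) ^+ N) (z - p) zp => v w w0; field.
Qed.

Lemma ipow_der (p z : C) (N : nat) : z - p != 0 ->
  is_derive z (1 : C) (fun z => ((z - p) ^+ N)^-1) (- N%:R * ((z - p) ^+ N)^-1 / (z - p)).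
Proof.
move=> zp; have n0 : (z - p) ^+ N != 0 by rewrite expf_neq0.
refine (cder_ext (@cderV _ (fun z => (z - p) ^+ N) z _ n0 (pow_der N zp)) _).
have e : ((z - p) ^+ N) ^- 2 * (z - p) ^+ N = ((z - p) ^+ N)^-1 by rewrite expr2 invfM mulfVK.
rewrite -e; have E (n x v w : C) : - x * (n * v / w) = - n * (x * v) / w by ring.
exact: E.
Qed.

(** The exponents are [- N] and [N + 1]. They differ by the odd number [2 N + 1], whereas the series
    advance in even steps, so both exponents give a solution and no logarithm appears. *)
Lemma singular_basis (p : C) (N : nat) (a : nat -> C) (rho K : R) : 0 < rho -> geo a rho K ->
  a 0%N = N%:R * (N%:R + 1) -> (forall j, odd j -> a j = 0) ->
  (forall w : C, 0 < normc w < rho -> w ^+ 2 * Q (p + w) = pser a w) ->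
  exists r', [/\ 0 < r', r' <= rho & exists y1 d1 y2 d2 : C -> C, exists G1 G2 : C -> C,
   [/\ forall z : C, 0 < normc (z - p) < r' -> [/\ sol z y1 d1, sol z y2 d2 & wronskian y1 d1 y2 d2 z = 1],
       hol (disc p r') G1, hol (disc p r') G2 &
       forall z : C, 0 < normc (z - p) < r' -> y1 z = G1 z / (z - p) ^+ N /\ y2 z = G2 z / (z - p) ^+ N]].
Proof.
move=> rho0 ga a0 aodd HQ.
(* For even [j] the integer [j - 1 - 2 N] is odd, hence of modulus at least 1. *)
have den1 j : (0 < j)%N -> ~~ odd j -> j%:R <= normc (j%:R * (j%:R - 1 + 2 * - N%:R) : C).
  move=> j0 ej; rewrite normcM normc_natr ler_peMr //.
  have -> : (j%:R - 1 + 2 * - N%:R : C) = (j%:Z - 1 - 2 * N%:Z)%:~R.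
    by rewrite !rmorphB /= rmorphM /= !pmulrn; ring.
  rewrite intC normc_real -intr_norm -[1]/(1%:~R) ler_int -gtz0_ge1 normr_gt0.
  by apply/eqP => h; lia.
have den2 j : (0 < j)%N -> ~~ odd j -> j%:R <= normc (j%:R * (j%:R - 1 + 2 * (N%:R + 1)) : C).
  move=> j0 ej; rewrite normcM normc_natr ler_peMr //.
  have -> : (j%:R - 1 + 2 * (N%:R + 1) : C) = (j + 1 + (N + N))%N%:R by rewrite !natrD; ring.
  by rewrite normc_natr ler1n; lia.
have s1 : a 0%N = - N%:R * (- N%:R - 1) by rewrite a0; ring.
have s2 : a 0%N = (N%:R + 1) * (N%:R + 1 - 1) by rewrite a0; ring.
have [c [rc [Mc [rc0 rcr gc c0 Hc]]]] := frobenius_series rho0 ga s1 aodd den1.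
have [e [re [Me [re0 rer ge e0 He]]]] := frobenius_series rho0 ga s2 aodd den2.
pose m := Num.min rc re; have m0 : 0 < m by rewrite lt_min rc0.
have mc : m <= rc by rewrite ge_min lexx.
have me : m <= re by rewrite ge_min lexx orbT.
have [h1 h2 h3 h4] := radii m0.
have [Mc' gc'] := geo_pder h1 h2 (geo_le m0 mc gc).
have [Me' ge'] := geo_pder h1 h2 (geo_le m0 me ge).
have hc : m / 2 <= rc := le_trans (ltW (lt_trans h4 h2)) mc.
have he : m / 2 <= re := le_trans (ltW (lt_trans h4 h2)) me.
have hr : m / 2 <= rho := le_trans hc rcr.
pose gC z := pser c (z - p); pose gC' z := pser (pder c) (z - p).
pose gE z := pser e (z - p); pose gE' z := pser (pder e) (z - p).
have n2 : (2 * N%:R + 1 : C) != 0 by rewrite -natrM natr1 natC_neq0.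
pose k : C := (2 * N%:R + 1)^-1.
pose y z := ((z - p) ^+ N)^-1 * gC z; pose dy z := ((z - p) ^+ N)^-1 * (- N%:R * gC z / (z - p) + gC' z).
pose x z := (z - p) ^+ N.+1 * gE z; pose dx z := (z - p) ^+ N.+1 * ((N%:R + 1) * gE z / (z - p) + gE' z).
have Sy z : 0 < normc (z - p) < m / 2 -> sol z y dy.
  move=> /andP[z0 z1]; have zp : z - p != 0 by rewrite -normc_gt0.
  have zr : 0 < normc (z - p) < rho by rewrite z0 (lt_le_trans z1 hr).
  have QE := HQ _ zr; rewrite [p + _]addrC subrK in QE.
  refine (frobenius_sol zp (fun x xp => ipow_der N xp) (pser_sol_der rc0 gc (lt_le_trans z1 hc))
    (pser_sol_der h1 gc' (lt_trans z1 h4)) QE (Hc _ (lt_le_trans z1 hc))).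
have Sx z : 0 < normc (z - p) < m / 2 -> sol z x dx.
  move=> /andP[z0 z1]; have zp : z - p != 0 by rewrite -normc_gt0.
  have zr : 0 < normc (z - p) < rho by rewrite z0 (lt_le_trans z1 hr).
  have QE := HQ _ zr; rewrite [p + _]addrC subrK in QE.
  have dex t : t - p != 0 -> is_derive t (1 : C) (fun z => (z - p) ^+ N.+1) ((N%:R + 1) * (t - p) ^+ N.+1 / (t - p)).
    by move=> tp; rewrite natr1; exact (pow_der N.+1 tp).
  refine (frobenius_sol zp dex (pser_sol_der re0 ge (lt_le_trans z1 he))
    (pser_sol_der h1 ge' (lt_trans z1 h4)) QE (He _ (lt_le_trans z1 he))).
have oD := @copen_disc R p (m / 2).
have hC : hol (disc p (m / 2)) gC := pser_hol_disc p rc0 hc gc.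
have hE : hol (disc p (m / 2)) gE := pser_hol_disc p re0 he ge.
have hC' : hol (disc p (m / 2)) gC' := pser_hol_disc p h1 (ltW h4) gc'.
have hE' : hol (disc p (m / 2)) gE' := pser_hol_disc p h1 (ltW h4) ge'.
have hsub : hol (disc p (m / 2)) (fun z => z - p) := hol_sub_cst p oD.
(* The Wronskian with its powers of [z - p] cancelled. It is holomorphic at [p], where its value
   [2 N + 1], the difference of the exponents, can be read off; dividing the first solution by this
   value normalises the basis. *)
pose W z := (2 * N%:R + 1) * (gC z * gE z) + (z - p) * (gC z * gE' z - gC' z * gE z).
have hW : hol (disc p (m / 2)) W.
  exact (holD oD (holM oD (hol_cst (2 * N%:R + 1) oD) (holM oD hC hE))
    (holM oD hsub (holB oD (holM oD hC hE') (holM oD hC' hE)))).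
have WE z : z - p != 0 -> wronskian y dy x dx z = W z.
  move=> zp; rewrite /wronskian /W /y /dy /x /dx exprS.
  have v0 : (z - p) ^+ N != 0 by rewrite expf_neq0.
  have E (n A B A' B' v w : C) : v != 0 -> w != 0 -> v^-1 * A * (w * v * ((n + 1) * B / w + B')) -
      v^-1 * (- n * A / w + A') * (w * v * B) = (2 * n + 1) * (A * B) + w * (A * B' - A' * B).
    by move=> v0' w0; field; rewrite v0' w0.
  exact: E.
have W1 z : 0 < normc (z - p) < m / 2 -> is_derive z (1 : C) W 0.
  move=> zr; have [z0 z1] := andP zr.
  have [d d0 dD] := @copen_ann R p 0 (m / 2) z zr.
  refine (cder_eq 0 d0 _ (wronskian_der (Sy z zr) (Sx z zr))) => t /dD /andP[t0 _].
  by apply: WE; rewrite -normc_gt0.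
have dW0 : dC W p = 0.
  have Dp : disc p (m / 2) p by rewrite /disc /= subrr Normc.normc0.
  refine (cont_zero h3 (hW p Dp).2 _) => z zr; exact (derive1_is (W1 z zr)).
have W0 z : normc (z - p) < m / 2 -> is_derive z (1 : C) W 0.
  move=> zr; have [->|zp] := eqVneq z p.
    have Dp : disc p (m / 2) p by rewrite /disc /= subrr Normc.normc0.
    by have := hol_is hW Dp; rewrite dW0.
  by apply W1; rewrite normc_gt0 subr_eq0 zp.
have Wc z : normc (z - p) < m / 2 -> W z = 2 * N%:R + 1.
  move=> zr; rewrite (disc_const W0 zr) /W /gC /gE subrr !pser_0 c0 e0 mul0r addr0 !mulr1 //.
exists (m / 2); split=> //.
(* The summand [0 * x z] lets [sol_lin] apply. Both solutions get the common denominator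
   [(z - p) ^ N], hence the power [2 N + 1] in the second numerator. *)
exists (fun z => k * y z + 0 * x z), (fun z => k * dy z + 0 * dx z), x, dx,
  (fun z => k * gC z), (fun z => (z - p) ^+ (2 * N).+1 * gE z); split.
- move=> z zr; split; [exact (sol_lin k 0 (Sy z zr) (Sx z zr))|exact (Sx z zr)|].
  have [z0 z1] := andP zr; have zp : z - p != 0 by rewrite -normc_gt0.
  have -> : wronskian (fun z => k * y z + 0 * x z) (fun z => k * dy z + 0 * dx z) x dx z = k * wronskian y dy x dx z.
    by rewrite /wronskian; ring.
  by rewrite (WE z zp) (Wc z z1) /k mulVf.
- exact (holM oD (hol_cst k oD) hC).
- exact (holM oD (holX (2 * N).+1 oD hsub) hE).
move=> z /andP[z0 _]; have zp : z - p != 0 by rewrite -normc_gt0.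
have v0 : (z - p) ^+ N != 0 by rewrite expf_neq0.
split; first by rewrite mul0r addr0 /y mulrA [_ / (z - p) ^+ N]mulrC; ring.
have E (B v w : C) : v != 0 -> w * v * B = w * (v * v) * B / v by move=> v1; field.
by rewrite /x !exprS mul2n -addnn exprD; exact: E.
Qed.

End LocalBases.

(** * Global solutions *)

Section Cousin.
Context {R : realType}.

(** Continuous induction: the supremum of the right ends reachable from [a] could always be passed
    if it stayed short of [b]. Intervals are glued only along overlaps of positive length. *)
Lemma cousin (P : R -> R -> Prop) (a b : R) : a <= b ->
  (forall x y x' y', P x y -> x <= x' -> y' <= y -> P x' y') ->
  (forall x x' y y', x <= x' -> x' < y -> y <= y' -> P x y -> P x' y' -> P x y') ->
  (forall x, a <= x <= b -> exists2 e, 0 < e & P (x - e) (x + e)) -> P a b.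
Proof.
move=> ab mono glue loc.
pose E : set R := [set x | a <= x <= b /\ P a x].
have Ea : E a.
  split; first by rewrite lexx ab.
  by have [e e0 Pe] := loc a (introT andP (conj (lexx a) ab)); apply: mono Pe _ _; lra.
have Eb : has_sup E by split; [exists a|exists b => x [/andP[]]].
pose s := sup E.
have as' : a <= s by apply: ub_le_sup => //; exact: Eb.2.
have sb : s <= b by apply: ge_sup; [exists a|move=> x [/andP[]]].
have [e e0 Pe] := loc s (introT andP (conj as' sb)).
have Pse : P a (s + e).
  have [sa|sa] := ltP (s - e) a; first by apply: mono Pe _ _ => //; exact: ltW.
  have [x [/andP[x1 x2] Px] xs] := sup_adherent e0 Eb.
  have xs' : x <= s by apply: ub_le_sup; [exact: Eb.2|split => //; rewrite x1 x2].
  by apply: (glue a (s - e) x (s + e)) => //; lra.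
have [bs|bs] := leP b (s + e); first exact: mono Pse _ _.
have : s + e <= s by apply: ub_le_sup; [exact: Eb.2|split => //; apply/andP; split; lra].
by lra.
Qed.

End Cousin.

(** * Gluing local bases over rectangles in lattice coordinates *)

Section Gluing.
Context {R : realType}.
Local Notation C := (cplx R).
Lemma rCaff (p q t : R) : (p + t * (q - p))%:C = p%:C + t%:C * (q - p)%:C :> C.
Proof. by rewrite (rmorphD (real_complex R)) (rmorphM (real_complex R)). Qed.

Lemma rCB (p q : R) : (p - q)%:C = p%:C - q%:C :> C.
Proof. exact: (rmorphB (real_complex R)). Qed.

Variables (tau : C) (tau_upper : 0 < complex.Im tau).

Definition tcoord (z : C) : R := complex.Im z / complex.Im tau.
Definition scoord (z : C) : R := complex.Re z - tcoord z * complex.Re tau.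

Let Itau0 : complex.Im tau != 0. Proof. by rewrite gt_eqF. Qed.

Lemma stcoordE (s t : R) : scoord (s%:C + t%:C * tau) = s /\ tcoord (s%:C + t%:C * tau) = t.
Proof.
have ht : tcoord (s%:C + t%:C * tau) = t.
  by rewrite /tcoord cImD cImM /=; move: Itau0; move: (complex.Im tau) => x x0; field.
by split => //; rewrite /scoord ht cReD cReM /=; ring.
Qed.

Lemma stcoordK z : z = (scoord z)%:C + (tcoord z)%:C * tau.
Proof.
apply: complex_ext; rewrite ?cReD ?cImD ?cReM ?cImM /=; rewrite /scoord.
  by ring.
by rewrite /tcoord; move: Itau0; move: (complex.Im tau) => x x0; field.
Qed.

Lemma tcoordD z w : tcoord (z + w) = tcoord z + tcoord w.
Proof. by rewrite /tcoord cImD mulrDl. Qed.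

Lemma scoordD z w : scoord (z + w) = scoord z + scoord w.
Proof. by rewrite /scoord tcoordD cReD; ring. Qed.

Lemma half_coords z : half_periods tau z -> exists m n : int, 2 * scoord z = m%:~R /\ 2 * tcoord z = n%:~R.
Proof.
move=> /(half_periodsP tau_upper)[m [n E]]; exists m, n.
have [h1 h2] := stcoordE m%:~R n%:~R.
have E2 : z + z = (m%:~R : R)%:C + (n%:~R : R)%:C * tau by rewrite -mulr2n -mulr_natl E !intC.
by rewrite -h1 -{2}h2 -E2 scoordD tcoordD; split; ring.
Qed.

Lemma coord_lip : exists2 k : R, 0 < k & forall z w : C,
  `|scoord w - scoord z| <= k * normc (w - z) /\ `|tcoord w - tcoord z| <= k * normc (w - z).
Proof.
pose i := (complex.Im tau)^-1; have i0 : 0 < i by rewrite invr_gt0.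
exists (1 + i + i * `|complex.Re tau|).
  by rewrite ltr_wpDr ?addr_gt0 // mulr_ge0 // ltW.
move=> z w; have n0 := normc_ge0 (w - z).
have ht : `|tcoord w - tcoord z| <= i * normc (w - z).
  rewrite /tcoord -mulrBl normrM (gtr0_norm i0) mulrC ler_pM2l // -cImB; exact: normc_Im.
have hr : `|complex.Re w - complex.Re z| <= normc (w - z) by rewrite -cReB normc_Re.
have a0 : 0 <= i * `|complex.Re tau| by rewrite mulr_ge0 // ltW.
split.
  have -> : scoord w - scoord z = (complex.Re w - complex.Re z) - (tcoord w - tcoord z) * complex.Re tau.
    by rewrite /scoord; ring.
  apply: le_trans (ler_normB _ _) _; rewrite normrM.
  have := ler_wpM2r (normr_ge0 (complex.Re tau)) ht; nra.
by apply: le_trans ht _; nra.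
Qed.

Definition rect (a b c d : R) : set C := [set z | a < scoord z < b /\ c < tcoord z < d].

Lemma copen_rect a b c d : copen (rect a b c d).
Proof.
move=> z [/andP[h1 h2] /andP[h3 h4]]; have [k k0 kP] := coord_lip.
pose m := Num.min (Num.min (scoord z - a) (b - scoord z)) (Num.min (tcoord z - c) (d - tcoord z)).
have m0 : 0 < m by rewrite !lt_min !subr_gt0 h1 h2 h3.
have m1 : m <= scoord z - a by rewrite !ge_min lexx.
have m2 : m <= b - scoord z by rewrite !ge_min lexx !orbT.
have m3 : m <= tcoord z - c by rewrite !ge_min lexx !orbT.
have m4 : m <= d - tcoord z by rewrite !ge_min lexx !orbT.
exists (m / k); first by rewrite divr_gt0.
move=> w; rewrite ltr_pdivlMr // mulrC => wz; have [s1 t1] := kP z w.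
have := le_lt_trans s1 wz; have := le_lt_trans t1 wz; rewrite !ltr_norml => /andP[x1 x2] /andP[x3 x4].
by split; apply/andP; split; lra.
Qed.

Lemma rect_disc p (r : R) : 0 < r -> exists2 e, 0 < e &
  rect (scoord p - e) (scoord p + e) (tcoord p - e) (tcoord p + e) `<=` disc p r.
Proof.
move=> r0; pose K := 1 + normc tau; have K0 : 0 < K by rewrite ltr_pwDl // normc_ge0.
exists (r / K); first by rewrite divr_gt0.
move=> z [/andP[h1 h2] /andP[h3 h4]]; rewrite /disc /=.
have -> : z - p = (scoord z - scoord p)%:C + (tcoord z - tcoord p)%:C * tau.
  by rewrite {1}(stcoordK z) {1}(stcoordK p) !rmorphB; ring.
apply: le_lt_trans (normcD _ _) _; rewrite normcM !normc_real.
have hs : `|scoord z - scoord p| < r / K by rewrite ltr_norml; lra.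
have ht : `|tcoord z - tcoord p| < r / K by rewrite ltr_norml; lra.
have := ler_wpM2r (normc_ge0 tau) (ltW ht).
have : r / K * K = r by rewrite divfK // gt_eqF.
rewrite {2}/K; lra.
Qed.

Lemma rect_reg a b c d : a < b -> c < d -> exists2 z, rect a b c d z & reg tau z.
Proof.
move=> ab cd; pose z0 : C := ((a + b) / 2)%:C + ((c + d) / 2)%:C * tau.
have [e1 e2] := stcoordE ((a + b) / 2) ((c + d) / 2).
have Rz : rect a b c d z0 by split; rewrite /z0 ?e1 ?e2; apply/andP; split; lra.
have [r r0 rP] := copen_rect Rz.
by have [w Rw wz] := reg_near tau_upper z0 r0; exists w => //; exact: rP.
Qed.

Variable S : set C.
Hypothesis S_half : forall z, S z -> half_periods tau z.
Hypothesis oS : copen (~` S).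

(** A substitute for connectedness of [D] minus [S], in the form in which it is used. *)
Definition const_on (D : set C) : Prop := forall F : C -> C,
  (forall z, D z -> ~ S z -> is_derive z (1 : C) F 0) ->
  forall z z', D z -> ~ S z -> D z' -> ~ S z' -> F z = F z'.

(** Half periods have half-integral coordinates, so the two coordinate lines through a generic point
    avoid [S]. *)
Let generic (z : C) := forall m : int, 2 * scoord z != m%:~R /\ 2 * tcoord z != m%:~R.

Lemma near_generic (x : R) : exists2 d : R, 0 < d & forall e, 0 < e < d -> forall m : int, 2 * (x + e) != m%:~R.
Proof.
have [h1 h2] := andP (floor_itv (2 * x)); rewrite intrD1 in h2.
exists (((Num.floor (2 * x))%:~R + 1 - 2 * x) / 2); first by lra.
move=> e /andP[e0 e1] m; apply/eqP => E.
have l1 : (Num.floor (2 * x) < m)%R by rewrite -(ltr_int R) -E; lra.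
have l2 : (m < Num.floor (2 * x) + 1)%R by rewrite -(ltr_int R) -E intrD1; lra.
by lia.
Qed.

Lemma const_seg (F : C -> C) (z v : C) :
  (forall t : R, 0 <= t <= 1 -> is_derive (z + t%:C * v : C) (1 : C) F 0) -> F (z + v) = F z.
Proof.
move=> H; have := @seg_const _ (fun w => F (w + z)) v _.
rewrite add0r [v + z]addrC; apply => t t01; refine (cder_add _).
by rewrite addrC; exact (H t t01).
Qed.

(** Every point is joined to a nearby generic one inside a small disc, and two generic points by an
    L-shaped path in lattice coordinates; neither meets [S]. *)
Lemma const_rect a b c d : const_on (rect a b c d).
Proof.
move=> F dF.
have toG z : rect a b c d z -> ~ S z -> exists z', [/\ rect a b c d z', generic z' & F z = F z'].
  move=> Dz nS; have [d1 d10 H1] := copen_rect Dz; have [d2 d20 H2] := oS nS.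
  have [e1 e10 E1] := near_generic (scoord z); have [e2 e20 E2] := near_generic (tcoord z).
  pose K := 1 + normc tau; have K0 : 0 < K by rewrite ltr_pwDl // normc_ge0.
  pose e := Num.min (Num.min e1 e2) (Num.min (d1 / K) (d2 / K)) / 2.
  have m0 : 0 < Num.min (Num.min e1 e2) (Num.min (d1 / K) (d2 / K)) by rewrite !lt_min e10 e20 !divr_gt0.
  have e0 : 0 < e by rewrite divr_gt0.
  have : e < Num.min (Num.min e1 e2) (Num.min (d1 / K) (d2 / K)) by rewrite /e; lra.
  rewrite !lt_min => /andP[/andP[l1 l2] /andP[l3 l4]].
  pose z' := z + (e%:C + e%:C * tau); have [s1 t1] := stcoordE e e.
  have nz : normc (z' - z) = e * normc (1 + tau).
    have -> : z' - z = e%:C * (1 + tau) by rewrite /z'; ring.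
    by rewrite normcM normc_real gtr0_norm.
  have nK : normc (1 + tau) <= K by apply: le_trans (normcD _ _) _; rewrite (normc_real 1) normr1.
  have n1 : normc (z' - z) < d1.
    by rewrite nz; apply: le_lt_trans (_ : e * K < _); [rewrite ler_pM2l|rewrite -ltr_pdivlMr].
  have n2 : normc (z' - z) < d2.
    by rewrite nz; apply: le_lt_trans (_ : e * K < _); [rewrite ler_pM2l|rewrite -ltr_pdivlMr].
  exists z'; split; first exact: H1.
    by move=> m; rewrite /z' scoordD tcoordD s1 t1; split; [apply: E1; rewrite e0|apply: E2; rewrite e0].
  symmetry; apply: (disc_const (r := Num.min d1 d2)); last by rewrite lt_min n1.
  by move=> w; rewrite lt_min => /andP[/H1 Dw /H2 nSw]; exact (dF w Dw nSw).
have GG z z' : rect a b c d z -> generic z -> rect a b c d z' -> generic z' -> F z = F z'.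
  move=> [/andP[a1 a2] /andP[c1 c2]] gz [/andP[a3 a4] /andP[c3 c4]] gz'.
  pose x := (scoord z')%:C + (tcoord z)%:C * tau.
  have nS w : (forall m : int, 2 * scoord w != m%:~R) \/ (forall m : int, 2 * tcoord w != m%:~R) -> ~ S w.
    by move=> h /S_half/half_coords[m [k [h1 h2]]]; case: h => h; [move: (h m); rewrite h1 eqxx|move: (h k); rewrite h2 eqxx].
  have conv (p q l r' t : R) : l < p < r' -> l < q < r' -> 0 <= t <= 1 -> l < p + t * (q - p) < r'.
    move=> /andP[? ?] /andP[? ?] /andP[t0 t1].
    have t1' : 0 <= 1 - t by rewrite subr_ge0.
    have [pq|pq] := leP p q.
      have pq' : 0 <= q - p by rewrite subr_ge0.
      by have := mulr_ge0 t0 pq'; have := mulr_ge0 t1' pq'; move=> ? ?; apply/andP; split; nra.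
    have pq' : 0 <= p - q by rewrite subr_ge0 ltW.
    by have := mulr_ge0 t0 pq'; have := mulr_ge0 t1' pq'; move=> ? ?; apply/andP; split; nra.
  have F1 : F x = F z.
    have -> : x = z + (scoord z' - scoord z)%:C.
      transitivity ((scoord z)%:C + (tcoord z)%:C * tau + (scoord z' - scoord z)%:C); last by rewrite -stcoordK.
      by rewrite /x rCB; ring.
    apply: const_seg => t t01.
    have E : z + t%:C * (scoord z' - scoord z)%:C = (scoord z + t * (scoord z' - scoord z))%:C + (tcoord z)%:C * tau.
      transitivity ((scoord z)%:C + (tcoord z)%:C * tau + t%:C * (scoord z' - scoord z)%:C); first by rewrite -stcoordK.
      by rewrite rCaff; ring.
    have [s1 t1] := stcoordE (scoord z + t * (scoord z' - scoord z)) (tcoord z).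
    rewrite E; apply dF.
      by split; rewrite ?s1 ?t1; [apply: conv => //; apply/andP; split|apply/andP; split].
    by apply: nS; right => m; rewrite t1; exact: (gz m).2.
  have F2 : F z' = F x.
    have -> : z' = x + (tcoord z' - tcoord z)%:C * tau.
      transitivity ((scoord z')%:C + (tcoord z')%:C * tau); first exact: stcoordK.
      by rewrite /x rCB; ring.
    apply: const_seg => t t01.
    have E : x + t%:C * ((tcoord z' - tcoord z)%:C * tau) = (scoord z')%:C + (tcoord z + t * (tcoord z' - tcoord z))%:C * tau.
      by rewrite /x rCaff; ring.
    have [s1 t1] := stcoordE (scoord z') (tcoord z + t * (tcoord z' - tcoord z)).
    rewrite E; apply dF.
      by split; rewrite ?s1 ?t1; [apply/andP; split|apply: conv => //; apply/andP; split].
    by apply: nS; left => m; rewrite s1; exact: (gz' m).1.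
  by rewrite F2 F1.
move=> z z' Dz nSz Dz' nSz'.
have [x [Dx gx ->]] := toG z Dz nSz; have [x' [Dx' gx' ->]] := toG z' Dz' nSz'.
exact: GG.
Qed.

Variable Q : C -> C.

(** Two solutions with their derivatives: the pairs are [qy], [qd] and [qx], [qe]. *)
Record quad := Quad { qy : C -> C; qd : C -> C; qx : C -> C; qe : C -> C }.

Definition basis (D : set C) (Y : quad) : Prop := forall z, D z -> ~ S z ->
  [/\ sol Q z (qy Y) (qd Y), sol Q z (qx Y) (qe Y) & wronskian (qy Y) (qd Y) (qx Y) (qe Y) z = 1].

Definition agree (D : set C) (Y Z : quad) : Prop := forall z, D z -> ~ S z ->
  [/\ qy Y z = qy Z z, qd Y z = qd Z z, qx Y z = qx Z z & qe Y z = qe Z z].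

Definition act (a b c d : C) (Y : quad) : quad :=
  Quad (fun z => a * qy Y z + b * qx Y z) (fun z => a * qd Y z + b * qe Y z)
       (fun z => c * qy Y z + d * qx Y z) (fun z => c * qd Y z + d * qe Y z).

Lemma basis_act D Y a b c d : a * d - b * c = 1 -> basis D Y -> basis D (act a b c d Y).
Proof.
move=> det H z Dz nS; have [s1 s2 W] := H z Dz nS.
split; [exact (sol_lin a b s1 s2)|exact (sol_lin c d s1 s2)|].
rewrite -[RHS]mulr1 -{1}det -W /wronskian /=.
by move: (qy Y z) (qx Y z) (qd Y z) (qe Y z) => *; ring.
Qed.

Lemma basis_sub D D' Y : D' `<=` D -> basis D Y -> basis D' Y.
Proof. by move=> s H z /s; exact: H. Qed.

(** Cramer's rule: the coefficients are Wronskians, which are constant on [D] off [S]. *)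
Lemma sol_coef D Y (f g : C -> C) z0 : const_on D -> basis D Y -> D z0 -> ~ S z0 ->
  (forall z, D z -> ~ S z -> sol Q z f g) ->
  exists a b : C, forall z, D z -> ~ S z -> f z = a * qy Y z + b * qx Y z /\ g z = a * qd Y z + b * qe Y z.
Proof.
move=> cD bY D0 S0 sf.
exists (wronskian f g (qx Y) (qe Y) z0), (wronskian (qy Y) (qd Y) f g z0) => z Dz nS.
have -> : wronskian f g (qx Y) (qe Y) z0 = wronskian f g (qx Y) (qe Y) z.
  apply: cD => // x Dx nSx; have [_ s2 _] := bY x Dx nSx; exact (wronskian_der (sf x Dx nSx) s2).
have -> : wronskian (qy Y) (qd Y) f g z0 = wronskian (qy Y) (qd Y) f g z.
  apply: cD => // x Dx nSx; have [s1 _ _] := bY x Dx nSx; exact (wronskian_der s1 (sf x Dx nSx)).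
have [_ _] := bY z Dz nS; rewrite /wronskian => W.
split; [rewrite -[LHS]mulr1 -W|rewrite -[LHS]mulr1 -W];
  by move: (f z) (g z) (qy Y z) (qx Y z) (qd Y z) (qe Y z) => *; ring.
Qed.

Lemma transition D Y Z z0 : const_on D -> basis D Y -> basis D Z -> D z0 -> ~ S z0 ->
  exists a b c d : C, a * d - b * c = 1 /\ agree D Y (act a b c d Z).
Proof.
move=> cD bY bZ D0 S0.
have [a [b H1]] := sol_coef cD bZ D0 S0 (fun z Dz nS => let: And3 h _ _ := bY z Dz nS in h).
have [c [d H2]] := sol_coef cD bZ D0 S0 (fun z Dz nS => let: And3 _ h _ := bY z Dz nS in h).
exists a, b, c, d; split; last first.
  by move=> z Dz nS; have [h1 h2] := H1 z Dz nS; have [h3 h4] := H2 z Dz nS.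
have [h1 h2] := H1 z0 D0 S0; have [h3 h4] := H2 z0 D0 S0.
have [_ _ WZ] := bZ z0 D0 S0; have [_ _] := bY z0 D0 S0.
rewrite /wronskian h1 h2 h3 h4 => <-; rewrite -[LHS]mulr1 -WZ /wronskian.
by move: (qy Z z0) (qx Z z0) (qd Z z0) (qe Z z0) => *; ring.
Qed.

Lemma sol_local (f g f' g' : C -> C) (z : C) (r : R) : 0 < r ->
  (forall w, normc (w - z) < r -> f w = f' w) -> (forall w, normc (w - z) < r -> g w = g' w) ->
  sol Q z f g -> sol Q z f' g'.
Proof.
move=> r0 ff gg [h1 h2].
have zz : normc (z - z) < r by rewrite subrr Normc.normc0.
split; first by refine (cder_ext (cder_eq 0 r0 ff h1) _); exact: gg.
by refine (cder_ext (cder_eq 0 r0 gg h2) _); rewrite ff.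
Qed.

Lemma basis_local D Y Y' (z : C) (r : R) : 0 < r -> basis D Y -> D z -> ~ S z ->
  (forall w, normc (w - z) < r -> [/\ qy Y w = qy Y' w, qd Y w = qd Y' w, qx Y w = qx Y' w & qe Y w = qe Y' w]) ->
  [/\ sol Q z (qy Y') (qd Y'), sol Q z (qx Y') (qe Y') & wronskian (qy Y') (qd Y') (qx Y') (qe Y') z = 1].
Proof.
move=> r0 bY Dz nS H; have [s1 s2 W] := bY z Dz nS; split.
- by refine (sol_local r0 _ _ s1) => w /H[].
- by refine (sol_local r0 _ _ s2) => w /H[].
have [|h1 h2 h3 h4] := H z; first by rewrite subrr Normc.normc0.
by rewrite -W /wronskian h1 h2 h3 h4.
Qed.

Definition good (D : set C) := exists Y, basis D Y.

(** On the overlap the two bases differ by a constant matrix; acting with it on the second basis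
    makes them agree, and a definition by cases covers the union. *)
Lemma good_glue U V z0 : copen U -> copen V -> const_on (U `&` V) -> U z0 -> V z0 -> ~ S z0 ->
  good U -> good V -> good (U `|` V).
Proof.
move=> oU oV cUV U0 V0 S0 [Y bY] [Z bZ].
have sU : U `&` V `<=` U by move=> z [].
have sV : U `&` V `<=` V by move=> z [].
have [a [b [c [d [det A]]]]] := transition cUV (basis_sub sU bY) (basis_sub sV bZ) (conj U0 V0) S0.
have bZ' := basis_act det bZ; set Z' := act a b c d Z in A bZ'.
pose X := Quad (fun z => if `[< U z >] then qy Y z else qy Z' z) (fun z => if `[< U z >] then qd Y z else qd Z' z)
  (fun z => if `[< U z >] then qx Y z else qx Z' z) (fun z => if `[< U z >] then qe Y z else qe Z' z).
exists X => z Dz nS; have [Uz|nU] := pselect (U z).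
  have [r r0 rP] := oU z Uz.
  by apply (basis_local r0 bY Uz nS) => w /rP Uw; rewrite /X /=; case: asboolP.
have Vz : V z by case: Dz.
have [r r0 rP] := oV z Vz; have [r' r'0 rP'] := oS nS.
have m0 : 0 < Num.min r r' by rewrite lt_min r0.
apply (basis_local m0 bZ' Vz nS) => w; rewrite lt_min => /andP[/rP Vw /rP' nSw].
by rewrite /X /=; case: asboolP => // Uw; have [-> -> -> ->] := A w (conj Uw Vw) nSw.
Qed.

Lemma good_sub D D' : D' `<=` D -> good D -> good D'.
Proof. by move=> s [Y bY]; exists Y; exact: basis_sub bY. Qed.

Lemma good_empty D : (forall z, ~ D z) -> good D.
Proof. by move=> e; exists (Quad id id id id) => z /e. Qed.

Lemma nS_reg z : reg tau z -> ~ S z. Proof. by move=> Rz /S_half. Qed.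

Lemma good_rects U V W a b c d : copen U -> copen V ->
  (forall z, (U z /\ V z) <-> rect a b c d z) -> W `<=` U `|` V -> a < b -> c < d -> good U -> good V -> good W.
Proof.
move=> oU oV E s ab cd gU gV.
have E' : U `&` V = rect a b c d by apply/seteqP; split => z /E.
have [z0 Dz0 /nS_reg S0] := rect_reg ab cd.
have [U0 V0] := proj2 (E z0) Dz0.
by apply: good_sub s (good_glue oU oV _ U0 V0 S0 gU gV); rewrite E'; exact: const_rect.
Qed.

Hypothesis local_good : forall p, exists2 r : R, 0 < r & good (disc p r).

(** The thickness [e] of the strip is part of the existential statement, since each gluing step may
    shrink it; compactness of the segment enters through [cousin]. *)
Lemma good_strip a b t : a <= b -> exists2 e, 0 < e & good (rect a b (t - e) (t + e)).
Proof.
move=> ab; apply: (cousin (P := fun x y => exists2 e, 0 < e & good (rect x y (t - e) (t + e)))) ab _ _ _.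
- move=> x y x' y' [e e0 g] xx yy; exists e => //; apply: good_sub g.
  by move=> z [/andP[? ?] ?]; split => //; apply/andP; split; lra.
- move=> x x' y y' xx xy yy [e e0 g] [e' e'0 g'].
  pose m := Num.min e e'; have m0 : 0 < m by rewrite lt_min e0.
  have me : m <= e by rewrite ge_min lexx.
  have me' : m <= e' by rewrite ge_min lexx orbT.
  exists m => //.
  apply: (@good_rects (rect x y (t - m) (t + m)) (rect x' y' (t - m) (t + m)) _ x' y (t - m) (t + m)) => //; try exact: copen_rect.
  + move=> z; split=> [[[/andP[? ?] /andP[? ?]] [/andP[? ?] /andP[? ?]]]|[/andP[? ?] /andP[? ?]]].
      by split; apply/andP; split; lra.
    by split; split; apply/andP; split; lra.
  + move=> z [/andP[h1 h2] h3]; have [zy|zy] := ltP (scoord z) y; [left|right]; split => //; apply/andP; split => //; lra.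
  + by lra.
  + by apply: good_sub g => z [? /andP[? ?]]; split => //; apply/andP; split; lra.
  + by apply: good_sub g' => z [? /andP[? ?]]; split => //; apply/andP; split; lra.
move=> x xab; have [r r0 g] := local_good (x%:C + t%:C * tau).
have [e e0 sub] := rect_disc (x%:C + t%:C * tau) r0.
have [s1 t1] := stcoordE x t; rewrite s1 t1 in sub.
by exists e => //; exists e => //; apply: good_sub g.
Qed.

Lemma good_rect a b c d : a <= b -> c <= d -> good (rect a b c d).
Proof.
move=> ab cd.
have [ab'|ba] := ltP a b; last first.
  by apply: good_empty => z [/andP[? ?] _]; lra.
apply: (cousin (P := fun x y => good (rect a b x y))) cd _ _ _.
- move=> x y x' y' g xx yy; apply: good_sub g.
  by move=> z [? /andP[? ?]]; split => //; apply/andP; split; lra.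
- move=> x x' y y' xx xy yy g g'.
  apply: (@good_rects (rect a b x y) (rect a b x' y') _ a b x' y) => //; try exact: copen_rect.
  + move=> z; split=> [[[/andP[? ?] /andP[? ?]] [/andP[? ?] /andP[? ?]]]|[/andP[? ?] /andP[? ?]]].
      by split; apply/andP; split; lra.
    by split; split; apply/andP; split; lra.
  + move=> z [h3 /andP[h1 h2]]; have [zy|zy] := ltP (tcoord z) y; [left|right]; split => //; apply/andP; split => //; lra.
by move=> t _; exact: good_strip.
Qed.

End Gluing.

(** * Exhaustion of the plane by squares *)

Section Global.
Context {R : realType}.
Local Notation C := (cplx R).
Variables (tau : C) (tau_upper : 0 < complex.Im tau) (S : set C) (Q : C -> C).
Hypothesis S_half : forall z, S z -> half_periods tau z.
Hypothesis oS : copen (~` S).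
Hypothesis local_basis : forall p : C, exists2 r : R, 0 < r & exists (Z : quad) (N : nat) (G1 G2 : C -> C),
  [/\ basis S Q (disc p r) Z, hol (disc p r) G1, hol (disc p r) G2 &
      forall z : C, 0 < normc (z - p) < r -> qy Z z = G1 z / (z - p) ^+ N /\ qx Z z = G2 z / (z - p) ^+ N].

Let sq (n : nat) : set C := rect tau (- n.+1%:R) n.+1%:R (- n.+1%:R) n.+1%:R.

Let sq_le m n : (m <= n)%N -> sq m `<=` sq n.
Proof.
move=> mn z [/andP[h1 h2] /andP[h3 h4]].
have : m.+1%:R <= n.+1%:R :> R by rewrite ler_nat.
by split; apply/andP; split; lra.
Qed.

Let sq_ex (z : C) : exists n, sq n z.
Proof.
pose x := `|scoord tau z| + `|tcoord tau z|.
have x0 : 0 <= x by rewrite addr_ge0.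
exists (Num.bound x).
have h : x < (Num.bound x).+1%:R by apply: lt_trans (archi_boundP x0) _; rewrite ltr_nat.
suff hh k : x < k -> rect tau (- k) k (- k) k z by exact: hh h.
rewrite /x => hk; have := normr_ge0 (scoord tau z); have := normr_ge0 (tcoord tau z).
have := ler_norm (scoord tau z); have := ler_norm (tcoord tau z).
have := ler_norm (- scoord tau z); have := ler_norm (- tcoord tau z); rewrite !normrN => *.
by split; apply/andP; split; lra.
Qed.

Let sq_pt n : exists2 z, sq n z & reg tau z.
Proof.
have n0 : 0 < n.+1%:R :> R by rewrite ltr0n.
by apply: rect_reg => //; lra.
Qed.

Let cst_sq n : const_on S (sq n).
Proof. exact: const_rect. Qed.

Lemma coef_unique (y x e f a b : C) : y * f - e * x = 1 -> y = a * y + b * x -> e = a * e + b * f ->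
  a = 1 /\ b = 0.
Proof.
move=> W1 E1 E2; split.
  by rewrite -[a]mulr1 -W1 (_ : a * _ = (a * y + b * x) * f - (a * e + b * f) * x); [rewrite -E1 -E2|ring].
by rewrite -[b]mulr1 -W1 (_ : b * _ = y * (a * e + b * f) - e * (a * y + b * x)); [rewrite -E1 -E2; ring|ring].
Qed.

Lemma const_setT : const_on S setT.
Proof.
move=> F dF z z' _ nS _ nS'; have [n zn] := sq_ex z; have [n' zn'] := sq_ex z'.
apply: (cst_sq (n := maxn n n')) => //.
- by move=> w _; exact: dF.
- by apply: sq_le zn; exact: leq_maxl.
- by apply: sq_le zn'; exact: leq_maxr.
Qed.

(** The bases on growing squares are normalised to agree on the smallest one. A change of basis is
    determined by its effect at one point, so they agree wherever two squares meet, and each point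
    may use any square that contains it. *)
Lemma global_basis : exists Y, basis S Q setT Y.
Proof.
have lg p : exists2 r : R, 0 < r & good S Q (disc p r).
  by have [r r0 [Z [N [G1 [G2 [bZ _ _ _]]]]]] := local_basis p; exists r => //; exists Z.
have /choice[YY YP] : forall n, exists Y, basis S Q (sq n) Y.
  move=> n; apply: (good_rect tau_upper S_half oS lg).
    by have : 0 <= n.+1%:R :> R by [rewrite ler0n]; lra.
  by have : 0 <= n.+1%:R :> R by [rewrite ler0n]; lra.
have [z0 z0sq Rz0] := sq_pt 0.
have S0 : ~ S z0 by move=> /S_half.
have z0n n : sq n z0 by exact: sq_le z0sq.
have /choice[ZZ ZP] : forall n, exists Z, basis S Q (sq n) Z /\ agree S (sq 0) (YY 0%N) Z.
  move=> n; have b0 : basis S Q (sq 0) (YY n) by apply: basis_sub (YP n); exact: sq_le.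
  have [a [b [c [d [det A]]]]] := transition (cst_sq (n := 0)) (YP 0%N) b0 z0sq S0.
  by exists (act a b c d (YY n)); exact (conj (basis_act det (YP n)) A).
have coh m n : (m <= n)%N -> agree S (sq m) (ZZ m) (ZZ n).
  move=> mn; have bn : basis S Q (sq m) (ZZ n) by apply: basis_sub (ZP n).1; exact: sq_le.
  have [a [b [c [d [det A]]]]] := transition (cst_sq (n := m)) (ZP m).1 bn (z0n m) S0.
  have [h1 h2 h3 h4] := A z0 (z0n m) S0.
  have [m1 m2 m3 m4] := (ZP m).2 z0 z0sq S0; have [n1 n2 n3 n4] := (ZP n).2 z0 z0sq S0.
  have [_ _ W] := (ZP n).1 z0 (z0n n) S0.
  rewrite -m1 n1 /= in h1; rewrite -m2 n2 /= in h2; rewrite -m3 n3 /= in h3; rewrite -m4 n4 /= in h4.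
  have [a1 b0] := coef_unique W h1 h2.
  have [d0 c1] : c = 0 /\ d = 1.
    have W' : qx (ZZ n) z0 * - qd (ZZ n) z0 - qe (ZZ n) z0 * - qy (ZZ n) z0 = 1 by rewrite -W /wronskian; ring.
    have [] := @coef_unique (qx (ZZ n) z0) (- qy (ZZ n) z0) (qe (ZZ n) z0) (- qd (ZZ n) z0) d (- c) W'.
    - by rewrite {1}h3; ring.
    - by rewrite {1}h4; ring.
    by move=> -> /eqP; rewrite oppr_eq0 => /eqP ->.
  move=> z Dz nS; have [-> -> -> ->] := A z Dz nS.
  by rewrite /act /= a1 b0 d0 c1 !mul0r !mul1r !addr0 !add0r.
have /choice[N NP] := sq_ex.
have coh2 m n z : sq m z -> sq n z -> ~ S z ->
    [/\ qy (ZZ m) z = qy (ZZ n) z, qd (ZZ m) z = qd (ZZ n) z, qx (ZZ m) z = qx (ZZ n) z & qe (ZZ m) z = qe (ZZ n) z].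
  move=> mz nz nS; have [mn|/ltnW nm] := leqP m n; first exact: coh.
  by have [-> -> -> ->] := coh n m nm z nz nS.
exists (Quad (fun z => qy (ZZ (N z)) z) (fun z => qd (ZZ (N z)) z) (fun z => qx (ZZ (N z)) z) (fun z => qe (ZZ (N z)) z)).
move=> z _ nS; have [r r0 rP] := copen_rect tau_upper (NP z); have [r' r'0 rP'] := oS nS.
have m0 : 0 < Num.min r r' by rewrite lt_min r0.
apply (basis_local m0 (ZP (N z)).1 (NP z) nS) => w; rewrite lt_min => /andP[/rP Dw /rP' nSw] /=.
exact: coh2.
Qed.

Lemma sol_open (f g : C -> C) z : (forall z, ~ S z -> sol Q z f g) -> ~ S z ->
  [/\ derivable f z 1, derivable (derive1 f) z 1 & derive1 (derive1 f) z = Q z * f z].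
Proof.
move=> H nS; have [h1 h2] := H z nS; have [r r0 rP] := oS nS.
have e w : normc (w - z) < r -> g w = derive1 f w.
  by move=> /rP nSw; have [h _] := H w nSw; exact (esym (derive1_is h)).
have h3 := cder_eq 0 r0 e h2.
split; [by case: h1|by case: h3|exact (derive1_is h3)].
Qed.

(** Near [p] the solution is a combination with constant coefficients of the local basis, whose
    elements have the form [G / (z - p) ^ N]. *)
Lemma sol_mero (f g : C -> C) : (forall z, ~ S z -> sol Q z f g) -> meromorphic f.
Proof.
move=> H p; have [r r0 [Z [N [G1 [G2 [bZ h1 h2 E]]]]]] := local_basis p.
have [e e0 sub] := rect_disc tau_upper p r0; set D := rect _ _ _ _ _ in sub.
have [z0 Dz0 Rz0] : exists2 z, D z & reg tau z by apply: rect_reg => //; lra.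
have S0 : ~ S z0 by move=> /S_half.
have cD : const_on S D by exact: const_rect.
have [a [b ab]] := sol_coef cD (basis_sub sub bZ) Dz0 S0 (fun z _ nS => H z nS).
have Dp : D p by split; apply/andP; split; lra.
have [d d0 dP] := copen_rect tau_upper Dp.
exists N, (fun z => a * G1 z + b * G2 z); split.
  apply/nbhsCP; exists r => // z zr.
  have oD := @copen_disc R p r.
  exact: (holD oD (holM oD (hol_cst a oD) h1) (holM oD (hol_cst b oD) h2) z zr).1.
have [r1 r10 rS] : exists2 r1 : R, 0 < r1 & forall z : C, 0 < normc (z - p) < r1 -> ~ S z.
  have [c c0 sep] := half_period_sep tau_upper.
  have [Sp|nSp] := pselect (S p).
    exists c => // z /andP[z0' z1] Sz; have E' := sep z p (S_half Sz) (S_half Sp) z1.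
    by move: z0'; rewrite E' subrr Normc.normc0 ltxx.
  by have [d' d'0 H'] := oS nSp; exists d' => // z /andP[_ /H'].
apply/nbhsCP; exists (Num.min d (Num.min r r1)); first by rewrite !lt_min d0 r0.
move=> z; rewrite !lt_min => /and3P[z1 z2 z3] /eqP zp.
have n0 : 0 < normc (z - p) by rewrite normc_gt0 subr_eq0; apply/eqP.
have nS : ~ S z by apply: rS; rewrite n0.
have [-> _] := ab z (dP z z1) nS; have [|-> ->] := E z; first by rewrite n0.
by rewrite !mulrA -mulrDl.
Qed.

Lemma wronskian_free (Y : quad) (a b : C) : basis S Q setT Y ->
  (forall z, ~ S z -> a * qy Y z + b * qx Y z = 0) -> a = 0 /\ b = 0.
Proof.
move=> bY H; have [z _ Rz] := sq_pt 0.
have nS : ~ S z by move=> /S_half.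
have [[d1 _] [d2 _] W] := bY z I nS; have [r r0 rP] := oS nS.
have h0 := H z nS.
have hd : a * qd Y z + b * qe Y z = 0.
  have h1 := cderD (cderZ a d1) (cderZ b d2).
  have h2 : is_derive z (1 : C) (fun z => a * qy Y z + b * qx Y z) 0.
    by refine (cder_eq 0 r0 _ (cder_cst 0 z)) => w /rP /H.
  by rewrite -(derive1_is h1) (derive1_is h2).
move: W; rewrite /wronskian => W; split.
  rewrite -[a]mulr1 -W (_ : a * _ = (a * qy Y z + b * qx Y z) * qe Y z - (a * qd Y z + b * qe Y z) * qx Y z); last by ring.
  by rewrite h0 hd !mul0r subr0.
rewrite -[b]mulr1 -W (_ : b * _ = qy Y z * (a * qd Y z + b * qe Y z) - qd Y z * (a * qy Y z + b * qx Y z)); last by ring.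
by rewrite h0 hd !mulr0 subr0.
Qed.

Definition shift_quad (w : C) (Y : quad) : quad :=
  Quad (fun z => qy Y (z + w)) (fun z => qd Y (z + w)) (fun z => qx Y (z + w)) (fun z => qe Y (z + w)).

Lemma shift_basis w Y : (forall z, Q (z + w) = Q z) -> (forall z, S (z + w) -> S z) ->
  basis S Q setT Y -> basis S Q setT (shift_quad w Y).
Proof.
move=> Qw Sw bY z _ nS; have nS' : ~ S (z + w) by move=> /Sw.
have [[h1 h2] [h3 h4] W] := bY (z + w) I nS'; rewrite Qw in h2 h4; split => //.
  by split; [exact (cder_add h1)|exact (cder_add h2)].
by split; [exact (cder_add h3)|exact (cder_add h4)].
Qed.

End Global.

(** * The invariant Hermitian form *)

Section Metric.
Context {R : realType}.
Local Notation C := (cplx R).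

Lemma half_real : (1 / 2 : C) = (1 / 2 : R)%:C.
Proof. by rewrite !(rmorphM, fmorphV, rmorph1, rmorph_nat). Qed.

Lemma mhalf_real : (- (1 / 2) : C) = (- (1 / 2) : R)%:C.
Proof. by rewrite half_real (rmorphN (real_complex R)). Qed.

Lemma eighth_real (x : R) : x%:C / 8 = (x / 8)%:C :> C.
Proof. by rewrite (rmorphM (real_complex R)) fmorphV rmorph_nat. Qed.

Lemma conj_scale (r : R) (z : C) : conjc (r%:C * z) = r%:C * conjc z :> C.
Proof. by case: z => a b; apply: complex_ext => /=; ring. Qed.

Lemma real_scale (c x : R) (m : C) : (c * x)%:C * m = c%:C * (m * x%:C) :> C.
Proof. by rewrite (rmorphM (real_complex R)) -mulrA [_ * m]mulrC. Qed.

Lemma conjD (a b : C) : conjc (a + b) = conjc a + conjc b :> C.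
Proof. by case: a => a a'; case: b => b b'; apply: complex_ext => /=; ring. Qed.

Lemma conjN (a : C) : conjc (- a) = - conjc a :> C.
Proof. by case: a => a a'; apply: complex_ext => /=; ring. Qed.

Lemma conjM (a b : C) : conjc (a * b) = conjc a * conjc b :> C.
Proof. by case: a => a a'; case: b => b b'; apply: complex_ext => /=; ring. Qed.

Variables (tau : C) (tau_upper : 0 < complex.Im tau) (u : C -> R) (Q : C -> C).
Hypothesis u_smooth : smooth (reg tau) u.
Hypothesis pde : forall z, reg tau z -> laplacian u z = - expR (u z).
Hypothesis potQ : forall z, reg tau z -> pot u z = Q z.

Let ev z : C := (expR (- (1 / 2) * u z))%:C.
Let ew z : C := (expR (1 / 2 * u z) / 8)%:C.

(* With [v = exp (- u / 2)], this is the mixed Wronskian [v f' g'* - v_z f g'* - v_zbar f' g* + v_{z zbar} f g*],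
   written so that its positivity is visible. *)
Definition phi (f f' : C -> C) z : C := f' z + 1 / 2 * (mu u z * f z).
Definition herm (f f' g g' : C -> C) z : C :=
  ev z * (phi f f' z * conjc (phi g g' z)) + ew z * (f z * conjc (g z)).

Lemma exp_lin_wd (c k : R) z : reg tau z ->
  wd (fun z => (expR (c * u z) * k)%:C) z ((c * (expR (c * u z) * k))%:C * mu u z)
    ((c * (expR (c * u z) * k))%:C * conjc (mu u z)).
Proof.
move=> Rz; apply: (wd_real (g := fun x => expR (c * x) * k)); last exact: (u_wd tau_upper u_smooth Rz).
have h1 : is_derive (u z) 1 (fun x : R => c * x) c.
  by apply: is_derive_eq; rewrite /GRing.scale /= mulr1.
have h2 := is_derive1_comp (is_derive_expR (c * u z)) h1.
have h3 : is_derive (u z) 1 (fun x : R => k * expR (c * x)) (k * (expR (c * u z) * c)).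
  exact: (is_deriveZ k h2).
have -> : (fun x : R => expR (c * x) * k) = (fun x => k * expR (c * x)) by apply/funext => x; rewrite mulrC.
by apply: is_derive_eq h3 _; ring.
Qed.

Lemma ev_wd z : reg tau z -> wd ev z (- (1 / 2) * (mu u z * ev z)) (- (1 / 2) * (conjc (mu u z) * ev z)).
Proof.
move=> Rz; have h := exp_lin_wd (- (1 / 2)) 1 Rz.
have E : (fun z => (expR (- (1 / 2) * u z) * 1)%:C) = ev by apply/funext => x; rewrite mulr1.
rewrite E mulr1 in h; rewrite mhalf_real; apply (wd_ext h); exact: real_scale.
Qed.

Lemma ew_wd z : reg tau z -> wd ew z (1 / 2 * (mu u z * ew z)) (1 / 2 * (conjc (mu u z) * ew z)).
Proof.
move=> Rz; have h := exp_lin_wd (1 / 2) (8^-1) Rz.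
rewrite half_real; apply (wd_ext h); exact: real_scale.
Qed.

Lemma evE z : ev z * (expR (u z))%:C / 8 = ew z.
Proof.
rewrite /ev /ew -(rmorphM (real_complex R)) -expRD.
have -> : - (1 / 2) * u z + u z = 1 / 2 * u z by field.
by rewrite (rmorphM (real_complex R)) fmorphV rmorph_nat.
Qed.

(** With [v = exp (- u / 2)], the product [v phi] is the Wronskian [v f' - v_z f]. Because
    [f'' = V f] and [v_zz = V v], its z-derivative vanishes, which is the first coefficient once [v]
    is divided out. *)
Lemma phi_wd f f' z : reg tau z -> sol Q z f f' ->
  wd (phi f f') z (1 / 2 * (mu u z * phi f f' z)) (- ((expR (u z))%:C / 8 * f z)).
Proof.
move=> Rz [h1 h2].
have h := wdD (proj2 (wd_cder _ _ _) h2) (wdZ (1 / 2) (wdM (mu_wd tau_upper u_smooth pde Rz) (proj2 (wd_cder _ _ _) h1))).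
apply (wd_ext h); rewrite /phi.
  rewrite -(potQ Rz) /pot.
  have E1 (a b c d : C) : - (1 / 2) * (d - 1 / 2 * c ^+ 2) * a + 1 / 2 * (c * b + a * d) =
      1 / 2 * (c * (b + 1 / 2 * (c * a))) by field.
  exact (E1 _ _ _ _).
have E2 (a c d : C) : 0 + 1 / 2 * (c * 0 + a * (- d / 4)) = - (d / 8 * a) by field.
exact (E2 _ _ _).
Qed.

(** In each Wirtinger direction the derivative of [ev] cancels that of one of the two [phi] factors;
    the derivative of the other factor brings [- e^u / 8] times a solution, and cancels the
    derivative of the second summand because [ew = ev e^u / 8]. *)
Lemma herm_wd f f' g g' z : reg tau z -> sol Q z f f' -> sol Q z g g' -> wd (herm f f' g g') z 0 0.
Proof.
move=> Rz sf sg.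
have hf := proj2 (wd_cder _ _ _) sf.1; have hg := wd_conj (proj2 (wd_cder _ _ _) sg.1).
have pf := phi_wd Rz sf; have pg := wd_conj (phi_wd Rz sg).
have h := wdD (wdM (ev_wd Rz) (wdM pf pg)) (wdM (ew_wd Rz) (wdM hf hg)).
have e1 : conjc (- ((expR (u z))%:C / 8 * g z)) = - ((expR (u z))%:C / 8 * conjc (g z)) :> C.
  by rewrite eighth_real conjN conj_scale.
have e2 : conjc (1 / 2 * (mu u z * phi g g' z)) = 1 / 2 * (conjc (mu u z) * conjc (phi g g' z)) :> C.
  by rewrite half_real conj_scale conjM.
have e3 : conjc (phi g g' z) = conjc (g' z) + 1 / 2 * (conjc (mu u z) * conjc (g z)) :> C.
  by rewrite /phi half_real conjD conj_scale conjM.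
have e4 : conjc (0 : C) = 0 by apply: complex_ext => //=; rewrite oppr0.
rewrite e1 e2 e4 in h; apply (wd_ext h); rewrite -evE.
  have E (v e p psi fz fz' gb m : C) : p = fz' + 1 / 2 * (m * fz) ->
      v * (p * - (e / 8 * gb) + psi * (1 / 2 * (m * p))) + p * psi * (- (1 / 2) * (m * v)) +
      (v * e / 8 * (fz * 0 + gb * fz') + fz * gb * (1 / 2 * (m * (v * e / 8)))) = 0.
    by move=> ->; field.
  exact (E _ _ _ _ _ _ _ _ (erefl _)).
have E (v e p psi fz g'b gb mb : C) : psi = g'b + 1 / 2 * (mb * gb) ->
    v * (p * (1 / 2 * (mb * psi)) + psi * - (e / 8 * fz)) + p * psi * (- (1 / 2) * (mb * v)) +
    (v * e / 8 * (fz * g'b + gb * 0) + fz * gb * (1 / 2 * (mb * (v * e / 8)))) = 0.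
  by move=> ->; field.
exact (E _ _ _ _ _ _ _ _ e3).
Qed.

Lemma herm_const f f' g g' : (forall z, reg tau z -> sol Q z f f') -> (forall z, reg tau z -> sol Q z g g') ->
  forall z w, reg tau z -> reg tau w -> herm f f' g g' z = herm f f' g g' w.
Proof.
move=> sf sg z w Rz Rw.
have c : const_on (half_periods tau) setT.
  by apply (const_setT tau_upper) => //; exact: copen_reg.
have d x : setT x -> ~ half_periods tau x -> is_derive x (1 : C) (herm f f' g g') 0.
  (* A vanishing differential is in particular complex linear, with derivative 0, so [const_on]
     applies. *)
  move=> _ Rx; exact (proj1 (wd_cder _ _ _) (herm_wd Rx (sf x Rx) (sg x Rx))).
exact (c _ d z w I Rz I Rw).
Qed.

End Metric.

(** * Monodromy *)

Section Lame.
Context {R : realType}.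
Local Notation C := (cplx R).
Variables (tau : C) (tau_upper : 0 < complex.Im tau) (n : 'I_4 -> nat) (E : C).
Local Notation S := (lame_singular tau n).
Local Notation Q := (lame_potential tau n E).

Lemma singular_half z : S z -> half_periods tau z.
Proof. by move=> [k [_ lk]]; exists k. Qed.

Lemma singular_shift w z : lattice tau w -> S (z + w) -> S z.
Proof.
move=> lw [k [k0 lk]]; exists k; split => //.
have -> : z - omega tau k / 2 = z + w - omega tau k / 2 + - w by ring.
exact: latticeD lk (latticeN lw).
Qed.

Lemma copen_nsingular : copen (~` S).
Proof.
move=> z nS; have [hz|Rz] := pselect (half_periods tau z).
  have [c c0 sep] := half_period_sep tau_upper; exists c => // w wz Sw; apply: nS.
  by rewrite -(sep w z (singular_half Sw) hz wz).
have [d d0 dP] := copen_reg tau_upper Rz; exists d => // w /dP Rw /singular_half; exact: Rw.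
Qed.

Lemma lame_shift w z : lattice tau w -> Q (z + w) = Q z.
Proof.
move=> lw; congr (_ + _); apply: eq_bigr => k _; congr (_ * _).
by rewrite addrAC (wp_shift tau_upper _ lw).
Qed.

Lemma lame_hol : hol (~` S) Q.
Proof.
have oD := copen_nsingular.
refine (holD oD (hol_sum _ oD _) (hol_cst _ oD)) => k.
(* For [n k = 0] the coefficient removes the term together with its pole. *)
have [k0|k0] := posnP (n k).
  by refine (hol_eq oD _ (hol_cst 0 oD)) => z _; rewrite k0 mul0n mul0r.
refine (holM oD (hol_cst _ oD) (wp_term_hol tau_upper oD _)) => z nS l; apply: nS; exists k; split => //.
have -> : z - omega tau k / 2 = z + omega tau k / 2 + - omega tau k by field.
by apply: latticeD => //; apply/latticeN/lattice_omega.
Qed.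

Variable u : C -> R.
Hypothesis u_smooth : smooth (reg tau) u.
Hypothesis pde : forall z, reg tau z -> laplacian u z = - expR (u z).
Hypothesis u_per : doubly_periodic tau u.
Hypothesis u_even : forall z, u (- z) = u z.
Hypothesis u_log : forall k : 'I_4, exists M : R,
  \forall z \near (omega tau k / 2 : C)^',
    `|u z - 4 * (n k)%:R * ln (normc (z - omega tau k / 2))| <= M.
Hypothesis potQ : forall z, reg tau z -> pot u z = Q z.

(** At a singular point the even expansion of [pot] is translated from [omega_k / 2] to [p] and fed
    to Frobenius' method; every other point, half periods with [n_k = 0] included, is regular for
    the potential. *)
Lemma lame_local_basis (p : C) : exists2 r : R, 0 < r & exists (Z : quad) (N : nat) (G1 G2 : C -> C),
  [/\ basis S Q (disc p r) Z, hol (disc p r) G1, hol (disc p r) G2 &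
      forall z : C, 0 < normc (z - p) < r -> qy Z z = G1 z / (z - p) ^+ N /\ qx Z z = G2 z / (z - p) ^+ N].
Proof.
have [Sp|nSp] := pselect (S p).
  have [k [k0 lk]] := Sp.
  have [a [rho [K [rho0 ga a0 aodd ps]]]] := pot_local tau_upper u_smooth pde u_per u_even u_log k.
  have H (w : C) : 0 < normc w < rho -> w ^+ 2 * Q (p + w) = pser a w.
    move=> hw; have [Rw <-] := ps w hw; rewrite (potQ Rw) -(lame_shift (omega tau k / 2 + w) lk).
    by have -> : omega tau k / 2 + w + (p - omega tau k / 2) = p + w by field.
  have [r [r0 _ [y1 [d1 [y2 [d2 [G1 [G2 [B h1 h2 e]]]]]]]]] := singular_basis rho0 ga a0 aodd H.
  exists r => //; exists (Quad y1 d1 y2 d2), (n k), G1, G2; split => // z Dz nS.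
  apply: B; apply/andP; split => //; rewrite normc_gt0 subr_eq0.
  by apply/eqP => zp; apply: nS; rewrite zp.
have [r r0 rP] := copen_nsingular nSp.
have hD : hol (disc p r) Q by apply: hol_sub lame_hol => z; exact: rP.
have [r' [r'0 _ [y1 [d1 [y2 [d2 [B h1 h2]]]]]]] := regular_basis r0 hD.
exists r' => //; exists (Quad y1 d1 y2 d2), 0%N, y1, y2; split => //.
  by move=> z Dz _; exact: B.
by move=> z _; rewrite expr0 !divr1.
Qed.

Variables (Y : quad) (bY : basis S Q setT Y).

Definition fund (i : 'I_2) : C -> C := if i == 0 then qy Y else qx Y.
Definition fund' (i : 'I_2) : C -> C := if i == 0 then qd Y else qe Y.

Lemma ord2 (i : 'I_2) : i = 0 \/ i = 1.
Proof. by case: i => -[|[|//]] h; [left|right]; apply: val_inj. Qed.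

Lemma sum2 (V : nmodType) (F : 'I_2 -> V) : \sum_(i < 2) F i = F 0 + F 1.
Proof. by rewrite !big_ord_recl big_ord0 addr0; congr (_ + F _); apply: val_inj. Qed.

Lemma det2 (K : comNzRingType) (A : 'M[K]_2) : \det A = A 0 0 * A 1 1 - A 0 1 * A 1 0.
Proof.
rewrite (expand_det_row _ 0) sum2 /cofactor !det_mx11 !mxE /= expr0 expr1 mul1r mulN1r mulrN.
by congr (_ * A _ _ - _ * A _ _); apply: val_inj.
Qed.

Lemma fund_sol i z : ~ S z -> sol Q z (fund i) (fund' i).
Proof. by move=> nS; have [h1 h2 _] := bY I nS; rewrite /fund /fund'; case: eqP. Qed.

Lemma reg_nS z : reg tau z -> ~ S z. Proof. by move=> Rz /singular_half. Qed.

Lemma exists_reg : exists z, reg tau z.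
Proof. by have [z Rz _] := reg_near tau_upper 0 ltr01; exists z. Qed.

Lemma fund_basis : lame_basis tau n E fund.
Proof.
have oD := copen_nsingular.
split.
- move=> i; have si z : ~ S z -> sol Q z (fund i) (fund' i) by exact: fund_sol.
  split; first exact (sol_mero tau_upper singular_half oD lame_local_basis si).
  by move=> z nS; exact (sol_open oD si nS).
- move=> c H i; have [|c0 c1] := @wronskian_free _ _ tau_upper _ _ singular_half oD Y (c 0) (c 1) bY.
    by move=> z nS; rewrite -(H z nS) sum2.
  by case: (ord2 i) => ->.
move=> f [_ fs]; have [z0 Rz0] := exists_reg.
have sf z : setT z -> ~ S z -> sol Q z f (derive1 f).
  move=> _ nS; have [d1 d2 e] := fs z nS; split; first exact/is_derive1.
  by rewrite -e; exact/is_derive1.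
have [a [b ab]] := sol_coef (const_setT tau_upper singular_half oD) bY I (reg_nS Rz0) sf.
exists (fun i => if i == 0 then a else b) => z nS; rewrite sum2 /fund /=.
by have [-> _] := ab z I nS.
Qed.

(** The fundamental matrix, with one solution and its derivative per row, so that monodromy acts
    from the left. *)
Definition wmx (z : C) : 'M[R[i]]_2 := \matrix_(i, j) if j == 0 then fund i z else fund' i z.

Lemma wmx_det z : ~ S z -> \det (wmx z) = 1.
Proof.
move=> nS; have [_ _ W] := bY I nS; rewrite det2 !mxE /= -[RHS]W /fund /fund' /wronskian /=; ring.
Qed.

Lemma wmx_unit z : ~ S z -> wmx z \in unitmx.
Proof. by move=> nS; rewrite unitmxE wmx_det // unitr1. Qed.

(** The translated basis again has Wronskian one, and [transition] compares it with the original. *)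
Lemma monodromy_matrix w : lattice tau w -> exists M : 'M[R[i]]_2, \det M = 1 /\
  forall z, ~ S z -> wmx (z + w) = M *m wmx z.
Proof.
move=> lw; have [z0 Rz0] := exists_reg.
have bw : basis S Q setT (shift_quad w Y).
  by apply: shift_basis => // z; [exact: lame_shift|exact: singular_shift].
have [a [b [c [d [det A]]]]] :=
  transition (const_setT tau_upper singular_half copen_nsingular) bw bY I (reg_nS Rz0).
exists (\matrix_(i, j) if i == 0 then (if j == 0 then a else b) else if j == 0 then c else d); split.
  by rewrite det2 !mxE.
move=> z nS; have [h1 h2 h3 h4] := A z I nS.
apply/matrixP => i j; rewrite mxE [in RHS]mxE sum2 !mxE /=.
by case: (ord2 i) => ->; case: (ord2 j) => ->; rewrite /fund /fund' /=.
Qed.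

Lemma monodromy_exists : exists rho : int -> int -> 'M[R[i]]_2,
  monodromy_representation tau n fund rho /\
  forall m l z, ~ S z -> wmx (z + (m%:~R + l%:~R * tau)) = rho m l *m wmx z.
Proof.
have lat m l : lattice tau (m%:~R + l%:~R * tau : C) by exists m, l.
have /choice[rho rhoP] : forall p : int * int, exists M : 'M[R[i]]_2, \det M = 1 /\
    forall z, ~ S z -> wmx (z + (p.1%:~R + p.2%:~R * tau)) = M *m wmx z.
  by move=> p; exact: monodromy_matrix.
exists (fun m l => rho (m, l)); split; last by move=> m l; have [_ h] := rhoP (m, l).
split.
- by move=> m l; have [] := rhoP (m, l).
- move=> m l m' l'; have [z0 Rz0] := exists_reg; have nS := reg_nS Rz0.
  have [_ h1] := rhoP (m, l); have [_ h2] := rhoP (m', l'); have [_ h3] := rhoP (m + m', l + l').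
  have nS' : ~ S (z0 + (m'%:~R + l'%:~R * tau)) by move=> /(singular_shift (lat m' l')).
  (* Both sides are compared after multiplication by the invertible matrix [wmx z0]. *)
  apply: (can_inj (mulmxK (wmx_unit nS))).
  rewrite -mulmxA -h2 // -h1 // -h3 //=; congr wmx; rewrite !intrD; ring.
- move=> m l z nS i; have [_ h] := rhoP (m, l).
  by have /matrixP/(_ i 0) := h z nS; rewrite mxE [in RHS]mxE => ->; apply: eq_bigr => j _; rewrite !mxE.
Qed.

Local Notation adj A := (map_mx Num.conj (A^T)).

Lemma adjM (A B : 'M[R[i]]_2) : adj (A *m B) = adj B *m adj A.
Proof. by rewrite trmx_mul map_mxM. Qed.

(** [M] preserves the Hermitian form whose Gram matrix is [N] times its adjoint; conjugation by [N]
    carries this form to the standard one. *)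
Lemma unitary_conj (N M : 'M[R[i]]_2) : N \in unitmx -> M *m N *m adj (M *m N) = N *m adj N ->
  invmx N *m M *m N \is unitarymx.
Proof.
move=> uN MN; apply/unitarymxP; rewrite -mulmxA adjM [LHS]mulmxA -(mulmxA (invmx N) (M *m N)) MN mulmxA mulVmx // mul1mx.
by rewrite -adjM mulVmx // trmx1 map_mx1.
Qed.

Let ea z : R := Num.sqrt (expR (- (1 / 2) * u z)).
Let eb z : R := Num.sqrt (expR (1 / 2 * u z) / 8).

(* The columns of [wmx z *m gauge z] are [exp (- u / 4) phi] and [exp (u / 4) / sqrt 8] times the solutions,
   so that its rows have the inner products [herm]. *)
Definition gauge (z : C) : 'M[R[i]]_2 := \matrix_(i, j)
  if i == 0 then (if j == 0 then (ea z)%:C * (1 / 2 * mu u z) else (eb z)%:C)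
  else if j == 0 then (ea z)%:C else 0.

Lemma gauge_unit z : gauge z \in unitmx.
Proof.
have a0 : 0 < ea z by rewrite sqrtr_gt0 expR_gt0.
have b0 : 0 < eb z by rewrite sqrtr_gt0 divr_gt0 // expR_gt0.
rewrite unitmxE det2 !mxE /= mulr0 sub0r unitrN unitfE mulf_neq0 //.
  by rewrite (inj_eq (@complexI R)) gt_eqF.
by rewrite (inj_eq (@complexI R)) gt_eqF.
Qed.

Lemma gauge_shift w z : lattice tau w -> reg tau z -> gauge (z + w) = gauge z.
Proof.
move=> lw Rz; have uw x : u (x + w) = u x by exact: lattice_per.
have [h _] := mu_shift tau_upper u_smooth pde lw uw Rz.
by apply/matrixP => i j; rewrite !mxE /ea /eb uw h.
Qed.

Lemma gram z i j : (wmx z *m gauge z *m adj (wmx z *m gauge z)) i j =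
  herm u (fund i) (fund' i) (fund j) (fund' j) z.
Proof.
have e0 k : (wmx z *m gauge z) k 0 = (ea z)%:C * phi u (fund k) (fund' k) z.
  rewrite mxE sum2 !mxE /= /phi.
  by move: (fund k z) (fund' k z) (mu u z) ((ea z)%:C) => *; ring.
have e1 k : (wmx z *m gauge z) k 1 = (eb z)%:C * fund k z.
  by rewrite mxE sum2 !mxE /= mulr0 addr0 mulrC.
have sa : (ea z)%:C * (ea z)%:C = (expR (- (1 / 2) * u z))%:C :> C.
  by rewrite -(rmorphM (real_complex R)) -expr2 sqr_sqrtr // ltW // expR_gt0.
have sb : (eb z)%:C * (eb z)%:C = (expR (1 / 2 * u z) / 8)%:C :> C.
  by rewrite -(rmorphM (real_complex R)) -expr2 sqr_sqrtr // divr_ge0 // ltW // expR_gt0.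
have cj (x : R[i]) : Num.conj x = conjc x by [].
move: (wmx z *m gauge z) e0 e1 => X e0 e1.
rewrite mxE sum2 !mxE !cj e0 e0 e1 e1 !conj_scale /herm -sa -sb.
move: (conjc (phi u (fund j) (fund' j) z)) (phi u (fund i) (fund' i) z) (conjc (fund j z)) (fund i z) => *; ring.
Qed.

(** The gauge is periodic and the entries of the Gram matrix are values of the constant functions
    [herm], so a lattice translation leaves the Gram matrix unchanged. One matrix [N], taken at a
    fixed point, conjugates all of [rho]. *)
Lemma monodromy_SU2 (rho : int -> int -> 'M[R[i]]_2) : (forall m l, \det (rho m l) = 1) ->
  (forall m l z, ~ S z -> wmx (z + (m%:~R + l%:~R * tau)) = rho m l *m wmx z) -> conjugate_into_SU2 rho.
Proof.
move=> det H; have [z0 Rz0] := exists_reg; have nS := reg_nS Rz0.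
pose N := wmx z0 *m gauge z0.
have uN : N \in unitmx by rewrite unitmx_mul wmx_unit // gauge_unit.
exists (invmx N); first by rewrite unitmx_inv.
move=> m l; rewrite invmxK; set M := rho m l.
pose w : C := m%:~R + l%:~R * tau; have lw : lattice tau w by exists m, l.
have Rw : reg tau (z0 + w) by exact/reg_shift.
have E1 : M *m N = wmx (z0 + w) *m gauge (z0 + w).
  by rewrite gauge_shift // (H m l z0 nS) mulmxA.
have E2 : M *m N *m adj (M *m N) = N *m adj N.
  rewrite E1; apply/matrixP => i j; apply: (etrans (gram _ i j)); apply: (etrans _ (esym (gram _ i j))).
  have sf k z : reg tau z -> sol Q z (fund k) (fund' k) by move=> /reg_nS; exact: fund_sol.
  exact (herm_const tau_upper u_smooth pde potQ (sf i) (sf j) Rw Rz0).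
split; last first.
  by rewrite (det_mulmx _ N) (det_mulmx _ M) det mulr1 -det_mulmx (mulVmx uN) det1.
exact: unitary_conj.
Qed.

End Lame.

Theorem theorem2p2 (R : realType) (tau : cplx R) (n : 'I_4 -> nat)
    (tau_upper : 0 < complex.Im tau) (n_pos : (1 <= \sum_(k < 4) n k)%N)
    (even_sol : exists u : cplx R -> R,
       curvature_solution tau n u /\ forall z : cplx R, u (- z) = u z) :
  exists E : cplx R, unitary_monodromy tau n E.
Proof.
have [u [[u_per u_smooth u_log weak] u_even]] := even_sol.
have pde z : reg tau z -> laplacian u z = - expR (u z) by exact: strong weak z.
have [E potQ] := pot_lame tau_upper u_smooth pde u_per u_even u_log.
have [Y bY] := global_basis tau_upper (@singular_half _ tau n) (copen_nsingular tau_upper (n := n))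
  (lame_local_basis tau_upper u_smooth pde u_per u_even u_log potQ).
have [rho [mono H]] := monodromy_exists tau_upper bY.
exists E, (fund Y), rho; split => //.
  exact: (fund_basis tau_upper u_smooth pde u_per u_even u_log potQ).
have [det _ _] := mono; exact (monodromy_SU2 tau_upper u_smooth pde u_per potQ bY det H).
Qed.
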